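(* Let $k$ be a number field and $K\in\mathcal{E}_{\mathrm{ns}}(k)$. Suppose that $X(K)^{\dagger}$ is pseudo-null (equivalently zero) as a $\Lambda^{\dagger}(K/k)$-module and that $K/k$ is arithmetically semi-simple, i.e. $s'(K/k)=0$. Then $X(K)$ is a finitely generated $\mathbb{Z}_p$-module of rank $s(K/k)$.
   Context: $p$ is a fixed prime. For an algebraic extension $F/\mathbb{Q}$, $L(F)$ is the maximal unramified abelian pro-$p$ extension of $F$, $X(F)=\mathrm{Gal}(L(F)/F)$, $L'(F)\subset L(F)$ the maximal subextension in which all primes above $p$ split completely, $X'(F)=\mathrm{Gal}(L'(F)/F)$. For a $\mathbb{Z}_p$-extension $K/k$, $\Lambda(K/k)=\mathbb{Z}_p[[\mathrm{Gal}(K/k)]]$, $\Lambda^{\dagger}(K/k)=\Lambda(K/k)[1/(\gamma-1)\mid\gamma\in\mathrm{Gal}(K/k),\gamma\ne1]$, and $X(K)^{\dagger}=\Lambda^{\dagger}(K/k)\otimes_{\Lambda(K/k)}X(K)$. $\mathcal{E}_{\mathrm{ns}}(k)$ is the set of $\mathbb{Z}_p$-extensions of $k$ in which no prime of $k$ above $p$ splits. $s(K/k)=\mathrm{rank}_{\mathbb{Z}_p}X(K)_{\mathrm{Gal}(K/k)}$, $s'(K/k)=\mathrm{rank}_{\mathbb{Z}_p}X'(K)_{\mathrm{Gal}(K/k)}$. *)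

(* Defs.v *)
From HB Require Import structures.
From mathcomp Require Import all_boot all_order all_algebra all_fingroup all_field.
From mathcomp Require Import all_solvable.
From mathcomp Require Import generic_quotient ring_quotient ring.
From mathcomp Require Import boolp classical_sets.

Set Implicit Arguments.
Unset Strict Implicit.
Unset Printing Implicit Defensive.

Import GRing.Theory.
Local Open Scope ring_scope.
Local Open Scope quotient_scope.
Local Open Scope classical_set_scope.

(* The ring Z_p of p-adic integers, as the inverse limit of the rings
   Z/p^(n+1); for p > 1 the type 'Z_(p ^ n.+1) really is Z/p^(n+1). *)

Section PadicIntegers.
Variable p : nat.

Definition Zp_red n (a : 'Z_(p ^ n.+2)) : 'Z_(p ^ n.+1) := inZp a.

Record Zp := MkZp {
  Zp_seq :> forall n, 'Z_(p ^ n.+1);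
  Zp_compat : forall n, Zp_red (Zp_seq n.+1) = Zp_seq n
}.

Lemma Zp_ext (a b : Zp) : (forall n, a n = b n) -> a = b.
Proof.
case: a b => a ca [b cb] /= ab.
have {}ab : a = b by apply: functional_extensionality_dep.
by case: _ / ab cb => cb; congr MkZp; exact: Prop_irrelevance.
Qed.

HB.instance Definition _ := gen_eqMixin Zp.
HB.instance Definition _ := gen_choiceMixin Zp.

Lemma Zp_mod_dvd n : ((Zp_trunc (p ^ n.+1)).+2 %| (Zp_trunc (p ^ n.+2)).+2)%N.
Proof.
case: p => [|[|q]]; rewrite ?exp0n ?exp1n //.
have gt1 m : (1 < q.+2 ^ m.+1)%N by rewrite -(exp1n m.+1) ltn_exp2r.
by rewrite !Zp_cast // dvdn_exp2l.
Qed.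

Lemma Zp_redD n : {morph @Zp_red n : a b / a + b}.
Proof.
move=> a b; apply: val_inj => /=.
by rewrite modn_dvdm ?Zp_mod_dvd // modnDml modnDmr.
Qed.

Lemma Zp_redM n : {morph @Zp_red n : a b / a * b}.
Proof.
move=> a b; apply: val_inj => /=.
by rewrite modn_dvdm ?Zp_mod_dvd // modnMml modnMmr.
Qed.

Lemma Zp_red0 n : @Zp_red n 0 = 0.
Proof. by apply: val_inj; rewrite /= mod0n. Qed.

Lemma Zp_red1 n : @Zp_red n 1 = 1.
Proof. by apply: val_inj; rewrite /= modn_dvdm ?Zp_mod_dvd. Qed.

Lemma Zp_redN n : {morph @Zp_red n : a / - a}.
Proof.
by move=> a; apply: (addrI (Zp_red a)); rewrite -Zp_redD !subrr Zp_red0.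
Qed.

Definition Zp0 := @MkZp (fun=> 0) Zp_red0.
Definition Zp1 := @MkZp (fun=> 1) Zp_red1.
Definition Zp_opp (a : Zp) : Zp.
Proof. by exists (fun n => - a n) => n; rewrite Zp_redN Zp_compat. Defined.
Definition Zp_add (a b : Zp) : Zp.
Proof. by exists (fun n => a n + b n) => n; rewrite Zp_redD !Zp_compat. Defined.
Definition Zp_mul (a b : Zp) : Zp.
Proof. by exists (fun n => a n * b n) => n; rewrite Zp_redM !Zp_compat. Defined.

Lemma Zp_addA : associative Zp_add.
Proof. by move=> a b c; apply: Zp_ext => n; exact: addrA. Qed.
Lemma Zp_addC : commutative Zp_add.
Proof. by move=> a b; apply: Zp_ext => n; exact: addrC. Qed.
Lemma Zp_add0 : left_id Zp0 Zp_add.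
Proof. by move=> a; apply: Zp_ext => n; exact: add0r. Qed.
Lemma Zp_addN : left_inverse Zp0 Zp_opp Zp_add.
Proof. by move=> a; apply: Zp_ext => n; exact: addNr. Qed.
HB.instance Definition _ :=
  GRing.isZmodule.Build Zp Zp_addA Zp_addC Zp_add0 Zp_addN.

Lemma Zp_mulA : associative Zp_mul.
Proof. by move=> a b c; apply: Zp_ext => n; exact: mulrA. Qed.
Lemma Zp_mulC : commutative Zp_mul.
Proof. by move=> a b; apply: Zp_ext => n; exact: mulrC. Qed.
Lemma Zp_mul1 : left_id Zp1 Zp_mul.
Proof. by move=> a; apply: Zp_ext => n; exact: mul1r. Qed.
Lemma Zp_mulD : left_distributive Zp_mul Zp_add.
Proof. by move=> a b c; apply: Zp_ext => n; exact: mulrDl. Qed.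
Lemma Zp_1neq0 : Zp1 != 0.
Proof. by apply/eqP => /(congr1 (fun a : Zp => a 0%N)) /eqP; rewrite oner_eq0. Qed.
HB.instance Definition _ := GRing.Zmodule_isComNzRing.Build Zp
  Zp_mulA Zp_mulC Zp_mul1 Zp_mulD Zp_1neq0.

End PadicIntegers.

Section GroupRing.
Variables (R : comNzRingType) (G : finGroupType).

Definition group_ring := {ffun G -> R}.
HB.instance Definition _ := GRing.Zmodule.on group_ring.

Definition gr_single (a : R) (g : G) : group_ring := [ffun x => a *+ (x == g)].
Definition gr_mul (a b : group_ring) : group_ring :=
  [ffun x => \sum_y a y * b (y^-1 * x)%g].

Lemma gr_mulA : associative gr_mul.
Proof.
move=> a b c; apply/ffunP => x; rewrite !ffunE.
under eq_bigr => y _ do rewrite ffunE mulr_sumr.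
under [in RHS]eq_bigr => y _ do rewrite ffunE mulr_suml.
rewrite [RHS]exchange_big /=; apply: eq_bigr => y _.
rewrite [RHS](reindex_inj (mulgI y)) /=; apply: eq_bigr => z _.
by rewrite mulKg mulrA invMg mulgA.
Qed.

Lemma gr_mul1 : left_id (gr_single 1 1%g) gr_mul.
Proof.
move=> a; apply/ffunP => x; rewrite ffunE (bigD1 1%g) //= !ffunE eqxx mul1r.
by rewrite invg1 mul1g big1 ?addr0 // => y /negPf ne; rewrite ffunE ne mul0r.
Qed.

Lemma gr_mulr1 : right_id (gr_single 1 1%g) gr_mul.
Proof.
move=> a; apply/ffunP => x; rewrite ffunE (bigD1 x) //= !ffunE mulVg eqxx mulr1.
rewrite big1 ?addr0 // => y ne; rewrite ffunE -eq_mulVg1.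
by rewrite (negPf ne) mulr0.
Qed.

Lemma gr_mulDl : left_distributive gr_mul +%R.
Proof.
move=> a b c; apply/ffunP => x; rewrite !ffunE -big_split /=.
by apply: eq_bigr => y _; rewrite ffunE mulrDl.
Qed.

Lemma gr_mulDr : right_distributive gr_mul +%R.
Proof.
move=> a b c; apply/ffunP => x; rewrite !ffunE -big_split /=.
by apply: eq_bigr => y _; rewrite ffunE mulrDr.
Qed.

Lemma gr_1neq0 : gr_single 1 1%g != 0.
Proof.
apply/eqP => /ffunP /(_ 1%g) /eqP.
by rewrite !ffunE eqxx oner_eq0.
Qed.

HB.instance Definition _ := GRing.Zmodule_isNzRing.Build group_ring
  gr_mulA gr_mul1 gr_mulr1 gr_mulDl gr_mulDr gr_1neq0.

Lemma gr_mulE (a b : group_ring) x : (a * b) x = \sum_y a y * b (y^-1 * x)%g.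
Proof. exact: ffunE. Qed.

End GroupRing.

(* Every algebraic extension of Q is taken inside algC, the field of algebraic
   complex numbers, and is represented by its set of elements. *)

Definition subfield (M : set algC) : Prop :=
  [/\ M 1, forall x y, M x -> M y -> M (x - y) &
      forall x y, M x -> M y -> M (x / y)].

Definition number_field (k : set algC) : Prop :=
  subfield k /\
  exists (n : nat) (b : 'I_n -> algC), forall x, k x ->
    exists c : 'I_n -> rat, x = \sum_i ratr (c i) * b i.

(* The group of automorphisms of M over F.  An automorphism is stored with its
   inverse as a permutation of algC that is the identity outside M: this makes
   the representation unique and the group law plain composition. *)

Record gal (F M : set algC) := MkGal {
  gal_fun :> algC -> algC;
  gal_inv : algC -> algC;
  gal_funK : cancel gal_fun gal_inv;
  gal_invK : cancel gal_inv gal_fun;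
  gal_stab : forall x, M x <-> M (gal_fun x);
  gal_out : forall x, ~ M x -> gal_fun x = x;
  gal_base : forall x, F x -> gal_fun x = x;
  gal_add : forall x y, M x -> M y -> gal_fun (x + y) = gal_fun x + gal_fun y;
  gal_mul : forall x y, M x -> M y -> gal_fun (x * y) = gal_fun x * gal_fun y
}.

Section GaloisGroup.
Variables F M : set algC.
Local Notation gal := (gal F M).

Lemma gal_ext (s t : gal) : s =1 t -> s = t.
Proof.
case: s t => s s' sK s'K s1 s2 s3 s4 s5 [t t' tK t'K t1 t2 t3 t4 t5] /= st.
have {}st : s = t by apply: funext.
case: _ / st t' tK t'K t1 t2 t3 t4 t5 => t' tK t'K t1 t2 t3 t4 t5.
have E : s' = t' by apply: funext => x; apply: (can_inj sK); rewrite s'K t'K.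
case: _ / E tK t'K => tK t'K.
by congr MkGal; exact: Prop_irrelevance.
Qed.

HB.instance Definition _ := gen_eqMixin gal.
HB.instance Definition _ := gen_choiceMixin gal.

Definition gal_one : gal.
Proof. by exists id id. Defined.

Definition gal_comp (s t : gal) : gal.
Proof.
exists (s \o t) (gal_inv t \o gal_inv s).
- exact: can_comp (gal_funK s) (gal_funK t).
- exact: can_comp (gal_invK t) (gal_invK s).
- by move=> x; exact: iff_trans (gal_stab t x) (gal_stab s _).
- by move=> x Mx /=; rewrite (gal_out t Mx) (gal_out s Mx).
- by move=> x Fx /=; rewrite (gal_base t Fx) (gal_base s Fx).
- move=> x y Mx My /=; rewrite (gal_add t) //.
  by rewrite (gal_add s) //; apply: (proj1 (gal_stab t _)).
- move=> x y Mx My /=; rewrite (gal_mul t) //.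
  by rewrite (gal_mul s) //; apply: (proj1 (gal_stab t _)).
Defined.

Lemma gal_inv_stab (s : gal) x : M x <-> M (gal_inv s x).
Proof. by rewrite (propext (gal_stab s (gal_inv s x))) gal_invK. Qed.

Definition gal_opp (s : gal) : gal.
Proof.
exists (gal_inv s) s.
- exact: gal_invK.
- exact: gal_funK.
- exact: gal_inv_stab.
- by move=> x Mx; rewrite -{1}(gal_out s Mx) gal_funK.
- by move=> x Fx; rewrite -{1}(gal_base s Fx) gal_funK.
- move=> x y /(gal_inv_stab s) Mx /(gal_inv_stab s) My.
  by apply: (can_inj (gal_funK s)); rewrite (gal_add s) // !gal_invK.
- move=> x y /(gal_inv_stab s) Mx /(gal_inv_stab s) My.
  by apply: (can_inj (gal_funK s)); rewrite (gal_mul s) // !gal_invK.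
Defined.

Lemma gal_compA : associative gal_comp.
Proof. by move=> s t u; apply: gal_ext. Qed.
Lemma gal_comp1 : left_id gal_one gal_comp.
Proof. by move=> s; apply: gal_ext. Qed.
Lemma gal_compr1 : right_id gal_one gal_comp.
Proof. by move=> s; apply: gal_ext. Qed.
Lemma gal_compV : left_inverse gal_one gal_opp gal_comp.
Proof. by move=> s; apply: gal_ext; exact: gal_funK. Qed.
Lemma gal_comprV : right_inverse gal_one gal_opp gal_comp.
Proof. by move=> s; apply: gal_ext; exact: gal_invK. Qed.

HB.instance Definition _ := isGroup.Build gal
  gal_compA gal_comp1 gal_compr1 gal_compV gal_comprV.

(* The subgroups [gal_fixing A], for A a finite subset of M, form a basis of
   neighbourhoods of 1 for the Krull topology. *)
Definition gal_fixing (A : seq algC) : set gal :=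
  [set s | forall x, x \in A -> s x = x].

Definition galois : Prop :=
  [/\ subfield F, subfield M, F `<=` M &
      forall x, M x -> (forall s : gal, s x = x) -> F x].

(* Continuous surjective homomorphisms onto finite groups.  By Cayley's theorem
   it is enough to let the target be a permutation group, which makes the
   collection of all of them a small type. *)
Record finite_quotient := MkFiniteQuotient {
  fq_degree : nat;
  fq_perm : {group 'S_fq_degree};
  fq_map : gal -> subg_of fq_perm;
  fq_morph : forall s t, fq_map (s * t)%g = (fq_map s * fq_map t)%g;
  fq_surj : forall x, exists s, fq_map s = x;
  fq_cont : exists2 A : seq algC, (forall x, x \in A -> M x) &
    forall s, gal_fixing A s -> fq_map s = 1%g
}.

Definition fq_group (Q : finite_quotient) : finGroupType := subg_of (fq_perm Q).
Coercion fq_group : finite_quotient >-> finGroupType.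

Definition pro_p (p : nat) : Prop :=
  forall Q : finite_quotient, (p.-group [set: Q]%SET)%g.

(* The last two conditions are the continuity at 1 of phi and of its inverse. *)
Definition topological_iso_Zp (p : nat) (phi : gal -> Zp p) : Prop :=
  [/\ bijective phi,
      forall s t, phi (s * t)%g = phi s + phi t,
      forall n, exists2 A : seq algC, (forall x, x \in A -> M x) &
        forall s, gal_fixing A s -> phi s n = 0 &
      forall A : seq algC, (forall x, x \in A -> M x) ->
        exists n, forall s, phi s n = 0 -> gal_fixing A s].

End GaloisGroup.

Record Zp_extension (p : nat) (k : set algC) := MkZpExtension {
  ext_field :> set algC;
  ext_galois : galois k ext_field;
  ext_iso : exists phi : gal k ext_field -> Zp p, topological_iso_Zp phi
}.

(* The completed group algebra Z_p[[Gal(K/k)]]: the inverse limit of the group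
   rings Z_p[G] over all continuous finite quotients Gal(K/k) ->> G. *)

Section IwasawaAlgebra.
Variables (p : nat) (k : set algC) (K : Zp_extension p k).
Local Notation Gam := (gal k K).
Local Notation fquot := (finite_quotient k K).

Definition iw_compatible (a : forall Q : fquot, group_ring (Zp p) Q) : Prop :=
  forall (Q Q' : fquot) (h : Q -> Q'), (forall s, h (fq_map Q s) = fq_map Q' s) ->
  forall y, a Q' y = \sum_(x | h x == y) a Q x.

Record iwasawa_algebra := MkIwasawa {
  iw_fam :> forall Q : fquot, group_ring (Zp p) Q;
  iw_compat : iw_compatible iw_fam
}.
Local Notation Lambda := iwasawa_algebra.

Lemma iw_ext (a b : Lambda) : (forall Q, a Q = b Q) -> a = b.
Proof.
case: a b => a ca [b cb] /= ab.
have {}ab : a = b by apply: functional_extensionality_dep.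
by case: _ / ab cb => cb; congr MkIwasawa; exact: Prop_irrelevance.
Qed.

HB.instance Definition _ := gen_eqMixin Lambda.
HB.instance Definition _ := gen_choiceMixin Lambda.

Lemma fq_transM (Q Q' : fquot) (h : Q -> Q') :
  (forall s, h (fq_map Q s) = fq_map Q' s) ->
  forall x y, h (x * y)%g = (h x * h y)%g.
Proof.
move=> hQ x y; have [s <-] := fq_surj x; have [t <-] := fq_surj y.
by rewrite -fq_morph !hQ fq_morph.
Qed.

Lemma iw_single_compat (a : Zp p) (g : Gam) :
  iw_compatible (fun Q => gr_single a (fq_map Q g)).
Proof.
move=> Q Q' h hQ y; rewrite ffunE.
under eq_bigr => x _ do rewrite ffunE.
have [->|ne] := eqVneq y (fq_map Q' g).
  rewrite (bigD1 (fq_map Q g)) ?hQ //= eqxx mulr1n big1 ?addr0 //.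
  by move=> x /andP[_ /negPf ->].
rewrite big1 // => x /eqP hx; case: eqVneq => // xg.
by move: ne; rewrite -hx xg hQ eqxx.
Qed.

(* [iw_single a g] is the element a.g of Z_p[[Gal(K/k)]]. *)
Definition iw_single (a : Zp p) (g : Gam) : Lambda :=
  MkIwasawa (iw_single_compat a g).

Lemma iw_compat0 : iw_compatible (fun=> 0).
Proof.
by move=> Q Q' h hQ y; rewrite ffunE big1 // => x _; rewrite ffunE.
Qed.
Definition iw_zero : Lambda := MkIwasawa iw_compat0.

Definition iw_opp (a : Lambda) : Lambda.
Proof.
exists (fun Q => - a Q) => Q Q' h hQ y; rewrite ffunE (iw_compat a hQ) -sumrN.
by apply: eq_bigr => x _; rewrite ffunE.
Defined.

Definition iw_add (a b : Lambda) : Lambda.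
Proof.
exists (fun Q => a Q + b Q) => Q Q' h hQ y.
rewrite ffunE (iw_compat a hQ) (iw_compat b hQ) -big_split /=.
by apply: eq_bigr => x _; rewrite ffunE.
Defined.

Lemma iw_compatM (a b : Lambda) : iw_compatible (fun Q => a Q * b Q).
Proof.
move=> Q Q' h hQ y.
have hM := fq_transM hQ.
have hV x : h (x^-1)%g = (h x)^-1%g.
  have h1 : h 1%g = 1%g by apply: (mulgI (h 1%g)); rewrite -hM !mulg1.
  by apply: (mulgI (h x)); rewrite -hM !mulgV.
rewrite gr_mulE.
under [in RHS]eq_bigr => x _ do rewrite gr_mulE.
under [LHS]eq_bigr => z _ do rewrite (iw_compat a hQ) mulr_suml.
rewrite [RHS]exchange_big /= (exchange_big_dep xpredT) //=.
apply: eq_bigr => x _; rewrite (big_pred1 (h x)); last by move=> z; exact: eq_sym.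
rewrite (iw_compat b hQ) mulr_sumr [RHS](reindex_inj (mulgI x)) /=.
apply: eq_big => [u|u _]; last by rewrite mulKg.
by rewrite hM (can2_eq (mulKg _) (mulKVg _)).
Qed.
Definition iw_mul (a b : Lambda) : Lambda := MkIwasawa (iw_compatM a b).

Definition iw_one : Lambda := iw_single 1 1%g.

Lemma fq_map1 (Q : fquot) : fq_map Q 1%g = 1%g.
Proof. by apply: (mulgI (fq_map Q 1%g)); rewrite -fq_morph !mulg1. Qed.

Lemma gal_mulC (s t : Gam) : (s * t = t * s)%g.
Proof.
have [phi [[psi phiK _] phiM _ _]] := ext_iso K.
by apply: (can_inj phiK); rewrite !phiM addrC.
Qed.

Lemma fq_mulC (Q : fquot) (x y : Q) : (x * y = y * x)%g.
Proof.
have [s <-] := fq_surj x; have [t <-] := fq_surj y.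
by rewrite -!fq_morph gal_mulC.
Qed.

Definition trivial_fq : fquot.
Proof.
exists 0%N 1%G (fun=> 1%g).
- by move=> s t; rewrite mulg1.
- move=> x; exists 1%g; apply: val_inj => /=.
  by have /set1P -> := subgP x.
- by exists [::].
Defined.

Lemma iw_addA : associative iw_add.
Proof. by move=> a b c; apply: iw_ext => Q; exact: addrA. Qed.
Lemma iw_addC : commutative iw_add.
Proof. by move=> a b; apply: iw_ext => Q; exact: addrC. Qed.
Lemma iw_add0 : left_id iw_zero iw_add.
Proof. by move=> a; apply: iw_ext => Q; exact: add0r. Qed.
Lemma iw_addN : left_inverse iw_zero iw_opp iw_add.
Proof. by move=> a; apply: iw_ext => Q; exact: addNr. Qed.
HB.instance Definition _ :=
  GRing.isZmodule.Build Lambda iw_addA iw_addC iw_add0 iw_addN.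

Lemma iw_mulA : associative iw_mul.
Proof. by move=> a b c; apply: iw_ext => Q; exact: mulrA. Qed.
Lemma iw_mulC : commutative iw_mul.
Proof.
move=> a b; apply: iw_ext => Q; apply/ffunP => x; rewrite !gr_mulE.
rewrite [RHS](reindex_inj (inj_comp (mulgI x) invg_inj)) /=.
by apply: eq_bigr => y _; rewrite invMg invgK mulgKV mulrC (fq_mulC x).
Qed.
Lemma iw_oneE (Q : fquot) : iw_one Q = 1.
Proof. exact: (congr1 (gr_single 1) (fq_map1 Q)). Qed.
Lemma iw_mul1 : left_id iw_one iw_mul.
Proof.
move=> a; apply: iw_ext => Q; transitivity (iw_one Q * a Q); first by [].
by rewrite iw_oneE mul1r.
Qed.
Lemma iw_mulD : left_distributive iw_mul iw_add.
Proof. by move=> a b c; apply: iw_ext => Q; exact: mulrDl. Qed.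
Lemma iw_1neq0 : iw_one != 0.
Proof.
apply/eqP => /(congr1 (fun a : Lambda => a trivial_fq 1%g)) /eqP.
by rewrite !ffunE eqxx oner_eq0.
Qed.
HB.instance Definition _ := GRing.Zmodule_isComNzRing.Build Lambda
  iw_mulA iw_mulC iw_mul1 iw_mulD iw_1neq0.

Definition iw_const (a : Zp p) : Lambda := iw_single a 1%g.
Definition iw_group (g : Gam) : Lambda := iw_single 1 g.

Lemma iw_constD : {morph iw_const : a b / a + b}.
Proof. by move=> a b; apply: iw_ext => Q; apply/ffunP => x; rewrite !ffunE mulrnDl. Qed.
Lemma iw_constM : {morph iw_const : a b / a * b}.
Proof.
move=> a b; apply: iw_ext => Q; apply/ffunP => x.
rewrite gr_mulE !ffunE (bigD1 1%g) //= !ffunE fq_map1 eqxx mulr1n invg1 mul1g mulrnAr.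
by rewrite big1 ?addr0 // => y /negPf ne; rewrite ffunE ne mul0r.
Qed.
Lemma iw_const1 : iw_const 1 = 1. Proof. by []. Qed.

End IwasawaAlgebra.

(* In S^-1 R, x / s = y / t iff u (x t - y s) = 0 for some u in S.  The ring R
   need not be a domain, and S^-1 R may be the zero ring. *)

Record mult_set (R : comPzRingType) := MkMultSet {
  ms_pred :> R -> Prop;
  ms_1 : ms_pred 1;
  ms_M : forall x y, ms_pred x -> ms_pred y -> ms_pred (x * y)
}.

Section Localisation.
Variables (R : comPzRingType) (S : mult_set R).

Record loc_frac := MkFrac { loc_num : R; loc_den : R; loc_denP : S loc_den }.
HB.instance Definition _ := gen_eqMixin loc_frac.
HB.instance Definition _ := gen_choiceMixin loc_frac.

Definition loc_rel (x y : loc_frac) : Prop := exists2 t, S t &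
  t * (loc_num x * loc_den y) = t * (loc_num y * loc_den x).
Definition loc_eq (x y : loc_frac) : bool := `[< loc_rel x y >].

Lemma loc_eq_refl : reflexive loc_eq.
Proof. by move=> x; apply/asboolP; exists 1 => //; exact: ms_1. Qed.
Lemma loc_eq_sym : symmetric loc_eq.
Proof. by move=> x y; apply/asboolP/asboolP => -[t St e]; exists t. Qed.
Lemma loc_eq_trans : transitive loc_eq.
Proof.
move=> y x z /asboolP [t St e] /asboolP [u Su f]; apply/asboolP.
exists (t * u * loc_den y); first by do 2?[apply: ms_M => //]; exact: loc_denP.
transitivity (u * loc_den z * (t * (loc_num x * loc_den y))); first by ring.
rewrite e; transitivity (t * loc_den x * (u * (loc_num y * loc_den z))); first by ring.
by rewrite f; ring.
Qed.
Canonical loc_equiv := EquivRel loc_eq loc_eq_refl loc_eq_sym loc_eq_trans.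

Definition loc := {eq_quot loc_eq}.
HB.instance Definition _ : EqQuotient _ loc_eq loc := EqQuotient.on loc.
HB.instance Definition _ := Choice.on loc.

Definition loc_mk (x : loc_frac) : loc := \pi_loc x.

Lemma loc_mkP x y : loc_mk x = loc_mk y <-> loc_rel x y.
Proof.
split; first by move/eqmodP => h; apply/asboolP.
by move=> h; apply/eqmodP; apply/asboolP.
Qed.

Lemma loc_ind (P : loc -> Prop) : (forall x, P (loc_mk x)) -> forall x, P x.
Proof. by move=> h x; rewrite -[x]reprK; exact: h. Qed.

Lemma loc_repr x : loc_rel (repr (loc_mk x)) x.
Proof. by apply/loc_mkP; rewrite /loc_mk reprK. Qed.

Definition frac_add (x y : loc_frac) : loc_frac :=
  MkFrac (loc_num x * loc_den y + loc_num y * loc_den x)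
         (ms_M (loc_denP x) (loc_denP y)).
Definition frac_mul (x y : loc_frac) : loc_frac :=
  MkFrac (loc_num x * loc_num y)
         (ms_M (loc_denP x) (loc_denP y)).
Definition frac_opp (x : loc_frac) : loc_frac :=
  MkFrac (- loc_num x) (loc_denP x).
Definition frac_of (r : R) : loc_frac := MkFrac (r) (ms_1 S).

Definition loc_add (x y : loc) : loc := loc_mk (frac_add (repr x) (repr y)).
Definition loc_mul (x y : loc) : loc := loc_mk (frac_mul (repr x) (repr y)).
Definition loc_opp (x : loc) : loc := loc_mk (frac_opp (repr x)).
Definition loc_of (r : R) : loc := loc_mk (frac_of r).

Lemma loc_addE x y : loc_add (loc_mk x) (loc_mk y) = loc_mk (frac_add x y).
Proof.
apply/loc_mkP; have [t St e] := loc_repr x; have [u Su f] := loc_repr y.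
exists (t * u) => /=; first exact: ms_M.
set x' := repr _ in e *; set y' := repr _ in f *.
transitivity (u * loc_den y * loc_den y' * (t * (loc_num x' * loc_den x)) +
              t * loc_den x * loc_den x' * (u * (loc_num y' * loc_den y))).
  by ring.
by rewrite e f; ring.
Qed.

Lemma loc_mulE x y : loc_mul (loc_mk x) (loc_mk y) = loc_mk (frac_mul x y).
Proof.
apply/loc_mkP; have [t St e] := loc_repr x; have [u Su f] := loc_repr y.
exists (t * u) => /=; first exact: ms_M.
set x' := repr _ in e *; set y' := repr _ in f *.
transitivity ((t * (loc_num x' * loc_den x)) * (u * (loc_num y' * loc_den y))).
  by ring.
by rewrite e f; ring.
Qed.

Lemma loc_oppE x : loc_opp (loc_mk x) = loc_mk (frac_opp x).
Proof.
apply/loc_mkP; have [t St e] := loc_repr x.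
by exists t => //=; rewrite !mulNr !mulrN e.
Qed.

Lemma loc_mk_eq x y : loc_num x * loc_den y = loc_num y * loc_den x ->
  loc_mk x = loc_mk y.
Proof. by move=> e; apply/loc_mkP; exists 1; [exact: ms_1 | rewrite e]. Qed.

Lemma loc_addA : associative loc_add.
Proof.
elim/loc_ind => x; elim/loc_ind => y; elim/loc_ind => z.
by rewrite !loc_addE; apply: loc_mk_eq => /=; ring.
Qed.
Lemma loc_addC : commutative loc_add.
Proof.
elim/loc_ind => x; elim/loc_ind => y.
by rewrite !loc_addE; apply: loc_mk_eq => /=; ring.
Qed.
Lemma loc_add0 : left_id (loc_of 0) loc_add.
Proof. by elim/loc_ind => x; rewrite loc_addE; apply: loc_mk_eq => /=; ring. Qed.
Lemma loc_addN : left_inverse (loc_of 0) loc_opp loc_add.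
Proof.
by elim/loc_ind => x; rewrite loc_oppE loc_addE; apply: loc_mk_eq => /=; ring.
Qed.
HB.instance Definition _ :=
  GRing.isZmodule.Build loc loc_addA loc_addC loc_add0 loc_addN.

Lemma loc_mulA : associative loc_mul.
Proof.
elim/loc_ind => x; elim/loc_ind => y; elim/loc_ind => z.
by rewrite !loc_mulE; apply: loc_mk_eq => /=; ring.
Qed.
Lemma loc_mulC : commutative loc_mul.
Proof.
elim/loc_ind => x; elim/loc_ind => y.
by rewrite !loc_mulE; apply: loc_mk_eq => /=; ring.
Qed.
Lemma loc_mul1 : left_id (loc_of 1) loc_mul.
Proof. by elim/loc_ind => x; rewrite loc_mulE; apply: loc_mk_eq => /=; ring. Qed.
Lemma loc_mulD : left_distributive loc_mul loc_add.
Proof.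
elim/loc_ind => x; elim/loc_ind => y; elim/loc_ind => z.
by rewrite !(loc_addE, loc_mulE); apply: loc_mk_eq => /=; ring.
Qed.
HB.instance Definition _ := GRing.Zmodule_isComPzRing.Build loc
  loc_mulA loc_mulC loc_mul1 loc_mulD.

Lemma loc_of_zmod_morphism : zmod_morphism loc_of.
Proof.
move=> x y; rewrite -[RHS]/(loc_add (loc_of x) (loc_opp (loc_of y))).
by rewrite loc_oppE loc_addE; apply: loc_mk_eq => /=; ring.
Qed.
Lemma loc_of_monoid_morphism : monoid_morphism loc_of.
Proof.
split=> // x y; rewrite -[RHS]/(loc_mul (loc_of x) (loc_of y)).
by rewrite loc_mulE; apply: loc_mk_eq => /=; ring.
Qed.
HB.instance Definition _ :=
  GRing.isZmodMorphism.Build R loc loc_of loc_of_zmod_morphism.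
HB.instance Definition _ :=
  GRing.isMonoidMorphism.Build R loc loc_of loc_of_monoid_morphism.

End Localisation.

(* The tensor product A (x)_R V, as an A-module: formal sums of pairs (a, v)
   modulo the relations of a tensor product. *)

Section BaseChange.
Variables (R A : comPzRingType) (f : {rmorphism R -> A}) (V : lmodType R).

Definition formal := seq (A * V).
HB.instance Definition _ := gen_eqMixin formal.
HB.instance Definition _ := gen_choiceMixin formal.

Inductive tens_rel : formal -> formal -> Prop :=
| tens_refl s : tens_rel s s
| tens_sym s t : tens_rel s t -> tens_rel t s
| tens_trans t s u : tens_rel s t -> tens_rel t u -> tens_rel s u
| tens_cat s s' t t' : tens_rel s s' -> tens_rel t t' ->
    tens_rel (s ++ t) (s' ++ t')
| tens_catC s t : tens_rel (s ++ t) (t ++ s)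
| tens_0l v : tens_rel [:: (0, v)] [::]
| tens_Dl a b v : tens_rel [:: (a + b, v)] [:: (a, v); (b, v)]
| tens_Dr a v w : tens_rel [:: (a, v + w)] [:: (a, v); (a, w)]
| tens_bal a r v : tens_rel [:: (a * f r, v)] [:: (a, r *: v)].

Definition tens_eq (s t : formal) : bool := `[< tens_rel s t >].
Lemma tens_eq_refl : reflexive tens_eq.
Proof. by move=> s; apply/asboolP; exact: tens_refl. Qed.
Lemma tens_eq_sym : symmetric tens_eq.
Proof. by move=> s t; apply/asboolP/asboolP; exact: tens_sym. Qed.
Lemma tens_eq_trans : transitive tens_eq.
Proof.
by move=> t s u /asboolP st /asboolP tu; apply/asboolP; exact: tens_trans tu.
Qed.
Canonical tens_equiv := EquivRel tens_eq tens_eq_refl tens_eq_sym tens_eq_trans.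

Definition base_change := {eq_quot tens_eq}.
Local Notation T := base_change.
HB.instance Definition _ : EqQuotient _ tens_eq T := EqQuotient.on T.
HB.instance Definition _ := Choice.on T.

Definition tens_mk (s : formal) : T := \pi_T s.

Lemma tens_mkP s t : tens_mk s = tens_mk t <-> tens_rel s t.
Proof.
split; first by move/eqmodP => h; apply/asboolP.
by move=> h; apply/eqmodP; apply/asboolP.
Qed.

Lemma tens_ind (P : T -> Prop) : (forall s, P (tens_mk s)) -> forall x, P x.
Proof. by move=> h x; rewrite -[x]reprK; exact: h. Qed.

Lemma tens_repr s : tens_rel (repr (tens_mk s)) s.
Proof. by apply/tens_mkP; rewrite /tens_mk reprK. Qed.

Definition formal_scale (c : A) (s : formal) : formal :=
  [seq (c * x.1, x.2) | x <- s].

Lemma formal_scale_rel c s t :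
  tens_rel s t -> tens_rel (formal_scale c s) (formal_scale c t).
Proof.
elim=> {s t} [s|s t _|t s u _ st _ tu|s s' t t' _ h _ h'|s t|v|a b v|a v w|a r v].
- exact: tens_refl.
- exact: tens_sym.
- exact: tens_trans tu.
- by rewrite /formal_scale !map_cat; exact: tens_cat.
- by rewrite /formal_scale !map_cat; exact: tens_catC.
- by rewrite /= mulr0; exact: tens_0l.
- by rewrite /= mulrDr; exact: tens_Dl.
- exact: tens_Dr.
- by rewrite /= mulrA; exact: tens_bal.
Qed.

Definition tens_add (x y : T) : T := tens_mk (repr x ++ repr y).
Definition tens_scale (c : A) (x : T) : T := tens_mk (formal_scale c (repr x)).
Definition tens_opp (x : T) : T := tens_scale (-1) x.
Definition tens_zero : T := tens_mk [::].

Lemma tens_addE s t : tens_add (tens_mk s) (tens_mk t) = tens_mk (s ++ t).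
Proof. by apply/tens_mkP; apply: tens_cat; exact: tens_repr. Qed.
Lemma tens_scaleE c s : tens_scale c (tens_mk s) = tens_mk (formal_scale c s).
Proof. by apply/tens_mkP; apply: formal_scale_rel; exact: tens_repr. Qed.

Lemma tens_addA : associative tens_add.
Proof.
by elim/tens_ind => s; elim/tens_ind => t; elim/tens_ind => u; rewrite !tens_addE catA.
Qed.
Lemma tens_addC : commutative tens_add.
Proof.
elim/tens_ind => s; elim/tens_ind => t; rewrite !tens_addE.
by apply/tens_mkP; exact: tens_catC.
Qed.
Lemma tens_add0 : left_id tens_zero tens_add.
Proof. by elim/tens_ind => s; rewrite tens_addE. Qed.

Lemma tens_scaleA c d x : tens_scale c (tens_scale d x) = tens_scale (c * d) x.
Proof.
elim/tens_ind: x => s; rewrite !tens_scaleE /formal_scale -map_comp.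
by congr tens_mk; apply: eq_map => x /=; rewrite mulrA.
Qed.
Lemma tens_scale1 : left_id 1 tens_scale.
Proof.
elim/tens_ind => s; rewrite tens_scaleE /formal_scale.
by congr tens_mk; rewrite -[RHS]map_id; apply: eq_map => -[a v] /=; rewrite mul1r.
Qed.
Lemma tens_scaleDr : right_distributive tens_scale tens_add.
Proof.
move=> c; elim/tens_ind => s; elim/tens_ind => t.
by rewrite !(tens_scaleE, tens_addE) /formal_scale map_cat.
Qed.
Lemma tens_scaleDl x c d :
  tens_scale (c + d) x = tens_add (tens_scale c x) (tens_scale d x).
Proof.
elim/tens_ind: x => s; rewrite !tens_scaleE tens_addE; apply/tens_mkP.
elim: s => [|[a v] s IH]; first exact: tens_refl.
have -> : formal_scale c ((a, v) :: s) ++ formal_scale d ((a, v) :: s) =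
  [:: (c * a, v)] ++ (formal_scale c s ++ [:: (d * a, v)]) ++ formal_scale d s.
  by rewrite /= -catA.
apply: (@tens_trans
  ([:: (c * a, v)] ++ ([:: (d * a, v)] ++ formal_scale c s) ++ formal_scale d s)).
  apply: (@tens_cat [:: ((c + d) * a, v)] [:: (c * a, v); (d * a, v)]) IH.
  by rewrite mulrDl; exact: tens_Dl.
apply: tens_cat; first exact: tens_refl.
apply: tens_cat; last exact: tens_refl.
exact: tens_catC.
Qed.
Lemma tens_scale0 x : tens_scale 0 x = tens_zero.
Proof.
elim/tens_ind: x => s; rewrite tens_scaleE; apply/tens_mkP.
elim: s => [|[a v] s IH]; first exact: tens_refl.
rewrite /= mul0r -[_ :: _]/([:: (0, v)] ++ _) -[[::]]/([::] ++ [::]).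
by apply: tens_cat => //; exact: tens_0l.
Qed.
Lemma tens_addN : left_inverse tens_zero tens_opp tens_add.
Proof.
move=> x; rewrite -{2}[x]tens_scale1 -tens_scaleDl addNr.
exact: tens_scale0.
Qed.

HB.instance Definition _ :=
  GRing.isZmodule.Build T tens_addA tens_addC tens_add0 tens_addN.
HB.instance Definition _ := GRing.Zmodule_isLmodule.Build A T
  tens_scaleA tens_scale1 tens_scaleDr (fun x c d => tens_scaleDl x c d).

End BaseChange.

Section RankAndFiniteGeneration.
Variables (R : comNzRingType) (V : lmodType R).

Definition finitely_generated : Prop :=
  exists (n : nat) (v : 'I_n -> V), forall x, exists c : 'I_n -> R,
    x = \sum_i c i *: v i.

Definition lin_indep n (v : 'I_n -> V) : Prop :=
  forall c : 'I_n -> R, \sum_i c i *: v i = 0 -> forall i, c i = 0.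

Definition has_rank (r : nat) : Prop :=
  (exists v : 'I_r -> V, lin_indep v) /\
  (forall v : 'I_r.+1 -> V, ~ lin_indep v).

(* The maximal number of linearly independent elements; [None] means that there
   is no maximum.  Over a domain this is the dimension of V after extension of
   scalars to the fraction field. *)
Definition rank : option nat :=
  if pselect (exists r, has_rank r) is left h then Some (projT1 (cid h))
  else None.

End RankAndFiniteGeneration.

Section PseudoNull.
Variable R : comPzRingType.

Definition prime_ideal (P : set R) : Prop :=
  [/\ P 0, forall x y, P x -> P y -> P (x + y), forall a x, P x -> P (a * x),
      ~ P 1 & forall x y, P (x * y) -> P x \/ P y].

Definition height_le1 (P : set R) : Prop :=
  forall P0 P1 : set R, prime_ideal P0 -> prime_ideal P1 ->
    ~ (P0 `<` P1 /\ P1 `<` P).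

(* The localisation of V at each prime ideal P of height at most 1 vanishes,
   i.e. each v in V is killed by some a outside P. *)
Definition pseudo_null (V : lmodType R) : Prop :=
  forall P : set R, prime_ideal P -> height_le1 P ->
    forall v : V, exists2 a, ~ P a & a *: v = 0.

End PseudoNull.

Section IwasawaModules.
Variables (p : nat) (k : set algC) (K : Zp_extension p k).
Local Notation Lambda := (iwasawa_algebra K).
Local Notation Gam := (gal k K).

Section RestrictScalars.
Variable V : lmodType Lambda.

Definition Zp_module : Type := V.
HB.instance Definition _ := GRing.Zmodule.on Zp_module.
Definition Zp_scale (a : Zp p) (v : Zp_module) : Zp_module :=
  iw_const K a *: (v : V).

Lemma Zp_scaleA a b v : Zp_scale a (Zp_scale b v) = Zp_scale (a * b) v.
Proof. by rewrite /Zp_scale scalerA -iw_constM. Qed.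
Lemma Zp_scale1 : left_id 1 Zp_scale.
Proof. by move=> v; rewrite /Zp_scale iw_const1 scale1r. Qed.
Lemma Zp_scaleDr : right_distributive Zp_scale +%R.
Proof. by move=> a v w; rewrite /Zp_scale scalerDr. Qed.
Lemma Zp_scaleDl v : {morph Zp_scale^~ v : a b / a + b}.
Proof. by move=> a b; rewrite /Zp_scale iw_constD scalerDl. Qed.
HB.instance Definition _ := GRing.Zmodule_isLmodule.Build (Zp p) Zp_module
  Zp_scaleA Zp_scale1 Zp_scaleDr Zp_scaleDl.

End RestrictScalars.

(* V_Gal(K/k) is the quotient of V by the subgroup generated by the elements
   (g - 1) v, which is a Lambda-submodule. *)
Section Coinvariants.
Variable V : lmodType Lambda.

Inductive aug_rel : V -> Prop :=
| aug_gen (g : Gam) v : aug_rel ((iw_group g - 1) *: v)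
| aug_0 : aug_rel 0
| aug_B x y : aug_rel x -> aug_rel y -> aug_rel (x - y).

Definition aug_sub : {pred V} := [pred v | `[< aug_rel v >]].
Lemma aug_subP v : reflect (aug_rel v) (v \in aug_sub).
Proof. exact: asboolP. Qed.

Lemma aug_zmod_closed : zmod_closed aug_sub.
Proof.
split; first by apply/aug_subP; exact: aug_0.
by move=> x y /aug_subP x1 /aug_subP y1; apply/aug_subP; exact: aug_B.
Qed.
HB.instance Definition _ := GRing.isZmodClosed.Build V aug_sub aug_zmod_closed.

Lemma aug_scale c v : v \in aug_sub -> c *: v \in aug_sub.
Proof.
move=> /aug_subP h; apply/aug_subP.
elim: h => {v} [g v||x y _ hx _ hy].
- by rewrite scalerA mulrC -scalerA; exact: aug_gen.
- by rewrite scaler0; exact: aug_0.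
- by rewrite scalerBr; exact: aug_B.
Qed.

Definition aug_zmod : zmodClosed V := aug_sub.
Definition coinvariants := Quotient.quot aug_zmod.
Local Notation Q := coinvariants.
HB.instance Definition _ : EqQuotient V (Quotient.equiv aug_zmod) Q :=
  EqQuotient.on Q.
HB.instance Definition _ := Choice.on Q.
HB.instance Definition _ := GRing.Zmodule.on Q.

Definition coinv_scale (c : Lambda) (x : Q) : Q := \pi_Q (c *: repr x).

Lemma coinv_piP (x y : V) : (\pi_Q x = \pi_Q y) <-> (x - y \in aug_sub).
Proof. by split=> [/eqmodP|h]; last exact/eqmodP. Qed.

Lemma coinv_scaleE c x : coinv_scale c (\pi_Q x) = \pi_Q (c *: x).
Proof.
apply/coinv_piP; rewrite -scalerBr; apply: aug_scale.
by apply/coinv_piP; rewrite reprK.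
Qed.

Lemma coinv_ind (P : Q -> Prop) : (forall x, P (\pi_Q x)) -> forall x, P x.
Proof. by move=> h x; rewrite -[x]reprK; exact: h. Qed.

Lemma coinv_scaleA c d x : coinv_scale c (coinv_scale d x) = coinv_scale (c * d) x.
Proof. by elim/coinv_ind: x => x; rewrite !coinv_scaleE scalerA. Qed.
Lemma coinv_scale1 : left_id 1 coinv_scale.
Proof. by elim/coinv_ind => x; rewrite coinv_scaleE scale1r. Qed.
Lemma coinv_scaleDr : right_distributive coinv_scale +%R.
Proof.
move=> c; elim/coinv_ind => x; elim/coinv_ind => y.
by rewrite -raddfD !coinv_scaleE scalerDr raddfD.
Qed.
Lemma coinv_scaleDl x : {morph coinv_scale^~ x : c d / c + d}.
Proof.
elim/coinv_ind: x => x c d.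
by rewrite !coinv_scaleE scalerDl raddfD.
Qed.
HB.instance Definition _ := GRing.Zmodule_isLmodule.Build Lambda Q
  coinv_scaleA coinv_scale1 coinv_scaleDr coinv_scaleDl.

End Coinvariants.

Inductive dagger_rel : Lambda -> Prop :=
| dagger_1 : dagger_rel 1
| dagger_M (g : Gam) x :
    g <> 1%g -> dagger_rel x -> dagger_rel ((iw_group g - 1) * x).

Lemma dagger_relM x y : dagger_rel x -> dagger_rel y -> dagger_rel (x * y).
Proof.
elim=> {x} [|g x g1 _ IH] hy; first by rewrite mul1r.
by rewrite -mulrA; apply: dagger_M => //; exact: IH.
Qed.

Definition dagger_set : mult_set Lambda := MkMultSet dagger_1 dagger_relM.

Definition iw_dagger := loc dagger_set.
HB.instance Definition _ := GRing.ComPzRing.on iw_dagger.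

Definition dagger (V : lmodType Lambda) : lmodType iw_dagger :=
  base_change (loc_of dagger_set : {rmorphism Lambda -> iw_dagger}) V.

(* Gal(M/K) as a module over Lambda = Z_p[[Gal(K/k)]], for M/K abelian pro-p
   with M/k Galois: Gal(K/k) acts by conjugation by arbitrary lifts to Gal(M/k),
   and the Lambda-module structure is the unique one extending this action for
   which l |-> l x is continuous for all x.  The ideals of the l in Lambda whose
   image in (Z/p^(n+1))[Q] is 0 form a basis of neighbourhoods of 0. *)
Record iwasawa_module (M : set algC) := MkIwasawaModule {
  im_mod :> lmodType Lambda;
  im_aut : im_mod -> gal K M;
  im_bij : bijective im_aut;
  im_morph : forall x y, im_aut (x + y) = (im_aut x * im_aut y)%g;
  im_conj : forall (t : gal k M) (g : Gam), (forall a, ext_field K a -> t a = g a) ->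
    forall x a, M a -> im_aut (iw_group g *: x) (t a) = t (im_aut x a);
  im_cont : forall x (A : seq algC), (forall a, a \in A -> M a) ->
    exists (Q : finite_quotient k K) (n : nat), forall l : Lambda,
      (forall y, l Q y n = 0) -> gal_fixing A (im_aut (l *: x))
}.

Definition coinvariant_rank (M : set algC) (X : iwasawa_module M) : option nat :=
  rank (Zp_module (coinvariants X)).

End IwasawaModules.

Definition integers_of (M : set algC) : set algC := [set x | M x /\ x \in Aint].

Definition prime_of (M P : set algC) : Prop :=
  [/\ P `<=` integers_of M /\ (exists2 x, P x & x != 0),
      forall x y, P x -> P y -> P (x + y),
      forall a x, integers_of M a -> P x -> P (a * x),
      ~ P 1 &
      forall x y, integers_of M x -> integers_of M y -> P (x * y) -> P x \/ P y].

Definition decomposition (F M P : set algC) : set (gal F M) :=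
  [set s | forall x, P x <-> P (s x)].

Definition inertia (F M P : set algC) : set (gal F M) :=
  [set s | forall x, integers_of M x -> P (s x - x)].

Arguments decomposition F M P _ : clear implicits.
Arguments inertia F M P _ : clear implicits.

Definition embedding (M : set algC) (t : algC -> algC) : Prop :=
  [/\ t 1 = 1, forall x y, M x -> M y -> t (x + y) = t x + t y &
      forall x y, M x -> M y -> t (x * y) = t x * t y].

(* Unramified at all places: trivial inertia at the finite primes, and no real
   place of F becomes complex in M. *)
Definition unramified (F M : set algC) : Prop :=
  (forall P, prime_of M P -> inertia F M P = [set 1%g]) /\
  (forall t, embedding M t -> (forall x, F x -> t x \is Num.real) ->
    forall x, M x -> t x \is Num.real).

Definition unramified_abelian_pro_p (p : nat) (F M : set algC) : Prop :=
  [/\ galois F M, forall s t : gal F M, (s * t = t * s)%g, pro_p F M p &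
      unramified F M].

Definition p_split (p : nat) (F M : set algC) : Prop :=
  forall P, prime_of M P -> P p%:R -> decomposition F M P = [set 1%g].

(* L = L(F) *)
Definition max_unramified (p : nat) (F L : set algC) : Prop :=
  unramified_abelian_pro_p p F L /\
  forall M, unramified_abelian_pro_p p F M -> M `<=` L.

(* L' = L'(F), where L = L(F); as L/F is abelian, every subextension of L/F is
   Galois over F. *)
Definition max_p_split (p : nat) (F L L' : set algC) : Prop :=
  let sub M := [/\ subfield M, F `<=` M, M `<=` L & p_split p F M] in
  sub L' /\ forall M, sub M -> M `<=` L'.

(* No prime of k above p splits in K: only one prime of K lies above it. *)
Definition nonsplit (p : nat) (k K : set algC) : Prop :=
  forall q, prime_of k q -> q p%:R ->
  forall P P', prime_of K P -> prime_of K P' ->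
    P `&` k = q -> P' `&` k = q -> P = P'.

(* Main.v *)
(* Write G = Gal(K/k), T = g - 1 for a topological generator g, and X = X(K).

   Finite generation. X/(p, T)X is finite: an independent family in it gives that many characters of
   order p of Gal(L/k), by extension from Gal(L/K); since L/K is unramified, such a character is
   determined by its values at finitely many elements of inertia for each of the finitely many primes over p of
   k(zeta_p), up to unramified characters, which are finitely many by Kummer theory, Dirichlet's unit
   theorem and the finiteness of the class number. As the dagger module is pseudo-null, X
   vanishes locally at p Lambda: some f outside p Lambda kills given generators, f divides a power of
   T modulo p, and X is finitely generated over Z_p.

   Rank. The augmentation submodule of X turns out to be Z_p-torsion, from three facts.
   (1) If h <> 1 fixes exactly F over k, then s |-> [t, s] is, modulo (h - 1)X, an unramified
   homomorphism on Gal(Qbar/F): at a prime over p one chooses t in the decomposition group, which is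
   possible as the prime does not split, and decomposition groups are commutative modulo inertia.
   Unramified characters of F have bounded order (the counting of Hilbert 94), so a fixed power of p
   sends the augmentation submodule into (h - 1)X.
   (2) All primes over p split in the fixed field of the invariants X^G, again by commutators in the
   decomposition groups. Hence the kernel of X -> X' consists of invariants, and s'(K/k) = 0 gives, for
   each v, a nonzero multiple of v in the sum of X^G and the augmentation submodule.
   (3) Every prime of Lambda strictly above two others contains p, so X is killed by some p^m s with s
   a product of elements h - 1.
   Iterating (1) and (2) along the factors of s, each v has a nonzero multiple in X^G. *)

From HB Require Import structures.
From mathcomp Require Import all_boot all_order all_algebra all_fingroup all_field.
From mathcomp Require Import generic_quotient ring_quotient.
From mathcomp Require Import boolp classical_sets filter.
From mathcomp Require Import ring lra zify.
From mathcomp Require cyclic.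
Require Import Defs.
Set Implicit Arguments. Unset Strict Implicit. Unset Printing Implicit Defensive.
Import Order.TTheory GRing.Theory Num.Theory.
Local Open Scope ring_scope.

(** * Automorphisms of the algebraic numbers *)

(** The bound on the order of unramified characters of F comes from a count of units rather than
    from class field theory. For M/F cyclic of degree N with generator s, unramified everywhere, and
    r archimedean places of F, let E be the units of M, A those of norm 1, phi x = s x / x, and B =
    phi(U) with U generated by a Galois-stable family of Minkowski units. Then A has at least
    [A : B] N^r classes modulo phi(B). But Hilbert 90 embeds A / phi(E) in the class group of F, the
    norm bounds the index of phi(A) in phi(E) by a constant times N^(r-1), and phi(A) / phi(B) has
    at most [A : B] elements. So N is bounded in terms of F. For finite generation the obstacle is
    that X is at first only a compact module: relations are proved modulo the open submodules that
    fix finite Galois-stable sets of numbers, and ultrafilter limits of their coefficients make them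
    exact. *)

(* The automorphisms of algC: every Galois group below is studied through lifts to this group. *)
Notation aut := (gal (@classical_sets.set0 algC) (@classical_sets.setT algC)).

Lemma autM (s t : aut) x : (s * t)%g x = s (t x). Proof. by []. Qed.
Lemma aut1 x : (1%g : aut) x = x. Proof. by []. Qed.
Lemma autKV (s : aut) : cancel s (s^-1)%g. Proof. exact: gal_funK. Qed.
Lemma autVK (s : aut) : cancel (s^-1)%g s. Proof. exact: gal_invK. Qed.

Lemma aut_zmod_morphism (s : aut) : zmod_morphism s.
Proof.
move=> x y; apply: (addIr (s y)).
by rewrite -(gal_add s) // !subrK.
Qed.

Lemma aut_monoid_morphism (s : aut) : monoid_morphism s.
Proof.
split=> [|x y]; last exact: (gal_mul s).
have h : s 1 * s 1 = s 1 by rewrite -(gal_mul s) // mulr1.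
have n0 : s 1 != 0.
  apply/eqP => s10; have s0 : s 0 = 0.
    by rewrite -[X in s X](subrr 1) aut_zmod_morphism subrr.
  by move: (can_inj (autKV s)) => /(_ 1 0); rewrite s0 => /(_ s10) /eqP; rewrite oner_eq0.
by apply: (mulfI n0); rewrite h mulr1.
Qed.

HB.instance Definition _ (s : aut) :=
  GRing.isZmodMorphism.Build algC algC (gal_fun s) (aut_zmod_morphism s).
HB.instance Definition _ (s : aut) :=
  GRing.isMonoidMorphism.Build algC algC (gal_fun s) (aut_monoid_morphism s).

Definition aut_mk (f g : algC -> algC) (fK : cancel f g) (gK : cancel g f)
  (fD : {morph f : x y / x + y}) (fM : {morph f : x y / x * y}) : aut.
Proof.
exists f g => //; by move=> x; case.
Defined.

Definition aut_of (nu : {rmorphism algC -> algC}) : aut.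
Proof. exact: (aut_mk (algC_autK nu) (algC_invautK nu) (rmorphD nu) (rmorphM nu)). Defined.

Lemma aut_ofE (nu : {rmorphism algC -> algC}) x : aut_of nu x = nu x.
Proof. by []. Qed.

Definition conjugates (a : algC) : seq algC :=
  undup (sval (closed_field_poly_normal (minCpoly a))).

Lemma conjugatesP a b : (b \in conjugates a) = root (minCpoly a) b.
Proof.
rewrite /conjugates mem_undup; case: closed_field_poly_normal => r /= ->.
by rewrite (monicP (minCpoly_monic a)) scale1r root_prod_XsubC.
Qed.

Lemma aut_conjugates (s : aut) a : s a \in conjugates a.
Proof. by rewrite conjugatesP -(minCpoly_aut s) root_minCpoly. Qed.

(** The induction moves the points of an excluded fibre over [v] into the fibre of some [g t0]
    different from [v], so that [v] leaves the list of values. *)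
Lemma ultra_fin T (U : set_system T) (V : eqType) (r : seq V) (g : T -> V) :
  UltraFilter U -> (forall t, g t \in r) -> exists v, U [set t | g t = v]%classic.
Proof.
move=> UU; elim: r g => [|v r IH] g gr.
  have /filter_ex [t _] : U setT by exact: filterT.
  by have := gr t; rewrite in_nil.
have [h|h] := in_ultra_setVsetC [set t | g t = v]%classic UU; first by exists v.
have [t0 /= gt0] := filter_ex h.
have : forall t, (if g t == v then g t0 else g t) \in r.
  move=> t; case: eqP => [_|ne].
    by have := gr t0; rewrite inE => /orP[/eqP|].
  by have := gr t; rewrite inE => /orP[/eqP|].
move=> /IH [w Uw]; exists w; apply: filterS (filterI h Uw) => t /= [ne].
by case: eqP.
Qed.

Lemma ultra_seq T (U : set_system T) (V : eqType) (A : seq V) (Q : V -> set T) :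
  UltraFilter U -> (forall a, U (Q a)) -> U [set t | forall a, a \in A -> Q a t]%classic.
Proof.
move=> UU UQ; elim: A => [|a A IH]; first by apply: filterS filterT.
apply: filterS (filterI (UQ a) IH) => t /= [h1 h2] b.
by rewrite inE => /orP[/eqP->|/h2].
Qed.

(** Compactness of the absolute Galois group of Q: a number has finitely many conjugates, so an
    ultrafilter decides the value of the limit at each point; the limit of the inverses is its
    inverse. *)
Lemma aut_ulim T (U : set_system T) (f : T -> aut) : UltraFilter U ->
  exists s : aut, forall A : seq algC,
    U [set t | forall x, x \in A -> f t x = s x]%classic.
Proof.
move=> UU.
have h1 x : exists v, U [set t | f t x = v]%classic.
  by apply: (ultra_fin (r := conjugates x)) => t; exact: aut_conjugates.
have h2 x : exists v, U [set t | (f t)^-1%g x = v]%classic.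
  by apply: (ultra_fin (r := conjugates x)) => t; exact: aut_conjugates.
pose s0 x := projT1 (cid (h1 x)); pose s1 x := projT1 (cid (h2 x)).
have U0 x : U [set t | f t x = s0 x]%classic by rewrite /s0; case: cid.
have U1 x : U [set t | (f t)^-1%g x = s1 x]%classic by rewrite /s1; case: cid.
have A0 := fun A => ultra_seq A UU U0.
have K0 : cancel s0 s1.
  move=> x; have [t /= [e1 e2]] := filter_ex (filterI (U0 x) (U1 (s0 x))).
  by move: (gal_funK (f t) x); rewrite e1 e2.
have K1 : cancel s1 s0.
  move=> x; have [t /= [e1 e2]] := filter_ex (filterI (U1 x) (U0 (s1 x))).
  by move: (gal_invK (f t) x); rewrite e1 e2.
have sD x y : s0 (x + y) = s0 x + s0 y.
  have [t /= h] := filter_ex (A0 [:: x; y; x + y]).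
  by rewrite -!h ?inE ?eqxx ?orbT // rmorphD.
have sM x y : s0 (x * y) = s0 x * s0 y.
  have [t /= h] := filter_ex (A0 [:: x; y; x * y]).
  by rewrite -!h ?inE ?eqxx ?orbT // rmorphM.
by exists (aut_mk K0 K1 sD sM).
Qed.

(** The sets [C A] need not be closed, so [s] is not claimed to lie in them: on any finite list it
    is approximated by members of each [C B]. Every use recovers a closed condition by taking for
    [A] the points that it involves. *)
Lemma aut_compact (C : seq algC -> set aut) :
  (forall A, exists s, C A s) ->
  (forall A B : seq algC, {subset A <= B} -> (C B `<=` C A)%classic) ->
  exists s : aut, forall A B : seq algC, exists2 s' : aut, C B s' & forall x, x \in A -> s' x = s x.
Proof.
move=> C0 CS; pose F := filter_from [set: seq algC]%classic C.
have FF : ProperFilter F.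
  apply: filter_from_proper; last by move=> A _; have [s] := C0 A; exists s.
  apply: filter_from_filter; first by exists [::].
  move=> A B _ _; exists (A ++ B) => // s h; split; apply: CS h => x xA;
    by rewrite mem_cat xA ?orbT.
have [U [UU FU]] := ultraFilterLemma FF.
have [s hs] := aut_ulim id UU; exists s => A B.
have UB : U (C B) by apply: FU; exists B.
by have [s' /= [h1 h2]] := filter_ex (filterI UB (hs A)); exists s'.
Qed.

Definition fixes (F : set algC) (s : aut) : Prop := forall x, F x -> s x = x.

Section Subfield.
Variables (F : set algC) (sF : subfield F).
Lemma sf1 : F 1. Proof. by case: sF. Qed.
Lemma sfB x y : F x -> F y -> F (x - y). Proof. by case: sF => _ h _; exact: h. Qed.
Lemma sf_div x y : F x -> F y -> F (x / y). Proof. by case: sF => _ _ h; exact: h. Qed.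
Lemma sf0 : F 0. Proof. by rewrite -(subrr 1); apply: sfB; exact: sf1. Qed.
Lemma sfN x : F x -> F (- x). Proof. by rewrite -sub0r; apply: sfB; exact: sf0. Qed.
Lemma sfD x y : F x -> F y -> F (x + y).
Proof. by move=> Fx Fy; rewrite -[y]opprK; apply/sfB/sfN. Qed.
Lemma sfV x : F x -> F x^-1. Proof. by rewrite -div1r; apply: sf_div; exact: sf1. Qed.
Lemma sfM x y : F x -> F y -> F (x * y).
Proof. by move=> Fx Fy; rewrite -[y]invrK; apply/sf_div/sfV. Qed.
Lemma sfX x n : F x -> F (x ^+ n).
Proof. by move=> Fx; elim: n => [|n IH]; rewrite ?expr0 ?exprS; [exact: sf1|exact: sfM]. Qed.
Lemma sf_sum I (r : seq I) (P : pred I) (f : I -> algC) :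
  (forall i, P i -> F (f i)) -> F (\sum_(i <- r | P i) f i).
Proof. by move=> h; elim/big_ind: _ => //; [exact: sf0|exact: sfD]. Qed.
Lemma sf_prod I (r : seq I) (P : pred I) (f : I -> algC) :
  (forall i, P i -> F (f i)) -> F (\prod_(i <- r | P i) f i).
Proof. by move=> h; elim/big_ind: _ => //; [exact: sf1|exact: sfM]. Qed.
Lemma sf_nat n : F n%:R.
Proof. by elim: n => [|n IH]; rewrite ?mulrS; [exact: sf0|apply: sfD => //; exact: sf1]. Qed.
Lemma sf_int (n : int) : F n%:~R.
Proof. by case: n => n; rewrite ?NegzE ?mulrNz; [|apply: sfN]; exact: sf_nat. Qed.
Lemma sf_rat (r : rat) : F (ratr r).
Proof. by rewrite /ratr; apply: sf_div; exact: sf_int. Qed.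
Lemma sf_horner (p : {poly algC}) x : (forall i, F p`_i) -> F x -> F p.[x].
Proof.
move=> hp Fx; rewrite horner_coef; apply: sf_sum => i _.
by apply: sfM; [exact: hp|exact: sfX].
Qed.
End Subfield.

Local Notation pQtoC := (map_poly (ratr : rat -> algC)).

(* A finite Galois extension of Q containing [B] and [x] moves [x] over Q(B)
   unless x lies in Q(B); its automorphisms extend to algC. *)
Lemma subfield_fix_seq (B : seq algC) (F : set algC) x : subfield F ->
  (forall y, y \in B -> F y) ->
  (forall s : aut, (forall y, y \in B -> s y = y) -> s x = x) -> F x.
Proof.
move=> sF BF fx.
have [z _ [[|px ps] // [Dx Ds]]] := algC_PET (x :: B).
have [p [_ mon_p] /(_ p) pz0] := minCpolyP z; rewrite dvdpp in pz0.
have [r Dr] := closed_field_poly_normal (pQtoC p : {poly algC}).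
rewrite lead_coef_map {mon_p}(monicP mon_p) rmorph1 scale1r in Dr.
have rz : z \in r by rewrite -root_prod_XsubC -Dr.
have [Qr [QrC [rr Drr genQr]]] := num_field_exists r.
have [zz Dz] : {zz | QrC zz = z}.
  by move: rz; rewrite -Drr => /mapP/sig2_eqW[zz]; exists zz.
have Sinj_poly q : map_poly QrC (map_poly (in_alg Qr) q) = pQtoC q.
  by rewrite -map_poly_comp; apply: eq_map_poly => a; rewrite /= rmorphZ_num rmorph1 mulr1.
have axQ : SplittingField.axiom Qr.
  exists (map_poly (in_alg Qr) p).
    by apply/polyOverP=> i; rewrite coef_map memvZ ?memv_line.
  exists rr => //.
  congr (_ %= _): (eqpxx (map_poly (in_alg Qr) p)); apply/(map_poly_inj QrC).
  rewrite Sinj_poly Dr -Drr big_map rmorph_prod /=; apply: eq_bigr => y _.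
  by rewrite map_polyXsubC.
pose QM := FieldExt_isSplittingField.Build _ Qr axQ.
pose Qn : splittingFieldType rat := HB.pack Qr QM.
pose QnC : {rmorphism Qn -> algC} := QrC.
pose lift q : Qn := (map_poly (in_alg Qr) q).[zz].
have liftE q : QnC (lift q) = (pQtoC q).[z] by rewrite /lift -horner_map Dz Sinj_poly.
pose xx := lift px; pose BB := map lift ps.
have DB : map QnC BB = B.
  by rewrite Ds -map_comp; apply: eq_map => q /=; rewrite liftE.
pose K := <<1 & BB>>%AS.
suff : xx \in K.
  have FBgen (t : seq Qn) : (forall b, b \in t -> F (QnC b)) ->
      forall u, u \in <<1 & t>>%VS -> F (QnC u).
    elim/last_ind: t => [_ u|t b IH FB u].
      by rewrite Fadjoin_nil => /vlineP[c ->]; rewrite alg_num_field fmorph_rat; exact: sf_rat.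
    rewrite adjoin_rcons => /Fadjoin_polyP [q qK ->].
    rewrite -horner_map; apply: sf_horner => // [i|]; last by apply: FB; rewrite mem_rcons inE eqxx.
    rewrite coef_map; apply: IH; last exact: (polyOverP qK).
    by move=> c cs; apply: FB; rewrite mem_rcons inE cs orbT.
  have FB : forall b, b \in BB -> F (QnC b).
    by move=> b bB; apply: BF; rewrite -DB; exact: map_f.
  move=> h; have := FBgen _ FB _ h.
  by rewrite liftE -Dx.
have galK : galois.galois K {:Qn}.
  apply/and3P; split; rewrite ?subvf ?normalFieldf //.
  by apply/separableP => u _; apply: pcharf0_separable => q; rewrite pchar_lalg pchar_num.
rewrite -(galois_fixedField galK); apply/fixedFieldP; first exact: memvf.
move=> g gK; have [nu Dnu] := @extend_algC_subfield_aut Qr QrC (g : {rmorphism Qr -> Qr}).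
apply: (fmorph_inj QnC); rewrite Dnu liftE -Dx.
apply: (fx (aut_of nu)) => y; rewrite -DB => /mapP[b bB ->].
rewrite aut_ofE -Dnu; congr (QrC _).
by apply: (fixed_gal _ gK); rewrite ?subvf // (subvP (seqv_sub_adjoin _ bB)) ?memv_line.
Qed.

(** Galois correspondence for a subfield of possibly infinite degree: if x were outside F, each
    finite part of F could be fixed while x moves, and compactness would give one automorphism doing
    so for all of F. *)
Lemma subfield_fix (F : set algC) x : subfield F ->
  (forall s : aut, fixes F s -> s x = x) -> F x.
Proof.
move=> sF fx; apply: contrapT => nFx.
have [A|A B AB s [h1 h2]|s hs] := @aut_compact
  (fun A => [set s : aut | (forall y, y \in A -> F y -> s y = y) /\ s x <> x]%classic).
- apply: contrapT => /forallNP h; apply: nFx.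
  apply: (@subfield_fix_seq [seq y <- A | `[< F y >]] F x sF) => [y|s hs].
    by rewrite mem_filter => /andP[/asboolP].
  apply: contrapT => sx; apply: (h s); split => // y yA Fy; apply: hs.
  by rewrite mem_filter yA andbT; apply/asboolP.
- by split=> // y yA; apply: h1; exact: AB.
have sF' : fixes F s.
  by move=> y Fy; have [s' [h1 _] e] := hs [:: y] [:: y]; rewrite -e ?inE // h1 ?inE.
by have [s' [_ h2] e] := hs [:: x] [::]; apply: h2; rewrite e ?inE ?fx.
Qed.

(** * Subgroups of automorphisms, their orbits on finite lists and their closures *)

Definition aut_group (H : set aut) : Prop :=
  [/\ H 1%g, forall s t, H s -> H t -> H (s * t)%g & forall s, H s -> H (s^-1)%g].

Lemma fixes_group F : aut_group (fixes F).
Proof.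
split=> [x|s t hs ht x Fx|s hs x Fx] //; first by rewrite autM ht // hs.
by rewrite -{1}(hs x Fx) autKV.
Qed.

Lemma fixesM F s t : fixes F s -> fixes F t -> fixes F (s * t)%g.
Proof. by case: (fixes_group F) => _ h _; exact: h. Qed.
Lemma fixesV F s : fixes F s -> fixes F (s^-1)%g.
Proof. by case: (fixes_group F) => _ _ h; exact: h. Qed.
Lemma fixesX F s n : fixes F s -> fixes F (s ^+ n)%g.
Proof.
move=> h; elim: n => [|n IH]; first by rewrite expg0.
by rewrite expgS; exact: fixesM.
Qed.

Fixpoint conj_lists (A : seq algC) : seq (seq algC) :=
  if A is a :: A' then [seq b :: l | b <- conjugates a, l <- conj_lists A']
  else [:: [::]].

Lemma map_conj_lists (s : aut) A : map s A \in conj_lists A.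
Proof.
elim: A => //= a A IH; apply/allpairsP; exists (s a, map s A).
by split => //; exact: aut_conjugates.
Qed.

Definition orbit_list (H : set aut) (A : seq algC) : seq (seq algC) :=
  [seq l <- undup (conj_lists A) | `[< exists2 h, H h & l = map h A >]].

Lemma orbit_listP H A l : l \in orbit_list H A <-> exists2 h, H h & l = map h A.
Proof.
rewrite mem_filter mem_undup; split; first by case/andP=> /asboolP.
move=> [h Hh ->]; rewrite map_conj_lists andbT; apply/asboolP; by exists h.
Qed.

Lemma orbit_list_uniq H A : uniq (orbit_list H A).
Proof. by rewrite filter_uniq // undup_uniq. Qed.

Lemma map_Poly (R S : nzRingType) (f : {rmorphism R -> S}) l :
  map_poly f (Poly l) = Poly (map f l).
Proof.
apply/polyP => i; rewrite coef_map !coef_Poly.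
have [h|h] := ltnP i (size l); first by rewrite (nth_map 0).
by rewrite (nth_default _ h) nth_default ?size_map ?raddf0.
Qed.

Lemma orbit_list_perm H A h : aut_group H -> H h ->
  perm_eq (map (map h) (orbit_list H A)) (orbit_list H A).
Proof.
case=> H1 HM HV Hh.
have inj : injective (map h) by apply: inj_map; exact: fmorph_inj.
apply: uniq_perm; rewrite ?map_inj_uniq ?orbit_list_uniq // => l.
apply/idP/idP => [/mapP[l' /orbit_listP[h' Hh' ->] ->]|/orbit_listP[h' Hh' ->]].
  by apply/orbit_listP; exists (h * h')%g; [exact: HM|rewrite -map_comp].
apply/mapP; exists (map (h^-1 * h')%g A).
  by apply/orbit_listP; exists (h^-1 * h')%g => //; apply: HM => //; exact: HV.
by rewrite -map_comp; apply: eq_map => x; exact: esym (autVK h _).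
Qed.

(* The generic element [sum_i a_i T^i] turns statements about finite lists of
   algebraic numbers into statements about a single root. *)
Definition orbit_poly (H : set aut) (A : seq algC) : {poly {poly algC}} :=
  \prod_(l <- orbit_list H A) ('X - (Poly l)%:P).

Lemma orbit_poly_fix H A h : aut_group H -> H h ->
  map_poly (map_poly h) (orbit_poly H A) = orbit_poly H A.
Proof.
move=> gH Hh; rewrite /orbit_poly -[RHS](perm_big _ (orbit_list_perm A gH Hh)).
rewrite big_map rmorph_prod; apply: eq_bigr => l _.
by rewrite rmorphB /= map_polyX map_polyC /= map_Poly.
Qed.

Lemma orbit_poly_root H A : aut_group H -> (orbit_poly H A).[Poly A] = 0.
Proof.
case=> H1 _ _; apply/rootP; rewrite /orbit_poly.
have := @root_prod_XsubC _ (map (@Poly _) (orbit_list H A)) (Poly A).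
rewrite big_map => ->; apply/mapP; exists A => //.
by apply/orbit_listP; exists 1%g => //; rewrite map_id.
Qed.

Lemma orbit_poly_coef H A i j : aut_group H ->
  forall h, H h -> h (orbit_poly H A)`_i`_j = (orbit_poly H A)`_i`_j.
Proof.
by move=> gH h Hh; rewrite -[in RHS](orbit_poly_fix A gH Hh) !coef_map.
Qed.

Lemma Poly_map_inj (f g : algC -> algC) A : Poly (map f A) = Poly (map g A) ->
  {in A, f =1 g}.
Proof.
move=> e x xA; have iA : (index x A < size A)%N by rewrite index_mem.
have := congr1 (fun p : {poly algC} => p`_(index x A)) e.
by rewrite !coef_Poly !(nth_map 0) // nth_index.
Qed.

(** [d] lies in the Krull closure of [H]: the orbit polynomial of [A] has coefficients fixed by [H],
    hence by [d], so [d] sends the root attached to [A] to another root, which is attached to some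
    image of [A] under [H]. This is the Galois correspondence for subgroups that are not known to be
    closed. *)
Lemma closure_agree (H : set aut) (d : aut) (A : seq algC) : aut_group H ->
  (forall x, (forall h, H h -> h x = x) -> d x = x) ->
  exists2 h, H h & {in A, h =1 d}.
Proof.
move=> gH fd.
have : (orbit_poly H A).[Poly (map d A)] = 0.
  have -> : orbit_poly H A = map_poly (map_poly d) (orbit_poly H A).
    apply/polyP => i; apply/polyP => j; rewrite !coef_map /= fd // => h Hh.
    exact: orbit_poly_coef.
  by rewrite -map_Poly horner_map orbit_poly_root // rmorph0.
move/rootP; have := @root_prod_XsubC _ (map (@Poly _) (orbit_list H A)) (Poly (map d A)).
rewrite big_map /orbit_poly => -> /mapP[l /orbit_listP[h Hh ->] e].
by exists h => // x xA; apply/esym; move: x xA; exact: Poly_map_inj.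
Qed.

(** The algebraic integers as a type, so that ring morphisms out of them and quotients by a prime
    can be formed. *)
Record Zb := MkZb { zb_val :> algC; zb_int : zb_val \in Aint }.
HB.instance Definition _ := [isSub for zb_val].
HB.instance Definition _ := [Choice of Zb by <:].
HB.instance Definition _ := [SubChoice_isSubComNzRing of Zb by <:].

Definition zb_aut (s : aut) (z : Zb) : Zb.
Proof. by exists (s z); rewrite Aint_aut zb_int. Defined.
Lemma zb_aut_zmod s : zmod_morphism (zb_aut s).
Proof. by move=> x y; apply: val_inj; rewrite /= rmorphB. Qed.
Lemma zb_aut_monoid s : monoid_morphism (zb_aut s).
Proof. by split => [|x y]; apply: val_inj; rewrite /= ?rmorph1 ?rmorphM. Qed.
HB.instance Definition _ s := GRing.isZmodMorphism.Build Zb Zb (zb_aut s) (zb_aut_zmod s).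
HB.instance Definition _ s := GRing.isMonoidMorphism.Build Zb Zb (zb_aut s) (zb_aut_monoid s).

Lemma zb_val_zmod : zmod_morphism zb_val. Proof. by []. Qed.
Lemma zb_val_monoid : monoid_morphism zb_val. Proof. by []. Qed.
HB.instance Definition _ := GRing.isZmodMorphism.Build Zb algC zb_val zb_val_zmod.
HB.instance Definition _ := GRing.isMonoidMorphism.Build Zb algC zb_val zb_val_monoid.

(** * Primes of the ring of all algebraic integers *)

Lemma pigeon (T : finType) (f : nat -> T) :
  exists i j, [/\ (i < j)%N, (j <= #|T|)%N & f i = f j].
Proof.
apply: contrapT => h.
have inj : injective (fun i : 'I_#|T|.+1 => f i).
  move=> i j e; apply: val_inj; have [lt|gt|//] := ltngtP i j.
    by case: h; exists (val i), (val j); split=> //; exact: (ltn_ord j).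
  by case: h; exists (val j), (val i); split=> //; exact: (ltn_ord i).
by have := leq_card _ inj; rewrite card_ord ltnn.
Qed.

Lemma subfieldT : subfield [set: algC]%classic. Proof. by []. Qed.
#[local] Hint Resolve subfieldT : core.

Section PrimeOf.
Variables (M : set algC) (sM : subfield M) (P : set algC) (hP : prime_of M P).

Lemma pr_sub x : P x -> M x. Proof. by case: hP => -[h _] _ _ _ _ /h []. Qed.
Lemma pr_int x : P x -> x \in Aint. Proof. by case: hP => -[h _] _ _ _ _ /h []. Qed.
Lemma prD x y : P x -> P y -> P (x + y). Proof. by case: hP => _ h _ _ _; exact: h. Qed.
Lemma prM a x : M a -> a \in Aint -> P x -> P (a * x).
Proof. by case: hP => _ _ h _ _ Ma Aa; apply: h; split. Qed.
Lemma prMr a x : M a -> a \in Aint -> P x -> P (x * a).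
Proof. by rewrite mulrC; exact: prM. Qed.
Lemma pr1 : ~ P 1. Proof. by case: hP. Qed.
Lemma pr_or x y : M x -> x \in Aint -> M y -> y \in Aint -> P (x * y) -> P x \/ P y.
Proof. by case: hP => _ _ _ _ h Mx Ax My Ay; apply: h; split. Qed.
Lemma pr0 : P 0.
Proof. by case: (hP) => -[_ [x Px _]] _ _ _ _; rewrite -(mul0r x); apply: prM => //; exact: sf0. Qed.
Lemma prN x : P x -> P (- x).
Proof. by rewrite -mulN1r; apply: prM; rewrite ?rpredN ?rpred1 //; apply: sfN => //; exact: sf1. Qed.
Lemma prB x y : P x -> P y -> P (x - y). Proof. by move=> Px Py; apply/prD/prN. Qed.
Lemma prBC x y : P (x - y) -> P (y - x). Proof. by move/prN; rewrite opprB. Qed.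
Lemma pr_trans y x z : P (x - y) -> P (y - z) -> P (x - z).
Proof. by move=> h1 h2; have := prD h1 h2; rewrite addrA subrK. Qed.
Lemma pr_sum I (r : seq I) (Q : pred I) f : (forall i, Q i -> P (f i)) ->
  P (\sum_(i <- r | Q i) f i).
Proof. by move=> h; elim/big_ind: _ => //; [exact: pr0|exact: prD]. Qed.
Lemma prX x n : M x -> x \in Aint -> P (x ^+ n) -> P x.
Proof.
move=> Mx Ax; elim: n => [|n IH]; first by rewrite expr0 => /pr1.
by rewrite exprS => /pr_or [||||//|/IH]; rewrite ?rpredX //; exact: sfX.
Qed.
Lemma pr_mulcong x y z t : M x -> x \in Aint -> M t -> t \in Aint ->
  P (x - y) -> P (z - t) -> P (x * z - y * t).
Proof.
move=> Mx Ax Mt At h1 h2.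
have -> : x * z - y * t = x * (z - t) + t * (x - y).
  by rewrite !mulrBr (mulrC t y) (mulrC t x) addrA subrK.
by apply: prD; apply: prM.
Qed.
Lemma pr_congX x y n : M x -> x \in Aint -> M y -> y \in Aint ->
  P (x - y) -> P (x ^+ n - y ^+ n).
Proof.
move=> Mx Ax My Ay h; elim: n => [|n IH]; first by rewrite subrr; exact: pr0.
by rewrite !exprS; apply: pr_mulcong; rewrite ?rpredX //; exact: sfX.
Qed.

(** The constant term of the minimal polynomial of a nonzero element of P is a nonzero integer in P;
    primality then descends to one of its prime factors. *)
Lemma pr_char : exists2 l, prime l & P l%:R.
Proof.
have [[_ [x Px x0]] _ _ _ _] := hP.
suff [n n0 Pn] : exists2 n : nat, (0 < n)%N & P n%:R.
  elim: {n}n.+1 {-2}n (leqnn n.+1) n0 Pn => // b IH n nb n0 Pn.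
  have [n1|n1|n1] := ltngtP n 1; first by move: n0 n1; case: (n).
    have pr := pdiv_prime n1; move: Pn; rewrite -{1}(divnK (pdiv_dvd n)) natrM.
    move=> /pr_or [|||||]; rewrite ?rpred_nat //; try exact: sf_nat; last by exists (pdiv n).
    apply: IH; last by rewrite divn_gt0 ?pdiv_gt0 // pdiv_leq.
    by apply: (@leq_trans n) => //; apply: ltn_Pdiv => //; exact: prime_gt1.
  by move: Pn; rewrite n1 => /pr1.
have [r [Dr mon_r] min_r] := minCpolyP x.
have Ax := pr_int Px.
have c0 : (minCpoly x)`_0 != 0.
  apply/eqP => e; have e' : r`_0 = 0.
    by apply: (fmorph_inj (ratr : rat -> algC)); rewrite -coef_map -Dr e rmorph0.
  have [d Dr'] : exists d, r = d * 'X.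
    exists (drop_poly 1 r); rewrite -[LHS](poly_take_drop 1) expr1 (_ : take_poly 1 r = 0) ?add0r //.
    by apply/polyP => i; rewrite coef_take_poly coef0; case: i.
  have nz : d != 0.
    by apply/eqP => z; move: (monic_neq0 mon_r); rewrite Dr' z mul0r eqxx.
  have : root (map_poly ratr d) x.
    have := root_minCpoly x; rewrite Dr Dr' rmorphM /= map_polyX rootM.
    by case/orP => //; rewrite rootE hornerX (negPf x0).
  by rewrite min_r => h; have := dvdp_leq nz h; rewrite Dr' size_mulX // ltnn.
have hi : forall i, (minCpoly x)`_i \in Num.int by move: Ax => /polyOverP.
have Pc : P (minCpoly x)`_0.
  have /rootP := root_minCpoly x; rewrite horner_coef.
  case sz : (size _) => [|n]; first by move: (size_minCpoly x); rewrite sz.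
  rewrite big_ord_recl /= expr0 mulr1 => /eqP; rewrite addr_eq0 => /eqP ->.
  apply: prN; apply: pr_sum => i _; rewrite exprS mulrCA; apply: prMr => //.
    apply: sfM => //; last by apply: sfX => //; exact: pr_sub.
    by have /intrP [m ->] := hi (bump 0 i); exact: sf_int.
  by rewrite rpredM ?rpredX //; apply: Aint_Cint.
have /intrP [m Dm] := hi 0%N; exists `|m|%N.
  by rewrite absz_gt0; apply: contraNneq c0 => m0; rewrite Dm m0.
by move: Pc; rewrite Dm; case: (m) => n //; rewrite NegzE mulrNz => /prN; rewrite opprK.
Qed.

(** The powers of y lie in a finitely generated Z-module, which is finite modulo a prime number l of
    P. Two powers are therefore congruent modulo l, and the lower one cancels because y is outside
    P. In particular nonzero primes are maximal. *)
Lemma pr_unit_pow y : M y -> y \in Aint -> ~ P y -> exists2 m, (0 < m)%N & P (y ^+ m - 1).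
Proof.
move=> My Ay nPy; have [l l_pr Pl] := pr_char.
have [S [S_ring SX] [[n Y] /= SY Sspan]] := @Aint_subring_exists [:: y] (fun z => ltac:(by rewrite inE => /eqP ->)).
have S_Aint : {subset S <= Aint} by apply: (fin_Csubring_Aint S_ring Sspan).
have Sy i : y ^+ i \in S.
  have [S1 SB SM] := S_ring; elim: i => [|i IH]; first by rewrite expr0.
  by rewrite exprS SM // SX // inE.
have Sy' i : inIntSpan Y (y ^+ i) by apply/Sspan.
pose a i : int ^ n := projT1 (cid (Sy' i)).
have aE i : y ^+ i = \sum_(j < n) Y`_j *~ a i j by rewrite /a; case: cid.
have l0 : l%:Z != 0 by rewrite eqz_nat -lt0n prime_gt0.
have lt_l i j : (`|(a i j %% l)%Z| < l)%N.
  have := ltz_mod (a i j) l0; rewrite -{1}(gez0_abs (modz_ge0 (a i j) l0)).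
  by rewrite ltz_nat.
have [i [j [ij _ e]]] := pigeon (fun i : nat => [ffun k : 'I_n => Ordinal (lt_l i k)]).
have {}e k : (a j k - a i k)%R = (a j k %/ l)%Z * l - (a i k %/ l)%Z * l.
  have /(congr1 val) /= := congr1 (fun f : {ffun 'I_n -> 'I_l} => f k) e.
  rewrite !ffunE /= => /(congr1 Posz); rewrite !gez0_abs ?modz_ge0 // => e'.
  by rewrite {1}(divz_eq (a j k) l) {1}(divz_eq (a i k) l) e' opprD addrACA subrr addr0.
pose w := \sum_(k < n) Y`_k *~ ((a j k %/ l)%Z - (a i k %/ l)%Z).
have Dw : y ^+ j - y ^+ i = l%:R * w.
  rewrite !aE -sumrB mulr_sumr; apply: eq_bigr => k _.
  by rewrite -mulrzBr e -mulrBl mulrzA mulr_natl.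
have Sw : w \in Aint.
  apply/S_Aint/Sspan; exists [ffun k => (a j k %/ l)%Z - (a i k %/ l)%Z].
  by apply: eq_bigr => k _; rewrite ffunE.
have Mw : M w.
  have -> : w = (y ^+ j - y ^+ i) / l%:R.
    by rewrite Dw mulrAC divff ?mul1r // pnatr_eq0 -lt0n prime_gt0.
  by apply: sf_div => //; [apply: sfB => //; exact: sfX|exact: sf_nat].
exists (j - i)%N; first by rewrite subn_gt0.
have : P (y ^+ i * (y ^+ (j - i) - 1)).
  by rewrite mulrBr mulr1 -exprD subnKC 1?ltnW // Dw; exact: prMr.
case/pr_or => //; rewrite ?rpredB ?rpredX ?rpred1 //; try exact: sfX.
  by apply: sfB => //; [exact: sfX|exact: sf1].
by move/prX => /(_ My Ay) /nPy.
Qed.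

Lemma pr_inv y : M y -> y \in Aint -> ~ P y ->
  exists z, [/\ M z, z \in Aint & P (z * y - 1)].
Proof.
move=> My Ay nPy; have [[|m] // _ h] := pr_unit_pow My Ay nPy.
by exists (y ^+ m); rewrite -exprSr rpredX //; split => //; exact: sfX.
Qed.

End PrimeOf.

Lemma prime_sub_eq M P Q : subfield M -> prime_of M P -> prime_of M Q ->
  (forall x, P x -> Q x) -> forall x, Q x -> P x.
Proof.
move=> sM hP hQ PQ x Qx; apply: contrapT => nPx.
have [z [Mz Az Pz]] := pr_inv sM hP (pr_sub hQ Qx) (pr_int hQ Qx) nPx.
apply: (pr1 hQ); rewrite -(subKr (z * x) 1).
by apply: (prB sM hQ); [exact: (prM hQ)|exact: PQ].
Qed.

Section Residue.
Variables (P : set algC).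

Definition res_ideal of prime_of [set: algC]%classic P : {pred Zb} :=
  fun z => `[< P (val z) >].
Variable hP : prime_of [set: algC]%classic P.
Local Notation I := (res_ideal hP).

Lemma res_idealP z : reflect (P (val z)) (z \in I). Proof. exact: asboolP. Qed.
Lemma res_ideal_idealr : idealr_closed I.
Proof.
split=> [||a u v /res_idealP Pu /res_idealP Pv]; apply/res_idealP => /=.
- exact: pr0.
- exact: (pr1 hP).
- by apply: (prD hP) => //; apply: (prM hP) => //; exact: zb_int.
Qed.
HB.instance Definition _ := isIdealr.Build Zb I res_ideal_idealr.

Definition residue := Quotient.quot (I : zmodClosed Zb).
HB.instance Definition _ : EqQuotient Zb (Quotient.equiv (I : zmodClosed Zb)) residue :=
  EqQuotient.on residue.
HB.instance Definition _ := Choice.on residue.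
HB.instance Definition _ := GRing.ComNzRing.copy residue (Quotient.quot (I : idealr Zb)).

Definition to_res (z : Zb) : residue := \pi_(Quotient.quot (I : idealr Zb))%qT z.
HB.instance Definition _ := GRing.RMorphism.copy to_res
  (\pi_(Quotient.quot (I : idealr Zb))%qT : Zb -> Quotient.quot (I : idealr Zb)).

Lemma to_resP x y : to_res x = to_res y <-> P (val x - val y).
Proof.
rewrite /to_res; split.
  move/eqP; rewrite -Quotient.idealrBE => /res_idealP //.
by move=> h; apply/eqP; rewrite -Quotient.idealrBE; apply/res_idealP.
Qed.

Lemma to_res_surj (u : residue) : exists z, u = to_res z.
Proof. by exists (repr u); rewrite /to_res reprK. Qed.

Lemma res_inv_ex (u : residue) : exists v, (u != 0 -> v * u = 1) /\ (u = 0 -> v = 0).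
Proof.
have [->|u0] := eqVneq u 0; first by exists 0.
have [z Dz] := to_res_surj u.
have nP : ~ P (val z).
  move=> Pz; case/eqP: u0; rewrite Dz -(rmorph0 to_res).
  by apply/to_resP; rewrite subr0.
have [w [_ Aw Pw]] := pr_inv subfieldT hP Logic.I (zb_int z) nP.
exists (to_res (MkZb Aw)); split=> [_|/eqP]; last by rewrite (negPf u0).
by rewrite Dz -rmorphM -(rmorph1 to_res); exact/to_resP.
Qed.
Definition res_inv (u : residue) : residue := projT1 (cid (res_inv_ex u)).
Lemma res_mulVf u : u != 0 -> res_inv u * u = 1.
Proof. by rewrite /res_inv; case: cid => v [h _] /=. Qed.
Lemma res_inv0 : res_inv 0 = 0.
Proof. by rewrite /res_inv; case: cid => v [_ h] /=; exact: h. Qed.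
HB.instance Definition _ := GRing.ComNzRing_isField.Build residue res_mulVf res_inv0.
End Residue.

Lemma map_zb_val (A : seq algC) : (forall x, x \in A -> x \in Aint) ->
  map zb_val (map (insubd (0 : Zb)) A) = A.
Proof.
move=> h; rewrite -map_comp -[RHS]map_id; apply/eq_in_map => x xA /=.
by rewrite insubdK //; exact: h.
Qed.

Lemma orbit_list_int H A l : {subset A <= Aint} -> l \in orbit_list H A ->
  forall x, x \in l -> x \in Aint.
Proof.
move=> AZ /orbit_listP[h _ ->] x /mapP[y yA ->].
by rewrite Aint_aut; exact: AZ.
Qed.

Section Lift.
Variables (M : set algC) (sM : subfield M).

Definition zb_orbit (A : seq Zb) : seq (seq Zb) :=
  map (map (insubd (0 : Zb))) (orbit_list (fixes M) (map zb_val A)).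

Lemma zb_orbitP A l : l \in zb_orbit A -> exists2 h, fixes M h & l = map (zb_aut h) A.
Proof.
move=> /mapP[l' /orbit_listP[h Mh ->] ->]; exists h => //.
rewrite -!map_comp; apply: eq_map => x; apply: val_inj => /=.
by rewrite insubdK // Aint_aut zb_int.
Qed.

Lemma zb_orbit_self A : A \in zb_orbit A.
Proof.
apply/mapP; exists (map zb_val A).
  by apply/orbit_listP; exists 1%g => //; rewrite map_id.
by rewrite -map_comp -[LHS]map_id; apply: eq_map => x; apply: val_inj; rewrite /= insubdK ?zb_int.
Qed.

Lemma zb_orbit_map (A : seq Zb) : map (map zb_val) (zb_orbit A) = orbit_list (fixes M) (map zb_val A).
Proof.
rewrite -map_comp -[RHS]map_id; apply/eq_in_map => l lA /=; apply: map_zb_val.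
by apply: orbit_list_int lA => x /mapP[z _ ->]; exact: zb_int.
Qed.

(** For f the reduction modulo a prime and g a twist of it by a residue automorphism, this is the
    surjectivity of the decomposition group. The orbit polynomial over M of a finite list B has
    coefficients in M, so f and g give it the same image; g B is one of its roots, and its roots are
    the f (h B). *)
Lemma lift_hom (Om : idomainType) (f g : {rmorphism Zb -> Om}) :
  (forall z : Zb, M (val z) -> f z = g z) ->
  exists2 eta : aut, fixes M eta & forall z, f (zb_aut eta z) = g z.
Proof.
move=> fg.
pose C (A : seq algC) : set aut := fun eta => fixes M eta /\
  forall z : Zb, val z \in A -> f (zb_aut eta z) = g z.
have [A|A B AB s [h1 h2]|s hs] := @aut_compact C.
- pose B := pmap (insub : algC -> option Zb) A.
  pose q := \prod_(l <- zb_orbit B) ('X - (Poly l)%:P) : {poly {poly Zb}}.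
  have Dq : map_poly (map_poly zb_val) q = orbit_poly (fixes M) (map zb_val B).
    rewrite /orbit_poly -zb_orbit_map big_map rmorph_prod; apply: eq_bigr => l _.
    by rewrite rmorphB /= map_polyX map_polyC /= map_Poly.
  have qfg : map_poly (map_poly f) q = map_poly (map_poly g) q.
    apply/polyP => i; apply/polyP => j; rewrite !coef_map /=; apply: fg.
    apply: subfield_fix => // h Mh.
    have := orbit_poly_coef (map zb_val B) i j (fixes_group M) Mh.
    by rewrite -Dq !coef_map.
  have q0 : q.[Poly B] = 0.
    by rewrite /q (big_rem B) ?zb_orbit_self //= hornerM !hornerE subrr mul0r.
  have : (map_poly (map_poly f) q).[Poly (map g B)] = 0.
    by rewrite qfg -map_Poly horner_map q0 rmorph0.
  move=> /eqP; rewrite rmorph_prod horner_prod prodf_seq_eq0 => /hasP[l lB] /=.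
  rewrite map_polyXsubC /= map_Poly !hornerE subr_eq0 => /eqP e.
  have [h Mh Dl] := zb_orbitP lB; exists h; split => // z zA.
  have zB : z \in B by rewrite mem_pmap; apply/mapP; exists (val z); rewrite ?valK.
  have iB : (index z B < size B)%N by rewrite index_mem.
  have := congr1 (fun p : {poly Om} => p`_(index z B)) e.
  rewrite !coef_Poly Dl -map_comp !(nth_map 0) ?size_map // nth_index //.
- by split=> // z zA; apply: h2; exact: AB.
exists s => [x Mx|z].
  by have [s' [h1 _] e] := hs [:: x] [::]; rewrite -e ?inE // h1.
have [s' [_ h2] e] := hs [:: val z] [:: val z]; rewrite -h2 ?inE //.
by congr (f _); apply: val_inj; rewrite /= e ?inE.
Qed.

(* Going through the orbit of a finite list of elements of P. *)
Lemma prime_transitive P Q : prime_of [set: algC]%classic P -> prime_of [set: algC]%classic Q ->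
  (forall x, M x -> P x -> Q x) ->
  exists2 eta : aut, fixes M eta & forall x, P x <-> Q (eta x).
Proof.
move=> hP hQ PQ.
suff [eta Meta h] : exists2 eta : aut, fixes M eta & forall x, P x -> Q (eta x).
  exists eta => // x; split; first exact: h.
  pose P' : set algC := fun x => Q (eta x).
  have hP' : prime_of [set: algC]%classic P'.
    have [[Q1 [q Qq q0]] Q2 Q3 Q4 Q5] := hQ; rewrite /P'; split.
    + split; first by move=> y /Q1 [_]; rewrite Aint_aut.
      by exists (eta^-1%g q); [rewrite (autVK eta)|rewrite fmorph_eq0].
    + by move=> y z; rewrite rmorphD; exact: Q2.
    + by move=> a y [_ Aa]; rewrite rmorphM; apply: Q3; split; rewrite ?Aint_aut.
    + by rewrite rmorph1.
    + by move=> y z [_ Ay] [_ Az]; rewrite rmorphM; apply: Q5; split; rewrite ?Aint_aut.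
  exact: (prime_sub_eq subfieldT hP hP' h).
pose C (A : seq algC) : set aut := fun eta => fixes M eta /\
  forall x, x \in A -> P x -> Q (eta x).
have [A|A B AB s [h1 h2]|s hs] := @aut_compact C.
- pose B := [seq z <- pmap (insub : algC -> option Zb) A | `[< P (val z) >]].
  (* The coefficients of this product lie in M, and vanish modulo P because the factor at [B] does.
     So they vanish modulo Q, and one factor already does. *)
  pose q := \prod_(l <- zb_orbit B) (Poly l) : {poly Zb}.
  have qP : map_poly (to_res hP) q = 0.
    rewrite rmorph_prod; apply/eqP; rewrite prodf_seq_eq0; apply/hasP.
    exists B; first exact: zb_orbit_self.
    rewrite /= map_Poly; apply/eqP/polyP => i; rewrite coef_Poly coef0.
    have [h|h] := ltnP i (size B); last by rewrite nth_default ?size_map.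
    rewrite (nth_map 0) // -(rmorph0 (to_res hP)); apply/to_resP; rewrite subr0.
    by have := mem_nth 0 h; rewrite mem_filter => /andP[/asboolP].
  have qQ : map_poly (to_res hQ) q = 0.
    apply/polyP => i; rewrite coef_map coef0 -(rmorph0 (to_res hQ)); apply/to_resP.
    rewrite subr0; apply: PQ.
      apply: subfield_fix => // h Mh.
      have Dq : map_poly zb_val q = \prod_(l <- orbit_list (fixes M) (map zb_val B)) Poly l.
        by rewrite -zb_orbit_map big_map rmorph_prod; apply: eq_bigr => l _; rewrite /= map_Poly.
      have : map_poly h (map_poly zb_val q) = map_poly zb_val q.
        rewrite Dq rmorph_prod -[RHS](perm_big _ (orbit_list_perm (map zb_val B) (fixes_group M) Mh)).
        by rewrite big_map; apply: eq_bigr => l _; rewrite /= map_Poly.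
      by move/(congr1 (fun p : {poly algC} => p`_i)); rewrite !coef_map.
    have := congr1 (fun p : {poly _} => p`_i) qP; rewrite coef_map coef0 -(rmorph0 (to_res hP)).
    by move/to_resP; rewrite subr0.
  move/eqP: qQ; rewrite rmorph_prod prodf_seq_eq0 => /hasP[l lB /=].
  rewrite map_Poly => /eqP e; have [h Mh Dl] := zb_orbitP lB.
  exists h; split => // x xA Px.
  pose z := MkZb (pr_int hP Px).
  have zB : z \in B.
    rewrite mem_filter; apply/andP; split; first exact/asboolP.
    by rewrite mem_pmap; apply/mapP; exists x => //; rewrite -[x]/(val z) valK.
  have iB : (index z B < size B)%N by rewrite index_mem.
  have := congr1 (fun p : {poly _} => p`_(index z B)) e.
  rewrite coef_Poly coef0 Dl -map_comp (nth_map 0) // nth_index //= -(rmorph0 (to_res hQ)).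
  by move/to_resP; rewrite subr0.
- by split=> // z zA; apply: h2; exact: AB.
exists s => [x Mx|x Px].
  by have [s' [h1 _] e] := hs [:: x] [::]; rewrite -e ?inE // h1.
by have [s' [_ h2] e] := hs [:: x] [:: x]; rewrite -e ?inE //; apply: h2; rewrite ?inE.
Qed.

End Lift.

#[local] Hint Resolve subfieldT : core.

Definition zb_ideal (I : set algC) : Prop :=
  [/\ forall x, I x -> x \in Aint, forall x y, I x -> I y -> I (x + y) &
      forall a x, a \in Aint -> I x -> I (a * x)].

Lemma max_ideal (I : set algC) x0 : zb_ideal I -> I x0 -> x0 != 0 -> ~ I 1 ->
  exists2 P, prime_of [set: algC]%classic P & forall x, I x -> P x.
Proof.
move=> hI Ix0 nz I1.
pose Q (S : set algC) := S = classical_sets.set0 \/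
  [/\ zb_ideal S, forall x, I x -> S x & ~ S 1].
have [F FQ tot|A [QA maxA]] := @Zorn_bigcup _ Q.
  have [[S [FS S0]]|none] := pselect (exists S, F S /\ S <> classical_sets.set0); last first.
    left; rewrite -subset0 => x [S FS Sx]; apply: none; exists S; split => // e.
    by rewrite e in Sx.
  have hS T : F T -> T <> classical_sets.set0 -> [/\ zb_ideal T, forall x, I x -> T x & ~ T 1].
    by move=> FT T0; have [//|] := FQ _ FT.
  have hx T x : F T -> T x -> T <> classical_sets.set0 by move=> _ Tx e; rewrite e in Tx.
  right; split; last first.
  - by move=> [T FT T1]; have [_ _] := hS T FT (hx _ _ FT T1).
  - by move=> x Ix; exists S => //; have [_ h _] := hS _ FS S0; exact: h.
  split=> [x [T FT Tx]|x y [T FT Tx] [T' FT' T'y]|a x Aa [T FT Tx]].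
  - by have [[h _ _] _ _] := hS _ FT (hx _ _ FT Tx); exact: h.
  - have [h|h] := tot _ _ FT FT'.
      by exists T' => //; have [[_ D _] _ _] := hS _ FT' (hx _ _ FT' T'y); apply: D => //; exact: h.
    by exists T => //; have [[_ D _] _ _] := hS _ FT (hx _ _ FT Tx); apply: D => //; exact: h.
  - by exists T => //; have [[_ _ h] _ _] := hS _ FT (hx _ _ FT Tx); exact: h.
have {QA}[A0|[[Aint_A AD AM] IA A1]] := QA.
  exfalso; apply: (maxA I); last by right.
  by rewrite A0; split => // h; exact: (h x0 Ix0).
exists A => //.
have max x : x \in Aint -> ~ A x -> exists a b, [/\ A a, b \in Aint & 1 = a + b * x].
  move=> Ax nAx; apply: contrapT => h.
  pose B : set algC := fun y => exists a b, [/\ A a, b \in Aint & y = a + b * x].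
  have AB y : A y -> B y by move=> Ay; exists y, 0; rewrite mul0r addr0.
  apply: (maxA B).
    split => // h'; apply: nAx; apply: h'.
    by exists (0 * x0), 1; rewrite mul0r add0r mul1r; split=> //; rewrite -(mul0r x0); apply: AM => //; apply: IA.
  right; split => [|y /IA /AB //|[a [b [h1 h2 h3]]]]; last by apply: h; exists a, b.
  split=> [y [a [b [h1 h2 ->]]]|y z [a [b [h1 h2 ->]]] [c [d [h3 h4 ->]]]|e y Ae [a [b [h1 h2 ->]]]].
  - by rewrite rpredD ?rpredM // Aint_A.
  - exists (a + c), (b + d); rewrite rpredD // addrACA mulrDl; split=> //; exact: AD.
  - by exists (e * a), (e * b); rewrite rpredM // mulrDr mulrA; split=> //; exact: AM.
split=> //.
- split; first by move=> x Ax; split => //; exact: Aint_A.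
  by exists x0 => //; exact: IA.
- by move=> a x [_ Aa]; exact: AM.
move=> x y [_ Ax] [_ Ay] Axy.
have [|nAx] := pselect (A x); first by left.
right; have [a [b [Aa Ab e]]] := max x Ax nAx.
rewrite -(mul1r y) e mulrDl -mulrA (mulrC a); apply: AD; exact: AM.
Qed.

(** * Primes of a subfield lie under primes of the ring of all algebraic integers *)

Section LyingOver.
Variables (M : set algC) (sM : subfield M) (P : set algC) (hP : prime_of M P).

Definition comb (s : seq (algC * algC)) : algC := \sum_(u <- s) u.1 * u.2.

Lemma det_cong n (C : 'M[algC]_n) : (forall i j, P (C i j)) -> P (\det (1%:M - C) - 1).
Proof.
move=> PC; rewrite /determinant (bigD1 1%g) //= odd_perm1 expr0 mul1r addrAC.
have MC i j : M ((1%:M - C) i j).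
  by rewrite !mxE; apply: sfB => //; [exact: sf_nat|exact: (pr_sub hP)].
have AC i j : (1%:M - C) i j \in Aint.
  by rewrite !mxE rpredB ?rpred_nat // (pr_int hP).
apply: (prD hP).
  have hprod (r : seq 'I_n) : P (\prod_(i <- r) (1%:M - C) i ((1 : 'S_n)%g i) - 1).
    elim: r => [|i r IH]; first by rewrite big_nil subrr; exact: (pr0 sM hP).
    rewrite big_cons; set y := \prod_(_ <- _) _ in IH *.
    have -> : (1%:M - C) i ((1 : 'S_n)%g i) * y - 1 = (y - 1) - y * C i i.
      by rewrite perm1 !mxE eqxx mulrBl mul1r addrAC mulrC.
    apply: (prB sM hP) => //; apply: (prM hP) => //; rewrite /y.
      by apply: sf_prod.
    by rewrite rpred_prod.
  exact: hprod.
apply: (pr_sum sM hP) => s s1; apply: (prM hP).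
- by apply: sfX => //; apply: sfN => //; exact: sf1.
- by rewrite rpredX // rpredN rpred1.
have [i si] : exists i, s i != i.
  apply/existsP; apply: contraR s1; rewrite negb_exists => /forallP h.
  by apply/eqP/permP => i; rewrite perm1; apply/eqP; move: (h i); rewrite negbK.
rewrite (bigD1 i) //= mulrC; apply: (prM hP).
- by apply: sf_prod.
- by rewrite rpred_prod.
by rewrite !mxE eq_sym (negPf si) sub0r; apply: (prN sM hP).
Qed.

(** Determinant trick. If 1 were such a combination, multiplication by it would write the Z-module
    generators Y of a ring as Y = C Y with the entries of C in P; then det(1 - C) kills Y, so it is
    0, whereas it is 1 modulo P. *)
Lemma comb_neq1 s : (forall u, u \in s -> P u.1 /\ u.2 \in Aint) -> comb s <> 1.
Proof.
move=> hs s1.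
have Xint : {subset map snd s <= Aint} by move=> x /mapP[u /hs[_ h] ->].
have [S [S_ring SX] [[n Y] /= SY Sspan]] := Aint_subring_exists Xint.
have [S1 SB SM] := S_ring.
have step (t : seq (algC * algC)) : {subset t <= s} -> forall j : 'I_n,
    exists c : 'I_n -> algC, (forall l, P (c l)) /\ comb t * Y`_j = \sum_l c l * Y`_l.
  elim: t => [|u t IH] ts j.
    exists (fun=> 0); split=> [_|]; first exact: (pr0 sM hP).
    by rewrite /comb big_nil mul0r big1 // => i _; rewrite mul0r.
  have us : u \in s by apply: ts; rewrite inE eqxx.
  have [Pu Au] := hs _ us.
  have [c [Pc Dc]] := IH (fun v vt => ts v (mem_behead (s := u :: t) vt)) j.
  have Yj : Y`_j \in S by apply: SY; rewrite mem_nth ?size_tuple.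
  have /Sspan [a Da] : u.2 * Y`_j \in S by apply: SM => //; apply: SX; exact: map_f.
  exists (fun l => u.1 * (a l)%:~R + c l); split.
    move=> l; apply: (prD hP) => //; apply: (prMr hP) => //; first exact: sf_int.
    exact: Aint_int.
  rewrite /comb big_cons mulrDl -/(comb t) Dc -mulrA Da mulr_sumr -big_split /=.
  by apply: eq_bigr => l _; rewrite mulrDl -mulrA mulrzl.
pose c (j : 'I_n) := projT1 (cid (step s (fun v h => h) j)).
have Pc j l : P (c j l) by rewrite /c; case: cid => ? [].
have Dc (j : 'I_n) : Y`_j = \sum_l c j l * Y`_l.
  by rewrite /c; case: cid => ? [_ /= <-]; rewrite s1 mul1r.
pose C : 'M[algC]_n := \matrix_(j, l) c j l.
pose v : 'cV[algC]_n := \col_j Y`_j.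
have Cv : (1%:M - C) *m v = 0.
  apply/matrixP => j l; rewrite mulmxBl mul1mx !mxE -[X in X - _]/(Y`_j) Dc.
  by apply/eqP; rewrite subr_eq0; apply/eqP/eq_bigr => i _; rewrite !mxE.
have dv (j : 'I_n) : \det (1%:M - C) * Y`_j = 0.
  have : (\det (1%:M - C))%:M *m v = 0 by rewrite -mul_adj_mx -mulmxA Cv mulmx0.
  by rewrite mul_scalar_mx => /matrixP /(_ j ord0); rewrite !mxE.
have d0 : \det (1%:M - C) = 0.
  have /Sspan [a Da] := S1.
  move: (congr1 (fun x => \det (1%:M - C) * x) Da); rewrite mulr1 => ->.
  rewrite mulr_sumr big1 // => j _.
  by rewrite mulrzAr dv mul0rz.
have := det_cong (C := C); rewrite d0 sub0r => /(_ _) h.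
apply: (pr1 hP); rewrite -(opprK 1); apply: (prN sM hP); apply: h => i j.
by rewrite mxE.
Qed.

Lemma lying_over : exists2 Q, prime_of [set: algC]%classic Q & forall x, M x -> (Q x <-> P x).
Proof.
pose I : set algC := fun x => exists2 s, (forall u, u \in s -> P u.1 /\ u.2 \in Aint) & x = comb s.
have PI x : P x -> I x.
  move=> Px; exists [:: (x, 1)]; last by rewrite /comb big_seq1 mulr1.
  by move=> u; rewrite inE => /eqP ->; rewrite rpred1.
have hI : zb_ideal I.
  split=> [x [s hs ->]|x y [s hs ->] [t ht ->]|a x Aa [s hs ->]].
  - rewrite /comb big_seq rpred_sum // => u /hs [h1 h2]; rewrite rpredM //.
    exact: (pr_int hP).
  - exists (s ++ t); last by rewrite /comb big_cat.
    by move=> u; rewrite mem_cat => /orP[/hs|/ht].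
  - exists [seq (u.1, a * u.2) | u <- s].
      by move=> _ /mapP[u /hs[h1 h2] ->]; rewrite rpredM.
    rewrite /comb big_map mulr_sumr; apply: eq_bigr => u _ /=.
    by rewrite mulrCA.
have [[_ [x0 Px0 nz]] _ _ _ _] := hP.
have [|Q hQ IQ] := max_ideal hI (PI _ Px0) nz; first by move=> [s hs /esym]; exact: comb_neq1.
exists Q => // x Mx; split=> [Qx|/PI/IQ //]; apply: contrapT => nPx.
have [z [Mz Az Pz]] := pr_inv sM hP Mx (pr_int hQ Qx) nPx.
apply: (pr1 hQ); rewrite -(subKr (z * x) 1).
by apply: (prB subfieldT hQ); [exact: (prM hQ)|apply/IQ/PI].
Qed.

End LyingOver.

Section ResidueUnity.
Variables (P : set algC) (hP : prime_of [set: algC]%classic P).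

(** Some y^m is 1 modulo P, and y^m - 1 is the product of the y - z over the m-th roots of unity
    z. *)
Lemma res_unity y : y \in Aint -> ~ P y ->
  exists z m, [/\ (0 < m)%N, z ^+ m = 1 & P (y - z)].
Proof.
move=> Ay nPy; have [m m0 Pm] := pr_unit_pow subfieldT hP Logic.I Ay nPy.
have [r Dr] := closed_field_poly_normal ('X^m - 1 : {poly algC}).
have mon : lead_coef ('X^m - 1 : {poly algC}) = 1 by apply/eqP; exact: monicXnsubC.
rewrite mon scale1r in Dr.
have rm z : z \in r -> z ^+ m = 1.
  rewrite -root_prod_XsubC -Dr rootE !hornerE => /eqP h.
  by apply/eqP; rewrite -subr_eq0 h.
have Am z : z \in r -> z \in Aint.
  by move=> /rm h; apply: (@Aint_unity_root m) => //; apply/unity_rootP.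
move: Pm.
have -> : y ^+ m - 1 = \prod_(z <- r) (y - z).
  have := congr1 (fun p : {poly algC} => p.[y]) Dr.
  rewrite !hornerE => ->; rewrite horner_prod; apply: eq_bigr => z _.
  by rewrite !hornerE.
elim: r rm Am {Dr} => [|z r IH] rm Am; first by rewrite big_nil => /(pr1 hP).
rewrite big_cons => /(pr_or hP) [||||h|/IH] //.
- by rewrite rpredB // Am // inE eqxx.
- by rewrite big_seq rpred_prod // => i ir; rewrite rpredB // Am // inE ir orbT.
- by exists z, m; split => //; apply: rm; rewrite inE eqxx.
- by apply=> w wr; [apply: rm|apply: Am]; rewrite inE wr orbT.
Qed.

Lemma aut_unity_root z m : (0 < m)%N -> z ^+ m = 1 ->
  forall s : aut, exists k, s z = z ^+ k.
Proof.
move=> m0 zm s; have [n pz _] := prim_order_exists m0 zm.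
have szn : s z ^+ n = 1 by rewrite -rmorphXn /= (prim_expr_order pz) rmorph1.
have [i ->] := prim_rootP pz szn; by exists i.
Qed.

Definition aut_comm (s t : aut) : aut := (s * t * s^-1 * t^-1)%g.

Lemma aut_comm_unity s t z m : (0 < m)%N -> z ^+ m = 1 -> aut_comm s t z = z.
Proof.
move=> m0 zm.
have comm w : w ^+ m = 1 -> s (t w) = t (s w).
  move=> wm; have [i si] := aut_unity_root m0 wm s.
  have [j tj] := aut_unity_root m0 wm t.
  by rewrite si tj !rmorphXn /= si tj -!exprM mulnC.
rewrite /aut_comm !autM comm.
  by rewrite (autVK s) (autVK t).
have h (u : aut) x : x ^+ m = 1 -> u x ^+ m = 1.
  by move=> e; rewrite -rmorphXn /= e rmorph1.
by do 2!apply: (h).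
Qed.

(* Modulo P every element is 0 or a root of unity, and automorphisms commute on
   roots of unity. *)
Lemma aut_comm_inertia (s t : aut) : (forall x, P x <-> P (s x)) -> (forall x, P x <-> P (t x)) ->
  forall y, y \in Aint -> P (aut_comm s t y - y).
Proof.
move=> sP tP.
have sVP x : P x -> P ((s^-1)%g x) by move=> Px; apply/sP; rewrite (autVK s).
have tVP x : P x -> P ((t^-1)%g x) by move=> Px; apply/tP; rewrite (autVK t).
have cP x : P x -> P (aut_comm s t x).
  by move=> Px; rewrite /aut_comm !autM; apply/(proj1 (sP _))/(proj1 (tP _))/sVP/tVP.
move=> y Ay; have [Py|nPy] := pselect (P y).
  by apply: (prB subfieldT hP) => //; exact: cP.
have [z [m [m0 zm Pz]]] := res_unity Ay nPy.
apply: (pr_trans hP (y := z)).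
  by rewrite -(aut_comm_unity s t m0 zm) -rmorphB; exact: cP.
exact: (prBC subfieldT hP).
Qed.

End ResidueUnity.

(** * Number fields: coordinates, ideal classes and units *)

Lemma subfield_Crat : subfield [set x : algC | x \in Crat]%classic.
Proof. by split=> /= [|x y hx hy|x y hx hy]; rewrite ?rpred1 ?rpredB ?rpred_div. Qed.

Lemma Crat_fix x : (forall s : aut, s x = x) -> x \in Crat.
Proof. by move=> h; apply: (subfield_fix (F := [set x | x \in Crat]%classic) subfield_Crat). Qed.

Lemma aut_rat (s : aut) (r : rat) : s (ratr r) = ratr r.
Proof. exact: fmorph_rat. Qed.

Lemma aut_pQ (s : aut) p x : s (pQtoC p).[x] = (pQtoC p).[s x].
Proof. by rewrite -horner_map -map_poly_comp; congr (_.[_]); apply: eq_map_poly => r /=; rewrite aut_rat. Qed.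

Lemma poly_Crat_fix (p : {poly algC}) : (forall s : aut, map_poly s p = p) ->
  exists q : {poly rat}, p = pQtoC q.
Proof.
move=> h; have hp i : p`_i \in Crat.
  by apply: Crat_fix => s; rewrite -[in RHS](h s) coef_map.
exists (\poly_(i < size p) projT1 (cid (CratP _ (hp i)))); apply/polyP => i.
rewrite coef_map coef_poly; case: ltnP => hi /=; last by rewrite raddf0 nth_default.
by case: cid => r /= ->.
Qed.

Lemma prod_XsubC_aut (r : seq algC) : uniq r -> (forall (s : aut) x, x \in r -> s x \in r) ->
  exists q : {poly rat}, \prod_(w <- r) ('X - w%:P) = pQtoC q.
Proof.
move=> ur hr; apply: poly_Crat_fix => s; rewrite rmorph_prod /=.
have pr : perm_eq (map s r) r.
  have us : uniq (map s r) by rewrite map_inj_uniq //; exact: fmorph_inj.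
  apply: uniq_perm => //; apply: (uniq_min_size us _ _).2; last by rewrite size_map.
  by move=> _ /mapP[x xr ->]; exact: hr.
rewrite -[RHS](perm_big _ pr) big_map; apply: eq_bigr => w _.
by rewrite map_polyXsubC.
Qed.

Lemma conjugates_aut (s : aut) z w : w \in conjugates z -> s w \in conjugates z.
Proof.
rewrite !conjugatesP.
have [r [-> _] _] := minCpolyP z.
by rewrite /root -aut_pQ fmorph_eq0.
Qed.

Lemma conjugates_uniq z : uniq (conjugates z). Proof. exact: undup_uniq. Qed.

(** The product over the distinct conjugates is already rational, so the minimal polynomial has no
    multiple root. *)
Lemma size_conjugates z : size (minCpoly z) = (size (conjugates z)).+1.
Proof.
have [q Dq] := prod_XsubC_aut (conjugates_uniq z) (@conjugates_aut ^~ z).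
have zz : z \in conjugates z by rewrite conjugatesP root_minCpoly.
apply/eqP; rewrite eqn_leq; apply/andP; split.
  have [r [Dr _] min_r] := minCpolyP z.
  have : root (pQtoC q) z by rewrite -Dq root_prod_XsubC.
  rewrite min_r -(dvdp_map (ratr : {rmorphism rat -> algC})) -Dr -Dq => /dvdp_leq h.
  have := h (monic_neq0 (monic_prod_XsubC _ _ _)).
  by rewrite size_prod_XsubC.
apply: max_poly_roots => //; rewrite ?minCpoly_eq0 ?conjugates_uniq //.
by apply/allP => w; rewrite conjugatesP.
Qed.

(** The product of the X - w over the images w of z under automorphisms is rational, hence divisible
    by the minimal polynomial. *)
Lemma conjugates_emb z w : w \in conjugates z -> exists s : aut, s z = w.
Proof.
pose r := [seq x <- conjugates z | `[< exists s : aut, s z = x >]].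
have rP x : x \in r <-> exists s : aut, s z = x.
  rewrite mem_filter; split; first by case/andP => /asboolP.
  by move=> h; rewrite asboolT //=; case: h => s <-; exact: aut_conjugates.
have [|s x /rP[t <-]|q Dq] := @prod_XsubC_aut r.
- by rewrite filter_uniq // conjugates_uniq.
- by apply/rP; exists (s * t)%g.
move=> wz; apply/rP; rewrite -root_prod_XsubC Dq.
have [p [Dp _] min_p] := minCpolyP z.
have /dvdpP [u ->] : (p %| q) by rewrite -min_p -Dq root_prod_XsubC; apply/rP; exists 1%g.
by rewrite rmorphM /= rootM -Dp -conjugatesP wz orbT.
Qed.

Lemma algC_inv_poly y : y != 0 -> exists p : {poly rat}, y^-1 = (pQtoC p).[y].
Proof.
move=> y0; have [r [Dr mon_r] min_r] := minCpolyP y.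
have Dr' := poly_take_drop 1 r; set u := drop_poly 1 r in Dr'.
have ry : (pQtoC r).[y] = 0 by apply/rootP; rewrite -Dr root_minCpoly.
have t1 : take_poly 1 r = (r`_0)%:P.
  by apply/polyP => i; rewrite coef_take_poly coefC; case: i.
have e : ratr r`_0 + (pQtoC u).[y] * y = 0.
  by rewrite -ry -[in RHS]Dr' t1 expr1 rmorphD rmorphM /= map_polyC map_polyX !hornerE.
have r0 : r`_0 != 0.
  apply/eqP => r0; move: e; rewrite r0 rmorph0 add0r => /eqP.
  rewrite mulf_eq0 (negPf y0) orbF => uy.
  have un : u != 0.
    by apply/eqP => z; move: (monic_neq0 mon_r); rewrite -Dr' t1 r0 z mul0r addr0 eqxx.
  have : root (pQtoC u) y by [].
  rewrite min_r => /(dvdp_leq un); rewrite -{1}Dr' t1 r0 add0r expr1 size_mulX //.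
  by rewrite ltnn.
exists (- (r`_0)^-1 *: u); rewrite map_polyZ hornerZ /= rmorphN fmorphV /= mulNr.
move/eqP: e; rewrite addrC addr_eq0 => /eqP e.
apply: (mulIf y0); rewrite mulVf // mulNr -mulrA e mulrN mulVf ?opprK //.
by rewrite fmorph_eq0.
Qed.

(* Coordinates on a number field M: a primitive element z which is an algebraic
   integer, and one automorphism for each of the d embeddings of M. *)
Record nf_data (M : set algC) := NfData {
  nf_d : nat;
  nf_z : algC;
  nf_e : 'I_nf_d -> aut;
  nf_sub : subfield M;
  nf_zM : M nf_z;
  nf_zA : nf_z \in Aint;
  nf_surj : forall s : aut, exists i, forall x, M x -> s x = nf_e i x;
  nf_inj : injective (fun i => nf_e i nf_z);
  nf_gen : forall x, M x -> exists a : 'I_nf_d -> rat, x = \sum_i ratr (a i) * nf_z ^+ i;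
  nf_free : forall a : 'I_nf_d -> rat, \sum_i ratr (a i) * nf_z ^+ i = 0 -> forall i, a i = 0
}.

Lemma nf_degree_bound (M : set algC) n (b : 'I_n -> algC) : subfield M ->
  (forall x, M x -> exists c : 'I_n -> rat, x = \sum_i ratr (c i) * b i) ->
  forall x, M x -> (size (conjugates x) <= n)%N.
Proof.
move=> sM hb x Mx.
pose c (i : nat) := projT1 (cid (hb _ (sfX sM i Mx))).
have Dc i : x ^+ i = \sum_j ratr (c i j) * b j by rewrite /c; case: cid.
pose A : 'M[rat]_(n.+1, n) := \matrix_(i, j) c i j.
have kA : kermx A != 0.
  rewrite -mxrank_eq0 mxrank_ker -lt0n subn_gt0; exact: leq_ltn_trans (rank_leq_col _) _.
have /rowV0Pn [v /sub_kermxP vA v0] := kA.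
pose p := \poly_(i < n.+1) v ord0 (inord i).
have px : root (pQtoC p) x.
  apply/rootP; rewrite (@horner_coef_wide _ n.+1); last first.
    by apply: leq_trans (size_poly _ _) _; exact: size_poly.
  under eq_bigr => i _ do rewrite coef_map coef_poly ltn_ord inord_val /= Dc mulr_sumr.
  rewrite exchange_big big1 //= => j _.
  under eq_bigr => i _ do rewrite mulrA -rmorphM.
  rewrite -mulr_suml -rmorph_sum.
  have /matrixP /(_ ord0 j) := vA; rewrite !mxE => e.
  rewrite (_ : \sum_i _ = 0) ?rmorph0 ?mul0r // -[RHS]e.
  by apply: eq_bigr => i _; rewrite !mxE.
have p0 : p != 0.
  apply: contraNneq v0 => p0; apply/eqP/rowP => i; rewrite mxE.
  have := congr1 (fun q : {poly rat} => q`_i) p0.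
  by rewrite coef_poly ltn_ord inord_val coef0.
have [r [Dr _] min_r] := minCpolyP x.
move: px; rewrite min_r => /(dvdp_leq p0) h.
rewrite -ltnS -size_conjugates Dr size_map_poly.
exact: leq_trans h (size_poly _ _).
Qed.

(** Let N be the product of the denominators in the minimal polynomial, of degree d with
    coefficients r_i. Then N x is a root of the monic polynomial with coefficients N^(d - i) r_i,
    which are integers. *)
Lemma Aint_mul_nat x : exists m : nat, (0 < m)%N /\ m%:R * x \in Aint.
Proof.
have [r [Dr mon_r] _] := minCpolyP x.
pose N : int := \prod_(i < size r) denq r`_i.
have N0 : 0 < N by apply: prodr_gt0 => i _; exact: denq_gt0.
exists `|N|%N; split; first by rewrite absz_gt0 gt_eqF.
have -> : `|N|%:R = N%:~R :> algC by rewrite pmulrn gez0_abs // ltW.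
pose d := (size r).-1.
have sr : size r = d.+1 by rewrite /d prednK // lt0n size_poly_eq0 monic_neq0.
pose q := \poly_(i < d.+1) ((N ^+ (d - i))%:~R * ratr r`_i : algC).
have qd : q`_d = 1.
  by rewrite coef_poly ltnSn subnn expr0 mul1r /d -lead_coefE (monicP mon_r) rmorph1.
have sq : size q = d.+1 by rewrite size_poly_eq // -[_ * _]/(_) subnn expr0 mul1r /d -lead_coefE (monicP mon_r) rmorph1 oner_eq0.
have qZ : q \is a polyOver Num.int.
  apply/polyOverP => i; rewrite coef_poly; case: ltnP => hi; last exact: rpred0.
  have [e|ne] := eqVneq (i : nat) d.
    by rewrite e subnn expr0 mul1r /d -lead_coefE (monicP mon_r) rmorph1 rpred1.
  have id' : (i < d)%N by rewrite ltn_neqAle ne -ltnS.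
  rewrite -(subnSK id') exprS rmorphM mulrAC /=.
  suff : N%:~R * ratr r`_i \in (Num.int : {pred algC}) by move=> h; rewrite rpredM // intr_int.
  have hi' : (i < size r)%N by rewrite sr.
  rewrite /N (bigD1 (Ordinal hi')) //= rmorphM mulrAC.
  rewrite (_ : (denq r`_i)%:~R * ratr r`_i = (numq r`_i)%:~R); first by rewrite -rmorphM intr_int.
  by rewrite mulrC /ratr divfK // intr_eq0 denq_eq0.
have qm : q \is monic by rewrite monicE lead_coefE sq /= qd.
apply: (root_monic_Aint (p := q)) => //.
have rx : (pQtoC r).[x] = 0 by apply/rootP; rewrite -Dr root_minCpoly.
apply/rootP; rewrite horner_coef sq.
transitivity ((N ^+ d)%:~R * (pQtoC r).[x]); last by rewrite rx mulr0.
rewrite horner_coef size_map_poly sr mulr_sumr; apply: eq_bigr => i _.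
rewrite coef_poly ltn_ord coef_map /= exprMn -!rmorphXn /=.
have -> : N ^+ d = N ^+ (d - i) * N ^+ i by rewrite -exprD subnK // -ltnS.
by rewrite rmorphM /=; ring.
Qed.

Lemma uniq_map_inj (T U : eqType) (f : T -> U) s : uniq (map f s) -> {in s &, injective f}.
Proof.
move=> uf x y xs ys e.
have ix : (index x s < size s)%N by rewrite index_mem.
have iy : (index y s < size s)%N by rewrite index_mem.
have : nth (f x) (map f s) (index x s) == nth (f x) (map f s) (index y s).
  by rewrite !(nth_map x) // !nth_index // e.
rewrite nth_uniq ?size_map // => /eqP ei.
by rewrite -(nth_index x xs) ei nth_index.
Qed.

Lemma subfield_poly z : subfield [set y : algC | exists p : {poly rat}, y = (pQtoC p).[z]]%classic.
Proof.
split=> /= [|x y [p ->] [q ->]|x y [p ->] [q ->]].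
- by exists 1; rewrite rmorph1 hornerE.
- by exists (p - q); rewrite rmorphB /= !hornerE.
have [->|y0] := eqVneq (pQtoC q).[z] 0; first by exists 0; rewrite invr0 mulr0 rmorph0 horner0.
have [u ->] := algC_inv_poly y0; exists (p * (u \Po q)).
by rewrite rmorphM /= map_comp_poly hornerM horner_comp.
Qed.

(** The primitive element is an integer z of M with the largest number of conjugates. For an integer
    x' of M, a primitive element z' of Q(x', z) has no more conjugates than z, so an automorphism
    fixing z fixes z' and hence x'. *)
Lemma nf_exists (M : set algC) : number_field M -> exists D : nf_data M, True.
Proof.
move=> [sM [n [b hb]]]; have bnd := nf_degree_bound sM hb.
pose Q d := `[< exists x, [/\ M x, x \in Aint & size (conjugates x) = d] >].
have exQ : exists d, Q d.
  by exists (size (conjugates 1)); apply/asboolP; exists 1; split => //; exact: sf1.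
have ubQ d : Q d -> (d <= n)%N by move=> /asboolP[x [Mx _ <-]]; exact: bnd.
case: (ex_maxnP exQ ubQ) => d /asboolP[z [Mz Az sz]] maxd.
have prim (s : aut) : s z = z -> forall x, M x -> s x = x.
  move=> sz' x Mx; have [m [m0 Amx]] := Aint_mul_nat x.
  set x' := m%:R * x in Amx.
  suff : s x' = x'.
    rewrite /x' rmorphM rmorph_nat; apply: mulfI.
    by rewrite pnatr_eq0 -lt0n.
  have Mx' : M x' by apply: sfM => //; exact: sf_nat.
  have [z' [a Dz'] [[|px [|pz []]] //= [Dx Dz]]] := algC_PET [:: x'; z].
  have Mz' : M z'.
    rewrite Dz'; apply: sf_sum => // i _; rewrite -mulr_natr; apply: sfM => //; last exact: sf_nat.
    by case: i => [[|[|]]].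
  have Az' : z' \in Aint.
    by rewrite Dz' rpred_sum // => i _; rewrite rpredMn //; case: i => [[|[|]]].
  have le : (size (conjugates z') <= size (conjugates z))%N.
    by rewrite sz; apply: maxd; apply/asboolP; exists z'.
  have um : uniq (map (fun w => (pQtoC pz).[w]) (conjugates z')).
    apply: (leq_size_uniq (conjugates_uniq z)); last by rewrite size_map.
    move=> w /conjugates_emb[t <-]; apply/mapP; exists (t z'); first exact: aut_conjugates.
    by rewrite [in LHS]Dz aut_pQ.
  have sz'' : s z' = z'.
    apply: (uniq_map_inj um); rewrite ?aut_conjugates //; first by rewrite -[z' \in _]/(_ ) -[X in X \in _](aut1 z') aut_conjugates.
    by rewrite -aut_pQ -Dz.
  by rewrite Dx aut_pQ sz''.
have szd : size (minCpoly z) = d.+1 by rewrite size_conjugates sz.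
have conjP (i : 'I_d) : exists s : aut, s z = (conjugates z)`_i.
  by apply: conjugates_emb; rewrite mem_nth // sz.
pose e i := projT1 (cid (conjP i)).
have De i : e i z = (conjugates z)`_i by rewrite /e; case: cid.
have [r [Dr mon_r] min_r] := minCpolyP z.
have szr : size r = d.+1 by rewrite -szd Dr size_map_poly.
unshelve eexists; last by [].
apply: (@NfData M d z e) => // [s|i j|x Mx|a].
- have : s z \in conjugates z by exact: aut_conjugates.
  rewrite -index_mem sz => hi; exists (Ordinal hi) => x Mx.
  have h : ((e (Ordinal hi))^-1 * s)%g z = z.
    rewrite autM; apply: (can_inj (autKV (e (Ordinal hi)))).
    by rewrite (autVK (e _)) De /= nth_index // aut_conjugates.
  by have := prim _ h x Mx; rewrite autM => {2}<-; rewrite (autVK (e _)).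
- rewrite !De => /eqP; rewrite nth_uniq ?conjugates_uniq ?sz // => /eqP ij.
  exact: val_inj.
- have [p Dp] : [set y : algC | exists p : {poly rat}, y = (pQtoC p).[z]]%classic x.
    apply: subfield_fix; first exact: subfield_poly.
    move=> s hs; apply: prim => //; apply: hs; exists 'X.
    by rewrite map_polyX hornerX.
  exists (fun i => (p %% r)`_i); rewrite Dp {1}(divp_eq p r) rmorphD rmorphM /= -Dr.
  rewrite hornerD hornerM (rootP (root_minCpoly z)) mulr0 add0r.
  rewrite (@horner_coef_wide _ d); first by apply: eq_bigr => i _; rewrite coef_map.
  by rewrite size_map_poly -ltnS -szr ltn_modp monic_neq0.
- move=> a0; pose p := \poly_(i < d) (oapp a 0 (insub i)).
  have pi (i : 'I_d) : p`_i = a i by rewrite coef_poly ltn_ord valK.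
  move=> i; rewrite -pi; suff -> : p = 0 by rewrite coef0.
  apply: contraTeq isT => p0; have : root (pQtoC p) z.
    apply/rootP; rewrite (@horner_coef_wide _ d) ?size_map_poly ?size_poly // -[RHS]a0.
    by apply: eq_bigr => j _; rewrite coef_map /= pi.
  rewrite min_r => /(dvdp_leq p0); rewrite szr => h.
  by have := leq_trans h (size_poly _ _); rewrite ltnn.
Qed.

Section NumberField.
Variables (M : set algC) (D : nf_data M).
Local Notation d := (nf_d D).
Local Notation z := (nf_z D).
Local Notation e := (@nf_e M D).
Let sM := nf_sub D.
Let OM x := M x /\ x \in Aint.

Lemma nf_agree (s t : aut) : s z = t z -> forall x, M x -> s x = t x.
Proof.
move=> st x Mx; have [a ->] := nf_gen D Mx.
by rewrite !rmorph_sum; apply: eq_bigr => i _; rewrite rmorphM [RHS]rmorphM !rmorphXn /= st !aut_rat.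
Qed.

Lemma nf_emb_inj (i j : 'I_d) : (forall x, M x -> e i x = e j x) -> i = j.
Proof. by move=> h; apply: (@nf_inj M D); rewrite /= h //; exact: nf_zM. Qed.

Definition nf_V : 'M[algC]_d := \matrix_(i, j) (e i z) ^+ j.

Lemma nf_V_unit : nf_V \in unitmx.
Proof.
rewrite -unitmx_tr -row_free_unit -kermx_eq0; apply/rowV0P => v /sub_kermxP vV.
pose p := \poly_(i < d) (oapp (v ord0) 0 (insub i)) : {poly algC}.
have pi (i : 'I_d) : p`_i = v ord0 i.
  by rewrite coef_poly ltn_ord valK.
have pr i : root p (e i z).
  apply/rootP; rewrite (@horner_coef_wide _ d) ?size_poly //.
  have /matrixP /(_ ord0 i) := vV; rewrite !mxE => h; rewrite -[RHS]h.
  by apply: eq_bigr => j _; rewrite !mxE pi.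
apply/rowP => i; rewrite mxE -pi; suff -> : p = 0 by rewrite coef0.
apply: contraTeq isT => p0.
have := @max_poly_roots _ p [seq e i z | i <- enum 'I_d] p0.
rewrite size_map -cardE card_ord map_inj_uniq ?enum_uniq; last exact: (@nf_inj M D).
move=> /(_ _ isT) h; have : (d < size p)%N.
  by apply: h; apply/allP => _ /mapP[j _ ->].
by rewrite ltnNge size_poly.
Qed.

Lemma nf_coord_inv x (a : 'I_d -> rat) : x = \sum_j ratr (a j) * z ^+ j ->
  forall j, ratr (a j) = \sum_i invmx nf_V j i * e i x.
Proof.
move=> Dx j; pose av : 'cV[algC]_d := \col_j ratr (a j).
have h : nf_V *m av = \col_i e i x.
  apply/matrixP => i k; rewrite !mxE Dx rmorph_sum; apply: eq_bigr => l _.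
  by rewrite !mxE rmorphM rmorphXn /= aut_rat mulrC.
have := congr1 (fun w : 'cV_d => w j ord0) (mulKmx nf_V_unit av).
by rewrite h !mxE => <-; apply: eq_bigr => i _; rewrite !mxE.
Qed.

(** Cramer's rule: D0 is chosen with D0 / det V integral, so that D0 times a coordinate is a
    rational algebraic integer. *)
Lemma nf_int_coord : exists D0 : nat, (0 < D0)%N /\ exists c : algC -> 'I_d -> int,
  forall x, OM x -> D0%:R * x = \sum_j (c x j)%:~R * z ^+ j.
Proof.
have d0 : \det nf_V != 0 by move: nf_V_unit; rewrite unitmxE unitfE.
have VA i j : nf_V i j \in Aint by rewrite mxE rpredX // Aint_aut nf_zA.
have [m [m0 mA]] := Aint_mul_nat (\det nf_V)^-1.
exists m; split => //.
suff h x : exists c : 'I_d -> int, OM x -> m%:R * x = \sum_j (c j)%:~R * z ^+ j.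
  by have [c hc] := choice h; exists c.
have [[Mx Ax]|n] := pselect (OM x); last by exists (fun=> 0).
have [a Da] := nf_gen D Mx.
have hj j : exists k : int, m%:R * ratr (a j) = k%:~R :> algC.
  suff : m%:R * ratr (a j) \in (Num.int : {pred algC}) by case/intrP => k ->; exists k.
  apply: Cint_rat_Aint; first by rewrite rpredM ?rpred_nat ?Crat_rat.
  rewrite (nf_coord_inv Da) mulr_sumr rpred_sum // => i _.
  rewrite mulrA rpredM ?Aint_aut // /invmx nf_V_unit mxE mulrA rpredM //.
  rewrite mxE /cofactor rpredM ?rpredX ?rpredN ?rpred1 //.
  rewrite rpred_sum // => s _; rewrite rpredM ?rpredX ?rpredN ?rpred1 //.
  by rewrite rpred_prod // => k _; rewrite !mxE rpredX // Aint_aut nf_zA.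
have [c hc] := choice hj; exists c => _.
by rewrite {1}Da mulr_sumr; apply: eq_bigr => j _; rewrite mulrA hc.
Qed.

Lemma modcode m : (0 < m)%N -> exists (T : finType) (code : algC -> T),
  forall x y, OM x -> OM y -> code x = code y -> (x - y) / m%:R \in Aint.
Proof.
move=> m0; have [D0 [D00 [c hc]]] := nf_int_coord.
have nz : (D0 * m)%:Z != 0 by rewrite eqz_nat -lt0n muln_gt0 D00.
have lt_l x j : (`|(c x j %% (D0 * m)%N)%Z| < D0 * m)%N.
  by rewrite -ltz_nat gez0_abs ?modz_ge0 // ltz_mod.
exists {ffun 'I_d -> 'I_(D0 * m)}, (fun x => [ffun j => Ordinal (lt_l x j)]).
move=> x y Ox Oy ecode.
have hj j : exists k : int, c x j - c y j = k * (D0 * m)%N.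
  have /(congr1 val) /= := congr1 (fun f : {ffun 'I_d -> 'I_(D0 * m)} => f j) ecode.
  rewrite !ffunE /= => /(congr1 Posz); rewrite !gez0_abs ?modz_ge0 // => e'.
  exists ((c x j %/ (D0 * m)%N)%Z - (c y j %/ (D0 * m)%N)%Z).
  rewrite {1}(divz_eq (c x j) (D0 * m)%N) {1}(divz_eq (c y j) (D0 * m)%N) e'.
  by rewrite opprD addrACA subrr addr0 mulrBl.
have [k hk] := choice hj.
have D0n : D0%:R != 0 :> algC by rewrite pnatr_eq0 -lt0n.
have mn : m%:R != 0 :> algC by rewrite pnatr_eq0 -lt0n.
have -> : (x - y) / m%:R = \sum_j (k j)%:~R * z ^+ j.
  apply: (mulfI D0n); apply: (mulIf mn).
  have -> : D0%:R * ((x - y) / m%:R) * m%:R = D0%:R * x - D0%:R * y by field.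
  rewrite (hc _ Ox) (hc _ Oy) -sumrB mulr_sumr mulr_suml; apply: eq_bigr => j _.
  by rewrite -mulrBl -rmorphB /= hk rmorphM /= -pmulrn natrM; ring.
by rewrite rpred_sum // => j _; rewrite rpredM ?Aint_int // rpredX // nf_zA.
Qed.

(** The inverse Vandermonde matrix bounds the coordinates of x by its conjugates, and D0 times these
    coordinates are integers. *)
Lemma northcott (B : algC) : exists (T : finType) (code : algC -> T),
  forall x y, OM x -> OM y -> (forall i, `|e i x| <= B) -> (forall i, `|e i y| <= B) ->
  code x = code y -> x = y.
Proof.
have [D0 [D00 [c hc]]] := nf_int_coord.
have D0n : D0%:R != 0 :> algC by rewrite pnatr_eq0 -lt0n.
pose K := \sum_j \sum_i `|invmx nf_V j i| * (D0%:R * `|B|).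
have K0 : 0 <= K.
  apply: sumr_ge0 => j _; apply: sumr_ge0 => i _.
  by rewrite !mulr_ge0 ?normr_ge0 ?ler0n.
have [k Kk] : exists k : nat, K <= k%:R.
  by exists (Num.bound K); apply: ltW; exact: archi_boundP.
have cb x j : OM x -> (forall i, `|e i x| <= B) -> (`|c x j| <= k)%N.
  move=> Ox hB; have hx := hc _ Ox.
  have Dx : x = \sum_j ratr ((c x j)%:~R / D0%:R) * z ^+ j.
    apply: (mulfI D0n); rewrite hx mulr_sumr; apply: eq_bigr => l _.
    by rewrite rmorphM fmorphV rmorph_int rmorph_nat; field.
  have := nf_coord_inv Dx j.
  rewrite rmorphM fmorphV rmorph_int rmorph_nat => h.
  rewrite -(ler_nat algC); apply: le_trans Kk.
  have -> : `|c x j|%:R = `|(c x j)%:~R| :> algC by rewrite -intr_norm pmulrn abszE.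
  have -> : (c x j)%:~R = D0%:R * \sum_i invmx nf_V j i * e i x :> algC.
    by rewrite -h mulrC divfK.
  rewrite normrM normr_nat; apply: le_trans (_ : \sum_i `|invmx nf_V j i| * (D0%:R * `|B|) <= _).
    apply: le_trans (ler_wpM2l (ler0n _ _) (ler_norm_sum _ _ _)) _.
    rewrite mulr_sumr ler_sum // => i _; rewrite normrM mulrCA ler_wpM2l ?normr_ge0 //.
    rewrite ler_wpM2l ?ler0n //; apply: le_trans (hB i) _.
    by apply: real_ler_norm; apply: ger0_real; exact: le_trans (normr_ge0 _) (hB i).
  rewrite /K [X in _ <= X](bigD1 j) //= lerDl; apply: sumr_ge0 => l _; apply: sumr_ge0 => i _.
  by rewrite !mulr_ge0 ?normr_ge0 ?ler0n.
exists {ffun 'I_d -> 'I_(k + k).+1}, (fun x => [ffun j => inord `|c x j + k%:Z|]).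
move=> x y Ox Oy hx hy ecode; apply: (mulfI D0n); rewrite (hc _ Ox) (hc _ Oy).
apply: eq_bigr => j _; congr (_%:~R * _).
have /(congr1 val) /= := congr1 (fun f : {ffun 'I_d -> 'I_(k + k).+1} => f j) ecode.
have := cb x j Ox hx; have := cb y j Oy hy.
rewrite !ffunE => h1 h2; rewrite !inordK; lia.
Qed.

Definition nf_norm (x : algC) : algC := \prod_i e i x.

Lemma nf_perm (s : aut) : exists pi : 'I_d -> 'I_d, injective pi /\
  forall i x, M x -> s (e i x) = e (pi i) x.
Proof.
have h i := nf_surj D (s * e i)%g.
have [pi hpi] := choice h; exists pi; split => [i j ij|i x Mx]; last by rewrite -hpi.
apply: nf_emb_inj => x Mx; apply: (fmorph_inj s).
by rewrite -[LHS]/((s * e i)%g x) hpi // ij -hpi.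
Qed.

Lemma nf_norm_rat x : M x -> nf_norm x \in Crat.
Proof.
move=> Mx; apply: Crat_fix => s; have [pi [inj hpi]] := nf_perm s.
rewrite /nf_norm rmorph_prod [RHS](reindex_inj inj) /=.
by apply: eq_bigr => i _; exact: hpi.
Qed.

Lemma nf_norm_int x : OM x -> nf_norm x \in Num.int.
Proof.
move=> [Mx Ax]; apply: Cint_rat_Aint; first exact: nf_norm_rat.
by rewrite rpred_prod // => i _; rewrite Aint_aut.
Qed.

Lemma nf_norm_neq0 x : x != 0 -> nf_norm x != 0.
Proof. by move=> x0; apply/prodf_neq0 => i _; rewrite fmorph_eq0. Qed.

Lemma nf_normM x y : nf_norm (x * y) = nf_norm x * nf_norm y.
Proof. by rewrite /nf_norm -big_split; apply: eq_bigr => i _; rewrite rmorphM. Qed.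

Lemma nf_id : exists i, forall x, M x -> e i x = x.
Proof. by have [i h] := nf_surj D 1%g; exists i => x /h <-. Qed.

Lemma nf_norm_div x : OM x -> x != 0 -> nf_norm x / x \in Aint.
Proof.
move=> [Mx Ax] x0; have [i hi] := nf_id.
rewrite /nf_norm (bigD1 i) //= hi // mulrAC divff // mul1r.
by rewrite rpred_prod // => j _; rewrite Aint_aut.
Qed.

End NumberField.

(** * The box principle and the finiteness of the class group *)

Lemma floor_eq_dist (R : archiNumDomainType) (x y : R) : x \is Num.real -> y \is Num.real ->
  Num.floor x = Num.floor y -> `|x - y| < 1.
Proof.
move=> xr yr xy; have := real_floor_itv xr; have := real_floor_itv yr; rewrite xy.
rewrite rmorphD /= => /andP[h1 h2] /andP[h3 h4].
rewrite real_ltr_norml ?realB //; apply/andP; split.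
  by rewrite ltrNl opprB ltrBlDl; apply: lt_le_trans h2 _; rewrite lerD2r.
by rewrite ltrBlDl; apply: lt_le_trans h4 _; rewrite lerD2r.
Qed.

Lemma floor_bound (R : archiNumDomainType) (x : R) (n : nat) : 0 <= x -> x < n%:R ->
  (`|Num.floor x| < n)%N.
Proof.
move=> x0 xn; have xr := ger0_real x0.
rewrite -ltz_nat gez0_abs ?real_floor_ge0 //.
by rewrite real_floor_lt_int // -pmulrn.
Qed.

Section ClassNumber.
Variables (M : set algC) (D : nf_data M).
Local Notation d := (nf_d D).
Local Notation z := (nf_z D).
Local Notation e := (@nf_e M D).
Let sM := nf_sub D.
Let OM x := M x /\ x \in Aint.

Let C0 : algC := \sum_i \sum_(j < d) `|e i z ^+ j|.

Lemma nf_sum_bound (i : 'I_d) : \sum_(j < d) `|e i z ^+ j| <= C0.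
Proof.
rewrite /C0 [X in _ <= X](bigD1 i) //= lerDl.
by apply: sumr_ge0 => k _; apply: sumr_ge0 => j _; exact: normr_ge0.
Qed.

Lemma nf_C0_ge0 : 0 <= C0.
Proof. by apply: sumr_ge0 => k _; apply: sumr_ge0 => j _; exact: normr_ge0. Qed.

Lemma nf_comb_bound (a : 'I_d -> algC) (B : algC) i : 0 <= B ->
  (forall j, `|a j| <= B) -> `|\sum_j a j * e i z ^+ j| <= B * C0.
Proof.
move=> B0 aB; apply: le_trans (ler_norm_sum _ _ _) _.
apply: le_trans (_ : B * \sum_(j < d) `|e i z ^+ j| <= _).
  by rewrite mulr_sumr ler_sum // => j _; rewrite normrM ler_wpM2r ?normr_ge0.
by rewrite ler_wpM2l // nf_sum_bound.
Qed.

Lemma nf_emb_comb (a : 'I_d -> rat) i :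
  e i (\sum_j ratr (a j) * z ^+ j) = \sum_j ratr (a j) * e i z ^+ j.
Proof.
rewrite rmorph_sum; apply: eq_bigr => j _.
by rewrite rmorphM rmorphXn /= aut_rat.
Qed.

Lemma nf_comb_OM (c : 'I_d -> int) : OM (\sum_j (c j)%:~R * z ^+ j).
Proof.
split; last by rewrite rpred_sum // => j _; rewrite rpredM ?Aint_int // rpredX // nf_zA.
by apply: sf_sum => // j _; apply: sfM => //; [exact: sf_int|apply: sfX => //; exact: nf_zM].
Qed.

(** Hurwitz's replacement for Euclidean division. The fractional parts of the coordinates of the
    multiples k al are sorted into s^d boxes of side 1/s; two multiples in one box differ by an
    integer of M up to an error of at most C0 / s < 1 at every embedding. *)
Lemma hurwitz : exists2 M0, (0 < M0)%N & forall al, M al ->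
  exists t w, [/\ (0 < t <= M0)%N, OM w & forall i, `|e i (t%:R * al - w)| < 1].
Proof.
pose s := (Num.bound C0).+1.
have Cs : C0 < s%:R.
  by apply: lt_trans (archi_boundP nf_C0_ge0) _; rewrite ltr_nat.
have s0 : 0 < s%:R :> rat by rewrite ltr0n.
pose frac (x : rat) := x - (Num.floor x)%:~R.
have frac0 x : 0 <= s%:R * frac x < s%:R.
  have /andP[h1 h2] := floor_itv x; apply/andP; split.
    by apply: mulr_ge0; [exact: ltW|rewrite subr_ge0].
  by rewrite -[X in _ < X]mulr1 ltr_pM2l // /frac ltrBlDl -[X in _ + X]/(1%:~R) -rmorphD.
have box_lt : forall x, (`|Num.floor (s%:R * frac x)| < s)%N.
  by move=> x; have /andP[h1 h2] := frac0 x; exact: floor_bound.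
exists #|{ffun 'I_d -> 'I_s}|; first by rewrite card_ffun !card_ord expn_gt0.
move=> al Mal; have [a Da] := nf_gen D Mal.
have [i [j [ij jT ef]]] := pigeon (fun k : nat => [ffun l : 'I_d => Ordinal (box_lt (k%:R * a l))]).
pose fl k l := Num.floor (k%:R * a l : rat).
exists (j - i)%N, (\sum_l (fl j l - fl i l)%:~R * z ^+ l); split.
- by rewrite subn_gt0 ij /= (leq_trans (leq_subr _ _)).
- exact: nf_comb_OM.
have E (f : {rmorphism rat -> algC}) (u v : int) (q : rat) :
    (j - i)%N%:R * f q - (u - v)%:~R = f ((j%:R * q - u%:~R) - (i%:R * q - v%:~R)).
  rewrite natrB ?(ltnW ij) // !(rmorphB, rmorphM, rmorph_nat, rmorph_int) /=.
  by rewrite mulrBl; ring.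
move=> m; pose dl l : rat := frac (j%:R * a l) - frac (i%:R * a l).
have -> : (j - i)%N%:R * al - \sum_l (fl j l - fl i l)%:~R * z ^+ l = \sum_l ratr (dl l) * z ^+ l.
  rewrite Da mulr_sumr -sumrB; apply: eq_bigr => l _.
  rewrite mulrA -mulrBl; congr (_ * _).
  exact: E.
rewrite nf_emb_comb.
have dl_lt l : `|s%:R * dl l| < 1.
  rewrite /dl mulrBr; apply: floor_eq_dist; rewrite ?num_real //.
  have /(congr1 val) /= := congr1 (fun f : {ffun 'I_d -> 'I_s} => f l) ef.
  rewrite !ffunE /= => /(congr1 Posz).
  have /andP[h1 _] := frac0 (i%:R * a l); have /andP[h2 _] := frac0 (j%:R * a l).
  by rewrite !gez0_abs ?floor_ge0.
have sC : 0 < s%:R :> algC by rewrite ltr0n.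
apply: le_lt_trans (_ : s%:R^-1 * C0 < 1); last by rewrite mulrC ltr_pdivrMr // mul1r.
apply: nf_comb_bound; first by rewrite invr_ge0 ltW.
move=> l; rewrite -[X in _ <= X]mul1r ler_pdivlMr // mulrC.
rewrite -[X in X * _]gtr0_norm // -normrM -[s%:R](rmorph_nat (ratr : {rmorphism rat -> algC})).
by rewrite -rmorphM /= -ratr_norm -(rmorph1 (ratr : {rmorphism rat -> algC})) ler_rat ltW.
Qed.

Definition nf_ideal (A : set algC) : Prop :=
  [/\ forall x, A x -> M x /\ x \in Aint, exists2 x, A x & x != 0,
      forall x y, A x -> A y -> A (x + y) & forall a x, M a -> a \in Aint -> A x -> A (a * x)].

(** Let a in A have minimal norm. [hurwitz] applied to b / a leaves a remainder in A of smaller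
    norm, hence zero, so (M0! / a) A consists of integers. It contains M0! times every integer of M,
    as a is in A, and is thus determined by a set of classes modulo M0!. *)
Lemma class_number : exists (T : finType) (code : set algC -> T),
  forall A B, nf_ideal A -> nf_ideal B -> code A = code B ->
  exists c, [/\ M c, c != 0 & forall x, B x <-> A (x / c)].
Proof.
have [M0 M00 hM0] := hurwitz.
have m0 : (0 < M0`!)%N by exact: fact_gt0.
have [T [code hcode]] := modcode D m0.
pose gen A a := [/\ A a, a != 0 & forall b, A b -> (M0`!%:R / a) * b \in Aint].
have ex_gen A : nf_ideal A -> exists a, gen A a.
  move=> [AO [x0 Ax0 x00] AD AM].
  pose Q n := `[< exists x, [/\ A x, x != 0 & `|nf_norm D x| = n%:R] >].
  have norm_nat x : A x -> exists n : nat, `|nf_norm D x| = n%:R.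
    by move=> /AO /(nf_norm_int D) /intrP [k ->]; exists `|k|%N; rewrite -intr_norm pmulrn abszE.
  have exQ : exists n, Q n by have [n hn] := norm_nat _ Ax0; exists n; apply/asboolP; exists x0.
  case: (ex_minnP exQ) => n /asboolP[a [Aa a0 an]] minn.
  exists a; split => // b Ab; have [Ma Aia] := AO _ Aa; have [Mb Aib] := AO _ Ab.
  have [t [w [/andP[t0 tM] [Mw Aw] hw]]] := hM0 _ (sf_div sM Mb Ma).
  pose r := t%:R * b - w * a.
  have Ar : A r.
    apply: AD; first by apply: AM => //; [exact: sf_nat|rewrite rpred_nat].
    by rewrite -mulNr; apply: AM => //; [exact: sfN|rewrite rpredN].
  have r0 : r = 0.
    apply: contrapT => /eqP r0; have [k hk] := norm_nat _ Ar.
    have : (n <= k)%N by apply: minn; apply/asboolP; exists r.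
    apply/negP; rewrite -ltnNge -(ltr_nat algC) -hk -an.
    have -> : r = (t%:R * (b / a) - w) * a by rewrite mulrBl -mulrA divfK.
    rewrite nf_normM normrM -[X in _ < X]mul1r ltr_pM2r ?normr_gt0 ?nf_norm_neq0 //.
    rewrite /nf_norm normr_prod; have [i0 _] := nf_id D.
    rewrite (bigD1 i0) //=.
    have P1 : \prod_(i | i != i0) `|e i (t%:R * (b / a) - w)| <= 1.
      by apply: prodr_ile1 => i _; rewrite normr_ge0 ltW.
    by apply: le_lt_trans (ler_wpM2l (normr_ge0 _) P1) _; rewrite mulr1 hw.
  have /dvdnP [q Dq] : (t %| M0`!)%N by apply: dvdn_fact; rewrite t0.
  have -> : M0`!%:R / a * b = q%:R * w.
    rewrite Dq natrM; move/eqP: r0; rewrite subr_eq0 => /eqP r0.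
    by rewrite mulrAC -[_ * _ * b]mulrA r0 mulrA mulfK.
  by rewrite rpredM ?rpred_nat.
have ex_gen' A : exists a, nf_ideal A -> gen A a.
  have [h|n] := pselect (nf_ideal A); last by exists 0.
  by have [a ha] := ex_gen A h; exists a.
have [g hg] := choice ex_gen'.
pose bb A := fun x => A (x * g A / M0`!%:R).
exists {set T}, (fun A => [set t | `[< exists2 x, bb A x & code x = t >]]%SET).
have mn : M0`!%:R != 0 :> algC by rewrite pnatr_eq0 -lt0n.
have bbOM A x : nf_ideal A -> bb A x -> OM x.
  move=> hA bx; have [Aa a0 h] := hg A hA; have [AO _ _ _] := hA.
  have := h _ bx; rewrite [X in X \in _](_ : _ = x); last by field; rewrite ?mn ?a0.
  move=> Ax; split => //; have [Mxg _] := AO _ bx.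
  rewrite (_ : x = x * g A / M0`!%:R * M0`!%:R / g A); last by field; rewrite ?mn ?a0.
  apply: sf_div => //; last by have [] := AO _ Aa.
  by apply: sfM => //; exact: sf_nat.
have bbD A x y : nf_ideal A -> bb A x -> bb A y -> bb A (x + y).
  by move=> [_ _ AD _]; rewrite /bb !mulrDl; exact: AD.
have bbm A x : nf_ideal A -> OM x -> bb A (M0`!%:R * x).
  move=> hA [Mx Ax]; have [Aa a0 h] := hg A hA; have [_ _ _ AM] := hA.
  rewrite /bb (_ : _ / _ = x * g A); last by field; rewrite ?mn.
  exact: AM.
have sub A B : nf_ideal A -> nf_ideal B ->
    [set t | `[< exists2 x, bb A x & code x = t >]]%SET = [set t | `[< exists2 x, bb B x & code x = t >]]%SET ->
    forall x, bb A x -> bb B x.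
  move=> hA hB eAB x bx.
  have : code x \in [set t | `[< exists2 x, bb A x & code x = t >]]%SET.
    by rewrite inE; apply/asboolP; exists x.
  rewrite eAB inE => /asboolP[y by' exy].
  have Ox := bbOM _ _ hA bx; have Oy := bbOM _ _ hB by'.
  have Aw := hcode _ _ Ox Oy (esym exy).
  rewrite -(subrK y x) -(divfK mn (x - y)) mulrC; apply: bbD => //; apply: bbm => //.
  by split => //; apply: sf_div => //; [apply: sfB => //; [case: Ox|case: Oy]|exact: sf_nat].
move=> A B hA hB eAB.
have [Aa a0 _] := hg A hA; have [Bb b0 _] := hg B hB.
have [AO _ _ _] := hA; have [BO _ _ _] := hB.
exists (g B / g A); split.
- by apply: sf_div => //; [case: (BO _ Bb)|case: (AO _ Aa)].
- by rewrite mulf_neq0 // invr_eq0.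
move=> x; have hx : x = (x * M0`!%:R / g B) * g B / M0`!%:R by field; rewrite ?mn ?b0.
have hx' : x / (g B / g A) = (x * M0`!%:R / g B) * g A / M0`!%:R by field; rewrite ?mn ?b0 ?a0.
rewrite hx'; split => [Bx|Ax].
  by apply: (sub B A) => //; rewrite /bb -hx.
by rewrite hx; apply: (sub A B).
Qed.

End ClassNumber.

(** * Units of prescribed size at the archimedean places *)

Definition cj : aut := aut_of (Num.Def.conjC : {rmorphism algC -> algC}).
Lemma cjE x : cj x = x^*. Proof. by []. Qed.

Section Units.
Variables (M : set algC) (D : nf_data M).
Local Notation d := (nf_d D).
Local Notation z := (nf_z D).
Local Notation e := (@nf_e M D).
Local Notation N := (nf_norm D).
Let sM := nf_sub D.
Let OM x := M x /\ x \in Aint.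

Definition nf_unit (u : algC) : Prop := [/\ M u, u \in Aint, u^-1 \in Aint & u != 0].

Lemma nf_unitM u v : nf_unit u -> nf_unit v -> nf_unit (u * v).
Proof.
move=> [Mu Au Au' u0] [Mv Av Av' v0]; split; rewrite ?rpredM ?invfM ?mulf_neq0 ?rpredM //.
exact: sfM.
Qed.
Lemma nf_unitV u : nf_unit u -> nf_unit u^-1.
Proof. by move=> [Mu Au Au' u0]; split; rewrite ?invrK ?invr_eq0 //; exact: sfV. Qed.
Lemma nf_unit1 : nf_unit 1.
Proof. by split; rewrite ?invr1 ?oner_eq0 //; exact: sf1. Qed.
Lemma nf_unit_exp u (n : int) : nf_unit u -> nf_unit (u ^ n).
Proof.
have h (m : nat) v : nf_unit v -> nf_unit (v ^+ m).
  by move=> hv; elim: m => [|m IH]; rewrite ?expr0 ?exprS; [exact: nf_unit1|exact: nf_unitM].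
by move=> hu; case: n => m; [|rewrite NegzE -exprnN; apply: nf_unitV]; exact: h.
Qed.
Lemma nf_unit_prod I (r : seq I) (Q : pred I) f : (forall i, Q i -> nf_unit (f i)) ->
  nf_unit (\prod_(i <- r | Q i) f i).
Proof. by move=> h; elim/big_ind: _ => //; [exact: nf_unit1|exact: nf_unitM]. Qed.
Lemma nf_unit_norm u : nf_unit u -> \prod_i `|e i u| = 1.
Proof.
move=> [Mu Au Au' u0].
have h1 := nf_norm_int D (conj Mu Au).
have h2 := nf_norm_int D (conj (sfV sM Mu) Au').
have : `|N u| * `|N u^-1| = 1.
  rewrite -normrM -nf_normM divff // /nf_norm big1 ?normr1 // => i _; exact: rmorph1.
rewrite -(normr_prod _ _ (fun i => e i u)) -/(N u).
have intn v : v \in Num.int -> exists a : nat, `|v| = a%:R :> algC.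
  by move=> /intrP [k ->]; exists `|k|%N; rewrite -intr_norm pmulrn abszE.
have [a ->] := intn _ h1; have [b ->] := intn _ h2.
by rewrite -natrM => /eqP; rewrite pnatr_eq1 muln_eq1 => /andP[/eqP -> _].
Qed.

Lemma conj_index_ex i : exists j, forall x, M x -> e j x = (e i x)^*.
Proof. by have [j hj] := nf_surj D (cj * e i)%g; exists j => x Mx; rewrite -hj. Qed.
Definition cc i := projT1 (cid (conj_index_ex i)).
Lemma ccE i x : M x -> e (cc i) x = (e i x)^*.
Proof. by move: x; rewrite /cc; case: cid. Qed.
Lemma ccK : involutive cc.
Proof. by move=> i; apply: nf_emb_inj => x Mx; rewrite !ccE // conjCK. Qed.

(** Of two conjugate embeddings the one of smaller index contributes the real part and the other the
    imaginary part, so that there are d real coordinates in all. A real embedding has j = cc j and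
    contributes its real part. *)
Definition rho (j : 'I_d) (x : algC) : algC :=
  if (j <= cc j)%N then 'Re (e j x) else 'Im (e j x).

Lemma rho_real j x : rho j x \is Num.real.
Proof. by rewrite /rho; case: ifP => _; [exact: Creal_Re|exact: Creal_Im]. Qed.
Lemma rhoB j x y : rho j (x - y) = rho j x - rho j y.
Proof. by rewrite /rho; case: ifP => _; rewrite rmorphB raddfB. Qed.
Lemma norm_Re_le (x : algC) : `|'Re x| <= `|x|.
Proof.
rewrite ReE normrM normfV (ger0_norm (ler0n _ 2)) ler_pdivrMr ?ltr0n //.
apply: le_trans (ler_normD _ _) _; by rewrite norm_conjC mulr_natr mulr2n.
Qed.
Lemma norm_Im_le (x : algC) : `|'Im x| <= `|x|.
Proof.
rewrite ImE normrM normfV (ger0_norm (ler0n _ 2)) ler_pdivrMr ?ltr0n //.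
rewrite normrM normCi mul1r.
apply: le_trans (ler_normB _ _) _; by rewrite norm_conjC mulr_natr mulr2n.
Qed.
Lemma rho_le j x : `|rho j x| <= `|e j x|.
Proof. by rewrite /rho; case: ifP => _; [exact: norm_Re_le|exact: norm_Im_le]. Qed.
Lemma norm_ReIm (x : algC) a : `|'Re x| <= a -> `|'Im x| <= a -> `|x| <= 2 * a.
Proof.
move=> h1 h2; rewrite [X in `|X|]algCrect; apply: le_trans (ler_normD _ _) _.
by rewrite normrM normCi mul1r mulr_natl mulr2n lerD.
Qed.
Lemma rho_bound j x a : 0 <= a -> M x -> `|rho j x| <= a -> `|rho (cc j) x| <= a -> `|e j x| <= 2 * a.
Proof.
move=> a0 Mx; rewrite /rho ccK !ccE // Re_conj Im_conj.
have [lt|gt|eq] := ltngtP j (cc j).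
- by rewrite normrN; exact: norm_ReIm.
- by move=> h1 h2; exact: norm_ReIm.
move=> h _; apply: norm_ReIm => //.
have er : e j x \is Num.real.
  by apply/CrealP; rewrite -ccE // -(val_inj eq).
by move/Creal_ImP: er => ->; rewrite normr0.
Qed.

Definition off_place i := [pred j | (j != i) && (j != cc i)].
Lemma off_place_cc i j : off_place i j -> off_place i (cc j).
Proof.
move=> /andP[h1 h2]; apply/andP; split.
  by apply: contraNneq h2 => e'; rewrite -e' ccK.
by apply: contraNneq h1 => e'; apply/eqP/(can_inj ccK).
Qed.

Local Notation Jn i := #|off_place i|.

Lemma off_place_card i : exists di, [/\ (0 < di)%N & d = (di + Jn i)%N].
Proof.
exists (d - Jn i)%N; split; last by rewrite subnK // -[X in (_ <= X)%N]card_ord max_card.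
rewrite subn_gt0 -[X in (_ < X)%N]card_ord; apply: proper_card.
apply/properP; split; first by apply/fintype.subsetP.
by exists i; rewrite // inE eqxx.
Qed.

Lemma C0_bound : exists K : nat, [/\ (0 < K)%N & forall i (a : 'I_d -> algC) (B : algC), 0 <= B ->
  (forall j, `|a j| <= B) -> `|\sum_j a j * e i z ^+ j| <= B * K%:R].
Proof.
pose C := \sum_i \sum_(j < d) `|e i z ^+ j|.
have C0 : 0 <= C by apply: sumr_ge0 => k _; apply: sumr_ge0 => j _; exact: normr_ge0.
exists (Num.bound C).+1; split => // i a B B0 aB.
apply: le_trans (nf_comb_bound i B0 aB) _; rewrite ler_wpM2l // ltW //.
by apply: lt_trans (archi_boundP C0) _; rewrite ltr_nat.
Qed.

Lemma emb_int_comb (c : 'I_d -> int) i :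
  e i (\sum_j (c j)%:~R * z ^+ j) = \sum_j (c j)%:~R * e i z ^+ j.
Proof.
rewrite rmorph_sum; apply: eq_bigr => j _.
by rewrite rmorphM rmorphXn /= rmorph_int.
Qed.

Lemma int_comb_neq0 (c : 'I_d -> int) j0 : c j0 != 0 -> \sum_j (c j)%:~R * z ^+ j != 0.
Proof.
apply: contraNneq => c0.
have c0' : \sum_j ratr ((c j)%:~R : rat) * z ^+ j = 0.
  by rewrite -[RHS]c0; apply: eq_bigr => j _; rewrite ratr_int.
by have /eqP := nf_free c0' j0; rewrite intr_eq0.
Qed.

(* Dirichlet's box principle on the real coordinates away from the place i. *)
Lemma small_elements : exists2 K : nat, (0 < K)%N & forall i (s : nat), (1 < s)%N ->
  exists x, [/\ OM x, x != 0, forall j, off_place i j -> `|e j x| <= (8 * K)%N%:R / s%:R &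
    `|N x| <= ((8 * K) ^ d)%N%:R].
Proof.
have [K [K0 hK]] := C0_bound; exists K => // i s s1.
have [di [di0 Dd]] := off_place_card i.
(* There are (H + 1)^d coefficient vectors with entries in [0, H]. The coordinates away from the
   place, each cut into t + 1 = s^d intervals, give only (s^d)^(Jn i) = H^d boxes. *)
pose H := (s ^ Jn i)%N; pose t := (s ^ d).-1.
have s0 : (0 < s)%N by apply: ltnW.
have d0 : (0 < d)%N by rewrite Dd addn_gt0 di0.
have t1 : t.+1 = (s ^ d)%N by rewrite prednK // expn_gt0 s0.
have H0 : (0 < H)%N by rewrite expn_gt0 s0.
have s2d : (2 <= s ^ d)%N by apply: leq_trans s1 _; rewrite -{1}(expn1 s) leq_pexp2l.
have t0 : (0 < t)%N by rewrite -ltnS t1.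
pose T := {ffun 'I_d -> 'I_H.+1}.
pose elt (a : T) : algC := \sum_j ((a j : nat) : int)%:~R * z ^+ j.
have eltb (a : T) j : `|e j (elt a)| <= (H * K)%:R.
  rewrite emb_int_comb natrM; apply: hK => // l.
  by rewrite -pmulrn normr_nat ler_nat -ltnS.
pose A : algC := (2 * H * K)%:R.
have A0 : 0 < A by rewrite ltr0n !muln_gt0 H0 K0.
pose v j a : algC := (rho j (elt a) + (H * K)%:R) * t%:R / A.
have vr j a : v j a \is Num.real by rewrite /v rpred_div ?rpredM ?rpredD ?rho_real ?rpred_nat.
have v_bnd j a : 0 <= v j a < t.+1%:R.
  have := le_trans (rho_le j (elt a)) (eltb a j).
  rewrite real_ler_norml ?rho_real // => /andP[h1 h2]; apply/andP; split.
    by rewrite /v divr_ge0 ?mulr_ge0 ?ler0n // -lerBlDr sub0r.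
  apply: le_lt_trans (_ : t%:R < _); last by rewrite ltr_nat.
  have DA : A = (H * K)%:R + (H * K)%:R by rewrite /A -natrD; congr _%:R; lia.
  by rewrite /v ler_pdivrMr // mulrC ler_wpM2l ?ler0n // DA lerD2r.
have v_lt j a : (`|Num.floor (v j a)| < t.+1)%N.
  by have /andP[h1 h2] := v_bnd j a; exact: floor_bound.
pose F (a : T) : {ffun {j | off_place i j} -> 'I_t.+1} := [ffun j => Ordinal (v_lt (val j) a)].
have [a [b [ab Fab]]] : exists a b, a <> b /\ F a = F b.
  apply: contrapT => h; have inj : injective F.
    by move=> a b Fab; apply: contrapT => ab; apply: h; exists a, b.
  have := leq_card _ inj; rewrite !card_ffun !card_ord card_sig t1 leqNgt.
  rewrite -expnM mulnC expnM -/H => /negP; apply.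
  by rewrite ltn_exp2r.
pose c j : int := (a j : nat)%:Z - (b j : nat)%:Z.
have [j0 cj0] : exists j0, c j0 != 0.
  apply: contrapT => h; apply: ab; apply/ffunP => j; apply: val_inj.
  apply: contrapT => ne; apply: h; exists j; rewrite subr_eq0.
  by apply/eqP => -[].
pose x := \sum_j (c j)%:~R * z ^+ j.
have Dx : x = elt a - elt b.
  rewrite /x /elt -sumrB; apply: eq_bigr => j _.
  by rewrite /c rmorphB /= mulrBl.
have Ox : OM x := nf_comb_OM c.
have x0 : x != 0 := int_comb_neq0 cj0.
have sR : 0 < s%:R :> algC by rewrite ltr0n.
have rho_small j : off_place i j -> `|rho j x| <= 4 * K%:R / s%:R ^+ di.
  move=> oj.
  have hv : `|v j a - v j b| < 1.
    apply: floor_eq_dist => //.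
    have /(congr1 val) /= := congr1 (fun f : {ffun {j | off_place i j} -> 'I_t.+1} => f (exist _ j oj)) Fab.
    rewrite !ffunE /= => /(congr1 Posz).
    have /andP[h1 _] := v_bnd j a; have /andP[h2 _] := v_bnd j b.
    by rewrite !gez0_abs ?real_floor_ge0.
  have tR : 0 < t%:R :> algC by rewrite ltr0n.
  have e1 : v j a - v j b = rho j x * (t%:R / A).
    by rewrite Dx rhoB /v; ring.
  move: hv; rewrite e1 normrM (gtr0_norm (divr_gt0 tR A0)) => hv.
  have : `|rho j x| <= A / t%:R.
    by rewrite -[X in _ <= X]mul1r -[X in _ <= _ * X]invf_div ler_pdivlMr ?divr_gt0 // ltW.
  move/le_trans; apply; rewrite ler_pdivrMr // mulrAC ler_pdivlMr ?exprn_gt0 //.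
  rewrite /A -natrX -!natrM ler_nat.
  have e2 : (s ^ d = s ^ di * H)%N by rewrite {1}Dd expnD.
  have le2 : (s ^ d <= 2 * t)%N by rewrite mul2n -addnn; move: s2d t1; lia.
  apply: (@leq_trans (2 * K * (s ^ d))); first by rewrite e2; lia.
  by apply: (@leq_trans (2 * K * (2 * t))); [rewrite leq_mul2l le2 orbT|lia].
have small j : off_place i j -> `|e j x| <= 8 * K%:R / s%:R ^+ di.
  move=> oj; have := rho_bound _ (proj1 Ox) (rho_small j oj) (rho_small _ (off_place_cc oj)).
  have -> : 2 * (4 * K%:R / s%:R ^+ di) = 8 * K%:R / s%:R ^+ di :> algC by rewrite !mulrA -natrM.
  by apply; rewrite divr_ge0 ?exprn_ge0 ?mulr_ge0 ?ler0n.
have big j : `|e j x| <= (H * K)%:R.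
  rewrite /x emb_int_comb natrM; apply: hK => // l.
  have ha := ltn_ord (a l); have hb := ltn_ord (b l).
  rewrite -intr_norm -abszE -pmulrn ler_nat /c; lia.
exists x; split => //.
  move=> j oj; apply: le_trans (small j oj) _; rewrite natrM.
  rewrite ler_wpM2l ?mulr_ge0 ?ler0n // lef_pV2 ?posrE ?exprn_gt0 //.
  by rewrite -natrX ler_nat -{1}(expn1 s) leq_pexp2l.
rewrite /nf_norm normr_prod (bigID (off_place i)) /=.
have cn : #|[pred j | ~~ off_place i j]| = di.
  by have := cardC (off_place i); rewrite card_ord => h; move: (etrans h Dd); rewrite addnC => /addIn.
apply: le_trans (_ : (8 * K%:R / s%:R ^+ di) ^+ Jn i * (H * K)%:R ^+ di <= _).
  apply: ler_pM.
  - by apply: prodr_ge0 => j _; exact: normr_ge0.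
  - by apply: prodr_ge0 => j _; exact: normr_ge0.
  - rewrite -prodr_const; apply: ler_prod => j oj; rewrite normr_ge0; exact: small.
  - rewrite -cn -prodr_const; apply: ler_prod => j oj; rewrite normr_ge0; exact: big.
have sn : s%:R ^+ (di * Jn i) != 0 :> algC by rewrite expf_neq0 // gt_eqF.
have -> : (8 * K%:R / s%:R ^+ di) ^+ Jn i * (H * K)%:R ^+ di =
    (8 * K)%:R ^+ Jn i * K%:R ^+ di :> algC.
  by rewrite !natrM expr_div_n !exprMn /H natrX -!exprM (mulnC (Jn i)); field.
have -> : ((8 * K) ^ d = (8 * K) ^ di * (8 * K) ^ Jn i)%N by rewrite -expnD; congr (_ ^ _)%N.
rewrite [X in _ <= X]natrM [X in _ <= X]mulrC ![((8 * K) ^ _)%N%:R]natrX ler_wpM2l ?exprn_ge0 ?ler0n //.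
by rewrite lerXn2r ?nnegrE ?ler0n // ler_nat leq_pmull.
Qed.

(** [small_elements] yields an infinite sequence of bounded norm whose absolute values away from the
    place of i strictly decrease. Two terms with the same absolute norm and the same residue modulo
    B! have a unit as quotient. *)
Lemma minkowski_unit i : exists2 u, nf_unit u & forall j, off_place i j -> `|e j u| < 1.
Proof.
have [K K0 hK] := small_elements.
pose B := ((8 * K) ^ d)%N.
have B0 : (0 < B)%N by rewrite expn_gt0 muln_gt0 K0.
pose good x := [/\ OM x, x != 0 & `|N x| <= B%:R].
have next x : good x -> exists y, good y /\ forall j, off_place i j -> `|e j y| < `|e j x|.
  move=> [Ox x0 _].
  have ex_pos j : 0 < `|e j x| by rewrite normr_gt0 fmorph_eq0.
  (* This exceeds 8 K / |e j x| for every j; the two successors also ensure 1 < s. *)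
  pose s := (\sum_j Num.bound ((8 * K)%:R / `|e j x|)).+2.
  have [y [Oy y0 hy Ny]] := hK i s isT.
  exists y; split => // j oj; apply: le_lt_trans (hy j oj) _.
  rewrite ltr_pdivrMr ?ltr0n // mulrC -ltr_pdivrMr //.
  apply: lt_le_trans (archi_boundP _) _; first by rewrite divr_ge0 ?ler0n // ltW.
  rewrite ler_nat /s (bigD1 j) //=; apply: leqW; apply: leqW; exact: leq_addr.
have [x0 hx0] : exists x, good x by have [x [h1 h2 _ h3]] := hK i 2%N isT; exists x.
pose st := {x | good x}.
have next' (x : st) : exists y : st, forall j, off_place i j -> `|e j (sval y)| < `|e j (sval x)|.
  by have [y [gy hy]] := next _ (svalP x); exists (exist _ y gy).
have [f hf] := choice next'.
pose g n := sval (iter n f (exist _ x0 hx0)).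
have gg n : good (g n) by exact: svalP.
have gdec m n j : (m < n)%N -> off_place i j -> `|e j (g n)| < `|e j (g m)|.
  move=> mn oj; elim: n mn => // n IH; rewrite ltnS leq_eqVlt => /orP[/eqP ->|/IH].
    exact: (hf _ _ oj).
  by apply: lt_trans; exact: (hf _ _ oj).
have [T [code hcode]] := modcode D (fact_gt0 B).
have nrm n : exists a : nat, `|N (g n)| = a%:R :> algC /\ (0 < a <= B)%N.
  have [Og g0 gB] := gg n; have /intrP [k Dk] := nf_norm_int D Og.
  exists `|k|%N; rewrite Dk -intr_norm pmulrn abszE; split => //.
  have k0 : k != 0 by rewrite -(intr_eq0 algC) -Dk nf_norm_neq0.
  by move: gB; rewrite absz_gt0 k0 Dk -intr_norm -abszE -pmulrn ler_nat.
have [a ha] := choice nrm.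
have [m [n [mn _ emn]]] := pigeon (fun n => (code (g n), inord (a n) : 'I_B.+1)).
have [] : a m = a n /\ code (g m) = code (g n).
  case: emn => h1 /(congr1 val) /=; rewrite !inordK ?ltnS //.
    by have [_ /andP[]] := ha n.
  by have [_ /andP[]] := ha m.
move=> eamn ecode.
have [Om m0 _] := gg m; have [On n0 _] := gg n.
have main k l : (a k = a l) -> code (g k) = code (g l) -> g l / g k \in Aint.
  move=> eakl ekl; have [Ok k0 _] := gg k; have [Ol l0 _] := gg l.
  have Aw := hcode _ _ Ol Ok (esym ekl).
  have [Na /andP[a0 aB]] := ha k.
  have adv : (a k %| B`!)%N by apply: dvdn_fact; rewrite a0.
  have bn : B`!%:R != 0 :> algC by rewrite pnatr_eq0 -lt0n fact_gt0.
  (* [g k] divides its norm, equal to [a k] up to sign, which divides B!; and B! divides the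
     difference g l - g k. *)
  have -> : g l / g k = 1 + (B`! %/ a k)%N%:R * ((a k)%:R / g k) * ((g l - g k) / B`!%:R).
    have : (B`!)%:R = (B`! %/ a k)%N%:R * (a k)%:R :> algC by rewrite -natrM divnK.
    move=> Db; rewrite mulrA -Db; field; by rewrite ?bn ?k0.
  rewrite rpredD ?rpred1 // rpredM // rpredM ?rpred_nat // -Na.
  have Nr : N (g k) \is Num.real by apply: Rreal_int; exact: nf_norm_int.
  have [s ->] : exists s : bool, `|N (g k)| = (-1) ^+ s * N (g k).
    have [h|h] := real_ge0P Nr; first by exists false; rewrite mul1r.
    by exists true; rewrite mulN1r.
  by rewrite -mulrA rpredM ?rpredX ?rpredN ?rpred1 ?nf_norm_div.
exists (g n / g m).
  split.
  - by apply: sf_div => //; [case: On|case: Om].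
  - exact: main.
  - by rewrite invf_div; exact: main.
  - by rewrite mulf_neq0 ?invr_eq0.
move=> j oj; rewrite fmorph_div normrM normfV ltr_pdivrMr ?mul1r ?gdec //.
by rewrite normr_gt0 fmorph_eq0.
Qed.

End Units.

(** * Archimedean places and a covering form of Dirichlet's unit theorem *)

Definition same_place (M : set algC) (s t : aut) : Prop :=
  (forall x, M x -> s x = t x) \/ (forall x, M x -> s x = (t x)^*).

Definition place_system (M : set algC) (I : finType) (t : I -> aut) : Prop :=
  (forall s, exists i, same_place M s (t i)) /\
  (forall i j, same_place M (t i) (t j) -> i = j).

Lemma same_place_norm M s t x : same_place M s t -> M x -> `|s x| = `|t x|.
Proof. by case=> h Mx; rewrite h // norm_conjC. Qed.

Lemma same_place_sym M s t : same_place M s t -> same_place M t s.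
Proof. by case=> h; [left|right] => x Mx; rewrite h // conjCK. Qed.

Lemma same_place_trans M t s u : same_place M s t -> same_place M t u -> same_place M s u.
Proof.
case=> h [] h'; [left|right|right|left] => x Mx; rewrite h // ?h' //.
by rewrite conjCK.
Qed.

Lemma place_exists (M : set algC) : nf_data M ->
  exists (I : finType) (t : I -> aut), place_system M t.
Proof.
move=> D; exists {i : 'I_(nf_d D) | (i <= cc i)%N}, (fun i => @nf_e M D (val i)); split.
  move=> s; have [i hi] := nf_surj D s.
  have [le|lt] := leqP i (cc i).
    by exists (Sub i le); left.
  have le : (cc i <= cc (cc i))%N by rewrite ccK ltnW.
  by exists (Sub (cc i) le); right => x Mx; rewrite ccE // conjCK hi.
move=> [i hi] [j hj] [] /= h; apply: val_inj => /=; first exact: nf_emb_inj.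
have e : i = cc j by apply: nf_emb_inj => x Mx; rewrite h // ccE.
by apply: val_inj; apply/eqP; rewrite eqn_leq {1}e in hi *; rewrite e ccK in hi *; rewrite hi hj.
Qed.

Lemma geom_small (a q : algC) : 0 <= a -> 0 <= q < 1 -> exists n, a * q ^+ n < 1.
Proof.
move=> a0 /andP[q0 q1].
have [->|qn] := eqVneq q 0; first by exists 1%N; rewrite expr1 mulr0.
have qp : 0 < q by rewrite lt0r qn.
set h := q^-1 - 1; have hp : 0 < h by rewrite subr_gt0 invf_gt1.
have hB n : 1 + h *+ n <= q^-1 ^+ n.
  elim: n => [|n IH]; first by rewrite mulr0n addr0 expr0.
  have qE : q^-1 = 1 + h by rewrite /h addrC subrK.
  rewrite qE in IH *; rewrite exprSr; apply: (@le_trans _ _ ((1 + h *+ n) * (1 + h))).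
    have -> : (1 + h *+ n) * (1 + h) = (1 + h *+ n.+1) + h *+ n * h by rewrite mulrSr; ring.
    by rewrite lerDl mulr_ge0 ?mulrn_wge0 // ltW.
  by rewrite ler_wpM2r // addr_ge0 ?ler01 // ltW.
have := archi_boundP (divr_ge0 a0 (ltW hp)); set n := Num.bound _ => hn.
exists n; rewrite -(invrK q) exprVn ltr_pdivrMr ?mul1r; last by rewrite exprn_gt0 ?invr_gt0.
apply: lt_le_trans (hB n); apply: (@lt_trans _ _ (h *+ n)); last by rewrite ltrDr ltr01.
by rewrite -mulr_natr -ltr_pdivrMl // mulrC.
Qed.

(** The bound r = 1 - prod (1 - q i) requires no comparison of the q i with each other. *)
Lemma sub1_prod_bound (I : finType) (q : I -> algC) (Q : pred I) : (forall i, Q i -> 0 <= q i < 1) ->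
  exists2 r, 0 <= r < 1 & forall i, Q i -> q i <= r.
Proof.
move=> hq; exists (1 - \prod_(i | Q i) (1 - q i)).
  rewrite subr_ge0 ltrBlDr ltrDl; apply/andP; split.
    by apply: prodr_ile1 => i /hq /andP[q0 q1]; rewrite subr_ge0 ltW //= lerBlDr lerDl.
  by apply: prodr_gt0 => i /hq /andP[_ q1]; rewrite subr_gt0.
move=> i Qi; rewrite lerBrDr -lerBrDl (bigD1 i) //= -[leRHS]mulr1 ler_wpM2l //.
  by rewrite subr_ge0 ltW //; case/andP: (hq i Qi).
by apply: prodr_ile1 => j /andP[/hq /andP[q0 q1] _]; rewrite subr_ge0 ltW //= lerBlDr lerDl.
Qed.

Lemma pos_leVlt (x y : algC) : 0 <= x -> 0 <= y -> x <= y \/ y < x.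
Proof. by move=> x0 y0; case: (real_leP (ger0_real x0) (ger0_real y0)); [left|right]. Qed.

(** For x > 0 this is max(x, 1/x), which takes the same value at x and at its inverse. *)
Definition mx1 (x : algC) : algC := if 1 <= x then x else x^-1.

Lemma mx1_ge1 (x : algC) : 0 < x -> 1 <= mx1 x.
Proof.
rewrite /mx1 => x0; case: ifP => // /negbT h.
by rewrite invf_ge1 //; have [h'|/ltW] := pos_leVlt ler01 (ltW x0); first by rewrite h' in h.
Qed.

Lemma mx1_le (x c : algC) : 0 < x -> x <= c -> x^-1 <= c -> mx1 x <= c.
Proof. by rewrite /mx1; case: ifP. Qed.

Lemma inv_le_self (x : algC) : 1 <= x -> x^-1 <= x.
Proof.
move=> h; have x0 : 0 < x := lt_le_trans ltr01 h.
have h' : x^-1 <= 1 by rewrite invf_le1.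
exact: le_trans h' h.
Qed.

Lemma mx1_geV (x : algC) : 0 < x -> x <= mx1 x /\ x^-1 <= mx1 x.
Proof.
move=> x0; rewrite /mx1; case: ifP => [h|/negbT h]; split=> //.
  exact: inv_le_self.
have {}h : x <= 1 by have [h'|/ltW //] := pos_leVlt ler01 (ltW x0); rewrite h' in h.
by apply: (le_trans h); rewrite invf_ge1.
Qed.

Lemma mx1M (a x : algC) : 1 <= a -> 0 < x -> mx1 (a * x) <= a * mx1 x.
Proof.
move=> a1 x0; have a0 : 0 < a by apply: lt_le_trans a1; rewrite ltr01.
have [h1 h2] := mx1_geV x0.
apply: mx1_le; first exact: mulr_gt0.
  by rewrite ler_wpM2l // ltW.
rewrite invfM; apply: ler_pM; rewrite ?invr_ge0 ?(ltW a0) ?(ltW x0) //.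
exact: inv_le_self.
Qed.

Lemma mx1V (x : algC) : 0 < x -> mx1 x^-1 = mx1 x.
Proof.
move=> x0; apply/eqP; rewrite eq_le.
have x0' : 0 < x^-1 by rewrite invr_gt0.
have [h1 h2] := mx1_geV x0; have [h3 h4] := mx1_geV x0'; rewrite invrK in h4.
by rewrite !mx1_le // invrK.
Qed.

Lemma expz_ge1 (x : algC) (n : int) : 0 < x -> (1 <= x /\ 0 <= n) \/ (x <= 1 /\ n <= 0) -> 1 <= x ^ n.
Proof.
case: n => n x0 [] [h hn] //; first by rewrite -exprnP exprn_ege1.
  by move: hn; case: n => // _; rewrite expr0z.
by rewrite NegzE -exprnN invf_ge1 ?exprn_gt0 // exprn_ile1 // ltW.
Qed.

Lemma normXz (x : algC) (n : int) : `|x ^ n| = `|x| ^ n.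
Proof. by case: n => n; rewrite ?NegzE -?exprnP -?exprnN ?normfV normrX. Qed.

Section Covering.
Variables (M : set algC) (D : nf_data M) (I : finType) (t : I -> aut).
Hypothesis tP : place_system M t.
Let sM := nf_sub D.
Local Notation e := (@nf_e M D).

Lemma place_of_ex (j : 'I_(nf_d D)) : exists i, same_place M (e j) (t i).
Proof. by case: tP => h _; exact: h. Qed.
Definition place_of j := projT1 (cid (place_of_ex j)).
Lemma place_ofP j : same_place M (e j) (t (place_of j)).
Proof. exact: (projT2 (cid (place_of_ex j))). Qed.

Lemma place_inh : exists i : I, True.
Proof. by have [j _] := nf_id D; exists (place_of j). Qed.

Lemma mink_places : exists2 u : I -> algC, (forall i, nf_unit M (u i)) &
  forall i j, j != i -> `|t j (u i)| < 1.
Proof.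
suff h i : exists u, nf_unit M u /\ forall j, j != i -> `|t j u| < 1.
  by have [u hu] := choice h; exists u => [i|i j]; case: (hu i) => // _; exact.
have [a ha] := nf_surj D (t i); have [u uu hu] := minkowski_unit a; exists u; split=> // j ji.
have [b hb] := nf_surj D (t j); have Mu : M u by case: uu.
rewrite hb //; apply: hu; rewrite /off_place /=; apply/andP; split; apply: contra ji => /eqP eb; apply/eqP.
  by case: tP => _ /(_ j i); apply; left => x Mx; rewrite hb // eb ha.
by case: tP => _ /(_ j i); apply; right => x Mx; rewrite hb // eb ccE // ha.
Qed.

(** The local degree: 1 at a real place and 2 at a complex one. *)
Definition place_deg i := #|[pred j | place_of j == i]|.

Lemma place_deg_gt0 i : (0 < place_deg i)%N.
Proof.
have [j hj] := nf_surj D (t i); apply/card_gt0P; exists j; rewrite inE; apply/eqP.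
case: tP => _ h; apply: h; apply: same_place_sym; apply: same_place_trans (place_ofP j); left => x Mx.
by rewrite hj.
Qed.

Lemma place_prod u : nf_unit M u -> \prod_i `|t i u| ^+ place_deg i = 1.
Proof.
move=> uu; rewrite -[RHS](nf_unit_norm D uu) [RHS](partition_big place_of xpredT) //=.
apply: eq_bigr => i _; rewrite -[RHS]/(\prod_(j | place_of j == i) _).
rewrite (eq_bigr (fun=> `|t i u|)) ?prodr_const // => j /eqP <-.
by case: uu => Mu *; exact: same_place_norm (place_ofP j) Mu.
Qed.

Variables (u : I -> algC).
Hypotheses (uu : forall i, nf_unit M (u i)) (u_lt : forall i j, j != i -> `|t j (u i)| < 1).

Definition uprod (m : I -> int) : algC := \prod_i u i ^ m i.

Lemma uprod_unit m : nf_unit M (uprod m).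
Proof. by apply: (nf_unit_prod D) => i _; exact: (nf_unit_exp D). Qed.

Lemma u_neq0 i : u i != 0. Proof. by case: (uu i). Qed.

Lemma uprodD m n : uprod (fun i => m i + n i) = uprod m * uprod n.
Proof. by rewrite -big_split /=; apply: eq_bigr => i _; rewrite expfzDr ?u_neq0. Qed.

Lemma uprod0 : uprod (fun=> 0) = 1.
Proof. by rewrite /uprod big1 // => i _; rewrite expr0z. Qed.

Lemma uprodMz m n : uprod (fun i => m i * n) = uprod m ^ n.
Proof.
rewrite /uprod; apply: (big_ind2 (fun x y => x = y ^ n)).
- by rewrite exp1rz.
- by move=> a b c d -> ->; rewrite expfzMl.
- by move=> i _; rewrite exprz_exp.
Qed.

Lemma uprod_delta i n : uprod (fun j => if j == i then n else 0) = u i ^ n.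
Proof.
rewrite /uprod (bigD1 i) //= eqxx big1 ?mulr1 // => j /negPf ->; exact: expr0z.
Qed.

(* If not all, but some, n_i are positive, the product over the places with n_i > 0
   of the absolute values of [uprod n] is > 1 by the product formula. *)
Lemma sign_lemma_pos (n : I -> int) : (forall i, `|t i (uprod n)| = 1) ->
  (exists i, 0 < n i) -> forall i, 0 < n i.
Proof.
move=> h1 [i0 hi0] i1; pose dd := place_deg.
case: ltP => // hi1; exfalso.
pose S i := 0 < n i.
have n0 i j : 0 < `|t i (u j)| by rewrite normr_gt0 fmorph_eq0 u_neq0.
pose W j := \prod_(i | S i) `|t i (u j)| ^+ dd i.
have W0 j : 0 < W j by apply: prodr_gt0 => i _; rewrite exprn_gt0.
have e1 : \prod_j W j ^ n j = 1.
  have : \prod_(i | S i) `|t i (uprod n)| ^+ dd i = 1.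
    by apply: big1 => i _; rewrite h1 expr1n.
  rewrite /uprod => h; rewrite -[RHS]h.
  under [RHS]eq_bigr => i _ do rewrite rmorph_prod normr_prod -prodrXl.
  rewrite exchange_big /=; apply: eq_bigr => j _.
  rewrite /W; set E := n j; clearbody E.
  apply: (big_ind2 (fun x y : algC => x ^ E = y)); first by rewrite exp1rz.
    by move=> a b c d <- <-; rewrite expfzMl.
  by move=> i Si; rewrite fmorphXz normXz !exprnP !exprz_exp mulrC.

have Wle j : ~~ S j -> W j <= 1.
  move=> Sj; apply: prodr_ile1 => i Si; rewrite exprn_ge0 //= exprn_ile1 // ltW // u_lt //.
  by apply: contra Sj => /eqP <-.
have Wgt j : S j -> 1 < W j.
  move=> Sj; have := place_prod (uu j); rewrite (bigID S) /= -/(W j) => hW.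
  have h2 : \prod_(i | ~~ S i) `|t i (u j)| ^+ dd i < 1.
    have lt i : ~~ S i -> `|t i (u j)| < 1 by move=> Si; apply: u_lt; apply: contra Si => /eqP ->.
    have Si1 : ~~ S i1 by rewrite /S -leNgt.
    rewrite (bigD1 i1) //=; apply: (@le_lt_trans _ _ (`|t i1 (u j)| ^+ dd i1)).
      rewrite -[leRHS]mulr1 ler_wpM2l ?exprn_ge0 //; apply: prodr_ile1 => i /andP[Si _].
      by rewrite exprn_ge0 //= exprn_ile1 // ltW // lt.
    by rewrite exprn_ilt1 ?lt // -lt0n place_deg_gt0.
  have h3 : 0 < \prod_(i | ~~ S i) `|t i (u j)| ^+ dd i by apply: prodr_gt0 => i _; rewrite exprn_gt0.
  by rewrite -(ltr_pM2r h3) hW mul1r.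
have : 1 < \prod_j W j ^ n j; last by rewrite e1 ltxx.
rewrite (bigD1 i0) //=; apply: (@lt_le_trans _ _ (W i0 ^ n i0)).
  by move: hi0 (Wgt _ hi0); case: (n i0) => // -[//|m] _ W1; rewrite -exprnP exprn_egt1.
rewrite -[leLHS]mulr1 ler_wpM2l ?exprz_ge0 ?(ltW (W0 _)) //.
apply: (big_ind (fun y => 1 <= y)) => [//|x y x1 y1|i _]; first by rewrite mulr_ege1.
have [Si|Si] := boolP (S i); apply: expz_ge1 => //; first by left; split; apply: ltW => //; exact: Wgt.
by right; split; [exact: Wle | rewrite leNgt].
Qed.

(** The positive case is applied to n and to -n. The result stands in for the independence of all
    but one of the u i: a relation whose exponents do not all have the same strict sign is
    trivial. *)
Lemma sign_lemma (n : I -> int) : (forall i, `|t i (uprod n)| = 1) ->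
  [\/ forall i, 0 < n i, forall i, n i < 0 | forall i, n i = 0].
Proof.
move=> h; have h' i : `|t i (uprod (fun i => n i * -1))| = 1.
  by rewrite uprodMz fmorphXz normXz h exp1rz.
have [/sign_lemma_pos|np] := pselect (exists i, 0 < n i); first by move=> /(_ h) ?; constructor 1.
have [|nn] := pselect (exists i, 0 < n i * -1).
  move=> /(sign_lemma_pos h') hn; constructor 2 => i.
  by have := hn i; rewrite mulrN1 oppr_gt0.
constructor 3 => i; apply/eqP; rewrite eq_le !leNgt; apply/andP; split; apply/negP => hi.
  by apply: np; exists i.
by apply: nn; exists i; rewrite mulrN1 oppr_gt0.
Qed.

Lemma off_prod_lt1 i0 w : i0 != w -> \prod_(j | j != w) `|t j (u w)| ^+ place_deg j < 1.
Proof.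
move=> iw; rewrite (bigD1 i0) //=; apply: (@le_lt_trans _ _ (`|t i0 (u w)| ^+ place_deg i0)).
  rewrite -[leRHS]mulr1 ler_wpM2l ?exprn_ge0 //; apply: prodr_ile1 => i /andP[iw' _].
  by rewrite exprn_ge0 //= exprn_ile1 // ltW // u_lt.
by rewrite exprn_ilt1 ?u_lt // -lt0n place_deg_gt0.
Qed.

(* Away from i0, multiplying by u_w or its inverse strictly decreases the product of the
   max(|x|_j, 1/|x|_j) as long as |x|_w lies outside [1/|u_w|_w, |u_w|_w]. *)
Lemma unit_covering (i0 : I) : exists (T : finType) (c : algC -> T) (m : algC -> I -> int),
  (forall x, m x i0 = 0) /\
  forall x y, nf_unit M x -> nf_unit M y -> c x = c y -> x * uprod (m x) = y * uprod (m y).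
Proof.
pose dd := place_deg.
have n0 i x : nf_unit M x -> 0 < `|t i x| by case=> *; rewrite normr_gt0 fmorph_eq0.
have cmp := pos_leVlt.
pose b w := `|t w (u w)|.
have b0 w : 0 < b w by apply: n0.
pose red x := forall w, w != i0 -> `|t w x| <= b w /\ `|t w x|^-1 <= b w.
pose Phi x := \prod_(j | j != i0) mx1 `|t j x| ^+ dd j.
have Phi1 x : nf_unit M x -> 1 <= Phi x.
  move=> ux; apply: (big_ind (fun y => 1 <= y)) => [//|y z y1 z1|j _]; first by rewrite mulr_ege1.
  by rewrite exprn_ege1 // mx1_ge1 // n0.
have PhiV x : nf_unit M x -> Phi x^-1 = Phi x.
  by move=> ux; apply: eq_bigr => j _; rewrite fmorphV normfV mx1V // n0.
(* One contraction factor for all w: a single reduction step multiplies [Phi] by at most [r]. *)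
have [r r01 hr] : exists2 r : algC, 0 <= r < 1 & forall w, w != i0 -> `|t i0 (u w)| ^+ dd i0 <= r.
  apply: sub1_prod_bound => w wi; rewrite exprn_ge0 //= exprn_ilt1 ?u_lt // -?lt0n ?place_deg_gt0 //.
  by rewrite eq_sym.
have bprod w : w != i0 -> `|t i0 (u w)| ^+ dd i0 * \prod_(j | j != i0) `|t j (u w)| ^+ dd j = 1.
  by move=> wi; rewrite -[RHS](place_prod (uu w)) [RHS](bigD1 i0).
have b1 w : w != i0 -> 1 <= b w.
  move=> wi; have [h|/ltW //] := cmp (b w) 1 (ltW (b0 w)) ler01.
  have iw : i0 != w by rewrite eq_sym.
  have := off_prod_lt1 iw; rewrite -[ltLHS]mul1r => hlt.
  have := place_prod (uu w); rewrite (bigD1 w) //= => e1; move: hlt.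
  rewrite -[X in _ < X]e1 ltr_pM2r; last by apply: prodr_gt0 => j _; rewrite exprn_gt0 // n0.
  move=> /lt_le_trans /(_ (exprn_ile1 _ (ltW (b0 w)) h)); by rewrite ltxx.
have step x w : nf_unit M x -> w != i0 -> b w < `|t w x| -> Phi (x / u w) <= Phi x * r.
  move=> ux wi hw; apply: (@le_trans _ _ (\prod_(j | j != i0) (mx1 `|t j x| / `|t j (u w)|) ^+ dd j)).
    apply: ler_prod => j ji; rewrite exprn_ge0 /=; last first.
      by rewrite (le_trans ler01) // mx1_ge1 // n0 //; apply: (nf_unitM D) => //; exact: (nf_unitV D).
    rewrite lerXn2r ?nnegrE ?divr_ge0 ?(le_trans ler01 (mx1_ge1 _)) ?n0 //.
      by apply: (nf_unitM D) => //; exact: (nf_unitV D).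
    rewrite rmorphM fmorphV normrM normfV; have [->|jw] := eqVneq j w.
      rewrite -/(b w) /mx1 [X in _ <= X / _]ifT; last by apply: le_trans (ltW hw); exact: b1.
      by rewrite ifT // ler_pdivlMr // mul1r ltW.
    rewrite mulrC [leRHS]mulrC; apply: mx1M; last exact: n0.
    by rewrite invf_ge1 ?n0 // ltW // u_lt.
  under eq_bigr => j _ do rewrite expr_div_n.
  rewrite big_split /= -/(Phi x) ler_wpM2l ?(le_trans ler01 (Phi1 _ ux)) //.
  have hb := bprod w wi.
  rewrite prodfV; set Q := \prod_(_ | _) _ in hb *.
  have Q0 : Q != 0 by apply: contra_eqN hb => /eqP ->; rewrite mulr0 eq_sym oner_eq0.
  by rewrite -[Q^-1]mul1r -hb mulfK // hr.
(* [n] is the fuel: [Phi] is at least 1 on units, so [Phi x * r ^+ n < 1] cannot survive n reduction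
   steps. *)
have reach n x : nf_unit M x -> Phi x * r ^+ n < 1 ->
    exists m : I -> int, m i0 = 0 /\ red (x * uprod m).
  elim: n x => [|n IH] x ux.
    by rewrite expr0 mulr1 => h; have := lt_le_trans h (Phi1 _ ux); rewrite ltxx.
  move=> h; have [hred|] := pselect (red x).
    by exists (fun=> 0); rewrite uprod0 mulr1.
  move=> /existsNP [w] /not_implyP [wi /not_andP hw].
  have rn0 : 0 <= r ^+ n by case/andP: r01 => *; rewrite exprn_ge0.
  case: hw => hw.
    have [//|hlt] := cmp _ _ (normr_ge0 (t w x)) (ltW (b0 w)).
    have ux' : nf_unit M (x / u w) by apply: (nf_unitM D) => //; exact: (nf_unitV D).
    have [|m [m0 hm]] := IH _ ux'.
      by apply: le_lt_trans h; rewrite exprS mulrA ler_wpM2r // step.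
    exists (fun i => (if i == w then -1 else 0) + m i); split.
      by rewrite m0 eq_sym (negPf wi).
    by rewrite uprodD uprod_delta mulrA.
  have [//|hlt] : `|t w x|^-1 <= b w \/ b w < `|t w x|^-1 by apply: cmp; rewrite ?invr_ge0 // ltW.
  have uxV := nf_unitV D ux.
  have ux' : nf_unit M (x * u w) by exact: (nf_unitM D).
  have [|m [m0 hm]] := IH _ ux'.
    apply: le_lt_trans h; rewrite exprS mulrA ler_wpM2r // -PhiV // -(PhiV _ ux) invfM.
    by apply: step => //; rewrite fmorphV normfV.
  exists (fun i => (if i == w then 1 else 0) + m i); split.
    by rewrite m0 eq_sym (negPf wi).
  by rewrite uprodD uprod_delta mulrA.
have reach' x : exists m : I -> int, m i0 = 0 /\ (nf_unit M x -> red (x * uprod m)).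
  have [ux|nux] := pselect (nf_unit M x); last by exists (fun=> 0).
  have [|n hn] := @geom_small (Phi x) r _ r01; first by apply: le_trans ler01 (Phi1 _ ux).
  by have [m [m0 hm]] := reach n x ux hn; exists m.
have [m hm] := choice reach'.
(* At i0 itself the product formula bounds a reduced unit by the inverses of its values elsewhere,
   which are at most the [b w]. *)
pose B0 := \prod_(w | w != i0) b w ^+ dd w.
have B00 : 0 <= B0 by apply: prodr_ge0 => w _; rewrite exprn_ge0 // ltW.
pose B := \sum_w b w + (1 + B0).
have redB x i : nf_unit M x -> red x -> `|t i x| <= B.
  move=> ux hx; have [->|ii] := eqVneq i i0; last first.
    apply: (@le_trans _ _ (b i)); first by case: (hx _ ii).
    rewrite /B (bigD1 i) //= -addrA lerDl addr_ge0 ?addr_ge0 // sumr_ge0 // => w _; exact: ltW.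
  apply: (@le_trans _ _ (1 + B0)); last by rewrite lerDr sumr_ge0 // => w _; exact: ltW.
  have [h|h] := cmp _ _ (normr_ge0 (t i0 x)) ler01; first by rewrite (le_trans h) // lerDl.
  apply: (@le_trans _ _ B0); last by rewrite lerDr ler01.
  apply: (@le_trans _ _ (`|t i0 x| ^+ dd i0)).
    by rewrite -[leLHS]expr1 ler_weXn2l ?place_deg_gt0 // ltW.
  have := place_prod ux; rewrite (bigD1 i0) //=; set Q := \prod_(_ | _) _ => hQ.
  have Q0 : Q != 0 by apply: contra_eqN hQ => /eqP ->; rewrite mulr0 eq_sym oner_eq0.
  have -> : `|t i0 x| ^+ dd i0 = Q^-1 by apply: (mulIf Q0); rewrite hQ mulVf.
  rewrite /Q -prodfV; apply: ler_prod => w wi; rewrite invr_ge0 exprn_ge0 //= -exprVn.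
  by rewrite lerXn2r ?nnegrE ?invr_ge0 // ?(ltW (b0 w)) //; case: (hx _ wi).
have [T [c hc]] := northcott D B.
exists T, (fun x => c (x * uprod (m x))), m; split=> [x|x y ux uy hxy]; first by case: (hm x).
have [uxm uym] := (nf_unitM D ux (uprod_unit (m x)), nf_unitM D uy (uprod_unit (m y))).
apply: hc => //; first by case: uxm.
- by case: uym.
- move=> i; have [j <-] : exists j, `|t j (x * uprod (m x))| = `|e i (x * uprod (m x))|.
    by exists (place_of i); rewrite -(same_place_norm (place_ofP i)) //; case: uxm.
  by apply: redB => //; case: (hm x) => _; exact.
- move=> i; have [j <-] : exists j, `|t j (y * uprod (m y))| = `|e i (y * uprod (m y))|.
    by exists (place_of i); rewrite -(same_place_norm (place_ofP i)) //; case: uym.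
  by apply: redB => //; case: (hm y) => _; exact.
Qed.
End Covering.

(** * Cyclic unramified extensions and unramified characters *)

(** If all these sums vanished, so would the sum of the c i q(z i) for every polynomial q, in
    particular for the one vanishing at every z i except z i0. *)
Lemma char_indep n (z c : 'I_n -> algC) i0 : injective z -> c i0 != 0 ->
  exists l, \sum_i c i * z i ^+ l != 0.
Proof.
move=> zi ci; apply: contrapT => /forallNP h.
have h' l : \sum_i c i * z i ^+ l = 0 by apply: contrapT => /eqP /h.
pose q := \prod_(i | i != i0) ('X - (z i)%:P).
have : \sum_i c i * q.[z i] = 0.
  rewrite (eq_bigr (fun i => \sum_(l < size q) q`_l * (c i * z i ^+ l))).
    by rewrite exchange_big big1 //= => l _; rewrite -mulr_sumr h' mulr0.
  by move=> i _; rewrite horner_coef mulr_sumr; apply: eq_bigr => l _; rewrite mulrCA.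
rewrite (bigD1 i0) //= big1 ?addr0; last first.
  move=> i ii0; rewrite /q horner_prod (bigD1 i) //= hornerXsubC subrr mul0r mulr0 //.
move/eqP; rewrite mulf_eq0 (negPf ci) /= /q horner_prod => /prodf_eq0 [i ii0].
by rewrite hornerXsubC subr_eq0 (inj_eq zi) eq_sym (negPf ii0).
Qed.

(* M/F is a cyclic extension of degree N, unramified at all places, and its Galois
   group is generated by the restriction of s. *)
Record cyc (F M : set algC) (s : aut) (N : nat) : Prop := Cyc {
  cyc_N : (0 < N)%N;
  cyc_subF : subfield F;
  cyc_FM : forall x, F x -> M x;
  cyc_s : fixes F s;
  cyc_stab : forall x, M x -> M (s x);
  cyc_gal : forall a : aut, fixes F a -> exists2 k, (k < N)%N & forall x, M x -> a x = (s ^+ k)%g x;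
  cyc_pow : forall x, M x -> (s ^+ N)%g x = x;
  cyc_sep : forall k, (0 < k < N)%N -> exists2 x, M x & (s ^+ k)%g x != x;
  cyc_fin : forall P k, prime_of [set: algC]%classic P -> (0 < k < N)%N ->
    ~ forall y, M y -> y \in Aint -> P ((s ^+ k)%g y - y);
  cyc_arch : forall (tau : aut) k, (0 < k < N)%N ->
    ~ forall x, M x -> tau ((s ^+ k)%g x) = (tau x)^*
}.

Lemma aut_Aint (s : aut) x : x \in Aint -> s x \in Aint.
Proof. by move=> h; exact: (zb_int (zb_aut s (MkZb h))). Qed.

(** The contraction to F of the ideal generated by a in the ring of all algebraic integers.
    [gen_contr] says that extending it back recovers a, so that the ideal of a comes from F. *)
Definition contr (F : set algC) (a : algC) : set algC :=
  [set x | [/\ F x, x \in Aint & x / a \in Aint]]%classic.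

Definition gen_contr (F : set algC) (a : algC) : Prop := exists l : seq (algC * algC),
  (forall u, u \in l -> u.1 \in Aint /\ contr F a u.2) /\ a = \sum_(u <- l) u.1 * u.2.

Lemma gen_class F a a' c : gen_contr F a -> gen_contr F a' -> c != 0 ->
  (forall x, contr F a' x <-> contr F a (x / c)) ->
  a' / (c * a) \in Aint /\ (a' / (c * a))^-1 \in Aint.
Proof.
move=> ga ga' c0 h; split.
- have [l [l1 ->]] := ga'; rewrite mulr_suml big_seq rpred_sum // => u /l1 [u1 /h [_ _ u2]].
  by rewrite -mulrA rpredM // invfM mulrA.
- have [l [l1 e]] := ga; rewrite invf_div {1}e mulr_sumr mulr_suml big_seq rpred_sum // => u /l1 [u1 u2].
  have [_ _ h3] : contr F a' (u.2 * c) by apply/h; rewrite mulfK.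
  by rewrite mulrCA -!mulrA rpredM // mulrA (mulrC c).
Qed.

Section Cyclic.
Variables (F M : set algC) (D : nf_data M) (s : aut) (N : nat).
Hypothesis hc : cyc F M s N.
Let sM := nf_sub D.
Let OM x := M x /\ x \in Aint.
Local Notation sg k := ((s ^+ k)%g : aut).

Lemma sgS k x : sg k.+1 x = s (sg k x). Proof. by rewrite expgS. Qed.
Lemma sgSr k x : sg k.+1 x = sg k (s x). Proof. by rewrite expgSr. Qed.
Lemma sgD k l x : sg (k + l) x = sg k (sg l x). Proof. by rewrite expgD. Qed.
Lemma sg0 x : sg 0 x = x. Proof. by []. Qed.

Lemma sg_stab k x : M x -> M (sg k x).
Proof. by elim: k => [//|k IH] Mx; rewrite sgS; apply: (cyc_stab hc); exact: IH. Qed.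

Lemma sg_fix k x : F x -> sg k x = x.
Proof. by move=> Fx; elim: k => [//|k IH]; rewrite sgS IH (cyc_s hc). Qed.

Lemma sg_mod k x : M x -> sg (k %% N) x = sg k x.
Proof.
move=> Mx; rewrite {2}(divn_eq k N) addnC sgD; congr (sg _ _).
elim: (k %/ N)%N => [//|q IH]; rewrite mulSn sgD -IH (cyc_pow hc) //.
Qed.

Lemma cyc_fixed x : M x -> s x = x -> F x.
Proof.
move=> Mx sx; apply: subfield_fix (cyc_subF hc) _ => a Fa.
have [k _ ->] := cyc_gal hc Fa => //.
by elim: k => [//|k IH]; rewrite sgS IH.
Qed.

Lemma sg_inj z : M z -> (forall s t : aut, s z = t z -> forall x, M x -> s x = t x) ->
  forall i j, (i < N)%N -> (j < N)%N -> sg i z = sg j z -> i = j.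
Proof.
move=> Mz hz; suff h i j : (i < j)%N -> (j < N)%N -> sg i z <> sg j z.
  by move=> i j iN jN e; case: (ltngtP i j) => // /h ; [move/(_ jN e) | move/(_ iN (esym e))].
move=> ij jN e; have k0 : (0 < j - i < N)%N by lia.
have [x Mx /eqP []] := cyc_sep hc k0.
apply: (hz (sg (j - i)) 1%g _ x Mx).
by apply: (can_inj (autKV (sg i))); rewrite -sgD aut1 subnKC // ltnW.
Qed.

Definition cyc_norm x := \prod_(k < N) sg k x.
Definition cyc_tr x := \sum_(k < N) sg k x.

Lemma sum_sg_shift (op : Monoid.com_law (0 : algC)) x : M x ->
  \big[op/0]_(k < N) sg k.+1 x = \big[op/0]_(k < N) sg k x.
Proof.
move=> Mx; rewrite -(big_mkord xpredT (fun k => sg k.+1 x)) -(big_mkord xpredT (fun k => sg k x)).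
case: N (cyc_N hc) (cyc_pow hc) => // n _ hp.
by rewrite big_nat_recr //= big_nat_recl //= hp // Monoid.mulmC.
Qed.

Lemma cyc_tr_F x : M x -> F (cyc_tr x).
Proof.
move=> Mx; apply: cyc_fixed; first by apply: (sf_sum sM) => i _; exact: sg_stab.
rewrite /cyc_tr rmorph_sum -[RHS](sum_sg_shift _ Mx); apply: eq_bigr => k _.
by rewrite sgS.
Qed.

Lemma cyc_norm_s x : M x -> s (cyc_norm x) = cyc_norm x.
Proof.
move=> Mx; rewrite /cyc_norm rmorph_prod.
rewrite (eq_bigr (fun k : 'I_N => sg k.+1 x)); last by move=> k _; rewrite sgS.
rewrite -(big_mkord xpredT (fun k => sg k.+1 x)) -(big_mkord xpredT (fun k => sg k x)).
case: N (cyc_N hc) (cyc_pow hc) => // n _ hp.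
by rewrite big_nat_recr //= big_nat_recl //= hp // mulrC.
Qed.

Lemma cyc_norm_F x : M x -> F (cyc_norm x).
Proof.
move=> Mx; apply: cyc_fixed; last exact: cyc_norm_s.
by apply: (sf_prod sM) => i _; exact: sg_stab.
Qed.

Lemma cyc_normM x y : cyc_norm (x * y) = cyc_norm x * cyc_norm y.
Proof. by rewrite -big_split; apply: eq_bigr => k _; rewrite rmorphM. Qed.
Lemma cyc_normV x : cyc_norm x^-1 = (cyc_norm x)^-1.
Proof. by rewrite -prodfV; apply: eq_bigr => k _; rewrite fmorphV. Qed.

Definition cphi x := s x / x.
Lemma cphiM x y : cphi (x * y) = cphi x * cphi y.
Proof. by rewrite /cphi rmorphM invfM mulrACA. Qed.
Lemma cphiV x : cphi x^-1 = (cphi x)^-1.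
Proof. by rewrite /cphi fmorphV invfM invrK. Qed.
Lemma cphi1 : cphi 1 = 1. Proof. by rewrite /cphi rmorph1 divr1. Qed.
Lemma cphi_F x : F x -> x != 0 -> cphi x = 1.
Proof. by move=> Fx x0; rewrite /cphi (cyc_s hc) // divff. Qed.

Lemma cyc_norm_phi x : M x -> x != 0 -> cyc_norm (cphi x) = 1.
Proof.
move=> Mx x0; rewrite /cphi cyc_normM cyc_normV.
have n0 : cyc_norm x != 0 by apply/prodf_neq0 => k _; rewrite fmorph_eq0.
suff -> : cyc_norm (s x) = cyc_norm x by rewrite divff.
rewrite -[RHS]cyc_norm_s // /cyc_norm rmorph_prod; apply: eq_bigr => k _.
by rewrite -sgSr sgS.
Qed.

(** The Lagrange resolvent b of z^l, nonzero for a suitable l by independence of characters,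
    satisfies u (s b) = b. Its inverse, multiplied by a natural number to become integral, is the
    required element. *)
Lemma hilbert90 u : M u -> cyc_norm u = 1 -> exists a, [/\ M a, a \in Aint, a != 0 & u = cphi a].
Proof.
move=> Mu nu; pose c (i : nat) := \prod_(j < i) sg j u.
have u0 : u != 0.
  apply/eqP => u0; move: nu; rewrite /cyc_norm u0 (bigD1 (Ordinal (cyc_N hc))) //= ?raddf0 mul0r.
  by move/eqP; rewrite eq_sym oner_eq0.
pose z := nf_z D; have Mz : M z := nf_zM D.
have zi : injective (fun i : 'I_N => sg i z).
  by move=> i j /= /(sg_inj Mz (@nf_agree M D)) h; apply: val_inj; exact: h.
pose i0 := Ordinal (cyc_N hc).
have [|l hl] := @char_indep N _ (fun i => c i) i0 zi; first by rewrite /c big_ord0 oner_neq0.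
pose b := \sum_(i < N) c i * sg i (z ^+ l).
have bE : b = \sum_(i < N) c i * sg i z ^+ l by apply: eq_bigr => i _; rewrite rmorphXn.
have b0 : b != 0 by rewrite bE.
have Mb : M b.
  apply: (sf_sum sM) => i _; apply: (sfM sM); last by apply: sg_stab; exact: (sfX sM).
  by apply: (sf_prod sM) => j _; exact: sg_stab.
have ub : u * s b = b.
  rewrite /b rmorph_sum mulr_sumr.
  rewrite (eq_bigr (fun i : 'I_N => c i.+1 * sg i.+1 (z ^+ l))).
    rewrite -(big_mkord xpredT (fun k => c k.+1 * sg k.+1 (z ^+ l))) -(big_mkord xpredT (fun k => c k * sg k (z ^+ l))).
    move: nu; rewrite /cyc_norm -/(c N).
    case: N (cyc_N hc) (cyc_pow hc) => // n _ hp nu.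
    rewrite big_nat_recr //= big_nat_recl //= hp ?nu; last exact: (sfX sM).
    by rewrite /c big_ord0 mul1r addrC.
  move=> i _; rewrite rmorphM mulrA sgS; congr (_ * _).
  rewrite /c big_ord_recl sg0 rmorph_prod; congr (_ * _).
  by apply: eq_bigr => j _; exact: (esym (sgS j u)).
have [m [m0 hm]] := Aint_mul_nat b^-1.
exists (m%:R * b^-1); split=> //.
- by apply: (sfM sM); [exact: sf_nat | exact: sfV].
- by rewrite mulf_neq0 ?invr_neq0 // pnatr_eq0 -lt0n.
have mR : m%:R != 0 :> algC by rewrite pnatr_eq0 -lt0n.
rewrite cphiM cphi_F ?mul1r //; last exact: (sf_nat (cyc_subF hc)).
rewrite cphiV /cphi invf_div -{1}ub mulfK // fmorph_eq0 //.
Qed.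

(** The list stands for a sum of tensors of an algebraic integer with an integer of M; this is the
    product map applied after twisting the second factor by s^k. *)
Definition bracket (l : seq (algC * algC)) (k : nat) := \sum_(u <- l) u.1 * sg k u.2.
Definition chr_list (l : seq (algC * algC)) := forall u : algC * algC, u \in l -> [/\ u.1 \in Aint, M u.2 & u.2 \in Aint].

Lemma chr_list_cat l l' : chr_list l -> chr_list l' -> chr_list (l ++ l').
Proof. by move=> h h' u; rewrite mem_cat => /orP[/h|/h']. Qed.

Lemma bracket_Aint l k : chr_list l -> bracket l k \in Aint.
Proof.
move=> h; rewrite /bracket big_seq; apply: rpred_sum => u /h [h1 _ h2].
by rewrite rpredM // aut_Aint.
Qed.

(* Otherwise the ideal generated by the differences y - s^k y would lie in a prime ideal. *)
Lemma chr_delta1 k : (0 < k < N)%N -> exists l, [/\ chr_list l, bracket l 0 = 1 & bracket l k = 0].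
Proof.
move=> hk; pose I := [set x : algC | exists2 l, chr_list l & x = bracket l 0 - bracket l k]%classic.
have I1 : I 1.
  apply: contrapT => nI1; pose z := nf_z D.
  have Mz : M z := nf_zM D.
  have Iy y : M y -> y \in Aint -> I (y - sg k y).
    move=> My yA; exists [:: (1, y)]; first by move=> u; rewrite inE => /eqP ->; split=> //; exact: rpred1.
    by rewrite /bracket !big_seq1 !mul1r.
  have z0 : z - sg k z != 0.
    rewrite subr_eq0; apply/eqP => hz; have [x Mx /eqP []] := cyc_sep hc hk.
    by have := @nf_agree M D 1%g (sg k) hz x Mx => <-.
  have iI : zb_ideal I.
    split.
    - by move=> x [l hl ->]; rewrite rpredB // bracket_Aint.
    - move=> x y [l hl ->] [l' hl' ->]; exists (l ++ l'); first exact: chr_list_cat.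
      by rewrite /bracket !big_cat /= opprD addrACA.
    - move=> a x aA [l hl ->]; exists [seq (a * u.1, u.2) | u <- l].
        by move=> u /mapP [v /hl [v1 v2 v3] ->]; split=> //=; rewrite rpredM.
      by rewrite /bracket !big_map /= mulrBr !mulr_sumr; congr (_ - _); apply: eq_bigr => u _; rewrite mulrA.
  have [P hP hIP] := max_ideal iI (Iy z Mz (nf_zA D)) z0 nI1.
  apply: (cyc_fin hc hP hk) => y My yA; apply: (prBC subfieldT hP); apply: hIP; exact: Iy.
case: I1 => l hl e1; exists (l ++ [:: (- bracket l k, 1)]); split.
- apply: chr_list_cat => // u; rewrite inE => /eqP -> /=; split; rewrite ?rpred1 ?rpredN ?bracket_Aint //.
  exact: sf1.
- by rewrite /bracket !big_cat /= !big_seq1 /= ?rmorph1 mulr1 -[LHS]/(bracket l 0 - bracket l k).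
- by rewrite /bracket !big_cat /= !big_seq1 /= ?rmorph1 mulr1 subrr.
Qed.

Lemma bracketM l l' k : bracket [seq (u.1 * v.1, u.2 * v.2) | u <- l, v <- l'] k = bracket l k * bracket l' k.
Proof.
rewrite /bracket big_allpairs_dep /= mulr_suml; apply: eq_bigr => u _.
by rewrite mulr_sumr; apply: eq_bigr => v _; rewrite rmorphM mulrACA.
Qed.

(** A product of the solutions for the individual k. The element so obtained expresses an ambiguous
    a through traces to F, as in [amb_gen]. *)
Lemma chr_delta : exists l, [/\ chr_list l, bracket l 0 = 1 & forall k, (0 < k < N)%N -> bracket l k = 0].
Proof.
suff h m : (m <= N)%N -> exists l, [/\ chr_list l, bracket l 0 = 1 & forall k, (0 < k < m)%N -> bracket l k = 0].
  exact: h.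
elim: m => [|m IH] mN.
  exists [:: (1, 1)]; split.
  - by move=> u; rewrite inE => /eqP ->; split; rewrite ?rpred1 //; exact: sf1.
  - by rewrite /bracket big_seq1 mulr1.
  - by move=> k; rewrite ltn0 andbF.
have [l [l1 l2 l3]] := IH (ltnW mN).
have [m0|m0] := posnP m.
  by exists l; split=> // k; rewrite m0; case: k.
have [|l' [l'1 l'2 l'3]] := @chr_delta1 m; first by rewrite m0.
exists [seq (u.1 * v.1, u.2 * v.2) | u <- l, v <- l']; split.
- move=> w /allpairsP [[u v] /= [/l1 [u1 u2 u3] /l'1 [v1 v2 v3] ->]]; split=> /=; rewrite ?rpredM //.
  exact: (sfM sM).
- by rewrite bracketM l2 l'2 mulr1.
- move=> k; rewrite ltnS => /andP[k0]; rewrite leq_eqVlt => /orP[/eqP ->|km]; rewrite bracketM.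
    by rewrite l'3 mulr0.
  by rewrite l3 ?mul0r // k0.
Qed.

Definition amb a := [/\ M a, a \in Aint, a != 0 & cphi a \in Aint].

Lemma amb_sg a k : amb a -> sg k a / a \in Aint.
Proof.
move=> [Ma aA a0 ha]; elim: k => [|k IH]; first by rewrite sg0 divff // rpred1.
have -> : sg k.+1 a / a = s (sg k a / a) * cphi a.
  by rewrite sgS rmorphM fmorphV /cphi mulrA divfK // fmorph_eq0.
by rewrite rpredM // aut_Aint.
Qed.

(** In an unramified extension a Galois-stable ideal comes from below: the delta element gives a =
    sum u.1 Tr(u.2 a), and Tr(u.2 a) / a is integral since every s^k a / a is. *)
Lemma amb_gen a : amb a -> gen_contr F a.
Proof.
move=> ha; have [l [l1 l2 l3]] := chr_delta; have [Ma aA a0 _] := ha.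
exists [seq (u.1, cyc_tr (u.2 * a)) | u <- l]; split.
  move=> v /mapP [u /l1 [u1 u2 u3] ->] /=; split=> //; split.
  - by apply: cyc_tr_F; exact: (sfM sM).
  - by apply: rpred_sum => k _; rewrite aut_Aint // rpredM.
  - rewrite /cyc_tr mulr_suml rpred_sum // => k _; rewrite rmorphM -mulrA rpredM ?aut_Aint //.
    exact: amb_sg.
rewrite big_map /= /cyc_tr.
have -> : \sum_(u <- l) u.1 * (\sum_(k < N) sg k (u.2 * a)) = \sum_(k < N) bracket l k * sg k a.
  rewrite /bracket; under [RHS]eq_bigr => k _ do rewrite mulr_suml.
  rewrite [RHS]exchange_big /=; apply: eq_bigr => u _; rewrite mulr_sumr; apply: eq_bigr => k _.
  by rewrite rmorphM mulrA.
pose i0 := Ordinal (cyc_N hc).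
rewrite (bigD1 i0) //= l2 mul1r big1 ?addr0 // => k k0; rewrite l3 ?mul0r // ltn_ord andbT lt0n.
by apply: contra k0 => /eqP k0; apply/eqP/val_inj.
Qed.

Lemma contr_ideal a : amb a -> nf_ideal F (contr F a).
Proof.
move=> ha; have sF := cyc_subF hc; have [Ma aA a0 _] := ha; split.
- by move=> x [].
- have [l [h1 e]] := amb_gen ha; apply: contrapT => hn; move: a0; rewrite e big_seq big1 ?eqxx // => u /h1 [_ hu].
  by have [->|u0] := eqVneq u.2 0; rewrite ?mulr0 //; case: hn; exists u.2.
- move=> x y [x1 x2 x3] [y1 y2 y3]; split; rewrite ?mulrDl ?rpredD //; exact: (sfD sF).
- move=> b x b1 b2 [x1 x2 x3]; split; [exact: (sfM sF) | by rewrite rpredM | by rewrite -mulrA rpredM].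
Qed.

Lemma amb_class a a' c : amb a -> amb a' -> F c -> c != 0 ->
  (forall x, contr F a' x <-> contr F a (x / c)) -> nf_unit M (a' / (c * a)).
Proof.
move=> ha ha' Fc c0 h; have [Ma aA a0 _] := ha; have [Ma' a'A a'0 _] := ha'.
have Mc := cyc_FM hc Fc; have [u1 u2] := gen_class (amb_gen ha) (amb_gen ha') c0 h.
split=> //; first by apply: (sf_div sM) => //; exact: (sfM sM).
by rewrite mulf_neq0 ?invr_neq0 ?mulf_neq0.
Qed.
End Cyclic.

Definition imod (n : nat) (a : int) : 'I_n.+1 := inord `|(a %% n.+1)%Z|.

Lemma imodP n a b : imod n a = imod n b -> exists q : int, a - b = q * n.+1%:Z.
Proof.
move=> /(congr1 val); rewrite /imod.
have lt x : (`|(x %% n.+1)%Z| < n.+1)%N.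
  by rewrite -ltz_nat gez0_abs ?modz_ge0 // ltz_pmod.
rewrite /= !inordK // => /(congr1 (fun k : nat => k%:Z)); rewrite !gez0_abs ?modz_ge0 // => e.
exists ((a %/ n.+1)%Z - (b %/ n.+1)%Z); rewrite {1}(divz_eq a n.+1) {1}(divz_eq b n.+1) e; ring.
Qed.

Lemma ratio_id (r r' a a' : algC) : r' != 0 -> a != 0 -> a' != 0 -> r / r' = r * a / (r' * a') * a' / a.
Proof. by move=> *; field; apply/and3P. Qed.

(** A root of unity in M has absolute value 1 at every embedding, so [northcott] bounds its order by
    #|T|; the factorial is a common multiple of the possible orders. *)
Lemma root_kill (M : set algC) : nf_data M ->
  exists2 k, (0 < k)%N & forall x n, M x -> (0 < n)%N -> x ^+ n = 1 -> x ^+ k = 1.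
Proof.
move=> D; have sM := nf_sub D; have [T [code hcode]] := northcott D 1.
exists (#|T|)`!; first exact: fact_gt0.
move=> x n Mx n0 xn.
have [i [j [ij jT e]]] := pigeon (fun i => code (x ^+ i)).
have xA : x \in Aint by apply: (Aint_unity_root n0); exact/unity_rootP.
have nx i' : `|nf_e i' x| = 1.
  by apply/eqP; rewrite -(pexpr_eq1 (n := n)) // -normrX -rmorphXn xn rmorph1 normr1.
have {}e : x ^+ i = x ^+ j.
  apply: hcode e; [by split; [exact: sfX|rewrite rpredX]|by split; [exact: sfX|rewrite rpredX]| |].
    by move=> i'; rewrite rmorphXn normrX nx expr1n.
  by move=> i'; rewrite rmorphXn normrX nx expr1n.
have x0 : x != 0 by apply: contra_eqN xn => /eqP ->; rewrite expr0n gtn_eqF // eq_sym oner_eq0.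
have xji : x ^+ (j - i) = 1.
  by apply: (mulfI (expf_neq0 i x0)); rewrite -exprD subnKC ?mulr1 // ltnW.
have /dvdnP [q ->] : (j - i %| (#|T|)`!)%N by apply: dvdn_fact; lia.
by rewrite mulnC exprM xji expr1n.
Qed.

(** Multiplicativity of indices in terms of codes: A modulo phi B, followed by phi B modulo phi B'.
    The second code is read after division by a chosen representative of the first. *)
Lemma code_step (A B B' : algC -> Prop) (phi : algC -> algC) (T T' : finType) (c : algC -> T) (d : algC -> T') :
  (forall x, A x -> x != 0) ->
  (forall x y, A x -> A y -> c x = c y -> exists2 v, B v & x / y = phi v) ->
  (forall v v', B v -> B v' -> d v = d v' -> exists2 v'', B' v'' & phi v / phi v' = phi v'') ->
  exists c' : algC -> T * T', forall x y, A x -> A y -> c' x = c' y -> exists2 v, B' v & x / y = phi v.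
Proof.
move=> A0 hc hd.
have /choice [rep hrep] (h : T) : exists x, (exists2 x', A x' & c x' = h) -> A x /\ c x = h.
  have [[x' x1 x2]|n] := pselect (exists2 x', A x' & c x' = h); first by exists x'.
  by exists 0 => /n.
have /choice [v hv] x : exists v, A x -> B v /\ x / rep (c x) = phi v.
  have [Ax|n] := pselect (A x); last by exists 0 => /n.
  have [r1 r2] : A (rep (c x)) /\ c (rep (c x)) = c x by apply: hrep; exists x.
  by have [v v1 v2] := hc _ _ Ax r1 (esym r2); exists v.
exists (fun x => (c x, d (v x))) => x y Ax Ay [e1 e2].
have [vx hx] := hv x Ax; have [vy hy] := hv y Ay.
have [v'' h1 h2] := hd _ _ vx vy e2; exists v'' => //.
rewrite -h2 -hx -hy e1 invf_div mulrA divfK //.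
by case: (hrep (c y)) => [|/A0 //]; exists y.
Qed.

Section Uprod.
Variables (M : set algC) (I : finType) (u : I -> algC).
Hypothesis uu : forall i, nf_unit M (u i).

Lemma uprodN m : uprod u (fun i => - m i) = (uprod u m)^-1.
Proof. by rewrite /uprod -prodfV; apply: eq_bigr => i _; rewrite invr_expz. Qed.
Lemma uprodB m n : uprod u (fun i => m i - n i) = uprod u m / uprod u n.
Proof. by rewrite (uprodD uu m (fun i => - n i)) uprodN. Qed.
Lemma uprod_neq0 m : uprod u m != 0.
Proof. by apply/prodf_neq0 => i _; rewrite expfz_neq0 // (u_neq0 uu). Qed.
Lemma uprodMn m (k : nat) : uprod u (fun i => m i * k%:Z) = uprod u m ^+ k.
Proof. by rewrite uprodMz. Qed.
Lemma eq_uprod m n : m =1 n -> uprod u m = uprod u n.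
Proof. by move=> h; apply: eq_bigr => i _; rewrite h. Qed.

(** The exponent at i0 is always zero, so units modulo N-th powers, N = n'.+1, cost only N^(r-1)
    classes beyond the finite covering, r being the number of places. This missing factor N is what
    bounds N in the end. *)
Lemma unit_pow_code (D : nf_data M) (T : finType) (c : algC -> T) (m : algC -> I -> int) (i0 : I) n' :
  (forall x, m x i0 = 0) ->
  (forall x y, nf_unit M x -> nf_unit M y -> c x = c y -> x * uprod u (m x) = y * uprod u (m y)) ->
  let d x := (c x, [ffun i : {i | i != i0} => imod n' (m x (val i))]) in
  forall y y', nf_unit M y -> nf_unit M y' -> d y = d y' -> exists2 z, nf_unit M z & y / y' = z ^+ n'.+1.
Proof.
move=> m0 hcm /= y y' uy uy' [e1 /ffunP e2].
have /choice [q hq] j : exists q : int, m y' j - m y j = q * n'.+1%:Z.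
  have [->|ji] := eqVneq j i0; first by exists 0; rewrite !m0 subrr mul0r.
  by have := e2 (Sub j ji); rewrite !ffunE => /esym /imodP.
have [y0 my0] : y' != 0 /\ uprod u (m y) != 0 by split; [case: uy' | exact: uprod_neq0].
exists (uprod u q); first exact: (uprod_unit D).
rewrite -uprodMn -(eq_uprod hq) uprodB.
by apply/eqP; rewrite eqr_div //; apply/eqP; rewrite (hcm _ _ uy uy') // mulrC.
Qed.
End Uprod.

(** * Bounding the degree of an unramified cyclic extension by counting units of norm 1 *)

Section Hilbert94.
Variables (F M : set algC) (DF : nf_data F) (D : nf_data M) (s : aut) (n' : nat).
Local Notation N := n'.+1.
Hypothesis hc : cyc F M s N.
Let sM := nf_sub D.
Local Notation sg k := ((s ^+ k)%g : aut).
Variables (I : finType) (t : I -> aut).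
Hypothesis tP : place_system F t.

Lemma cphi_neq0 x : x != 0 -> cphi s x != 0.
Proof. by move=> x0; rewrite /cphi mulf_neq0 ?invr_neq0 ?fmorph_eq0. Qed.

Definition tM (j : I * 'I_N) : aut := (t j.1 * s ^+ j.2)%g.

(** By [cyc_arch] no nontrivial power of s acts on M as a complex conjugation, so each place of F
    has exactly N places above it, permuted simply transitively by the powers of s. *)
Lemma tM_places : place_system M tM.
Proof.
split=> [a|[f e] [f' e'] h].
  case: tP => /(_ a) [f hf] _.
  have [b hb] : exists b : aut, fixes F (b^-1 * a)%g /\ ((forall x, b x = t f x) \/ (forall x, b x = (t f x)^*)).
    case: hf => hf; [exists (t f)|exists (cj * t f)%g]; split; try by [left|right].
    - by move=> x Fx; rewrite autM hf // autKV.
    - by move=> x Fx; rewrite autM hf // -[RHS](autKV (cj * t f)%g).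
  case: hb => hb1 hb2; have [k kN hk] := cyc_gal hc hb1.
  exists (f, Ordinal kN); case: hb2 => hb2; [left|right] => x Mx.
    by rewrite /tM [RHS]/= -hk // -hb2 autM autVK.
  by rewrite /tM [tM _ _]/= -hk // -hb2 autM autVK.
have ff : f = f'.
  case: tP => _; apply; case: h => h; [left|right] => x Fx; have := h x (cyc_FM hc Fx);
  by rewrite /tM !autM !(sg_fix hc).
rewrite -{}ff in h *; congr (_, _); apply: val_inj => /=.
suff key (a b : 'I_N) : (a < b)%N -> same_place M (tM (f, a)) (tM (f, b)) -> False.
  case: (ltngtP e e') => // lt; exfalso; first exact: key lt h.
  by apply: key lt _; exact: same_place_sym.
move=> ab; have k0 : (0 < b - a < N)%N by have := ltn_ord b; lia.
have sgb x : M x -> sg b x = sg a (sg (b - a) x).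
  by move=> Mx; rewrite -sgD subnKC // ltnW.
have inva x : M x -> exists2 y, M y & sg a y = x.
  move=> Mx; exists (sg (N - a) x); first exact: (sg_stab hc).
  by rewrite -sgD subnKC ?(cyc_pow hc) // ltnW.
case=> h'.
  have [x Mx /eqP ne] := cyc_sep hc k0; apply: ne.
  by have := h' x Mx; rewrite /tM !autM /= sgb // => /(can_inj (autKV _)) /(can_inj (autKV _)) /esym.
apply: (cyc_arch hc (tau := t f) k0) => x Mx.
have [y My <-] := inva x Mx.
have := h' y My; rewrite /tM !autM /= sgb // => h2.
by rewrite -sgD addnC sgD h2 conjCK.
Qed.

(** One Minkowski unit is chosen above each place of F and translated by the powers of s. This makes
    the family stable, and s acts on exponent vectors by a cyclic shift. *)
Lemma tM_minkowski : exists2 u : I * 'I_N -> algC, (forall j, nf_unit M (u j)) &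
  (forall i j, j != i -> `|tM j (u i)| < 1) /\ (forall f e, s (u (f, ordS e)) = u (f, e)).
Proof.
have [u0 uu0 ult0] := mink_places D tM_places.
pose w f := u0 (f, ord0).
have Mw f : M (w f) by case: (uu0 (f, ord0)).
have sgu k x : nf_unit M x -> nf_unit M (sg k x).
  case=> Mx xA xV x0; split; [exact: (sg_stab hc)|exact: aut_Aint| |by rewrite fmorph_eq0].
  by rewrite -fmorphV aut_Aint.
exists (fun j : I * 'I_N => sg (N - j.2) (w j.1)); first by move=> j; apply: sgu; exact: uu0.
split=> [[f e] [f' e'] ne /=|f e /=]; last first.
  rewrite -sgS; have [lt|ge] := ltnP e.+1 N.
    by rewrite modn_small // subnS prednK // subn_gt0.
  have -> : (e : nat) = n' by move: (ltn_ord e) ge; lia.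
  by rewrite modnn subn0 sgS (cyc_pow hc) // subSnn.
rewrite /tM /= -sgD.
have lt : ((e' + (N - e)) %% N < N)%N by rewrite ltn_mod.
rewrite -(sg_mod hc) //; have := @ult0 (f, ord0) (f', Ordinal lt); rewrite /tM autM; apply.
apply: contra ne => /eqP [-> h]; apply/eqP; congr (_, _); apply: val_inj => /=.
have eN := ltn_ord e; have e'N := ltn_ord e'; move: h.
case: (ltngtP e' e) => // lt' h.
  by rewrite modn_small in h; lia.
have e2 : (e' + (N - e) = (e' - e) + N)%N by lia.
by rewrite e2 modnDr modn_small in h; lia.
Qed.

Variables (u : I * 'I_N -> algC).
Hypotheses (uu : forall j, nf_unit M (u j)) (u_lt : forall i j, j != i -> `|tM j (u i)| < 1).
Hypothesis u_s : forall f e, s (u (f, ordS e)) = u (f, e).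

Definition shf (n : I * 'I_N -> int) (j : I * 'I_N) := n (j.1, ordS j.2).

Lemma ordS_bij : bijective (fun j : I * 'I_N => (j.1, ordS j.2)).
Proof.
by exists (fun j => (j.1, ord_pred j.2)) => -[f e] /=; rewrite ?ordSK ?ord_predK.
Qed.

Lemma uprod_s n : s (uprod u n) = uprod u (shf n).
Proof.
rewrite /uprod rmorph_prod (reindex _ (onW_bij _ ordS_bij)) /=.
by apply: eq_bigr => -[f e] _; rewrite fmorphXz /= u_s.
Qed.

Lemma cphi_uprod n : cphi s (uprod u n) = uprod u (fun j => shf n j - n j).
Proof. by rewrite (uprodB uu) /cphi uprod_s. Qed.

Definition dlt (c : I -> 'I_N) (j : I * 'I_N) : int := if j.2 == ord0 then (c j.1 : nat)%:Z else 0.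

Lemma sum_shf n f : \sum_e shf n (f, e) = \sum_e n (f, e).
Proof.
by rewrite /shf /= [RHS](reindex_inj (can_inj (@ordSK N))).
Qed.

(** The hypothesis is a relation whose exponents have the form shf nu - nu, with sum zero along each
    orbit, so [sign_lemma] makes them vanish. Then nu is constant along orbits, and N divides c f -
    c' f, which is smaller than N in absolute value. *)
Lemma uprod_indep (c c' : I -> 'I_N) n :
  cphi s (uprod u (dlt c)) / cphi s (uprod u (dlt c')) = cphi s (cphi s (uprod u n)) -> c =1 c'.
Proof.
pose nu j := dlt c j - dlt c' j - (shf n j - n j).
move=> h; have h1 : uprod u (fun j => shf nu j - nu j) = 1.
  rewrite -cphi_uprod /nu (uprodB uu) (uprodB uu) cphiM cphiV cphiM cphiV h -cphi_uprod divff //.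
  by rewrite !cphi_neq0 // (uprod_neq0 uu).
have s0 f : \sum_e (shf nu (f, e) - nu (f, e)) = 0 by rewrite sumrB sum_shf subrr.
have hs : forall j, shf nu j - nu j = 0.
  have [|hp|hn|//] := sign_lemma D tM_places uu u_lt (n := fun j => shf nu j - nu j).
  - by move=> i; rewrite h1 rmorph1 normr1.
  - move=> [f e]; have : 0 < \sum_e (shf nu (f, e) - nu (f, e)).
      by rewrite (bigD1 ord0) //= ltr_wpDr // sumr_ge0 // => i _; exact: ltW.
    by rewrite s0 ltxx.
  - move=> [f e]; have : 0 < \sum_e - (shf nu (f, e) - nu (f, e)).
      rewrite (bigD1 ord0) //= ltr_wpDr ?oppr_gt0 // sumr_ge0 // => i _; rewrite oppr_ge0; exact: ltW.
    by rewrite sumrN s0 oppr0 ltxx.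
move=> f; have cst k : (k < N)%N -> nu (f, inord k) = nu (f, ord0).
  elim: k => [|k IH] kN; first by congr (nu (_, _)); apply: val_inj; rewrite /= inordK.
  rewrite -IH ?(ltnW kN) //; apply/eqP; rewrite -subr_eq0 -[X in _ == X](hs (f, inord k)) /shf /=; apply/eqP.
  congr (nu (_, _) - _); apply: val_inj; rewrite /= !inordK ?modn_small //; exact: ltnW.
have e1 : \sum_e nu (f, e) = (c f : nat)%:Z - (c' f : nat)%:Z.
  rewrite /nu !sumrB sum_shf subrr subr0; congr (_ - _).
    by rewrite (bigD1 ord0) //= /dlt eqxx big1 ?addr0 //= => i /negPf ->.
  by rewrite (bigD1 ord0) //= /dlt eqxx big1 ?addr0 //= => i /negPf ->.
have e2 : \sum_e nu (f, e) = nu (f, ord0) * N%:Z.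
  rewrite (eq_bigr (fun=> nu (f, ord0))) ?sumr_const ?card_ord.
    by rewrite -mulr_natr natz.
  by move=> e _; rewrite -(cst e (ltn_ord e)) inord_val.
have c1 := ltn_ord (c f); have c2 := ltn_ord (c' f).
apply: val_inj => /=; move: e1; rewrite e2; set q := nu _; clearbody q.
case: (ltrgtP q 0) => [q0|q0|->]; [nia|nia|lia].
Qed.

Definition unitA x := nf_unit M x /\ cyc_norm s N x = 1.
Definition subA x := exists n, x = cphi s (uprod u n).

Lemma subA1 : subA 1. Proof. by exists (fun=> 0); rewrite uprod0 cphi1. Qed.
Lemma subAM x y : subA x -> subA y -> subA (x * y).
Proof. by move=> [m ->] [n ->]; exists (fun j => m j + n j); rewrite (uprodD uu) cphiM. Qed.
Lemma subAV x : subA x -> subA x^-1.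
Proof. by move=> [n ->]; exists (fun j => - n j); rewrite uprodN cphiV. Qed.

Lemma sg_uprod k n : exists n', sg k (uprod u n) = uprod u n'.
Proof.
elim: k => [|k [m hm]]; first by exists n.
by exists (shf m); rewrite sgS hm uprod_s.
Qed.

(** When the codes agree, x / y = w^N where w = z0^k and z0 is a product of powers of the u i. The
    exponent k kills the norm of z0, a root of unity, so w has norm 1 and w^N is the product of the
    w / s^j w, which all lie in [subA]. *)
Lemma unitA_finite : exists (T : finType) (c : algC -> T), forall x y, unitA x -> unitA y -> c x = c y -> subA (x / y).
Proof.
have [j0 _] := place_inh D tM_places.
have [T [c [m [_ hcm]]]] := unit_covering D tM_places uu u_lt j0.
have [k k0 hk] := root_kill D.
exists (T * {ffun I * 'I_N -> 'I_(N * k).-1.+1})%type, (fun x => (c x, [ffun j => imod (N * k).-1 (m x j)])).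
move=> x y [ux nx] [uy ny] [e1 /ffunP e2].
have /choice [q hq] j : exists q : int, m y j - m x j = q * (N * k)%N%:Z.
  by have := e2 j; rewrite !ffunE => /esym /imodP [q ->]; exists q; rewrite prednK // muln_gt0.
have [y0 mx0] : y != 0 /\ uprod u (m x) != 0 by split; [case: uy | exact: (uprod_neq0 uu)].
have exy : x / y = uprod u q ^+ k ^+ N.
  rewrite -exprM mulnC -uprodMn -(eq_uprod u hq) (uprodB uu).
  by apply/eqP; rewrite eqr_div //; apply/eqP; rewrite (hcm x y) // mulrC.
set z0 := uprod u q; have Mz0 : M z0 by case: (uprod_unit D uu q).
have nX (x0 : algC) j : cyc_norm s N (x0 ^+ j) = cyc_norm s N x0 ^+ j.
  by rewrite /cyc_norm -prodrXl; apply: eq_bigr => i _; rewrite rmorphXn.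
have nz : cyc_norm s N (z0 ^+ k) = 1.
  rewrite nX; apply: (hk _ (k * N)%N); rewrite ?muln_gt0 ?k0 //.
    by have := cyc_norm_F D hc Mz0; exact: (cyc_FM hc).
  by rewrite exprM -!nX -exy cyc_normM cyc_normV nx ny divr1.
have sz j : exists n, sg j (z0 ^+ k) = uprod u n.
  have -> : z0 ^+ k = uprod u (fun j => q j * k%:Z) by rewrite uprodMn.
  exact: sg_uprod.
have zj j : subA (z0 ^+ k / sg j (z0 ^+ k)).
  have zn0 : z0 ^+ k != 0 by rewrite expf_neq0 // (uprod_neq0 uu).
  elim: j => [|j IH]; first by rewrite sg0 divff //; exact: subA1.
  have -> : z0 ^+ k / sg j.+1 (z0 ^+ k) = z0 ^+ k / sg j (z0 ^+ k) * (cphi s (sg j (z0 ^+ k)))^-1.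
    by rewrite /cphi invf_div -sgS mulrA divfK // fmorph_eq0.
  by apply: subAM => //; apply: subAV; have [n ->] := sz j; exists n.
have -> : x / y = \prod_(j < N) (z0 ^+ k / sg j (z0 ^+ k)).
  by rewrite prodf_div -/(cyc_norm s N (z0 ^+ k)) nz divr1 prodr_const card_ord.
by apply: big_ind => //; [exact: subA1 | exact: subAM].
Qed.

Variables (Tcl : finType) (cls : set algC -> Tcl).
Hypothesis hcls : forall A B, nf_ideal F A -> nf_ideal F B -> cls A = cls B ->
  exists c, [/\ F c, c != 0 & forall x, B x <-> A (x / c)].
Variables (TF : finType) (cF : algC -> TF) (mF : algC -> I -> int) (uF : I -> algC) (i0 : I).
Hypotheses (uuF : forall i, nf_unit F (uF i)) (mF0 : forall x, mF x i0 = 0).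
Hypothesis hcF : forall x y, nf_unit F x -> nf_unit F y -> cF x = cF y ->
  x * uprod uF (mF x) = y * uprod uF (mF y).

Lemma unitA_neq0 x : unitA x -> x != 0. Proof. by case=> -[]. Qed.

Lemma unitA_class : exists c : algC -> Tcl, forall x y, unitA x -> unitA y -> c x = c y ->
  exists2 v, nf_unit M v & x / y = cphi s v.
Proof.
have /choice [a ha] x : exists a, unitA x -> amb M s a /\ x = cphi s a.
  have [[[Mx xA xV x0] nx]|n] := pselect (unitA x); last by exists 0 => /n.
  by have [a [a1 a2 a3 a4]] := hilbert90 D hc Mx nx; exists a => _; split=> //; split=> //; rewrite -a4.
exists (fun x => cls (contr F (a x))) => x y /ha [hx ex] /ha [hy ey] e.
have [c [Fc c0 h]] := hcls (contr_ideal D hc hy) (contr_ideal D hc hx) (esym e).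
exists (a x / (c * a y)); first exact: (amb_class D hc).
by rewrite !cphiM cphiV cphiM (cphi_F hc Fc c0) mul1r -ex -ey.
Qed.

(** If the norms of v and v' differ by the factor z^N with z in F, then v / (v' z) has norm 1, and
    dividing by z does not change [cphi]. *)
Lemma norm_code : exists d : algC -> TF * {ffun {i | i != i0} -> 'I_N},
  forall v v', nf_unit M v -> nf_unit M v' -> d v = d v' ->
  exists2 v'', unitA v'' & cphi s v / cphi s v' = cphi s v''.
Proof.
have uN v : nf_unit M v -> nf_unit F (cyc_norm s N v).
  move=> [Mv vA vV v0]; split; first exact: (cyc_norm_F D hc).
  - by apply: rpred_prod => k _; rewrite aut_Aint.
  - by rewrite -cyc_normV; apply: rpred_prod => k _; rewrite aut_Aint.
  - by apply/prodf_neq0 => k _; rewrite fmorph_eq0.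
exists (fun v => (cF (cyc_norm s N v), [ffun i => imod n' (mF (cyc_norm s N v) (val i))])).
move=> v v' uv uv' e; pose y := cyc_norm s N v; pose y' := cyc_norm s N v'.
have [z uz exy] : exists2 z, nf_unit F z & y / y' = z ^+ N.
  exact: (unit_pow_code uuF DF mF0 hcF (uN _ uv) (uN _ uv') e).
have [Fz zA zV z0] := uz; have Mz := cyc_FM hc Fz.
have [v0 v'0] : v != 0 /\ v' != 0 by split; [case: uv | case: uv'].
exists (v / (v' * z)).
  split; first by apply: (nf_unitM D) => //; apply: (nf_unitV D); apply: (nf_unitM D).
  rewrite cyc_normM cyc_normV cyc_normM -/y -/y'.
  have -> : cyc_norm s N z = z ^+ N.
    rewrite /cyc_norm (eq_bigr (fun=> z)) ?prodr_const ?card_ord // => k _.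
    by rewrite (sg_fix hc).
  by rewrite invfM mulrA exy divff // expf_neq0.
by rewrite !cphiM cphiV cphiM (cphi_F hc Fz z0) mulr1.
Qed.

Lemma cyc_bound : (N <= #|Tcl| * #|TF|)%N.
Proof.
have [Tf [cf hcf]] := unitA_finite.
pose Sof x : {set Tf} := [set tt | `[< exists y, [/\ unitA y, subA (y / x) & cf y = tt] >]].
have subAC x y : x != 0 -> y != 0 -> subA (x / y) -> subA (y / x).
  by move=> x0 y0 /subAV; rewrite invf_div.
have SofP x y : unitA x -> unitA y -> Sof x = Sof y -> subA (x / y).
  move=> ux uy e; have : cf x \in Sof x.
    by rewrite inE; apply/asboolP; exists x; split=> //; rewrite divff ?unitA_neq0 //; exact: subA1.
  rewrite e inE => /asboolP [w [uw hw /esym /(hcf _ _ ux uw) h]].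
  by have := subAM h hw; rewrite mulrA divfK // unitA_neq0.
have SofP' x y : unitA x -> unitA y -> subA (x / y) -> Sof x = Sof y.
  move=> ux uy h; apply/setP => tt; rewrite !inE; apply/asboolP/asboolP => -[w [uw hw ew]]; exists w; split=> //.
    by have := subAM hw h; rewrite mulrA divfK // unitA_neq0.
  have := subAM hw (subAC _ _ (unitA_neq0 ux) (unitA_neq0 uy) h).
  by rewrite mulrA divfK // unitA_neq0.
(* The quotient of [unitA] by [subA], each coset being represented by the set of codes of its
   elements. *)
pose T2 := {S : {set Tf} | `[< exists2 x, unitA x & S = Sof x >]}.
have u1 : unitA 1.
  split; first exact: (nf_unit1 D).
  by rewrite /cyc_norm big1 // => k _; rewrite rmorph1.
have T21 : `[< exists2 x, unitA x & Sof 1 = Sof x >] by apply/asboolP; exists 1.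
pose d2 x : T2 := insubd (Sub (Sof 1) T21 : T2) (Sof x).
have d2P x y : unitA x -> unitA y -> d2 x = d2 y -> subA (x / y).
  move=> ux uy /(congr1 val); rewrite /d2 !insubdK //; last 2 first.
  - by apply/asboolP; exists y.
  - by apply/asboolP; exists x.
  exact: SofP.
have /choice [rp hrp] (S : T2) : exists x, unitA x /\ val S = Sof x.
  by case: S => S /= /asboolP [x]; exists x.
have [c1 hc1] := unitA_class; have [d1 hd1] := norm_code.
have [c2 hc2] := code_step unitA_neq0 hc1 hd1.
(* [c3] separates units of norm 1 modulo the image of [subA] under [cphi] and, with r = #|I|, takes
   values in a set of size #|Tcl| #|TF| N^(r-1) #|T2|; the map [g] below exhibits #|T2| N^r distinct
   ones. *)
have [|c3 hc3] := @code_step unitA unitA subA (cphi s) _ _ c2 d2 unitA_neq0 hc2.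
  move=> v v' uv uv' e; exists (v / v'); first exact: d2P.
  by rewrite cphiM cphiV.
pose ac (c : {ffun I -> 'I_N}) := cphi s (uprod u (dlt c)).
have acA c : unitA (ac c).
  have [Mu uA uV u0] := uprod_unit D uu (dlt c); split.
    rewrite /ac /cphi; apply: (nf_unitM D); last by apply: (nf_unitV D).
    split; [exact: (cyc_stab hc)|exact: aut_Aint| by rewrite -fmorphV aut_Aint|by rewrite fmorph_eq0].
  by apply: (cyc_norm_phi hc).
have unitAM x y : unitA x -> unitA y -> unitA (x * y).
  by move=> [ux nx] [uy ny]; split; [exact: (nf_unitM D)|rewrite cyc_normM nx ny mulr1].
pose g (ic : T2 * {ffun I -> 'I_N}) := c3 (rp ic.1 * ac ic.2).
have gi : injective g.
  move=> [i c] [i' c'] e; rewrite /g /= in e.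
  have [hi1 hi2] := hrp i; have [hi'1 hi'2] := hrp i'.
  have [w [n ->] hw] := hc3 _ _ (unitAM _ _ hi1 (acA c)) (unitAM _ _ hi'1 (acA c')) e.
  have [r0 r'0] := (unitA_neq0 hi1, unitA_neq0 hi'1).
  have [a0 a'0] := (unitA_neq0 (acA c), unitA_neq0 (acA c')).
  have ii : i = i'.
    apply: val_inj; rewrite hi2 hi'2; apply: SofP' => //.
    have -> : rp i / rp i' = cphi s (cphi s (uprod u n)) * ac c' / ac c.
      by rewrite -hw; exact: ratio_id.
    apply: subAM; first apply: subAM; last by apply: subAV; exists (dlt c).
      by rewrite cphi_uprod; exists (fun j => shf n j - n j).
    by exists (dlt c').
  congr (_, _); first exact: ii.
  apply/ffunP; apply: (@uprod_indep c c' n); rewrite -hw -{}ii -/(ac c) -/(ac c').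
  by rewrite -[RHS]mulf_div divff // mul1r.
have cI : #|{: {i | i != i0}}| = #|I|.-1.
  by rewrite card_sig -(cardC1 i0); apply: eq_card => x; rewrite !inE.
have T2p : (0 < #|{: T2}|)%N by apply/card_gt0P; exists (Sub (Sof 1) T21 : T2).
have Ip : (0 < #|I|)%N by apply/card_gt0P; exists i0.
have Np : (0 < N ^ #|I|.-1)%N by rewrite expn_gt0.
have := leq_card g gi; rewrite !card_prod !card_ffun card_ord cI -{1}(prednK Ip) expnS.
rewrite -(leq_pmul2r T2p) => h.
rewrite -(leq_pmul2r T2p) -(leq_pmul2r Np) -(leq_pmul2r T2p); apply: leq_trans (leq_trans h _).
  by rewrite leq_eqVlt; apply/orP; left; apply/eqP; ring.
by rewrite leq_eqVlt; apply/orP; left; apply/eqP; ring.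
Qed.
End Hilbert94.

Lemma hilbert94 (F : set algC) : nf_data F ->
  exists C : nat, forall M (D : nf_data M) s N, cyc F M s N -> (N <= C)%N.
Proof.
move=> DF; have [I [t tP]] := place_exists DF.
have [uF uuF uF_lt] := mink_places DF tP.
have [i0 _] := place_inh DF tP.
have [TF [cF [mF [mF0 hcF]]]] := unit_covering DF tP uuF uF_lt i0.
have [Tcl [cls hcls]] := class_number DF.
exists (#|Tcl| * #|TF|)%N => M D s [//|n'] hc.
have [u uu [u_lt u_s]] := tM_minkowski D hc tP.
exact: (cyc_bound DF D hc tP uu u_lt u_s hcls uuF mF0 hcF).
Qed.

(** * Unramified characters: kernel fields, bounded order, and Kummer theory *)

Record unr_char (F : set algC) (chi : aut -> algC) : Prop := UnrChar {
  uc_M : forall a b, fixes F a -> fixes F b -> chi (a * b)%g = chi a * chi b;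
  uc_cont : exists A : seq algC, forall a, fixes F a -> (forall x, x \in A -> a x = x) -> chi a = 1;
  uc_fin : forall P a, prime_of [set: algC]%classic P -> fixes F a ->
    (forall y, y \in Aint -> P (a y - y)) -> chi a = 1;
  uc_arch : forall tau : aut, fixes F (tau * cj * tau^-1)%g -> chi (tau * cj * tau^-1)%g = 1
}.

Lemma nf_of_list (B : seq algC) : exists2 N, number_field N & forall b, b \in B -> N b.
Proof.
have [Q [f [s1 s1E _]]] := num_field_exists B.
exists [set y : algC | exists x, y = f x]%classic; last first.
  by move=> b; rewrite -s1E => /mapP [x _ ->]; exists x.
split.
  split; first by exists 1; rewrite rmorph1.
    by move=> _ _ [x ->] [y ->]; exists (x - y); rewrite rmorphB.
  by move=> _ _ [x ->] [y ->]; exists (x / y); rewrite fmorph_div.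
exists (\dim {:Q}), (fun i => f (vbasis {:Q})`_i) => _ [x ->].
exists (fun i => coord (vbasis {:Q}) i x); rewrite {1}(coord_vbasis (memvf x)) rmorph_sum.
by apply: eq_bigr => i _; rewrite -mulr_algl rmorphM -[f _%:A]/((f \o in_alg Q) _) fmorph_eq_rat.
Qed.

Lemma number_field_sub (N M : set algC) : number_field N -> subfield M ->
  (forall x, M x -> N x) -> number_field M.
Proof. by move=> [_ [n [b hb]]] sM h; split=> //; exists n, b => x /h /hb. Qed.

Lemma number_field_gen (F : set algC) : number_field F ->
  exists B : seq algC, forall s : aut, (forall x, x \in B -> s x = x) -> fixes F s.
Proof.
move=> /nf_exists [D _]; exists [:: nf_z D] => s hs x Fx.
by rewrite (@nf_agree F D s 1%g) // hs // inE.
Qed.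

Lemma fixed_number_field (F M : set algC) (A : seq algC) : number_field F -> subfield M ->
  (forall x, M x -> forall s : aut, fixes F s -> (forall y, y \in A -> s y = y) -> s x = x) ->
  number_field M.
Proof.
move=> nF sM h; have [B hB] := number_field_gen nF.
have [N nN hN] := nf_of_list (B ++ A).
apply: (number_field_sub nN sM) => x Mx; case: (nN) => sN _.
apply: (subfield_fix_seq sN hN) => s hs; apply: h => // [|y yA]; last by apply: hs; rewrite mem_cat yA orbT.
by apply: hB => y yB; apply: hs; rewrite mem_cat yB.
Qed.

Lemma nf_unit_code (F : set algC) (D : nf_data F) n : exists (T : finType) (d : algC -> T),
  forall y y', nf_unit F y -> nf_unit F y' -> d y = d y' -> exists2 z, nf_unit F z & y / y' = z ^+ n.+1.
Proof.
have [I [t tP]] := place_exists D; have [u uu u_lt] := mink_places D tP; have [i0 _] := place_inh D tP.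
have [T [c [m [m0 hcm]]]] := unit_covering D tP uu u_lt i0.
by eexists; eexists; exact: (unit_pow_code uu D m0 hcm (n' := n)).
Qed.

Section UnramifiedCharacter.
Variables (F : set algC) (nF : number_field F) (chi : aut -> algC) (hchi : unr_char F chi).
Let sF : subfield F. Proof. by case: nF. Qed.

Lemma uc_1 : chi 1%g = 1.
Proof. by have [A h] := uc_cont hchi; apply: h. Qed.

Lemma uc_mulV a : fixes F a -> chi a * chi (a^-1)%g = 1.
Proof. by move=> Fa; rewrite -(uc_M hchi) ?mulgV ?uc_1 //; exact: fixesV. Qed.

Lemma uc_neq0 a : fixes F a -> chi a != 0.
Proof. by move=> /uc_mulV h; apply/eqP => h0; move/eqP: h; rewrite h0 mul0r eq_sym oner_eq0. Qed.

Lemma uc_V a : fixes F a -> chi (a^-1)%g = (chi a)^-1.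
Proof. by move=> Fa; apply: (mulfI (uc_neq0 Fa)); rewrite uc_mulV // divff // uc_neq0. Qed.

Lemma uc_X a n : fixes F a -> chi (a ^+ n)%g = chi a ^+ n.
Proof.
move=> Fa; elim: n => [|n IH]; first by rewrite expg0 uc_1.
by rewrite expgS exprS (uc_M hchi) ?IH //; exact: fixesX.
Qed.

Lemma uc_agree : exists A : seq algC, forall a b, fixes F a -> fixes F b ->
  (forall x, x \in A -> a x = b x) -> chi a = chi b.
Proof.
have [A hA] := uc_cont hchi; exists A => a b Fa Fb e.
have : chi (b^-1 * a)%g = 1.
  apply: hA; first by apply: fixesM => //; exact: fixesV.
  by move=> x xA; rewrite autM e // autKV.
rewrite (uc_M hchi) ?uc_V //; last exact: fixesV.
by move=> h; apply: (mulfI (invr_neq0 (uc_neq0 Fb))); rewrite h mulVf // uc_neq0.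
Qed.

Definition kerF : set algC := [set x | forall a, fixes F a -> chi a = 1 -> a x = x]%classic.

Lemma kerF_sub : subfield kerF.
Proof.
split=> [a Fa _|x y hx hy a Fa ca|x y hx hy a Fa ca]; first by rewrite rmorph1.
  by rewrite rmorphB /= (hx a) ?(hy a).
by rewrite fmorph_div /= (hx a) ?(hy a).
Qed.

Lemma kerF_F x : F x -> kerF x. Proof. by move=> Fx a Fa _; exact: Fa. Qed.

Lemma kerF_nf : number_field kerF.
Proof.
have [A hA] := uc_cont hchi.
by apply: (fixed_number_field (A := A) nF kerF_sub) => x hx s Fs sA; apply: hx => //; exact: hA.
Qed.

(** The kernel is a priori only an abstract subgroup; continuity of chi shows that passing to its
    closure adds nothing. *)
Lemma kerF_fix a : fixes kerF a -> fixes F a /\ chi a = 1.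
Proof.
move=> h; have Fa : fixes F a by move=> x /kerF_F; exact: h.
split=> //; have [A hA] := uc_agree.
have gH : aut_group [set a | fixes F a /\ chi a = 1]%classic.
  split.
  - by split=> //; exact: uc_1.
  - move=> s t [s1 s2] [t1 t2]; split; first exact: fixesM.
    by rewrite (uc_M hchi) // s2 t2 mulr1.
  - move=> s [s1 s2]; split; first exact: fixesV.
    by rewrite uc_V // s2 invr1.
have [|h' [h1 h2] h3] := closure_agree (d := a) A gH; last by rewrite -(hA _ _ h1 Fa h3).
by move=> x hx; apply: h => b Fb cb; exact: hx.
Qed.

Lemma kerF_eq a b x : fixes F a -> fixes F b -> chi a = chi b -> kerF x -> a x = b x.
Proof.
move=> Fa Fb e hx; have : (b^-1 * a)%g x = x.
  apply: hx; first by apply: fixesM => //; exact: fixesV.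
  by rewrite (uc_M hchi) ?uc_V // ?e ?mulVf ?uc_neq0 //; exact: fixesV.
by move=> {2}<-; rewrite autM autVK.
Qed.

Lemma uc_cyc s N : fixes F s -> (0 < N)%N -> N.-primitive_root (chi s) ->
  (forall a, fixes F a -> exists k, chi a = chi s ^+ k) -> cyc F kerF s N.
Proof.
move=> Fs N0 pr gen.
have FX k := fixesX k Fs.
have ne1 k : (0 < k < N)%N -> chi (s ^+ k)%g != 1.
  move=> /andP[k0 kN]; rewrite uc_X //; apply/eqP => h.
  have : (N %| k)%N by rewrite (prim_order_dvd pr) h eqxx.
  by move=> /(dvdn_leq k0); rewrite leqNgt kN.
split=> //.
- exact: kerF_F.
- move=> x hx a Fa ca.
  have e : (s^-1 * a * s)%g x = x.
    apply: hx; first by apply: fixesM => //; apply: fixesM => //; exact: fixesV.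
    rewrite !(uc_M hchi) ?uc_V ?ca ?mulr1 ?mulVf ?uc_neq0 //; try exact: fixesV.
    by apply: fixesM => //; exact: fixesV.
  by rewrite -{2}e !autM autVK.
- move=> a Fa; have [k hk] := gen a Fa; exists (k %% N)%N; first by rewrite ltn_mod.
  by move=> x hx; apply: kerF_eq; rewrite ?uc_X // hk (prim_expr_mod pr).
- by move=> x hx; apply: hx => //; rewrite uc_X // prim_expr_order.
- move=> k hk; apply: contrapT => hn; case/eqP: (ne1 k hk).
  apply: (proj2 (@kerF_fix (s ^+ k)%g _)) => x hx; apply: contrapT => /eqP h.
  by apply: hn; exists x.
(* If s^k is trivial on the residues of the kernel field, reduction and reduction after s^k agree
   there, so s^k is congruent modulo P to some eta fixing that field. Then eta s^(-k) is an inertia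
   element, and chi is trivial both on it and on eta. *)
- move=> P k hP hk h; case/eqP: (ne1 k hk).
  have [|eta eta1 eta2] := @lift_hom kerF kerF_sub (residue hP) (to_res hP) (to_res hP \o zb_aut (s ^+ k)%g).
    by move=> z Mz; apply/to_resP/(prBC subfieldT hP); apply: h => //; exact: zb_int.
  have [Fe ce] := kerF_fix eta1.
  have : chi (eta * (s ^+ k)^-1)%g = 1.
    apply: (uc_fin hchi hP); first by apply: fixesM => //; exact: fixesV.
    move=> y yA; have := eta2 (zb_aut (s ^+ k)^-1%g (MkZb yA)).
    by move/to_resP => /=; rewrite autVK.
  rewrite (uc_M hchi) ?ce ?mul1r ?uc_V //; last exact: fixesV.
  by move/(congr1 GRing.inv); rewrite invrK invr1.
- move=> tau k hk h; case/eqP: (ne1 k hk).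
  have [Fe ce] : fixes F ((s ^+ k)^-1 * (tau^-1 * cj * tau))%g /\ chi ((s ^+ k)^-1 * (tau^-1 * cj * tau))%g = 1.
    apply: kerF_fix => x Mx.
    by rewrite !autM cjE -h // autKV autKV.
  have bE : (tau^-1 * cj * tau^-1^-1)%g = ((s ^+ k) * ((s ^+ k)^-1 * (tau^-1 * cj * tau)))%g.
    by rewrite mulKVg invgK.
  have : chi (tau^-1 * cj * tau^-1^-1)%g = 1.
    by apply: (uc_arch hchi); rewrite bE; exact: fixesM.
  by rewrite bE (uc_M hchi) // ce mulr1.
Qed.

(* All values are roots of unity of p-power order, and there are finitely many of them;
   one of maximal order generates. *)
Lemma uc_generator p : prime p -> (forall a, fixes F a -> exists n, chi a ^+ (p ^ n) = 1) ->
  exists n s, [/\ fixes F s, (p ^ n).-primitive_root (chi s) & forall a, fixes F a -> exists k, chi a = chi s ^+ k].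
Proof.
move=> pp ht; have [A hA] := uc_agree.
have /choice [e he] (l : seq algC) : exists n, forall a, fixes F a -> map a A = l -> chi a ^+ (p ^ n) = 1.
  have [[a Fa al]|n] := pselect (exists2 a, fixes F a & map a A = l); last by exists 0%N => a Fa al; case: n; exists a.
  have [n hn] := ht a Fa; exists n => b Fb bl; rewrite (hA _ a Fb Fa) // => x xA.
  by apply: (eq_in_map b a A).2 => //; rewrite al bl.
have ex0 : exists n, `[< forall a, fixes F a -> chi a ^+ (p ^ n) = 1 >].
  exists (\max_(l <- conj_lists A) e l)%N; apply/asboolP => a Fa.
  have le : (e (map a A) <= \max_(l <- conj_lists A) e l)%N by apply: (leq_bigmax_seq (map a A)) => //; exact: map_conj_lists.
  by rewrite -(subnKC le) expnD exprM he // expr1n.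
case: (ex_minnP ex0) => n /asboolP hn nmin.
have [n0|n0] := posnP n.
  exists 0%N, 1%g; split=> // [|a Fa]; first by rewrite uc_1 expn0; have [m hm] := @prim_order_exists _ 1 (1 : algC) isT (expr1 1); rewrite dvdn1 => /eqP <-.
  by exists 0%N; rewrite expr0; have := hn a Fa; rewrite n0 expn0 expr1.
have [s Fs hs] : exists2 s, fixes F s & chi s ^+ (p ^ n.-1) != 1.
  apply: contrapT => hh; have := nmin n.-1; rewrite leqNgt ltn_predL n0 => /(_ _)/negP; apply => //.
  by apply/asboolP => a Fa; apply: contrapT => /eqP h; apply: hh; exists a.
exists n, s; have pr : (p ^ n).-primitive_root (chi s).
  have pn0 : (0 < p ^ n)%N by rewrite expn_gt0 prime_gt0.
  have [m hm dm] := prim_order_exists pn0 (hn s Fs).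
  have /(dvdn_pfactor _ _ pp) [j jn em] := dm.
  have [jn'|nj] := ltnP j n; last by have -> : n = j; [apply/eqP; rewrite eqn_leq nj | rewrite -em].
  case/eqP: hs; have /dvdnP [q ->] : (m %| p ^ n.-1)%N by rewrite em dvdn_exp2l //; lia.
  by rewrite mulnC exprM (prim_expr_order hm) expr1n.
split=> // a Fa; have [k ->] := prim_rootP pr (hn a Fa); by exists k.
Qed.
End UnramifiedCharacter.

(** The values of chi form a cyclic group of order p^n, and p^n is the degree of an unramified
    cyclic extension of F. A bound C on p^n also bounds n. *)
Lemma unr_char_bound p (F : set algC) : prime p -> number_field F ->
  exists C : nat, forall chi, unr_char F chi -> (forall a, fixes F a -> exists n, chi a ^+ (p ^ n) = 1) ->
  forall a, fixes F a -> chi a ^+ (p ^ C) = 1.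
Proof.
move=> pp nF; have [D _] := nf_exists nF; have [C hC] := hilbert94 D.
exists C => chi hchi ht a Fa.
have [n [s [Fs pr gen]]] := uc_generator hchi pp ht.
have pn0 : (0 < p ^ n)%N by rewrite expn_gt0 prime_gt0.
have hcyc := uc_cyc nF hchi Fs pn0 pr gen.
have [DM _] := nf_exists (kerF_nf nF hchi).
have le : (n <= C)%N by apply: leq_trans (hC _ DM _ _ hcyc); apply: ltnW; apply: ltn_expl; exact: prime_gt1.
have [k ->] := gen a Fa.
by rewrite exprAC -(subnKC le) expnD exprM (prim_expr_order pr) !expr1n.
Qed.

(** [chi s] is a p-th root of unity in F, hence of norm 1, so Hilbert 90 writes it as s b / b. As
    this is a unit the ideal of b is stable, and it comes from F because the kernel field is
    unramified. The trivial character is generated by 1. *)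
Lemma kummer_gen p (F : set algC) (chi : aut -> algC) : prime p -> number_field F ->
  (exists2 z, F z & p.-primitive_root z) -> unr_char F chi -> (forall a, fixes F a -> chi a ^+ p = 1) ->
  exists b, [/\ b != 0, nf_ideal F (contr F b), gen_contr F b, F (b ^+ p) & forall a, fixes F a -> a b = chi a * b].
Proof.
move=> pp nF [z Fz pz] hchi hp; have sF : subfield F by case: nF.
have [[s Fs hs]|triv] := pselect (exists2 s, fixes F s & chi s != 1); last first.
  exists 1; split; rewrite ?oner_neq0 ?expr1n //; last first.
  - move=> a Fa; rewrite rmorph1 mulr1; apply: contrapT => h; apply: triv.
    by exists a => //; apply/eqP => h'; apply: h; rewrite h'.
  - exact: sf1.
  - exists [:: (1, 1)]; rewrite big_seq1 mulr1; split=> // u; rewrite inE => /eqP -> /=; split; first exact: rpred1.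
    by split; rewrite ?divr1 ?rpred1 //; exact: sf1.
  - split=> [x []|||] //; first by exists 1; rewrite ?oner_neq0 //; split; rewrite ?divr1 ?rpred1 //; exact: sf1.
      by move=> x y [x1 x2 x3] [y1 y2 y3]; split; rewrite ?mulrDl ?rpredD //; exact: (sfD sF).
    by move=> b x b1 b2 [x1 x2 x3]; split; [exact: (sfM sF) | by rewrite rpredM | by rewrite -mulrA rpredM].
have pr : p.-primitive_root (chi s).
  have [m hm] := prim_order_exists (prime_gt0 pp) (hp s Fs).
  have [m1|m1] := eqVneq m 1%N; last first.
    by move/(primeP pp).2 => /orP[|/eqP <- //]; rewrite (negPf m1).
  by case/eqP: hs; have := prim_expr_order hm; rewrite m1 expr1.
have gen a : fixes F a -> exists k, chi a = chi s ^+ k.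
  by move=> Fa; have [k ->] := prim_rootP pr (hp a Fa); exists k.
have hc := uc_cyc nF hchi Fs (prime_gt0 pp) pr gen.
have [D _] := nf_exists (kerF_nf nF hchi).
have Fchi a : fixes F a -> F (chi a).
  by move=> Fa; have [k ->] := prim_rootP pz (hp a Fa); exact: (sfX sF).
have nu : cyc_norm s p (chi s) = 1.
  rewrite /cyc_norm (eq_bigr (fun=> chi s)) ?prodr_const ?card_ord ?hp // => k _.
  by rewrite (sg_fix hc) //; exact: Fchi.
have [b [Mb bA b0 sb]] := hilbert90 D hc (@kerF_F F chi (chi s) (Fchi s Fs)) nu.
have ab a : fixes F a -> a b = chi a * b.
  move=> Fa; have [k ek] := gen a Fa.
  rewrite (@kerF_eq F chi hchi a (s ^+ k)%g b Fa) ?(uc_X hchi) //; last exact: fixesX.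
  rewrite ek; elim: k {ek} => [|j IH]; first by rewrite expr0 mul1r.
  rewrite expgS autM IH rmorphM rmorphXn /= (Fs _ (Fchi s Fs)) exprSr -mulrA; congr (_ * _).
  by rewrite [in RHS]sb /cphi divfK // fmorph_eq0.
have amb_b : amb (kerF F chi) s b.
  split=> //; rewrite -sb; apply: (Aint_unity_root (prime_gt0 pp)); apply/unity_rootP; exact: hp.
exists b; split=> //.
- exact: (contr_ideal D hc).
- exact: (amb_gen D hc).
- by apply: (subfield_fix sF) => a Fa; rewrite rmorphXn /= ab // exprMn hp // mul1r.
Qed.

Lemma kum_pow (a b e : algC) n : a ^+ n / b ^+ n = e ^+ n -> e != 0 -> (a / b / e) ^+ n = 1.
Proof. by move=> h e0; rewrite !expr_div_n h divff // expf_neq0. Qed.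

Lemma kum_id (b b' c c' q e : algC) : b' != 0 -> c != 0 -> c' != 0 -> q != 0 -> e != 0 ->
  b = b / (c * q) / (b' / (c' * q)) / e * e * c / c' * b'.
Proof. by move=> *; field; apply/and5P. Qed.

(** A Kummer generator b of chi is classified by the ideal class of its contraction and, with q a
    representative of that class and c in F relating the two, by the unit (b / (c q))^p modulo p-th
    powers. When both agree, b / b' lies in F, since F contains the p-th roots of unity. *)
Lemma unr_char_finite p (F : set algC) : prime p -> number_field F ->
  (exists2 z, F z & p.-primitive_root z) ->
  exists (T : finType) (code : (aut -> algC) -> T), forall chi chi',
    unr_char F chi -> unr_char F chi' -> (forall a, fixes F a -> chi a ^+ p = 1) ->
    (forall a, fixes F a -> chi' a ^+ p = 1) -> code chi = code chi' ->
    forall a, fixes F a -> chi a = chi' a.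
Proof.
move=> pp nF hz; have sF : subfield F by case: nF.
have [z Fz pz] := hz.
have [D _] := nf_exists nF; have [Tcl [cls hcls]] := class_number D.
have [TU [d hd]] := nf_unit_code D p.-1; rewrite (prednK (prime_gt0 pp)) in hd.
pose ok chi b := [/\ b != 0, nf_ideal F (contr F b), gen_contr F b, F (b ^+ p) & forall a, fixes F a -> a b = chi a * b].
pose uok chi := unr_char F chi /\ forall a, fixes F a -> chi a ^+ p = 1.
have /choice [bb hbb] (chi : aut -> algC) : exists b, uok chi -> ok chi b.
  by have [[h1 h2]|n] := pselect (uok chi); [have [b hb] := kummer_gen pp nF hz h1 h2; exists b | exists 0 => /n].
have /choice [rep hrep] (h : Tcl) : exists b, (exists2 chi, uok chi & cls (contr F (bb chi)) = h) ->
    (exists chi, ok chi b) /\ cls (contr F b) = h.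
  have [[chi h1 h2]|n] := pselect (exists2 chi, uok chi & cls (contr F (bb chi)) = h); last by exists 0 => /n.
  by exists (bb chi) => _; split=> //; exists chi; exact: hbb.
pose q chi := rep (cls (contr F (bb chi))).
have /choice [c hcc] (chi : aut -> algC) : exists c, uok chi -> [/\ F c, c != 0, (exists chi', ok chi' (q chi)) &
    nf_unit F ((bb chi / (c * q chi)) ^+ p)].
  have [u|n] := pselect (uok chi); last by exists 0 => /n.
  have [b0 b1 b2 b3 b4] := hbb _ u.
  have [[chi' [r0 r1 r2 r3 r4]] er] : (exists chi', ok chi' (q chi)) /\ cls (contr F (q chi)) = cls (contr F (bb chi)).
    by apply: hrep; exists chi.
  have [c [Fc c0 hcc]] := hcls _ _ r1 b1 er.
  have [u1 u2] := gen_class r2 b2 c0 hcc; exists c => _; split=> //; first by exists chi'.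
  split; rewrite ?rpredX // -?exprVn ?rpredX //; last by rewrite expf_neq0 // mulf_neq0 ?invr_neq0 ?mulf_neq0.
  rewrite expr_div_n exprMn; apply: (sf_div sF) => //; apply: (sfM sF) => //; exact: (sfX sF).
exists (Tcl * TU)%type, (fun chi => (cls (contr F (bb chi)), d ((bb chi / (c chi * q chi)) ^+ p))).
move=> chi chi' h1 h1' h2 h2' [e1 e2] a Fa.
have u : uok chi by []. have u' : uok chi' by [].
have [Fc c0 [chi0 [r0 _ _ _ _]] uu] := hcc _ u; have [Fc' c'0 _ uu'] := hcc _ u'.
have [eta [Feta _ _ eta0] he] := hd _ _ uu uu' e2.
have eq : q chi = q chi' by rewrite /q e1.
have [b0 _ _ _ hb] := hbb _ u; have [b'0 _ _ _ hb'] := hbb _ u'.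
have [i hi] : exists i : nat, bb chi / (c chi * q chi) / (bb chi' / (c chi' * q chi')) / eta = z ^+ i.
  by have [i hi] := prim_rootP pz (kum_pow he eta0); exists i.
have [f Ff ef] : exists2 f, F f & bb chi = f * bb chi'.
  exists (z ^+ i * eta * c chi / c chi'); last first.
    rewrite -hi -eq; exact: (kum_id _ b'0 c0 c'0 r0 eta0).
  by apply: (sf_div sF) => //; do 2?apply: (sfM sF) => //; exact: (sfX sF).
have := hb a Fa; rewrite {1}ef rmorphM /= (Fa _ Ff) hb' // mulrCA -ef => /(mulIf b0) ->.
by [].
Qed.

(** * Restriction of automorphisms, and the group Z_p *)

Lemma aut_restrict (F M : set algC) (s : aut) : subfield M -> (forall x, F x -> M x) -> fixes F s ->
  (forall x, M x -> M (s x)) -> (forall x, M x -> M ((s^-1)%g x)) ->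
  exists g : gal F M, forall x, M x -> g x = s x.
Proof.
move=> sM FM Fs st stV.
pose f (t : aut) x := if pselect (M x) then t x else x.
have fE t x : M x -> f t x = t x by rewrite /f; case: pselect.
have fN t x : ~ M x -> f t x = x by rewrite /f; case: pselect.
unshelve eexists.
  exists (f s) (f (s^-1)%g).
  - move=> x; have [Mx|nMx] := pselect (M x); last by rewrite !fN.
    by rewrite (fE s) // fE ?autKV //; exact: st.
  - move=> x; have [Mx|nMx] := pselect (M x); last by rewrite !fN.
    by rewrite (fE (s^-1)%g) // fE ?autVK //; exact: stV.
  - move=> x; have [Mx|nMx] := pselect (M x); last by rewrite fN.
    by rewrite fE //; split=> // _; exact: st.
  - by move=> x; exact: fN.
  - by move=> x Fx; rewrite fE ?Fs //; exact: FM.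
  - by move=> x y Mx My; rewrite !fE ?rmorphD //; exact: (sfD sM).
  - by move=> x y Mx My; rewrite !fE ?rmorphM //; exact: (sfM sM).
by move=> x Mx /=; exact: fE.
Qed.

Section Restriction.
Variables (F M : set algC) (hG : galois F M).
Let sF : subfield F. Proof. by case: hG. Qed.
Let sM : subfield M. Proof. by case: hG. Qed.
Let FM x : F x -> M x. Proof. by case: hG => _ _ h _; exact: h. Qed.
Local Notation gal := (gal F M).

Lemma gal1 (g : gal) : g 1 = 1. Proof. by apply: gal_base; exact: sf1. Qed.
Lemma gal0 (g : gal) : g 0 = 0. Proof. by apply: gal_base; exact: sf0. Qed.

Lemma galX (g : gal) x n : M x -> g (x ^+ n) = g x ^+ n.
Proof.
move=> Mx; elim: n => [|n IH]; first by rewrite !expr0 gal1.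
by rewrite !exprS gal_mul ?IH //; exact: (sfX sM).
Qed.

Lemma gal_sum (g : gal) I (r : seq I) (f : I -> algC) : (forall i, M (f i)) ->
  g (\sum_(i <- r) f i) = \sum_(i <- r) g (f i).
Proof.
move=> h; elim: r => [|i r IH]; first by rewrite !big_nil gal0.
by rewrite !big_cons gal_add ?IH //; apply: (sf_sum sM).
Qed.

Lemma gal_horner (g : gal) (q : {poly rat}) x : M x ->
  g (map_poly ratr q).[x] = (map_poly ratr q).[g x].
Proof.
move=> Mx; rewrite !horner_coef size_map_poly gal_sum; last first.
  by move=> i; apply: (sfM sM); [rewrite coef_map; exact: (sf_rat sM)|exact: (sfX sM)].
apply: eq_bigr => i _; rewrite coef_map gal_mul ?galX //; last exact: (sfX sM).
  by rewrite (gal_base g) //; exact: (sf_rat sF).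
exact: (sf_rat sM).
Qed.

Lemma gal_conjugate (g : gal) x : M x -> g x \in conjugates x.
Proof.
move=> Mx; have [q [qE _] _] := minCpolyP x.
rewrite conjugatesP qE rootE -gal_horner // -qE.
by have /rootP -> := root_minCpoly x; rewrite gal0.
Qed.

(** On a finite list an element of the Galois group is realised through a primitive element, whose
    image is one of its conjugates; compactness passes to all of M. *)
Lemma glift (g : gal) : exists2 s : aut, fixes F s & forall x, M x -> s x = g x.
Proof.
pose C (A : seq algC) := [set s : aut | forall x, x \in A -> M x -> s x = g x]%classic.
have [|A B AB s hs x xA|s hs] := @aut_compact C.
- move=> A; have [N nN hN] := nf_of_list A.
  have sN : subfield N by case: nN.
  have nNM : number_field [set x | N x /\ M x]%classic.
    apply: (number_field_sub nN) => [|x []//]; split; first by split; exact: sf1.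
      by move=> x y [? ?] [? ?]; split; [exact: (sfB sN)|exact: (sfB sM)].
    by move=> x y [? ?] [? ?]; split; [exact: (sf_div sN)|exact: (sf_div sM)].
  have [D _] := nf_exists nNM; have [_ Mz] := nf_zM D.
  have [s hs] := conjugates_emb (gal_conjugate g Mz).
  exists s => x xA Mx; have [c ->] := nf_gen D (conj (hN x xA) Mx).
  have Mr i : M (ratr (c i)) by exact: (sf_rat sM).
  rewrite gal_sum => [|i]; last by apply: (sfM sM) => //; exact: (sfX sM).
  rewrite rmorph_sum; apply: eq_bigr => i _; rewrite gal_mul ?galX //; last exact: (sfX sM).
  have gr : g (ratr (c i)) = ratr (c i) by apply: gal_base; exact: (sf_rat sF).
  by rewrite rmorphM rmorphXn /= hs aut_rat gr.
- by apply: hs; exact: AB.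
have sg x : M x -> s x = g x.
  move=> Mx; have [s' hs' e] := hs [:: x] [:: x].
  by rewrite -e ?inE // hs' ?inE.
by exists s => // x Fx; rewrite sg ?(gal_base g) //; exact: FM.
Qed.

(* The conjugates over F of an element of M form a finite set permuted by [gal F M], so the
   polynomial with these roots has coefficients in F. *)
Lemma galois_stable (s : aut) x : fixes F s -> M x -> M (s x).
Proof.
move=> Fs Mx; pose r := [seq y <- undup (conjugates x) | `[< exists g : gal, y = g x >]].
have rP y : y \in r <-> exists g : gal, y = g x.
  rewrite mem_filter mem_undup; split; first by case/andP => /asboolP.
  by move=> [g ->]; apply/andP; split; [apply/asboolP; exists g | exact: gal_conjugate].
have Mr y : y \in r -> M y by move=> /rP [g ->]; exact: (proj1 (gal_stab g x) Mx).
have hgr (g : gal) : perm_eq (map g r) r.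
  have ur : uniq r by rewrite filter_uniq // undup_uniq.
  apply: uniq_perm => //; first by rewrite map_inj_uniq //; exact: (can_inj (gal_funK g)).
  move=> y; apply/mapP/idP => [[z /rP [g' ->] ->]|/rP [g' ->]].
    by apply/rP; exists (g * g')%g.
  by exists ((g^-1 * g')%g x); [apply/rP; exists (g^-1 * g')%g | rewrite -[RHS]/((g * (g^-1 * g'))%g x) mulKVg].
pose f := \prod_(y <- r) ('X - y%:P).
have Mf i : M f`_i.
  rewrite /f; elim: (r) Mr i => [|y r' IH] Mr' i.
    by rewrite big_nil coef1; case: eqP => _; [exact: sf1 | exact: sf0].
  have {}IH j : M (\prod_(y <- r') ('X - y%:P))`_j.
    by apply: IH => y0 yr; apply: Mr'; rewrite inE yr orbT.
  rewrite big_cons mulrBl coefB coefXM coefCM; apply: (sfB sM).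
    by case: eqP => // _; exact: sf0.
  by apply: (sfM sM) => //; apply: Mr'; rewrite mem_head.
have Ff i : F f`_i.
  case: hG => _ _ _ hfix; apply: hfix => // g.
  have [h Fh hg] := glift g; rewrite -hg // -coef_map /=; suff -> : map_poly h f = f by [].
  rewrite /f rmorph_prod; apply: etrans (perm_big _ (hgr g)); rewrite big_map !big_seq.
  by apply: eq_bigr => y yr; rewrite rmorphB /= map_polyX map_polyC /= hg //; exact: Mr.
have sf : map_poly s f = f by apply/polyP => i; rewrite coef_map /= Fs.
have xr : x \in r by apply/rP; exists 1%g.
have : root f (s x).
  rewrite -sf fmorph_root /f root_prod_XsubC //.
by rewrite /f root_prod_XsubC; exact: Mr.
Qed.

Lemma gres_ex (s : aut) : fixes F s -> exists g : gal, forall x, M x -> g x = s x.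
Proof.
by move=> Fs; apply: aut_restrict => // x; apply: galois_stable => //; exact: fixesV.
Qed.

Definition gres (s : aut) (Fs : fixes F s) : gal := projT1 (cid (gres_ex Fs)).
Lemma gresE (s : aut) (Fs : fixes F s) x : M x -> gres Fs x = s x.
Proof. exact: (projT2 (cid (gres_ex Fs)) x). Qed.

Lemma gal_eqP (g h : gal) : (forall x, M x -> g x = h x) -> g = h.
Proof.
move=> e; apply: gal_ext => x; have [Mx|nMx] := pselect (M x); first exact: e.
by rewrite !gal_out.
Qed.

Lemma gresM (s t : aut) (Fs : fixes F s) (Ft : fixes F t) (Fst : fixes F (s * t)%g) :
  gres Fst = (gres Fs * gres Ft)%g.
Proof.
apply: gal_eqP => x Mx; rewrite gresE // -[RHS]/(gres Fs (gres Ft x)) !gresE //.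
exact: galois_stable.
Qed.

Lemma gres_irr (s t : aut) (Fs : fixes F s) (Ft : fixes F t) :
  (forall x, M x -> s x = t x) -> gres Fs = gres Ft.
Proof. by move=> e; apply: gal_eqP => x Mx; rewrite !gresE // e. Qed.

End Restriction.

Section PadicValues.
Variables (p : nat) (pp : prime p).
Local Notation Zp := (Zp p).

Lemma Zp_mod n : (Zp_trunc (p ^ n.+1)).+2 = (p ^ n.+1)%N.
Proof. by rewrite Zp_cast // -(exp1n n.+1) ltn_exp2r // prime_gt1. Qed.

Lemma Zp_val_lt (a : Zp) n : (a n < p ^ n.+1)%N.
Proof. by rewrite -{2}(Zp_mod n). Qed.

Lemma Zp_val_mod (a : Zp) n N : (n <= N)%N -> (a n : nat) = (a N %% p ^ n.+1)%N.
Proof.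
move=> /subnKC <-; elim: (N - n)%N => [|k IH]; first by rewrite addn0 modn_small // Zp_val_lt.
have e : (a (n + k)%N : nat) = (a (n + k).+1 %% p ^ (n + k).+1)%N.
  by rewrite -(Zp_compat a (n + k)) /=; congr (_ %% _)%N; exact: Zp_mod.
by rewrite IH addnS e modn_dvdm // dvdn_exp2l //; lia.
Qed.

Lemma Zp_seq0 (a : Zp) n : a n = 0 <-> (a n : nat) = 0%N.
Proof. by split=> [->|h] //; apply: val_inj. Qed.

Lemma Zp_dvd (a : Zp) n N : (n <= N)%N -> a n = 0 <-> (p ^ n.+1 %| a N)%N.
Proof. by move=> nN; rewrite Zp_seq0 (Zp_val_mod a nN) /dvdn; split=> /eqP. Qed.

Lemma Zp_le0 (a : Zp) n N : (n <= N)%N -> a N = 0 -> a n = 0.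
Proof. by move=> nN h; apply/(Zp_dvd a nN); rewrite h dvdn0. Qed.

Lemma Zp_neq0 (a : Zp) : a <> 0 -> exists n, a n <> 0.
Proof.
move=> h; apply: contrapT => /forallNP h'; apply: h; apply: Zp_ext => n.
by apply: contrapT => /h'.
Qed.

Lemma Zp_natE (m : nat) n : (m%:R : Zp) n = m%:R.
Proof. by elim: m => [//|m IH]; rewrite [in LHS]mulrS [in RHS]mulrS -IH. Qed.

Lemma Zp_quot (a b : Zp) v : b v <> 0 -> a v = 0 -> forall N, exists m : nat, a N = b N *+ m.
Proof.
move=> bv av N; have [Nv|vN] := leqP N v.
  by exists 0%N; rewrite (Zp_le0 Nv av).
have q0 : (0 < p ^ N.+1)%N by rewrite expn_gt0 prime_gt0.
have [a' _ ha'] := Bezoutl (b N) q0.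
have /(dvdn_pfactor _ _ pp) [e eN eg] := dvdn_gcdl (p ^ N.+1) (b N).
have ev : (e <= v)%N.
  rewrite leqNgt; apply/negP => ve; apply: bv; apply/(Zp_dvd b (ltnW vN)).
  by apply: dvdn_trans (dvdn_gcdr (p ^ N.+1) (b N)); rewrite eg dvdn_exp2l.
have /dvdnP [c ac] : (gcdn (p ^ N.+1) (b N) %| a N)%N.
  rewrite eg; apply: dvdn_trans ((Zp_dvd a (ltnW vN)).1 av); rewrite dvdn_exp2l //; lia.
have q1 : (1 < p ^ N.+1)%N by rewrite -Zp_mod.
have zero (x : nat) : (p ^ N.+1 %| x)%N -> x%:R = 0 :> 'Z_(p ^ N.+1).
  by move=> d; apply: val_inj; rewrite /= (val_Zp_nat q1); apply/eqP.
have h1 : (gcdn (p ^ N.+1) (b N))%:R = - (b N) *+ a' :> 'Z_(p ^ N.+1).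
  have := zero _ ha'; rewrite natrD => /eqP; rewrite addr_eq0 => /eqP ->.
  by rewrite natrM natr_Zp mulrC mulr_natr mulNrn.
have h2 : a N = - (b N) *+ (a' * c).
  by rewrite -[LHS]natr_Zp ac natrM h1 mulr_natl mulrnA.
exists (a' * c * (p ^ N.+1).-1)%N.
have hm : (- (b N) : 'Z_(p ^ N.+1)) = b N *+ (p ^ N.+1).-1.
  apply/eqP; rewrite eq_sym -addr_eq0 -mulrSr prednK // -mulr_natr zero ?mulr0 //.
by rewrite h2 hm -mulrnA mulnC.
Qed.
End PadicValues.

Section ZpExtension.
Variables (p : nat) (pp : prime p) (k : set algC) (K : Zp_extension p k).
Local Notation Gam := (gal k K).
Variables (phi : Gam -> Zp p) (hphi : topological_iso_Zp phi).

Lemma phi_inj : injective phi. Proof. by case: hphi => /bij_inj. Qed.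
Lemma phiM s t : phi (s * t)%g = phi s + phi t. Proof. by case: hphi. Qed.
Lemma phi1 : phi 1%g = 0. Proof. by apply: (addrI (phi 1%g)); rewrite -phiM mulg1 addr0. Qed.
Lemma phiV s : phi (s^-1)%g = - phi s.
Proof. by apply: (addrI (phi s)); rewrite -phiM mulgV phi1 subrr. Qed.
Lemma phiX s n : phi (s ^+ n)%g = phi s *+ n.
Proof. by elim: n => [|n IH]; rewrite ?expg0 ?phi1 // expgS phiM IH mulrS. Qed.
Lemma phi_open n : exists2 A : seq algC, (forall x, x \in A -> ext_field K x) & forall s : Gam, gal_fixing A s -> phi s n = 0.
Proof. by case: hphi. Qed.
Lemma phi_cont (A : seq algC) : (forall x, x \in A -> ext_field K x) -> exists n, forall s : Gam, phi s n = 0 -> gal_fixing A s.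
Proof. by case: hphi => _ _ _ h; exact: h. Qed.
Lemma phi_neq0 s : s <> 1%g -> exists n, phi s n <> 0.
Proof. by move=> h; apply: (Zp_neq0 (p := p)) => h'; apply: h; apply: phi_inj; rewrite h' phi1. Qed.

Lemma Zp_subE (a b : Zp p) n : (a - b) n = a n - b n. Proof. by []. Qed.
Lemma Zp_mulrnE (a : Zp p) m n : (a *+ m) n = a n *+ m.
Proof. by elim: m => [//|m IH]; rewrite [in LHS]mulrS [in RHS]mulrS -IH. Qed.

Lemma phi_agree (A : seq algC) : (forall x, x \in A -> ext_field K x) -> exists n, forall s t : Gam,
  phi s n = phi t n -> forall x, x \in A -> s x = t x.
Proof.
move=> hA; have [n hn] := phi_cont hA; exists n => s t e x xA.
have h : phi (t^-1 * s)%g n = 0.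
  by rewrite phiM phiV addrC Zp_subE e subrr.
have := hn _ h x xA; rewrite -[LHS]/(gal_inv t (s x)) => {2}<-.
by rewrite gal_invK.
Qed.

Lemma gam_pow_dense (h : Gam) v : phi h v <> 0 -> forall s : Gam, phi s v = 0 ->
  forall A : seq algC, (forall x, x \in A -> ext_field K x) -> exists m, forall x, x \in A -> s x = (h ^+ m)%g x.
Proof.
move=> hv s sv A hA; have [n hn] := phi_agree hA.
have [m hm] := Zp_quot pp hv sv n; exists m; apply: hn.
by rewrite phiX Zp_mulrnE.
Qed.

Lemma gam_generator (g : Gam) : phi g = 1 -> forall (s : Gam) (A : seq algC),
  (forall x, x \in A -> ext_field K x) -> exists m, forall x, x \in A -> s x = (g ^+ m)%g x.
Proof.
move=> g1 s A hA; have [n hn] := phi_agree hA; exists (phi s n : nat); apply: hn.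
by rewrite phiX g1 Zp_natE natr_Zp.
Qed.

Lemma gam_torsion_free (s : Gam) n : (0 < n)%N -> (s ^+ n)%g = 1%g -> s = 1%g.
Proof.
move=> n0 sn; apply: phi_inj; rewrite phi1; apply: Zp_ext => i.
pose v := logn p n.
have : phi (s ^+ n)%g (i + v)%N = 0 by rewrite sn phi1.
rewrite phiX Zp_mulrnE => h0; apply/(Zp_dvd pp _ (leq_addr v i)).
have h : (p ^ (i + v).+1 %| phi s (i + v)%N * n)%N.
  have q1 : (1 < p ^ (i + v).+1)%N by rewrite -(Zp_mod pp).
  have : (phi s (i + v)%N * n)%N%:R = 0 :> 'Z_(p ^ (i + v).+1) by rewrite natrM natr_Zp mulr_natr.
  by move/(congr1 val); rewrite /= (val_Zp_nat q1) => /eqP.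
have [m cm en] := pfactor_coprime pp n0.
set x := (phi s (i + v)%N : nat) in h *; clearbody x.
move: h; rewrite en -/v mulnA -addSn expnD dvdn_pmul2r ?expn_gt0 ?prime_gt0 //.
by rewrite mulnC Gauss_dvdr // coprimeXl.
Qed.
End ZpExtension.

#[local] Hint Resolve subfieldT : core.

(** * Inertia at the primes not above p *)

Section TamePrime.
Variables (P : set algC) (hP : prime_of [set: algC]%classic P).
Local Notation T := (fun x : algC => I : [set: algC]%classic x).

(** If z is not 1, the sum of the z^i for i < p^n is 0, but it is congruent to p^n modulo P. *)
Lemma pr_unity_eq1 p n (z : algC) : ~ P p%:R -> (0 < p)%N -> z ^+ (p ^ n) = 1 -> P (z - 1) -> z = 1.
Proof.
move=> np p0 zn hz; apply: contrapT => /eqP z1; apply: np.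
have zA : z \in Aint by apply: (@Aint_unity_root (p ^ n)); rewrite ?expn_gt0 ?p0 //; exact/unity_rootP.
have s0 : \sum_(i < p ^ n) z ^+ i = 0.
  have := subrX1 z (p ^ n); rewrite zn subrr => /esym /eqP; rewrite mulf_eq0 subr_eq0 (negPf z1) => /eqP //.
have : P ((p ^ n)%:R - \sum_(i < p ^ n) z ^+ i).
  rewrite -[X in X%:R](card_ord (p ^ n)) -sumr_const -sumrB; apply: (pr_sum subfieldT hP) => i _.
  apply: (prBC subfieldT hP); rewrite -[X in P (_ - X)](expr1n _ i).
  by apply: (pr_congX subfieldT hP) => //; exact: rpred1.
rewrite s0 subr0 natrX; apply: (prX subfieldT hP) => //; exact: rpred_nat.
Qed.

Lemma pr_resid_char l : P l%:R -> prime l -> l \in [pchar (residue hP)].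
Proof.
move=> Pl pl; rewrite inE pl /=; apply/eqP.
have -> : l%:R = to_res hP (l%:R : Zb) by rewrite rmorph_nat.
rewrite -(rmorph0 (to_res hP)); apply/to_resP.
by rewrite -[val]/zb_val rmorph_nat rmorph0 subr0.
Qed.

Lemma pr_intP l (c : int) : P l%:R -> prime l -> P c%:~R -> (l%:Z %| c)%Z.
Proof.
move=> Pl pl Pc; rewrite (dvdz_pcharf (pr_resid_char Pl pl)); apply/eqP.
have -> : c%:~R = to_res hP (c%:~R : Zb) by rewrite rmorph_int.
rewrite -(rmorph0 (to_res hP)); apply/to_resP.
by rewrite -[val]/zb_val rmorph_int rmorph0 subr0.
Qed.

(** The product of the Galois conjugates of f is monic with coefficients in Z. *)
Lemma Aint_monic (f : {poly algC}) w : f \is monic -> (forall i, f`_i \in Aint) -> root f w -> w \in Aint.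
Proof.
move=> mf hf rf; pose H := [set: aut]%classic; pose A : seq algC := f.
have gH : aut_group H by [].
pose G := \prod_(l <- orbit_list H A) Poly l.
have Al l : l \in orbit_list H A -> exists h : aut, Poly l = map_poly h f.
  by move=> /orbit_listP [h _ ->]; exists h; rewrite -map_Poly polyseqK.
have rG : root G w.
  have sA : A \in orbit_list H A by apply/orbit_listP; exists 1%g; rewrite // map_id.
  by rewrite /G (perm_big _ (perm_to_rem sA)) big_cons /A polyseqK rootM rf.
have mG : G \is monic.
  rewrite /G big_seq; apply: monic_prod => l /Al [h ->]; exact: monic_map.
have fG (s : aut) : map_poly s G = G.
  rewrite /G rmorph_prod; apply: etrans (perm_big _ (orbit_list_perm A gH (I : H s))).
  by rewrite big_map; apply: eq_bigr => l _; exact: map_Poly.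
apply: (root_monic_Aint rG mG); apply/polyOverP => i.
have iA : G`_i \in Aint.
  have : G \is a polyOver Aint.
    rewrite /G big_seq; apply: rpred_prod => l /Al [h ->]; apply/polyOverP => j.
    by rewrite coef_map aut_Aint.
  by move/polyOverP.
apply: Cint_rat_Aint => //; apply: Crat_fix => s.
by rewrite -[in RHS](fG s) coef_map.
Qed.

(** This is why the localisation at P is a valuation ring. The leading coefficient times w is
    integral; if both it and the leading coefficient lie in P, absorbing the leading term into the
    next coefficient lowers the degree and keeps a coefficient outside P. *)
Lemma val_quot_coef d : forall (c : nat -> algC) w, (forall i, c i \in Aint) ->
  \sum_(i < d.+1) c i * w ^+ i = 0 -> (exists2 i, (i <= d)%N & ~ P (c i)) ->
  exists x y, [/\ x \in Aint, y \in Aint, w * y = x & ~ P x \/ ~ P y].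
Proof.
elim: d => [|d IH] c w cA s0 [i id nP].
  case: nP; have -> : i = 0%N by lia.
  by move: s0; rewrite big_ord1 mulr1 => ->; exact: (pr0 subfieldT hP).
have uA : c d.+1 * w \in Aint.
  pose g : {poly algC} := \poly_(i < d.+1) (c i * c d.+1 ^+ (d - i)); pose f := 'X^(d.+1) + g.
  have szg : (size g <= d.+1)%N by exact: size_poly.
  apply: (@Aint_monic f).
  - by rewrite monicE lead_coefDl ?lead_coefXn // size_polyXn ltnS.
  - move=> j; rewrite coefD coefXn coef_poly; case: ifP => _; rewrite rpredD ?rpred_nat ?rpredM ?rpredX //.
  - rewrite rootE hornerD hornerXn horner_poly.
    have : c d.+1 ^+ d * \sum_(i < d.+2) c i * w ^+ i = 0 by rewrite s0 mulr0.
    rewrite big_ord_recr /= mulrDr mulr_sumr => h; rewrite -[X in _ == X]h addrC; apply/eqP; congr (_ + _).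
      apply: eq_bigr => j _; have e : c d.+1 ^+ d = c d.+1 ^+ (d - j) * c d.+1 ^+ j.
        by rewrite -exprD subnK // -ltnS.
      by rewrite e exprMn; ring.
    by rewrite exprMn exprSr -mulrA.
have [Pc|nc] := pselect (P (c d.+1)); last by exists (c d.+1 * w), (c d.+1); split=> //; [rewrite mulrC|right].
have [Pu|nu] := pselect (P (c d.+1 * w)); last by exists (c d.+1 * w), (c d.+1); split=> //; [rewrite mulrC|left].
have id' : (i <= d)%N by move: id; rewrite leq_eqVlt => /orP[/eqP e|//]; case: nP; rewrite e.
apply: (IH (fun j => if j == d then c d + c d.+1 * w else c j)).
- by move=> j; case: ifP => _ //; exact: rpredD.
- move: s0; rewrite big_ord_recr big_ord_recr /= => s0; rewrite big_ord_recr /= eqxx -[RHS]s0.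
  rewrite -addrA; congr (_ + _); last by rewrite mulrDl exprS mulrA.
  by apply: eq_bigr => j _; rewrite ltn_eqF.
- exists i => //; case: eqP => [e h|//]; apply: nP; rewrite e.
  by rewrite -(addrK (c d.+1 * w) (c d)); exact: (prB subfieldT hP h Pu).
Qed.

Lemma val_quot w : exists x y, [/\ x \in Aint, y \in Aint, w * y = x & ~ P x \/ ~ P y].
Proof.
have [f [fE fm] _] := minCpolyP w; have [q [a a0 qE]] := rat_poly_scale f.
have f0 : f != 0 by rewrite monic_neq0.
have q0 : q != 0 by apply: contraNneq f0 => q0; rewrite qE q0 rmorph0 scaler0.
pose g := zprimitive q; have g0 : g != 0 by rewrite zprimitive_eq0.
have rg : (map_poly (intr : int -> algC) g).[w] = 0.
  have rf : (map_poly (ratr : rat -> algC) f).[w] = 0 by apply/rootP; rewrite -fE root_minCpoly.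
  have e : map_poly (ratr : rat -> algC) f = ((a%:~R)^-1 * (zcontents q)%:~R) *: map_poly intr g.
    rewrite qE {1}(zpolyEprim q) -/g; apply/polyP => i.
    rewrite !(coef_map, coefZ) /= rmorphM fmorphV /= !rmorph_int.
    by rewrite rmorphM /= mulrA.
  move: rf; rewrite e hornerZ => /eqP; rewrite !mulf_eq0 invr_eq0 !intr_eq0 (negPf a0) zcontents_eq0 (negPf q0) /=.
  by move/eqP.
pose d := (size g).-1.
apply: (@val_quot_coef d (fun i => (g`_i)%:~R)).
- by move=> i; exact: Aint_int.
- rewrite -[RHS]rg horner_coef size_map_poly_id0 ?intr_eq0 ?lead_coef_eq0 //.
  rewrite /d prednK ?size_poly_gt0 //; apply: eq_bigr => i _; by rewrite coef_map.
- apply: contrapT => h; have [l pl Pl] := pr_char subfieldT hP.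
  have hall i : P (g`_i)%:~R.
    have [id|di] := leqP i d; last first.
      rewrite nth_default; first exact: (pr0 subfieldT hP).
      by move: di; rewrite /d prednK // size_poly_gt0.
    by apply: contrapT => hn; apply: h; exists i.
  have : (l%:Z %| zcontents g)%Z.
    by rewrite dvdz_contents; apply/polyOverP => i; apply: pr_intP.
  rewrite zcontents_primitive q0 dvdz1 /= => /eqP l1.
  by move: pl; rewrite l1.
Qed.

Lemma res_frob_mor l e : P l%:R -> prime l ->
  exists psi : {rmorphism Zb -> residue hP}, forall z, psi z = to_res hP z ^+ (l ^ e).
Proof.
move=> Pl pl; elim: e => [|e [psi hpsi]].
  by exists (to_res hP) => z; rewrite expn0 expr1.
exists (pFrobenius_aut (pr_resid_char Pl pl) \o psi : {rmorphism Zb -> residue hP}) => z /=.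
by rewrite pFrobenius_autE hpsi expnSr exprM.
Qed.

Lemma res_frob_cycle l F (D : nf_data F) (y : Zb) : P l%:R -> prime l -> F (val y) ->
  exists2 i, (0 < i <= nf_d D)%N & to_res hP y ^+ (l ^ i) = to_res hP y.
Proof.
move=> Pl pl Fy; set u := to_res hP y; set d := nf_d D.
have [q qE] : {q : {poly int} | minCpoly (val y) = map_poly intr q}.
  by apply: floorpP; exact: (zb_int y).
have mq : q \is monic.
  rewrite monicE -(eqr_int algC) -lead_coef_map_inj //; last exact: intr_inj.
  by rewrite -qE -monicE minCpoly_monic.
have szq : (size q <= d.+1)%N.
  have <- : size (minCpoly (val y)) = size q.
    by rewrite qE size_map_inj_poly //; exact: intr_inj.
  rewrite size_conjugates ltnS; apply: (nf_degree_bound (b := fun i : 'I_d => nf_z D ^+ i) (nf_sub D)) => //.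
  exact: nf_gen.
have root0 : (map_poly (intr : int -> Zb) q).[y] = 0.
  apply: val_inj; rewrite -[val]/zb_val -horner_map -map_poly_comp raddf0.
  rewrite (eq_map_poly (g := intr)); last by move=> c; exact: rmorph_int.
  by rewrite -qE; apply/rootP; exact: root_minCpoly.
pose qr := map_poly (intr : int -> residue hP) q.
have rt i : root qr (u ^+ (l ^ i)).
  have [psi hpsi] := res_frob_mor i Pl pl.
  rewrite rootE -hpsi /qr -(eq_map_poly (f := psi \o intr)); last by move=> c; exact: rmorph_int.
  by rewrite map_poly_comp horner_map root0 raddf0.
have qr0 : qr != 0 by apply: monic_neq0; exact: monic_map.
have : ~~ uniq (mkseq (fun i => u ^+ (l ^ i)) d.+1).
  apply/negP => un; have := max_poly_roots qr0 _ un; rewrite size_mkseq ltnNge => /(_ _)/negP; apply.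
    by apply/allP => x /mapP [i _ ->].
  by rewrite /qr size_map_poly_id0 // (monicP mq) rmorph1 oner_neq0.
move=> /(uniqPn 0) [i [j [ij jd]]]; rewrite size_mkseq in jd; rewrite !nth_mkseq //; last exact: ltn_trans jd.
move=> e; exists (j - i)%N; first by lia.
have [psi hpsi] := res_frob_mor i Pl pl; have [psi2 hpsi2] := res_frob_mor (j - i) Pl pl.
have [z hz] := to_res_surj (psi2 y - u).
have : psi z = 0.
  rewrite hpsi -hz.
  have : psi (y ^+ (l ^ (j - i)) - y) = 0.
    by rewrite rmorphB rmorphXn /= !hpsi -/u -exprM -expnD subnKC ?e ?subrr // ltnW.
  by rewrite hpsi rmorphB rmorphXn /= -/u hpsi2.
rewrite hpsi -hz => /eqP; rewrite expf_eq0 => /andP[_].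
by rewrite subr_eq0 hpsi2 => /eqP.
Qed.

(** With d the degree of F and l the residue characteristic, each residue of F is fixed by the
    l^i-power map for some i <= d. So the l^(d!)-power map fixes them all and lifts to an
    automorphism fixing F. *)
Lemma frobenius_lift F (D : nf_data F) : exists q rho,
  [/\ (1 < q)%N, fixes F rho & forall y, y \in Aint -> P (rho y - y ^+ q)].
Proof.
have [l pl Pl] := pr_char subfieldT hP.
set E := (nf_d D)`!; have [psi hpsi] := res_frob_mor E Pl pl.
have [|eta e1 e2] := lift_hom (nf_sub D) (f := to_res hP) (g := psi).
  move=> y Fy; rewrite hpsi; have [i id hi] := res_frob_cycle D Pl pl Fy.
  have /dvdnP [c ->] : (i %| E)%N by apply: dvdn_fact.
  rewrite mulnC; elim: c => [|c IH]; first by rewrite muln0 expn0 expr1.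
  by rewrite mulnS expnD exprM hi.
exists (l ^ E)%N, eta; split=> //.
  by rewrite -(exp1n E) ltn_exp2r ?prime_gt1 // fact_gt0.
move=> y yA; have := e2 (MkZb yA); rewrite hpsi -rmorphXn => /to_resP /=.
by rewrite -[val _]/(zb_val _) rmorphXn.
Qed.

(* The Frobenius lift rho acts on p-power roots of unity by raising to the power q, and
   rho r / r is a unit at P, so that a(rho r / r) = z^(q-1) (rho r / r) forces z^(q-1) = 1. *)
Lemma tame_resolvent p n (z r : algC) (a rho : aut) q : prime p -> ~ P p%:R ->
  z ^+ (p ^ n) = 1 -> r != 0 -> (0 < q)%N ->
  (forall y, y \in Aint -> P (a y - y)) -> (forall y, y \in Aint -> P (rho y - y ^+ q)) ->
  a r = z * r -> a (rho r) = rho (a r) -> z ^+ q.-1 = 1.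
Proof.
move=> pp np zn r0 q0 ha hrho ar arho.
have p0 := prime_gt0 pp.
have zA : z \in Aint by apply: (@Aint_unity_root (p ^ n)); rewrite ?expn_gt0 ?p0 //; exact/unity_rootP.
have z0 : z != 0 by apply: contra_eqN zn => /eqP ->; rewrite expr0n gtn_eqF ?expn_gt0 ?p0 // eq_sym oner_eq0.
have zV : z^-1 ^+ (p ^ n) = 1 by rewrite exprVn zn invr1.
have rz : rho z = z ^+ q.
  have e : rho z / z ^+ q = 1.
    apply: (pr_unity_eq1 (n := n) np p0).
      by rewrite expr_div_n -rmorphXn zn rmorph1 -exprM mulnC exprM zn expr1n divr1.
    have -> : rho z / z ^+ q - 1 = (rho z - z ^+ q) * z^-1 ^+ q by rewrite exprVn mulrBl divff ?expf_neq0.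
    apply: (prMr hP) => //; last exact: hrho.
    by rewrite rpredX //; apply: (@Aint_unity_root (p ^ n)); rewrite ?expn_gt0 ?p0 //; exact/unity_rootP.
  by apply: (mulIf (invr_neq0 (expf_neq0 q z0))); rewrite e divff // expf_neq0.
have stab y : y \in Aint -> P (rho y) -> P y.
  move=> yA Py; apply: (prX subfieldT hP (n := q)) => //.
  by have := prD hP (prBC subfieldT hP (hrho y yA)) Py; rewrite subrK.
have stab' y : y \in Aint -> P y -> P (rho y).
  move=> yA Py; rewrite -(subrK (y ^+ q) (rho y)); apply: (prD hP); first exact: hrho.
  by rewrite -(prednK q0) exprS; apply: (prMr hP) => //; exact: rpredX.
(* [mm w] says that w is in the maximal ideal of the valuation ring of P. *)
pose mm w := exists x y, [/\ x \in Aint, y \in Aint, w * y = x, P x & ~ P y].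
have mm_rho w : mm w -> mm (rho w).
  move=> [x [y [xA yA e Px nPy]]]; exists (rho x), (rho y); split; rewrite ?aut_Aint //.
  - by rewrite -rmorphM e.
  - exact: stab'.
  - by move/stab => h; apply: nPy; exact: h.
have mmM w w' : mm w -> mm w' -> mm (w * w').
  move=> [x [y [xA yA e Px nPy]]] [x' [y' [x'A y'A e' Px' nPy']]]; exists (x * x'), (y * y'); split; rewrite ?rpredM //.
  - by rewrite mulrACA e e'.
  - exact: (prM hP).
  - by move/(pr_or hP) => [] // h.
have mm1 : ~ mm 1 by move=> [x [y [xA yA]]]; rewrite mul1r => -> .
have [i [j [ij _ eij]]] : exists i j, [/\ (i < j)%N, (j <= size (conjugates r))%N & (rho ^+ i)%g r = (rho ^+ j)%g r].
  pose f (i : nat) : seq_sub (conjugates r) := SeqSub (aut_conjugates (rho ^+ i)%g r).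
  have [i [j [h1 h2 h3]]] := pigeon f; exists i, j; split=> //; last by have := congr1 val h3.
  by apply: leq_trans h2 _; rewrite card_seq_sub // undup_uniq.
have rfin : (rho ^+ (j - i))%g r = r.
  by apply: (can_inj (autKV (rho ^+ i)%g)); rewrite -autM -expgD subnKC // ltnW.
have mm_iter w m : w != 0 -> (0 < m)%N -> mm (rho w / w) -> mm ((rho ^+ m)%g w / w).
  move=> w0 m0 h; elim: m m0 => [//|[|m] IH] _; first by rewrite expg1.
  have -> : (rho ^+ m.+2)%g w / w = rho ((rho ^+ m.+1)%g w / w) * (rho w / w).
    have rw0 : rho w != 0 by rewrite fmorph_eq0.
    have -> : (rho ^+ m.+2)%g w = rho ((rho ^+ m.+1)%g w) by rewrite expgS.
    by set y := (rho ^+ m.+1)%g w; clearbody y; rewrite rmorphM fmorphV /= mulrA divfK.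
  by apply: mmM => //; apply: mm_rho; exact: IH.
have ji0 : (0 < j - i)%N by lia.
(* If rho r / r were in the maximal ideal, so would be rho^m r / r for every m > 0; but this is 1
   when rho^m fixes r. The same argument applies to the inverse, so rho r / r is a unit at P. *)
have nmm : ~ mm (rho r / r).
  by move=> /(mm_iter _ _ r0 ji0); rewrite rfin divff.
have nmm' : ~ mm (r / rho r).
  move=> h; apply: mm1; have -> : 1 = (rho ^+ (j - i))%g r^-1 / r^-1.
    by rewrite fmorphV /= rfin divff // invr_neq0.
  by apply: mm_iter => //; rewrite ?invr_neq0 // fmorphV invrK mulrC.
have rr0 : rho r != 0 by rewrite fmorph_eq0.
have [x [y [xA yA e nP]]] := val_quot (rho r / r).
have nPx : ~ P x by move=> Px; case: nP => // nPy; apply: nmm; exists x, y.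
have nPy : ~ P y.
  move=> Py; case: nP => // _; apply: nmm'; exists y, x; split=> //.
  by rewrite -e mulrA -invf_div mulVf ?mul1r // mulf_neq0 ?invr_neq0.
have aW : a (rho r / r) = z ^+ q.-1 * (rho r / r).
  rewrite rmorphM fmorphV /= arho ar rmorphM /= rz -{1}(prednK q0) exprSr invfM.
  have gen (u z' r' r1 : algC) : z' != 0 -> u * z' * r' * (z'^-1 / r1) = u * (r' / r1).
    by move=> z'0; rewrite !mulrA; congr (_ / _); rewrite -!mulrA; congr (_ * _); rewrite [r' / _]mulrC mulrA mulfV // mul1r.
  exact: gen.
have key : z ^+ q.-1 * x * a y = a x * y.
  by rewrite -{1}e -[in RHS]e rmorphM /= aW; ring.
apply: (pr_unity_eq1 (n := n) np p0); first by rewrite -exprM mulnC exprM zn expr1n.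
have : P ((z ^+ q.-1 - 1) * (x * y)).
  have -> : (z ^+ q.-1 - 1) * (x * y) =
    (a x - x) * y - (a y - y) * (z ^+ q.-1 * x) + (z ^+ q.-1 * x * a y - a x * y) by ring.
  rewrite key subrr addr0.
  apply: (prB subfieldT hP); apply: (prMr hP) => //; first exact: ha.
    by rewrite rpredM ?rpredX.
  exact: ha.
move/(pr_or hP) => [] //; rewrite ?rpredB ?rpredM ?rpredX ?rpred1 //.
by move/(pr_or hP) => [].
Qed.

Lemma tame_roots p n (z : algC) (a : aut) : prime p -> ~ P p%:R -> z ^+ (p ^ n) = 1 ->
  (forall y, y \in Aint -> P (a y - y)) -> a z = z.
Proof.
move=> pp np zn ha; have p0 := prime_gt0 pp.
have zA : z \in Aint by apply: (@Aint_unity_root (p ^ n)); rewrite ?expn_gt0 ?p0 //; exact/unity_rootP.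
have zVA : z^-1 \in Aint.
  by apply: (@Aint_unity_root (p ^ n)); rewrite ?expn_gt0 ?p0 //; apply/unity_rootP; rewrite exprVn zn invr1.
have z0 : z != 0 by apply: contra_eqN zn => /eqP ->; rewrite expr0n gtn_eqF ?expn_gt0 ?p0 // eq_sym oner_eq0.
have e : a z / z = 1.
  apply: (pr_unity_eq1 (n := n) np p0).
    by rewrite expr_div_n -rmorphXn zn rmorph1 divr1.
  have -> : a z / z - 1 = (a z - z) * z^-1 by rewrite mulrBl divff.
  by apply: (prMr hP) => //; exact: ha.
by apply: (mulIf (invr_neq0 z0)); rewrite e divff.
Qed.
End TamePrime.

(** * A Z_p-extension is unramified outside p *)

Section TameInertia.
Variables (p : nat) (pp : prime p) (k : set algC) (nk : number_field k) (K : Zp_extension p k).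
Local Notation Gam := (gal k K).
Local Notation KG := (ext_galois K).
Variables (phi : Gam -> Zp p) (hphi : topological_iso_Zp phi).

Definition fixK (h : Gam) : set algC := [set x | ext_field K x /\ h x = x]%classic.

Lemma K_sub : subfield (ext_field K). Proof. by case: KG. Qed.

Lemma fixK_subfield h : subfield (fixK h).
Proof.
have sK := K_sub; split.
- by split; [exact: sf1 | exact: (gal1 KG)].
- move=> x y [Kx hx] [Ky hy]; split; first exact: (sfB sK).
  have [s _ hs] := glift KG h; rewrite -hs; last exact: (sfB sK).
  by rewrite rmorphB /= !hs // hx hy.
- move=> x y [Kx hx] [Ky hy]; split; first exact: (sf_div sK).
  have [s _ hs] := glift KG h; rewrite -hs; last exact: (sf_div sK).
  by rewrite fmorph_div /= !hs // hx hy.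
Qed.

Lemma fixK_k h x : k x -> fixK h x.
Proof. by move=> kx; split; [case: KG => _ _ h' _; exact: h' | exact: gal_base]. Qed.

Lemma gal_pow_fix (h : Gam) x m : h x = x -> (h ^+ m)%g x = x.
Proof.
move=> hx; elim: m => [//|m IH]; rewrite expgS -[LHS]/(h ((h ^+ m)%g x)) IH //.
Qed.

Lemma fixK_nf (h : Gam) : h <> 1%g -> number_field (fixK h).
Proof.
move=> h1; have [v hv] := phi_neq0 hphi h1; have [A hA hA0] := phi_open hphi v.
apply: (fixed_number_field (A := A) nk (fixK_subfield h)) => x [Kx hx] s ks sA.
rewrite -(gresE KG ks Kx).
have [m ->] : exists m, forall y, y \in [:: x] -> gres KG ks y = (h ^+ m)%g y.
  apply: (gam_pow_dense pp hphi hv) => [|y]; last by rewrite inE => /eqP ->.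
  by apply: hA0 => y yA; rewrite gresE ?sA //; exact: hA.
  exact: gal_pow_fix.
by rewrite inE.
Qed.

(** The automorphisms over k that agree on K with a quotient of powers of h have their fixed field
    inside [fixK h], so s is approximated by one of them. Modulo p^(n+1) a negative exponent is made
    nonnegative by the factor p^(n+1) - 1. *)
Lemma fixK_phi (h : Gam) (s : aut) (ks : fixes k s) : fixes (fixK h) s ->
  forall n, exists m, phi (gres KG ks) n = phi h n *+ m.
Proof.
move=> hs n; have [A hA hA0] := phi_open hphi n.
pose H := [set t : aut | fixes k t /\ exists m m', forall x, ext_field K x -> t x = (h ^+ m * (h ^+ m')^-1)%g x]%classic.
have gcomm (g g' : Gam) : (g * g' = g' * g)%g := gal_mulC g g'.
have stab t x : fixes k t -> ext_field K x -> ext_field K (t x) by exact: (galois_stable KG).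
have gH : aut_group H.
  split.
  - by split=> //; exists 0%N, 0%N => x _; rewrite !expg0 invg1 mulg1.
  - move=> t t' [kt [m [m' e]]] [kt' [l [l' e']]]; split; first exact: fixesM.
    exists (m + l)%N, (m' + l')%N => x Kx; rewrite autM e; last exact: stab.
    rewrite e' // -[LHS]/((h ^+ m * (h ^+ m')^-1 * (h ^+ l * (h ^+ l')^-1))%g x); congr (gal_fun _ x).
    rewrite !expgD invMg -!mulgA; congr (_ * _)%g; rewrite !mulgA; rewrite (gcomm ((h ^+ m')^-1)%g).
    by rewrite -!mulgA; congr (_ * _)%g; exact: gcomm.
  - move=> t [kt [m [m' e]]]; split; first exact: fixesV.
    exists m', m => x Kx; apply: (can_inj (autKV t)); rewrite autVK e; last first.
      by rewrite -/(ext_field K); apply/(gal_stab _ x).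
    rewrite -[RHS]/((h ^+ m * (h ^+ m')^-1 * (h ^+ m' * (h ^+ m)^-1))%g x).
    by rewrite mulgA mulgKV mulgV.
have [t [kt [m [m' e]]] ets] : exists2 t, H t & {in A, t =1 s}.
  apply: closure_agree => // x hx; apply: hs.
  have Kx : ext_field K x.
    apply: (subfield_fix K_sub) => t ft; apply: hx; split.
      by move=> y ky; apply: ft; case: KG => _ _ h' _; exact: h'.
    by exists 0%N, 0%N => y Ky; rewrite !expg0 invg1 mulg1 ft.
  split=> //; have [t kt ht] := glift KG h; rewrite -ht //; apply: hx; split=> //.
  by exists 1%N, 0%N => y Ky; rewrite ht // expg0 expg1 invg1 mulg1.
have gt : phi (gres KG ks) n = phi (gres KG kt) n.
  apply/eqP; rewrite -subr_eq0; apply/eqP.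
  have : phi ((gres KG kt)^-1 * gres KG ks)%g n = 0.
    apply: hA0 => x xA; have Kx := hA x xA.
    rewrite -[LHS]/(gal_inv (gres KG kt) (gres KG ks x)) gresE // -ets // -(gresE KG kt) //.
    by rewrite gal_funK.
  by rewrite (phiM hphi) (phiV hphi) addrC.
have ge : gres KG kt = (h ^+ m * (h ^+ m')^-1)%g.
  by apply: gal_eqP => x Kx; rewrite gresE // e.
exists (m + m' * (p ^ n.+1).-1)%N; rewrite gt ge (phiM hphi) (phiV hphi) !(phiX hphi) Zp_subE !Zp_mulrnE mulrnDr mulrnA.
congr (_ + _); set y := phi h n *+ m'.
apply/eqP; rewrite eq_sym -addr_eq0 -mulrSr prednK ?expn_gt0 ?prime_gt0 // -mulr_natr.
have -> : (p ^ n.+1)%N%:R = 0 :> 'Z_(p ^ n.+1).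
  have q1 : (1 < p ^ n.+1)%N by rewrite -(Zp_mod pp).
  by apply: val_inj; rewrite /= (val_Zp_nat q1) modnn.
by rewrite mulr0.
Qed.

(** Otherwise g^(p^(n-1)) would fix the fixed field of g^(p^n) and be a limit of powers of the
    latter, which is impossible for g <> 1 in the group Z_p. *)
Lemma pow_orbit_ex (g : Gam) n : g <> 1%g -> (0 < n)%N -> exists x,
  [/\ ext_field K x, (g ^+ (p ^ n))%g x = x & (g ^+ (p ^ n.-1))%g x <> x].
Proof.
move=> g1 n0; apply: contrapT => hn.
have [s ks hs] := glift KG (g ^+ (p ^ n.-1))%g.
have sf : fixes (fixK (g ^+ (p ^ n))%g) s.
  by move=> x [Kx hx]; rewrite hs //; apply: contrapT => hx'; apply: hn; exists x.
have e : gres KG ks = (g ^+ (p ^ n.-1))%g by apply: gal_eqP => x Kx; rewrite gresE // hs.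
have [v hv] := phi_neq0 hphi g1.
have [m hm] := fixK_phi ks sf (v + n).
move: hm; rewrite e !(phiX hphi) !Zp_mulrnE => hm.
apply: hv; apply/(Zp_dvd pp _ (leq_addr n v)).
set b := phi g (v + n)%N in hm *.
have q1 : (1 < p ^ (v + n).+1)%N by rewrite -(Zp_mod pp).
have zero (x : nat) : x%:R = 0 :> 'Z_(p ^ (v + n).+1) -> (p ^ (v + n).+1 %| x)%N.
  by move/(congr1 val); rewrite /= (val_Zp_nat q1) => /eqP.
have q0 : (p ^ (v + n).+1)%N%:R = 0 :> 'Z_(p ^ (v + n).+1).
  by apply: val_inj; rewrite /= (val_Zp_nat q1) modnn.
have hX : b *+ p ^ n.-1 = b *+ p ^ n.-1 *+ (p * m).
  have e' : (p ^ n = p ^ n.-1 * p)%N by rewrite -expnSr prednK.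
  by rewrite {1}hm e' !mulrnA.
have hX' j : b *+ p ^ n.-1 = b *+ p ^ n.-1 *+ (p * m) ^ j.
  have gen (V : nmodType) (x : V) t : x = x *+ t -> x = x *+ t ^ j.
    by move=> h; elim: j => [|j IH]; rewrite ?mulr1n // expnSr mulrnA -IH.
  exact: gen.
have : (b * p ^ n.-1)%N%:R = 0 :> 'Z_(p ^ (v + n).+1).
  rewrite natrM natr_Zp mulr_natr (hX' (v + n).+1) expnMn mulrnA -[_ *+ p ^ _.+1]mulr_natr.
  by rewrite q0 mulr0 mul0rn.
move/zero; clearbody b; move: (b : nat) => b' {b hm hX hX'}.
have -> : (v + n).+1 = (v + n.-1.+1).+1 by rewrite prednK.
move: n.-1 => n'; rewrite addnS -addSn -addSn expnD dvdn_pmul2r ?expn_gt0 ?prime_gt0 //.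
by apply: dvdn_trans; rewrite dvdn_exp2l.
Qed.

(** The tame relation: a commutes on the abelian extension K with a Frobenius lift rho, whereas rho
    raises p-power roots of unity to the power q. The resolvent of an orbit of length p^n is an
    eigenvector of a with eigenvalue of order p^n, and [tame_resolvent] forces this order to divide
    q - 1. *)
Lemma tame_inertia P (a : aut) : prime_of [set: algC]%classic P -> ~ P p%:R -> fixes k a ->
  (forall y, y \in Aint -> P (a y - y)) -> forall x, ext_field K x -> a x = x.
Proof.
move=> hP np ka ha; set g := gres KG ka.
suff g1 : g = 1%g by move=> x Kx; rewrite -(gresE KG ka Kx) -/g g1.
apply: contrapT => g1; have [D _] := nf_exists (fixK_nf g1).
have [q [rho [q1 Frho hrho]]] := frobenius_lift hP D.
(* The choice n = q guarantees p^n > q - 1, which gives the final contradiction. *)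
pose n := q; have n0 : (0 < n)%N by apply: ltnW.
have [z [Kz z1 z2]] := pow_orbit_ex g1 n0.
have pn0 : (0 < p ^ n)%N by rewrite expn_gt0 prime_gt0.
have stabK t x : fixes k t -> ext_field K x -> ext_field K (t x) by exact: (galois_stable KG).
have krho : fixes k rho by move=> x kx; apply: Frho; exact: fixK_k.
have gX j x : ext_field K x -> (a ^+ j)%g x = (g ^+ j)%g x.
  move=> Kx; elim: j => [//|j IH]; rewrite !expgS autM IH -[RHS]/(g ((g ^+ j)%g x)) gresE //.
  exact: (proj1 (gal_stab _ x) Kx).
have zi : injective (fun i : 'I_(p ^ n) => (a ^+ i)%g z).
  suff h (i j : nat) : (i < j)%N -> (j < p ^ n)%N -> (a ^+ i)%g z <> (a ^+ j)%g z.
    move=> i j /= e; apply: val_inj => /=; case: (ltngtP i j) => // lt; exfalso.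
      exact: (h _ _ lt (ltn_ord j) e).
    exact: (h _ _ lt (ltn_ord i) (esym e)).
  move=> ij jn e.
  have e2 : (a ^+ (j - i))%g z = z.
    by apply: (can_inj (autKV (a ^+ i)%g)); rewrite -autM -expgD subnKC ?e // ltnW.
  have ap : (a ^+ (p ^ n))%g z = z by rewrite gX.
  have fixm m c : (a ^+ m)%g z = z -> (a ^+ (m * c))%g z = z.
    by move=> h; elim: c => [|c IH]; rewrite ?muln0 // mulnS expgD autM IH.
  have gc0 : (0 < gcdn (p ^ n) (j - i))%N by rewrite gcdn_gt0 pn0.
  have eg : (a ^+ gcdn (p ^ n) (j - i))%g z = z.
    have [c _ /dvdnP [c' hc']] := Bezoutl (j - i) pn0.
    have : (a ^+ (gcdn (p ^ n) (j - i) + c * (j - i)))%g z = z by rewrite hc' mulnC fixm.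
    by rewrite expgD autM mulnC fixm.
  apply: z2; rewrite -gX //.
  have /(dvdn_pfactor _ _ pp) [f fn fE] := dvdn_gcdl (p ^ n) (j - i).
  have fn' : (f <= n.-1)%N.
    rewrite -ltnS prednK // ltn_neqAle fn andbT; apply/eqP => fe.
    have : (p ^ n %| j - i)%N by rewrite -{1}fe -fE dvdn_gcdr.
    move/dvdn_leq => /(_ _); rewrite subn_gt0 ij => /(_ isT); lia.
  have /dvdnP [c ->] : (gcdn (p ^ n) (j - i) %| p ^ n.-1)%N by rewrite fE dvdn_exp2l.
  by rewrite mulnC fixm.
have [zeta hzeta] := C_prim_root_exists pn0.
have zn := prim_expr_order hzeta.
have zeta0 : zeta != 0 by apply: contra_eqN zn => /eqP ->; rewrite expr0n gtn_eqF // eq_sym oner_eq0.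
have [|l hl] := @char_indep _ _ (fun i : 'I_(p ^ n) => zeta^-1 ^+ i) (Ordinal pn0) zi; first by rewrite expr0 oner_neq0.
set r := \sum_(i < _) _ in hl.
have rE : r = \sum_(i < p ^ n) zeta^-1 ^+ i * (a ^+ i)%g (z ^+ l).
  by apply: eq_bigr => i _; rewrite rmorphXn.
have az : a zeta = zeta by exact: (tame_roots hP pp np zn ha).
have Kzl : ext_field K (z ^+ l) by exact: (sfX K_sub).
have ar : a r = zeta * r.
  rewrite rE rmorph_sum mulr_sumr.
  rewrite (eq_bigr (fun i : 'I_(p ^ n) => zeta * (zeta^-1 ^+ i.+1 * (a ^+ i.+1)%g (z ^+ l)))).
    rewrite -!mulr_sumr; congr (_ * _).
    rewrite -(big_mkord xpredT (fun i => zeta^-1 ^+ i.+1 * (a ^+ i.+1)%g (z ^+ l))) -(big_mkord xpredT (fun i => zeta^-1 ^+ i * (a ^+ i)%g (z ^+ l))).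
    have ezn : zeta^-1 ^+ (p ^ n) = 1 by rewrite exprVn zn invr1.
    have ean : (a ^+ (p ^ n))%g (z ^+ l) = z ^+ l by rewrite rmorphXn /= gX // z1.
    case: (p ^ n)%N pn0 ezn ean => // N _ ezn ean.
    by rewrite big_nat_recr //= big_nat_recl //= ezn ean expr0 addrC.
  move=> i _; rewrite rmorphM rmorphXn fmorphV /= az exprS mulrA mulrA mulfV // mul1r.
  by rewrite expgS.
have comm x : ext_field K x -> a (rho x) = rho (a x).
  move=> Kx; rewrite -(gresE KG krho Kx) -(gresE KG ka Kx) -(gresE KG ka) -?(gresE KG krho).
  - by rewrite -[LHS]/((gres KG ka * gres KG krho)%g x) gal_mulC.
  - exact: (proj1 (gal_stab _ x) Kx).
  - exact: (proj1 (gal_stab _ x) Kx).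
have [i0 rz] : exists i, rho zeta = zeta ^+ i.
  by have [i hi] := aut_unity_root pn0 zn rho; exists i.
have arho : a (rho r) = rho (a r).
  rewrite rE !rmorph_sum; apply: eq_bigr => i _; rewrite !rmorphM !rmorphXn !fmorphV /= az rz !rmorphXn /= az.
  congr (_ * _ ^+ l); apply: comm.
  by elim: (i : nat) => [|m IH] //; rewrite expgS autM; exact: stabK.
have := tame_resolvent hP pp np zn hl (ltnW q1) ha hrho ar arho.
have q2 : (0 < q.-1)%N by lia.
move/eqP; rewrite -(prim_order_dvd hzeta) => /(dvdn_leq q2) h.
have := leq_ltn_trans h (leq_ltn_trans (leq_pred q) (ltn_expl q (prime_gt1 pp))).
by rewrite ltnn.
Qed.
End TameInertia.

(** * The Iwasawa algebra *)

Lemma nat_ultra : exists U : set_system nat, UltraFilter U /\ forall n, U [set m | (n <= m)%N]%classic.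
Proof.
pose F := filter_from [set: nat]%classic (fun n => [set m | (n <= m)%N]%classic).
have FF : ProperFilter F.
  apply: filter_from_proper; last by move=> n _; exists n => /=.
have [U [UU FU]] := ultraFilterLemma FF.
by exists U; split=> // n; apply: FU; exists n.
Qed.

Lemma Zp_ulim p T (U : set_system T) (f : T -> Zp p) : UltraFilter U ->
  exists z : Zp p, forall n, U [set t | f t n = z n]%classic.
Proof.
move=> UU.
have h n : exists v, U [set t | f t n = v]%classic.
  by apply: (ultra_fin (r := enum 'Z_(p ^ n.+1))) => t; rewrite mem_enum.
pose z n := projT1 (cid (h n)).
have Uz n : U [set t | f t n = z n]%classic by rewrite /z; case: cid.
have zc n : Zp_red (z n.+1) = z n.
  have [t /= [e1 e2]] := filter_ex (filterI (Uz n.+1) (Uz n)).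
  by rewrite -e1 -e2 Zp_compat.
by exists (MkZp zc).
Qed.

Section FiniteLevels.
Variables (p : nat) (pp : prime p) (k : set algC) (K : Zp_extension p k).
Local Notation Gam := (gal k K).
Local Notation Lam := (iwasawa_algebra K).
Local Notation fq := (finite_quotient k K).
Variables (phi : Gam -> Zp p) (hphi : topological_iso_Zp phi).

(** Finite quotients are permutation groups, so Z/p^(n+1) is realised by its translations. *)
Definition trp n (a : 'Z_(p ^ n.+1)) : {perm 'Z_(p ^ n.+1)} := perm (@addrI _ a).

Lemma trpM n a b : (@trp n a * trp b)%g = trp (a + b).
Proof. by apply/permP => x; rewrite permM !permE addrCA addrA. Qed.

Lemma trp_inj n : injective (@trp n).
Proof. by move=> a b /permP /(_ 0); rewrite !permE !addr0. Qed.

Lemma trp_group n : group_set [set trp a | a : 'Z_(p ^ n.+1)].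
Proof.
apply/group_setP; split.
  by apply/imsetP; exists 0 => //; apply/permP => x; rewrite perm1 permE add0r.
by move=> x y /imsetP [a _ ->] /imsetP [b _ ->]; apply/imsetP; exists (a + b); rewrite ?trpM.
Qed.
Definition trG n : {group 'S_(Zp_trunc (p ^ n.+1)).+2} := group (trp_group n).

Lemma trp_in n a : @trp n a \in trG n. Proof. by apply/imsetP; exists a. Qed.

Lemma phi_surj n (a : 'Z_(p ^ n.+1)) : exists s, phi s n = a.
Proof.
have [[psi _ psiK] _ _ _] := hphi; exists (psi ((a : nat)%:R)).
by rewrite psiK Zp_natE natr_Zp.
Qed.

Definition stdq (n : nat) : fq.
Proof.
exists (Zp_trunc (p ^ n.+1)).+2 (trG n) (fun s => subg (trG n) (trp (phi s n))).
- move=> s t; rewrite -subgM ?trp_in // trpM (phiM hphi) //.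
- move=> x; have /imsetP [a _ ax] := subgP x; have [s hs] := phi_surj a.
  by exists s; apply: val_inj; rewrite /= subgK ?trp_in // hs ax.
- have [A hA hA0] := phi_open hphi n; exists A => // s /hA0 ->.
  apply: val_inj; rewrite /= subgK ?trp_in //.
  by apply/permP => x; rewrite perm1 permE add0r.
Defined.

Lemma stdq_eq n s t : fq_map (stdq n) s = fq_map (stdq n) t <-> phi s n = phi t n.
Proof.
split=> [/(congr1 val)|] /=; last by move=> ->.
by rewrite !subgK ?trp_in // => /trp_inj.
Qed.

Lemma stdq_dominates (Q : fq) : exists N, forall m, (N <= m)%N ->
  exists h : stdq m -> Q, forall s, h (fq_map (stdq m) s) = fq_map Q s.
Proof.
have [A hA hA0] := fq_cont Q; have [N hN] := phi_cont hphi hA; exists N => m Nm.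
have /choice [r hr] (x : stdq m) : exists s, fq_map (stdq m) s = x by exact: fq_surj.
exists (fun x => fq_map Q (r x)) => s.
have /stdq_eq e := hr (fq_map (stdq m) s).
set t := r _ in e *; have : fq_map Q (s^-1 * t)%g = 1%g.
  apply: hA0; apply: hN; apply: (Zp_le0 pp Nm).
  by rewrite (phiM hphi) (phiV hphi) addrC Zp_subE e subrr.
move=> h; have : fq_map Q (s * (s^-1 * t))%g = fq_map Q s by rewrite fq_morph h mulg1.
by rewrite mulKVg.
Qed.

Definition JQ (Q : fq) n (l : Lam) : Prop := forall y, l Q y n = 0.
(** The kernel of the map from Lambda to the group ring over Z/p^(n+1) of the quotient of order
    p^(n+1) of Gal(K/k). These ideals are cofinal among the [JQ] by [J_cofinal]. *)
Definition J n := JQ (stdq n) n.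

Lemma iwD (a b : Lam) Q y : (a + b) Q y = a Q y + b Q y. Proof. by rewrite ffunE. Qed.
Lemma iwN (a : Lam) Q y : (- a) Q y = - a Q y. Proof. by rewrite ffunE. Qed.
Lemma iw0 Q y : (0 : Lam) Q y = 0. Proof. by rewrite ffunE. Qed.
Lemma iwMn (a : Lam) c Q y : (a *+ c) Q y = a Q y *+ c.
Proof. by elim: c => [|c IH]; rewrite ?mulr0n ?iw0 // !mulrS iwD IH. Qed.
Lemma iw_sum I (r : seq I) (f : I -> Lam) Q y : (\sum_(i <- r) f i) Q y = \sum_(i <- r) f i Q y.
Proof. by elim: r => [|i r IH]; rewrite ?big_nil ?iw0 // !big_cons iwD IH. Qed.
Lemma Zp_sumE I (r : seq I) (P : pred I) (f : I -> Zp p) n : (\sum_(i <- r | P i) f i) n = \sum_(i <- r | P i) f i n.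
Proof. by apply: (big_morph (fun x : Zp p => x n)). Qed.

Lemma JQ0 Q n : JQ Q n 0. Proof. by move=> y; rewrite iw0. Qed.
Lemma JQD Q n a b : JQ Q n a -> JQ Q n b -> JQ Q n (a + b).
Proof. by move=> ha hb y; rewrite iwD -[LHS]/(_ + _) ha hb addr0. Qed.
Lemma JQM Q n a b : JQ Q n b -> JQ Q n (a * b).
Proof.
move=> hb y; rewrite gr_mulE Zp_sumE big1 // => x _.
by rewrite -[LHS]/(_ * _) hb mulr0.
Qed.
Lemma JQ_sum Q n I (r : seq I) f : (forall i : I, JQ Q n (f i)) -> JQ Q n (\sum_(i <- r) f i).
Proof. by move=> h; elim: r => [|i r IH]; rewrite ?big_nil ?big_cons; [exact: JQ0|exact: JQD]. Qed.
Lemma JQ_eq0 l : (forall Q n, JQ Q n l) -> l = 0.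
Proof.
by move=> h; apply: iw_ext => Q; apply/ffunP => y; apply: Zp_ext => n; rewrite h iw0.
Qed.

Lemma JQ_push (Q Q' : fq) (h : Q -> Q') n l : (forall s, h (fq_map Q s) = fq_map Q' s) ->
  JQ Q n l -> JQ Q' n l.
Proof. by move=> hh hl y; rewrite (iw_compat l hh) Zp_sumE big1 // => x _; exact: hl. Qed.

Lemma JQ_le Q n m l : (n <= m)%N -> JQ Q m l -> JQ Q n l.
Proof. by move=> nm h y; exact: (Zp_le0 pp nm (h y)). Qed.

Lemma J_cofinal Q n : exists N, forall m, (N <= m)%N -> forall l, J m l -> JQ Q n l.
Proof.
have [N hN] := stdq_dominates Q; exists (maxn N n) => m; rewrite geq_max => /andP[Nm nm] l hl.
have [h hh] := hN m Nm; apply: (JQ_push hh); exact: JQ_le nm hl.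
Qed.

Lemma J_eq0 l : (forall n, J n l) -> l = 0.
Proof.
move=> h; apply: JQ_eq0 => Q n; have [N hN] := J_cofinal Q n.
exact: (hN N).
Qed.

Lemma iw_ulim T (U : set_system T) (f : T -> Lam) : UltraFilter U ->
  exists l : Lam, forall Q n, U [set t | JQ Q n (f t - l)]%classic.
Proof.
move=> UU.
have /choice [z hz] (Qy : {Q : fq & Q}) : exists z : Zp p, forall n, U [set t | f t (projT1 Qy) (projT2 Qy) n = z n]%classic.
  exact: Zp_ulim.
pose a (Q : fq) : group_ring (Zp p) Q := [ffun y => z (existT (fun Q : fq => Q : Type) Q y)].
have Ua (Q : fq) n : U [set t | forall y, f t Q y n = a Q y n]%classic.
  have := ultra_seq (enum Q) UU (fun y => hz (existT (fun Q : fq => Q : Type) Q y) n).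
  by apply: filterS => t /= h y; rewrite ffunE -h // mem_enum.
have ac : iw_compatible a.
  move=> Q Q' h hh y; apply: Zp_ext => n.
  have [t /= [e1 e2]] := filter_ex (filterI (Ua Q n) (Ua Q' n)).
  rewrite -e2 (iw_compat (f t) hh) !Zp_sumE; apply: eq_bigr => x _; exact: e1.
exists (MkIwasawa ac) => Q n; apply: filterS (Ua Q n) => t /= h y.
by rewrite iwD iwN -[LHS]/(_ - _) h subrr.
Qed.

Lemma iw_const_zmod : zmod_morphism (@iw_const p k K).
Proof.
move=> a b; apply/eqP; rewrite eq_sym subr_eq -iw_constD subrK //.
Qed.
Lemma iw_const_monoid : monoid_morphism (@iw_const p k K).
Proof. by split=> // a b; rewrite iw_constM. Qed.
HB.instance Definition _ := GRing.isZmodMorphism.Build (Zp p) Lam (@iw_const p k K) iw_const_zmod.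
HB.instance Definition _ := GRing.isMonoidMorphism.Build (Zp p) Lam (@iw_const p k K) iw_const_monoid.

Lemma iw_singleE (a : Zp p) (g : Gam) Q y : iw_single a g Q y = a *+ (y == fq_map Q g).
Proof. by rewrite ffunE. Qed.

Lemma iw_groupM (g h : Gam) : iw_group (g * h)%g = iw_group g * iw_group h :> Lam.
Proof.
apply: iw_ext => Q; apply/ffunP => y; rewrite gr_mulE iw_singleE fq_morph.
rewrite (bigD1 (fq_map Q g)) //= !iw_singleE eqxx mulr1n mul1r big1 ?addr0; last first.
  by move=> x /negPf xg; rewrite iw_singleE xg mulr0n mul0r.
by congr (_%:R); congr nat_of_bool; apply/eqP/eqP => [->|<-]; rewrite ?mulKg ?mulKVg.
Qed.
Lemma iw_groupX (g : Gam) n : iw_group (g ^+ n)%g = iw_group g ^+ n :> Lam.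
Proof. by elim: n => [//|n IH]; rewrite expgS exprS iw_groupM IH. Qed.

Lemma JQ_const (a : Zp p) Q n : a n = 0 -> JQ Q n (iw_const K a).
Proof. by move=> h y; rewrite iw_singleE Zp_mulrnE h mul0rn. Qed.

(** A finitely generated ideal plus a finitely generated Z_p-module is closed: coefficients that
    approximate l modulo each J m have an ultrafilter limit. Weierstrass division uses both kinds of
    coefficients. *)
Lemma iw_closed (I J0 : finType) (g : I -> Lam) (r : J0 -> Lam) (l : Lam) :
  (forall m, exists (a : I -> Lam) (b : J0 -> Zp p), J m (l - \sum_i a i * g i - \sum_j iw_const K (b j) * r j)) ->
  exists (a : I -> Lam) (b : J0 -> Zp p), l = \sum_i a i * g i + \sum_j iw_const K (b j) * r j.
Proof.
move=> h; have [U [UU Un]] := nat_ultra.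
have /choice [ab hab] : forall m, exists ab : (I -> Lam) * (J0 -> Zp p),
    J m (l - \sum_i ab.1 i * g i - \sum_j iw_const K (ab.2 j) * r j).
  by move=> m; have [a [b hm]] := h m; exists (a, b).
have /choice [a ha] i := iw_ulim (fun m => (ab m).1 i) UU.
have /choice [b hb] j := Zp_ulim (fun m => (ab m).2 j) UU.
exists a, b; apply/eqP; rewrite -subr_eq0 opprD addrA; apply/eqP; apply: JQ_eq0 => Q n.
have [N hN] := J_cofinal Q n.
have UA := ultra_seq (enum I) UU (fun i => ha i Q n).
have UB := ultra_seq (enum J0) UU (fun j => hb j n).
have [m /= [[h1 h2] h3]] := filter_ex (filterI (filterI UA UB) (Un N)).
have e : l - \sum_i a i * g i - \sum_j iw_const K (b j) * r j =
  (l - \sum_i (ab m).1 i * g i - \sum_j iw_const K ((ab m).2 j) * r j)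
  + \sum_i g i * ((ab m).1 i - a i) + \sum_j r j * iw_const K ((ab m).2 j - b j).
  have -> : \sum_i g i * ((ab m).1 i - a i) = \sum_i (ab m).1 i * g i - \sum_i a i * g i.
    by rewrite -sumrB; apply: eq_bigr => i _; rewrite mulrC mulrBl.
  have -> : \sum_j r j * iw_const K ((ab m).2 j - b j) = \sum_j iw_const K ((ab m).2 j) * r j - \sum_j iw_const K (b j) * r j.
    by rewrite -sumrB; apply: eq_bigr => j _; rewrite rmorphB mulrC mulrBl.
  by ring.
rewrite e; apply: JQD; first apply: JQD.
- exact: (hN m h3 _ (hab m)).
- by apply: JQ_sum => i; apply: JQM; apply: h1; rewrite mem_enum.
- apply: JQ_sum => j; apply: JQM; apply: JQ_const.
  by rewrite Zp_subE h2 ?subrr // mem_enum.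
Qed.

Variables (g0 : Gam) (hg0 : phi g0 = 1).
Local Notation gm := (iw_group g0 : Lam).
Local Notation T := (gm - 1 : Lam).

Lemma iw_dense (l : Lam) n : exists c : 'I_(p ^ n.+1) -> nat, J n (l - \sum_(i < p ^ n.+1) gm ^+ i *+ c i).
Proof.
exists (fun i : 'I_(p ^ n.+1) => (l (stdq n) (fq_map (stdq n) (g0 ^+ i)%g) n : nat)) => y.
have [s <-] := fq_surj y.
have lt := Zp_val_lt pp (phi s) n.
have es : fq_map (stdq n) s = fq_map (stdq n) (g0 ^+ Ordinal lt)%g.
  by apply/stdq_eq; rewrite (phiX hphi) hg0 Zp_natE natr_Zp.
rewrite iwD iwN iw_sum -[LHS]/(_ - _) Zp_sumE (bigD1 (Ordinal lt)) // big1; last first.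
  move=> i /andP[_ ne]; rewrite iwMn -iw_groupX iw_singleE es.
  have -> : (fq_map (stdq n) (g0 ^+ Ordinal lt)%g == fq_map (stdq n) (g0 ^+ i)%g) = false.
    apply/negbTE; apply: contra ne => /eqP /stdq_eq; rewrite !(phiX hphi) hg0 !Zp_natE => e.
    have q1 : (1 < p ^ n.+1)%N by rewrite -(Zp_mod pp).
    have := congr1 val e; rewrite /= !(val_Zp_nat q1) !modn_small // => e'.
    by apply/eqP/val_inj.
  by rewrite mulr0n mul0rn.
rewrite iwMn -iw_groupX iw_singleE es eqxx mulr1n Zp_natE.
by rewrite [X in _ - X]addr0 natr_Zp subrr.
Qed.

End FiniteLevels.

(** * Congruences modulo p, inverses in Z_p and Weierstrass division *)

Definition congp (R : comNzRingType) (p : nat) (a b : R) := exists w, a = b + w *+ p.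

Lemma mulrn_lin (R : comNzRingType) (n : nat) : exists P : R, forall x, x *+ n = x * P.
Proof. by exists n%:R => x; rewrite mulr_natr. Qed.

Lemma sum_unit (V : nmodType) (f : unit -> V) : \sum_i f i = f tt.
Proof. by rewrite (big_pred1 tt) // => -[]. Qed.

Lemma sum_void (V : nmodType) (f : void -> V) : \sum_i f i = 0.
Proof. by apply: big1 => -[]. Qed.

Section ModP.
Variables (R : comNzRingType) (p : nat) (pp : prime p).
Local Notation modp := (@congp R p).

Lemma congp_refl a : modp a a. Proof. by exists 0; rewrite mul0rn addr0. Qed.
Lemma congp_trans a b c : modp a b -> modp b c -> modp a c.
Proof. by move=> [u ->] [v ->]; exists (v + u); rewrite mulrnDl addrA. Qed.
Lemma congp_sym a b : modp a b -> modp b a.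
Proof. by move=> [u ->]; exists (- u); rewrite mulNrn addrK. Qed.
Lemma congpM a b c d : modp a b -> modp c d -> modp (a * c) (b * d).
Proof.
move=> [u ->] [v ->]; exists (b * v + u * d + u * v *+ p).
have [P E] := mulrn_lin R p; rewrite !E; ring.
Qed.
Lemma congpX a b n : modp a b -> modp (a ^+ n) (b ^+ n).
Proof.
by move=> h; elim: n => [|n IH]; rewrite ?expr0 ?exprS; [exact: congp_refl | exact: congpM].
Qed.
Lemma congpB a b c d : modp a b -> modp c d -> modp (a - c) (b - d).
Proof. by move=> [u ->] [v ->]; exists (u - v); rewrite mulrnBl opprD addrACA. Qed.

Lemma congp_expD (x y : R) : modp ((x + y) ^+ p) (x ^+ p + y ^+ p).
Proof.
rewrite exprDn; have p0 := prime_gt0 pp.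
rewrite big_ord_recr /= subnn expr0 mul1r binn mulr1n.
rewrite /congp; case: p pp p0 => // q pq _; rewrite big_ord_recl /= subn0 expr0 mulr1 bin0 mulr1n addrAC.
suff [w ->] : exists w, \sum_(i < q) x ^+ (q.+1 - bump 0 i) * y ^+ bump 0 i *+ 'C(q.+1, bump 0 i) = w *+ q.+1.
  by exists w.
apply: (big_ind (fun z => exists w, z = w *+ q.+1)).
- by exists 0; rewrite mul0rn.
- by move=> a b [u ->] [v ->]; exists (u + v); rewrite mulrnDl.
- move=> i _; have /dvdnP [c ->] : (q.+1 %| 'C(q.+1, bump 0 i))%N.
    by apply: prime_dvd_bin => //; rewrite /bump /= add1n ltnS ltn_ord.
  by exists (x ^+ (q.+1 - bump 0 i) * y ^+ bump 0 i *+ c); rewrite mulrnA.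
Qed.

Lemma congp_expB (x y : R) m : modp ((x - y) ^+ (p ^ m)) (x ^+ (p ^ m) - y ^+ (p ^ m)).
Proof.
have h1 (a b : R) : modp ((a - b) ^+ p) (a ^+ p - b ^+ p).
  have := congp_expD (a - b) b; rewrite subrK => /congp_sym h.
  by have := congpB h (congp_refl (b ^+ p)); rewrite addrK.
elim: m => [|m IH]; first by rewrite !expn0 !expr1; exact: congp_refl.
rewrite !expnSr !exprM; apply: congp_trans (h1 _ _); exact: congpX.
Qed.
End ModP.

Section PadicInverse.
Variables (p : nat) (pp : prime p).
Local Notation Zp := (Zp p).

Lemma Zp_limit (P : Zp -> nat -> Prop) (f : nat -> Zp) :
  (forall n N (a b : Zp), (n <= N)%N -> P a N -> a n = b n -> P b n) -> (forall N, P (f N) N) ->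
  exists b, forall n, P b n.
Proof.
move=> hP hf; have [U [UU Un]] := nat_ultra; have [b hb] := Zp_ulim f UU.
exists b => n; have [N /= [e nN]] := filter_ex (filterI (hb n) (Un n)).
exact: hP nN (hf N) e.
Qed.

Lemma Zp_mulE (a b : Zp) n : (a * b) n = a n * b n. Proof. by []. Qed.

Lemma Zp_le_eq (a b : Zp) n N : (n <= N)%N -> a N = b N -> a n = b n.
Proof.
move=> nN e; apply/eqP; rewrite -subr_eq0 -Zp_subE; apply/eqP; apply: (Zp_le0 pp nN).
by rewrite Zp_subE e subrr.
Qed.

Lemma Zp_solve (a b : Zp) (f : nat -> Zp) : (forall N, a N = b N * f N N) -> exists c, a = b * c.
Proof.
move=> h; have [||c hc] := @Zp_limit (fun c n => a n = b n * c n) f; last first.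
- by exists c; apply: Zp_ext => n; rewrite Zp_mulE.
- exact: h.
move=> n N x y nN e exy; rewrite -exy; apply: (@Zp_le_eq a (b * x) n N nN); by rewrite Zp_mulE.
Qed.

Lemma Zp_quotE (a b : Zp) v : b v <> 0 -> a v = 0 -> exists c, a = b * c.
Proof.
move=> bv av; have /choice [m hm] := Zp_quot pp bv av.
by apply: (@Zp_solve _ _ (fun N => (m N)%:R)) => N; rewrite hm Zp_natE mulr_natr.
Qed.

Lemma Zp_divp (a : Zp) : a 0%N = 0 -> exists b, a = b *+ p.
Proof.
move=> a0; have [|c ->] := @Zp_solve a (p%:R) (fun N => (a N %/ p)%N%:R); last by exists c; rewrite mulr_natl.
move=> N; rewrite !Zp_natE -natrM mulnC divnK ?natr_Zp //.
by have := (Zp_dvd pp a (leq0n N)).1 a0; rewrite expn1.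
Qed.

Lemma Zp_unit (a : Zp) : a 0%N <> 0 -> exists b, a * b = 1.
Proof.
move=> a0; suff [b ->] : exists b, 1 = a * b by exists b.
have /choice [m hm] N : exists m : nat, 1 = a N *+ m :> 'Z_(p ^ N.+1).
  have cop : coprime (p ^ N.+1) (a N).
    rewrite coprimeXl // prime_coprime //; apply/negP => h; apply: a0.
    by apply/(Zp_dvd pp a (leq0n N)); rewrite expn1.
  have q0 : (0 < p ^ N.+1)%N by rewrite expn_gt0 prime_gt0.
  have [c _] := Bezoutl (a N) q0; rewrite (eqP cop) => d.
  have q1 : (1 < p ^ N.+1)%N by rewrite -(Zp_mod pp).
  have zero (x : nat) : (p ^ N.+1 %| x)%N -> x%:R = 0 :> 'Z_(p ^ N.+1).
    by move=> dx; apply: val_inj; rewrite /= (val_Zp_nat q1); apply/eqP.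
  exists (c * (p ^ N.+1).-1)%N; have := zero _ d.
  rewrite natrD natrM natr_Zp mulrC mulr_natr => /eqP; rewrite addr_eq0 => /eqP e1.
  rewrite -[LHS]/(1%:R) e1; apply/eqP; rewrite mulrnA eq_sym -addr_eq0 -mulrSr prednK // -mulr_natr zero ?mulr0 //.
by apply: (@Zp_solve _ _ (fun N => (m N)%:R)) => N; rewrite Zp_natE mulr_natr -hm.
Qed.

Lemma Zp_torsion (a : Zp) : a *+ p = 0 -> a = 0.
Proof.
move=> h; apply: Zp_ext => n; apply/(Zp_dvd pp a (leqnSn n)).
have : (a n.+1 * p)%N%:R = 0 :> 'Z_(p ^ n.+2).
  by rewrite natrM natr_Zp mulr_natr -Zp_mulrnE h.
have q1 : (1 < p ^ n.+2)%N by rewrite -(Zp_mod pp).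
move: (a n.+1 : nat) => x; move/(congr1 val); rewrite /= (val_Zp_nat q1) => /eqP.
by rewrite -/(dvdn _ _) expnSr dvdn_pmul2r ?prime_gt0.
Qed.
End PadicInverse.

(* The ideals J n are a basis of neighbourhoods of 0 in R = Z_p[[T]]. *)
Record ps_ring (R : comNzRingType) (p : nat) (pc : {rmorphism Zp p -> R}) (T : R) (J : nat -> R -> Prop) : Prop := PsRing {
  ps_M : forall n a b, J n b -> J n (a * b);
  ps_D : forall n a b, J n a -> J n b -> J n (a + b);
  ps_pn : forall n l, J n (l *+ p ^ n.+1);
  ps_sep : forall l, (forall n, J n l) -> l = 0;
  ps_closed : forall (I J0 : finType) (g : I -> R) (r : J0 -> R) (l : R),
    (forall m, exists (a : I -> R) (b : J0 -> Zp p), J m (l - \sum_i a i * g i - \sum_j pc (b j) * r j)) ->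
    exists (a : I -> R) (b : J0 -> Zp p), l = \sum_i a i * g i + \sum_j pc (b j) * r j;
  ps_aug : forall l, exists a m, l = pc a + T * m;
  ps_small : forall n, exists N, forall m l, (N <= m)%N -> J n (T ^+ m * l);
  ps_Tp : forall m w, T ^+ m <> w *+ p;
  ps_inj : injective pc
}.

Section Weierstrass.
Variables (R : comNzRingType) (p : nat) (pp : prime p) (pc : {rmorphism Zp p -> R}) (T : R) (J : nat -> R -> Prop).
Hypothesis hR : ps_ring pc T J.

Lemma T_dec j (l : R) : exists (b : nat -> Zp p) m, l = \sum_(i < j) pc (b i) * T ^+ i + T ^+ j * m.
Proof.
elim: j => [|j [b [m e]]]; first by exists (fun=> 0), l; rewrite big_ord0 add0r expr0 mul1r.
have [a [m' em]] := ps_aug hR m.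
exists (fun i => if i == j then a else b i), m'.
rewrite big_ord_recr /= eqxx e em mulrDr addrA; congr (_ + _); last by rewrite exprSr mulrA.
congr (_ + _); last by rewrite mulrC.
by apply: eq_bigr => i _; rewrite ltn_eqF.
Qed.

(** The partial sums of the geometric series put 1 in the closure of the ideal of 1 - T g, and this
    ideal is closed. *)
Lemma one_sub_unit (g : R) : exists e, (1 - T * g) * e = 1.
Proof.
have [|a [b e]] := ps_closed hR (I := unit) (J0 := void) (g := fun=> 1 - T * g) (r := fun=> 0) (l := 1).
  move=> m; have [N hN] := ps_small hR m.
  exists (fun=> \sum_(i < N) (T * g) ^+ i), (fun=> 0); rewrite sum_unit sum_void subr0.
  have -> : (\sum_(i < N) (T * g) ^+ i) * (1 - T * g) = 1 - (T * g) ^+ N.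
    by have := subrX1 (T * g) N => /(congr1 (fun x => - x)); rewrite opprB => ->; rewrite mulrC -mulNr opprB.
  by rewrite subKr exprMn; exact: hN.
exists (a tt); rewrite mulrC; rewrite sum_unit sum_void addr0 in e.
exact: esym e.
Qed.

Definition in_p (l : R) := exists w, l = w *+ p.

Lemma in_pM a b : in_p b -> in_p (a * b).
Proof. by move=> [w ->]; exists (a * w); rewrite mulrnAr. Qed.

Lemma in_p_closed (l : R) : (forall n, exists w, J n (l - w *+ p)) -> in_p l.
Proof.
move=> h; have [|a [b e]] := ps_closed hR (I := unit) (J0 := void) (g := fun=> p%:R) (r := fun=> 0) (l := l).
  move=> m; have [w hw] := h m; exists (fun=> w), (fun=> 0).
  by rewrite sum_unit sum_void subr0 mulr_natr.
by exists (a tt); rewrite e sum_unit sum_void addr0 mulr_natr.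
Qed.

Lemma in_p_separated (l : R) : (forall n, exists w, l = w *+ p ^ n) -> l = 0.
Proof.
by move=> h; apply: (ps_sep hR) => n; have [w ->] := h n.+1; exact: (ps_pn hR).
Qed.

(** Modulo p, f is T^i times a unit, where i is the index of its first coefficient prime to p. If
    there were none, f would be divisible by T^i modulo p for all i, hence lie in the closed ideal
    generated by p. *)
Lemma not_in_p_T (f : R) : ~ in_p f -> exists j a b, T ^+ j = f * a + b *+ p.
Proof.
move=> nf; apply: contrapT => h; apply: nf.
have P i : exists f' w, f = T ^+ i * f' + w *+ p.
  elim: i => [|i [f' [w e]]]; first by exists f, 0; rewrite expr0 mul1r mul0rn addr0.
  have [c [m em]] := ps_aug hR f'.
  have [c0|c0] := pselect (c 0%N = 0).
    have [c' ec] := Zp_divp pp c0; exists m, (T ^+ i * pc c' + w).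
    by rewrite e em ec raddfMn /= mulrDr mulrA -exprSr mulrnDl addrCA addrA mulrnAr.
  exfalso; have [d hd] := Zp_unit pp c0; have [u hu] := one_sub_unit (- (pc d * m)).
  have inv : f' * (pc d * u) = 1.
    rewrite -hu em; have cd : pc c * pc d = 1 by rewrite -rmorphM hd rmorph1.
    by rewrite mulrA mulrDl cd; congr (_ * _); ring.
  apply: h; exists i, (pc d * u), (- (w * (pc d * u))).
  by rewrite e mulrDl -mulrA inv mulr1 mulrnAl mulNrn addrK.
apply: in_p_closed => n; have [N hN] := ps_small hR n; have [f' [w e]] := P N.
by exists w; rewrite e addrK; exact: hN.
Qed.

(** Otherwise both factors divide powers of T modulo p, and T would be nilpotent modulo p, against
    [ps_Tp]. *)
Lemma in_p_prime a b : in_p (a * b) -> in_p a \/ in_p b.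
Proof.
move=> [w hw]; have [|na] := pselect (in_p a); first by left.
have [|nb] := pselect (in_p b); first by right.
have [i [a' [u hu]]] := not_in_p_T na; have [j [b' [v hv]]] := not_in_p_T nb.
have [P E] := mulrn_lin R p; exfalso; apply: (ps_Tp hR (m := i + j) (w := w * (a' * b') + a * a' * v + u * (b * b') + u * v *+ p)).
rewrite exprD hu hv.
have -> : (a * a' + u *+ p) * (b * b' + v *+ p) = (a * b) * (a' * b') + a * a' * (v *+ p) + u *+ p * (b * b') + u *+ p * (v *+ p) by ring.
rewrite hw !E; ring.
Qed.

Lemma in_p_dec (f : R) : f <> 0 -> exists m f', f = f' *+ p ^ m /\ ~ in_p f'.
Proof.
move=> f0; apply: contrapT => h; apply: f0; apply: in_p_separated => n.
elim: n => [|n [w e]]; first by exists f; rewrite expn0 mulr1n.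
have [[u eu]|nw] := pselect (in_p w); last by case: h; exists n, w.
by exists u; rewrite expnS mulrnA -eu.
Qed.

(** Dividing by the T^j of [not_in_p_T] instead of f leaves an error divisible by p; iteration gives
    the division modulo p^N, and closedness makes it exact. *)
Lemma weierstrass (f : R) : ~ in_p f -> exists j, forall l, exists a (b : 'I_j -> Zp p),
  l = f * a + \sum_i pc (b i) * T ^+ i.
Proof.
move=> nf; have [j [a [b e]]] := not_in_p_T nf; exists j => l.
have step N x : exists u (v : 'I_j -> Zp p) w, x = f * u + \sum_i pc (v i) * T ^+ i + w *+ p ^ N.
  elim: N x => [|N IH] x.
    exists 0, (fun=> 0), x; rewrite mulr0 big1 ?addr0 ?add0r ?expn0 ?mulr1n // => i _.
    by rewrite rmorph0 mul0r.
  have [u [v [w ->]]] := IH x; have [r [m ->]] := T_dec j w.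
  exists (u + a * m *+ p ^ N), (fun i => v i + r i *+ p ^ N), (b * m).
  rewrite e mulrDl mulrnDl mulrnDl.
  have -> : \sum_(i < j) pc (v i + r i *+ p ^ N) * T ^+ i = \sum_(i < j) pc (v i) * T ^+ i + (\sum_(i < j) pc (r i) * T ^+ i) *+ p ^ N.
    rewrite -sumrMnl -big_split /=; apply: eq_bigr => i _.
    by rewrite rmorphD /= raddfMn /= mulrDl mulrnAl.
  have [P E] := mulrn_lin R p; have [PN EN] := mulrn_lin R (p ^ N).
  by rewrite expnSr mulrnA !EN !E; move: (\sum_(i < j) _) (\sum_(i < j) _) => S1 S2; ring.
have [|u [v ->]] := ps_closed hR (I := unit) (J0 := 'I_j) (g := fun=> f) (r := fun i => T ^+ i) (l := l).
  move=> m; have [u [v [w ew]]] := step m.+1 l; exists (fun=> u), v.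
  rewrite sum_unit {1}ew (mulrC u).
  have -> : f * u + \sum_i pc (v i) * T ^+ i + w *+ p ^ m.+1 - f * u - \sum_j0 pc (v j0) * T ^+ j0 = w *+ p ^ m.+1 by ring.
  exact: (ps_pn hR).
by exists (u tt), v; rewrite sum_unit mulrC.
Qed.

(* A monic relation over Z_p for g modulo f, by the determinant trick. *)
Lemma integral_mod (f : R) : ~ in_p f -> forall g : R, exists (h : {poly Zp p}) a,
  h \is monic /\ (map_poly pc h).[g] = f * a.
Proof.
move=> /weierstrass [j hj] g.
have /choice [ab hab] (i : 'I_j) : exists ab : R * ('I_j -> Zp p), g * T ^+ i = f * ab.1 + \sum_l pc (ab.2 l) * T ^+ l.
  by have [a [b e]] := hj (g * T ^+ i); exists (a, b).
have [a1 [b1 e1]] := hj 1.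
pose C : 'M[Zp p]_j := \matrix_(i, l) (ab i).2 l.
pose v : 'cV[R]_j := \col_i T ^+ i; pose w : 'cV[R]_j := \col_i (f * (ab i).1).
pose A : 'M[R]_j := g%:M - map_mx pc C.
have Av : A *m v = w.
  rewrite mulmxBl mul_scalar_mx; apply/matrixP => i c; rewrite !mxE hab.
  under [X in _ - X]eq_bigr => l _ do rewrite !mxE.
  by rewrite addrK.
have dA : \det A = (map_poly pc (char_poly C)).[g].
  rewrite map_char_poly /char_poly -horner_evalE -det_map_mx; congr (\det _).
  apply/matrixP => i l; rewrite !mxE /= horner_evalE hornerD hornerN hornerC hornerMn hornerX.
  by [].
exists (char_poly C), (\det A * a1 + \sum_i pc (b1 i) * \sum_l \adj A i l * (ab l).1); split; first exact: char_poly_monic.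
rewrite -dA -[LHS]mulr1 {1}e1 !mulrDr mulrA (mulrC _ f) -!mulrA; congr (_ + _).
rewrite !mulr_sumr; apply: eq_bigr => i _.
have : \det A * T ^+ i = f * \sum_l \adj A i l * (ab l).1.
  have : (\adj A *m A *m v) i 0 = (\adj A *m w) i 0 by rewrite -mulmxA Av.
  rewrite mul_adj_mx mul_scalar_mx !mxE => ->.
  by rewrite mulr_sumr; apply: eq_bigr => l _; rewrite !mxE mulrCA.
by move=> e; rewrite mulrCA e mulrCA.
Qed.

(** Suppose that p is not in q. An f in q1 outside q0 may be stripped of its factors p. By
    [integral_mod] an element g of q outside q1 satisfies a monic equation over Z_p modulo f, hence
    modulo q1. A zero constant term is removed by cancelling g, and a nonzero one lies in q, which
    then contains a power of p. *)
Lemma no_chain (q0 q1 q : set R) : prime_ideal q0 -> prime_ideal q1 -> prime_ideal q ->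
  (q0 `<` q1 /\ q1 `<` q)%classic -> q p%:R.
Proof.
move=> [z0 D0 M0 n0 P0] [z1 D1 M1 n1 P1] [z D M n1q P] [[s01 ns01] [s1 ns1]].
apply: contrapT => nqp.
have qp c x : q1 (x *+ p ^ c) -> q1 x.
  rewrite -mulr_natr => /P1 [//|h]; exfalso; apply: nqp; apply: s1.
  elim: c h => [|c IH]; first by rewrite expn0 => /n1.
  by rewrite expnS natrM => /P1 [].
have [f f1 nf0] : exists2 f, q1 f & ~ q0 f.
  by apply: contrapT => h; apply: ns01 => x hx; apply: contrapT => nx; apply: h; exists x.
have fn0 : f <> 0 by move=> e; apply: nf0; rewrite e.
have [m [f' [ef nf']]] := in_p_dec fn0.
have f'1 : q1 f' by apply: (qp m); rewrite -ef.
have [g gq ng1] : exists2 g, q g & ~ q1 g.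
  by apply: contrapT => h; apply: ns1 => x hx; apply: contrapT => nx; apply: h; exists x.
have [h [a [hm ha]]] := integral_mod nf' g.
have hr : q1 (map_poly pc h).[g] by rewrite ha mulrC; exact: M1.
have gen d (c : nat -> Zp p) : c d = 1 -> ~ q1 (\sum_(i < d.+1) pc (c i) * g ^+ i).
  elim: d c => [|d IH] c cd; first by rewrite big_ord1 cd rmorph1 mulr1.
  rewrite big_ord_recl expr0 mulr1 /= => hs.
  have e : \sum_(i < d.+1) pc (c (bump 0 i)) * g ^+ bump 0 i = (\sum_(i < d.+1) pc (c i.+1) * g ^+ i) * g.
    by rewrite mulr_suml; apply: eq_bigr => i _; rewrite -mulrA -exprSr.
  have c0 : c 0%N = 0.
    apply: contrapT => c0; apply: nqp; have [v hv] := Zp_neq0 c0.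
    have qc : q (pc (c 0%N)).
      have := D _ _ (s1 _ hs) (M (-1) _ (M (\sum_(i < d.+1) pc (c i.+1) * g ^+ i) _ gq)).
      by rewrite e mulN1r addrK.
    have [|b hb] := Zp_quotE pp (a := (p ^ v.+1)%:R) hv.
      have q1' : (1 < p ^ v.+1)%N by rewrite -(Zp_mod pp).
      by rewrite Zp_natE; apply: val_inj; rewrite /= (val_Zp_nat q1') modnn.
    have : q (p ^ v.+1)%:R.
      rewrite -(rmorph_nat pc) hb rmorphM mulrC; exact: M.
    elim: (v.+1) => [|u IHu]; first by rewrite expn0 => /n1q.
    by rewrite expnS natrM => /P [].
  have IHc := IH (fun i => c i.+1) cd.
  by move: hs; rewrite c0 rmorph0 add0r e => /P1 [h1|//]; apply: IHc.
apply: (gen (size h).-1 (fun i => h`_i)); first by rewrite -[LHS]/(lead_coef h) (monicP hm).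
rewrite prednK ?size_poly_gt0 ?monic_neq0 //.
move: hr; rewrite horner_coef size_map_inj_poly ?rmorph0 //; last first.
  exact: (ps_inj hR).
by under eq_bigr => i _ do rewrite coef_map.
Qed.
End Weierstrass.

Section IwasawaAlgebra.
Variables (p : nat) (pp : prime p) (k : set algC) (K : Zp_extension p k).
Local Notation Gam := (gal k K).
Local Notation Lam := (iwasawa_algebra K).
Variables (phi : Gam -> Zp p) (hphi : topological_iso_Zp phi) (g0 : Gam) (hg0 : phi g0 = 1).
Local Notation gm := (iw_group g0 : Lam).
Local Notation T := (gm - 1 : Lam).
Local Notation J := (J hphi).
Local Notation pc := (@iw_const p k K).

Lemma iw_1E (Q : finite_quotient k K) y : (1 : Lam) Q y = 1 *+ (y == fq_map Q 1%g).
Proof. exact: (iw_singleE 1 1%g y). Qed.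

Lemma iw_sub1E (g : Gam) (Q : finite_quotient k K) y :
  (iw_group g - 1 : Lam) Q y = 1 *+ (y == fq_map Q g) - 1 *+ (y == fq_map Q 1%g).
Proof. by rewrite iwD iwN; congr (_ - _); [exact: (iw_singleE 1 g y) | exact: iw_1E]. Qed.

Lemma JQ_pn (Q : finite_quotient k K) n (l : Lam) : JQ Q n (l *+ p ^ n.+1).
Proof.
move=> y; rewrite iwMn Zp_mulrnE -mulr_natr.
have ->: (p ^ n.+1)%N%:R = 0 :> 'Z_(p ^ n.+1).
  have q1 : (1 < p ^ n.+1)%N by rewrite -(Zp_mod pp).
  by apply: val_inj; rewrite /= (val_Zp_nat q1) modnn.
by rewrite mulr0.
Qed.

Lemma J_gpow n : J n (gm ^+ (p ^ n.+1) - 1).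
Proof.
move=> y; rewrite -iw_groupX iw_sub1E.
have -> : fq_map (stdq hphi n) (g0 ^+ (p ^ n.+1))%g = fq_map (stdq hphi n) 1%g.
  apply/stdq_eq; rewrite (phiX hphi) hg0 (phi1 hphi) Zp_natE.
  have q1 : (1 < p ^ n.+1)%N by rewrite -(Zp_mod pp).
  by apply: val_inj; rewrite /= (val_Zp_nat q1) modnn.
by rewrite subrr.
Qed.

Lemma aug_dec (l : Lam) : exists a m, l = pc a + T * m.
Proof.
have [|a [b ->]] := @iw_closed p pp k K phi hphi unit unit (fun=> T) (fun=> 1) l.
  move=> m; have [c hc] := iw_dense pp hphi hg0 l m.
  exists (fun=> \sum_(i < p ^ m.+1) (\sum_(j < i) gm ^+ j) *+ c i), (fun=> (\sum_(i < p ^ m.+1) c i)%N%:R).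
  rewrite !sum_unit rmorph_nat mulr1 -addrA -opprD.
  suff -> : (\sum_(i < p ^ m.+1) (\sum_(j < i) gm ^+ j) *+ c i) * T + (\sum_(i < p ^ m.+1) c i)%:R =
    \sum_(i < p ^ m.+1) gm ^+ i *+ c i by [].
  rewrite natr_sum mulr_suml -big_split /=; apply: eq_bigr => i _.
  by rewrite mulrnAl mulrC -subrX1 -[(c i)%:R]/(1 *+ c i) -mulrnDl subrK.
by exists (b tt), (a tt); rewrite !sum_unit mulr1 addrC mulrC.
Qed.

(** T^(p^(n+1)) is congruent modulo p to [gm] ^ (p^(n+1)) - 1, which lies in J n, and p^(n+1) is in
    J n too; so the (n+1)-st power of T^(p^(n+1)) is in J n. *)
Lemma T_small n : exists N, forall m l, (N <= m)%N -> J n (T ^+ m * l).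
Proof.
have [w hw] := congp_expB pp gm 1 n.+1; rewrite expr1n in hw.
exists (p ^ n.+1 * n.+1)%N => m l Nm; rewrite -(subnKC Nm) exprD -mulrA mulrC; apply: JQM.
rewrite exprM hw; set A := gm ^+ _ - 1; set B := w *+ p.
rewrite -(subrK (B ^+ n.+1) ((A + B) ^+ n.+1)); apply: JQD.
  rewrite subrXX addrK mulrC; apply: JQM; exact: J_gpow.
by rewrite /B exprMn_n; exact: JQ_pn.
Qed.

Lemma iw_evalp (w : Lam) (Q : finite_quotient k K) y : (w *+ p) Q y 0%N = 0.
Proof. rewrite iwMn Zp_mulrnE -mulr_natr.
have ->: p%:R = 0 :> 'Z_(p ^ 1).
  have q1 : (1 < p ^ 1)%N by rewrite -(Zp_mod pp).
  by apply: val_inj; rewrite /= (val_Zp_nat q1) expn1 modnn.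
by rewrite mulr0. Qed.

Lemma group_sub1_not_p (g : Gam) (w : Lam) : g <> 1%g -> iw_group g - 1 <> w *+ p.
Proof.
move=> g1 e; have [n hn] := phi_neq0 hphi g1.
have := iw_evalp w (fq_map (stdq hphi n) g); rewrite -e iw_sub1E eqxx.
have -> : (fq_map (stdq hphi n) g == fq_map (stdq hphi n) 1%g) = false.
  by apply/negbTE/eqP => /stdq_eq; rewrite (phi1 hphi).
by rewrite mulr0n subr0 mulr1n => /eqP; rewrite oner_eq0.
Qed.

Lemma T_not_p m w : T ^+ m <> w *+ p.
Proof.
move=> h; have pm : (m <= p ^ m)%N by rewrite ltnW // ltn_expl // prime_gt1.
have [u hu] : exists u, gm ^+ (p ^ m) - 1 = u *+ p.
  have [u hu] := congp_sym (congp_expB pp gm 1 m); rewrite expr1n in hu.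
  exists (T ^+ (p ^ m - m) * w + u); rewrite hu -{1}(subnK pm) exprD h.
  by rewrite mulrnDl mulrnAr.
rewrite -iw_groupX in hu; apply: group_sub1_not_p hu => e.
have := congr1 phi e; rewrite (phiX hphi) hg0 (phi1 hphi) => /(congr1 (fun a : Zp p => a m)).
rewrite Zp_natE => /(congr1 val); have q1 : (1 < p ^ m.+1)%N by rewrite -(Zp_mod pp).
rewrite /= (val_Zp_nat q1) modn_small ?ltn_exp2l ?prime_gt1 // => /eqP.
by rewrite -leqn0 leqNgt expn_gt0 prime_gt0.
Qed.

Lemma iw_const_inj : injective pc.
Proof.
move=> x y e; apply/eqP; rewrite -subr_eq0; apply/eqP.
have : pc (x - y) (stdq hphi 0%N) (fq_map (stdq hphi 0%N) 1%g) = 0.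
  by have -> : pc (x - y) = pc x - pc y; [exact: raddfB | rewrite e subrr iw0].
by rewrite iw_singleE eqxx mulr1n.
Qed.

Lemma iw_ps_ring : ps_ring (pc : {rmorphism Zp p -> Lam}) T J.
Proof.
split.
- by move=> n a b; exact: JQM.
- by move=> n a b; exact: JQD.
- by move=> n l; exact: JQ_pn.
- exact: (J_eq0 pp).
- exact: (iw_closed pp).
- exact: aug_dec.
- exact: T_small.
- exact: T_not_p.
- exact: iw_const_inj.
Qed.
End IwasawaAlgebra.

(** * Annihilators in pseudo-null modules *)

Section Localisation.
Variables (R : comPzRingType) (S : mult_set R).

Lemma avoiding_prime (I : set R) : I 0 -> (forall x y, I x -> I y -> I (x + y)) ->
  (forall a x, I x -> I (a * x)) -> (forall x, I x -> ~ S x) ->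
  exists q, [/\ prime_ideal q, forall x, I x -> q x & forall x, q x -> ~ S x].
Proof.
move=> I0 ID IM IS.
pose ideal (A : set R) := (forall x y, A x -> A y -> A (x + y)) /\ (forall a x, A x -> A (a * x)).
pose Q (A : set R) := A = classical_sets.set0 \/
  [/\ ideal A, forall x, I x -> A x & forall x, A x -> ~ S x].
have [F FQ tot|A [QA maxA]] := @Zorn_bigcup _ Q.
  have [[A0 [FA A0n]]|none] := pselect (exists A, F A /\ A <> classical_sets.set0); last first.
    left; rewrite -subset0 => x [A FA Ax]; apply: none; exists A; split => // e.
    by rewrite e in Ax.
  have hA B x : F B -> B x -> [/\ ideal B, forall x, I x -> B x & forall x, B x -> ~ S x].
    by move=> FB Bx; have [e|//] := FQ _ FB; rewrite e in Bx.
  have [x0 A0x] : exists x, A0 x.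
    by apply: contrapT => h; apply: A0n; rewrite -subset0 => x Ax; apply: h; exists x.
  right; split; first split.
  - move=> x y [B FB Bx] [C FC Cy]; have [h|h] := tot _ _ FB FC.
      by exists C => //; have [[D _] _ _] := hA _ _ FC Cy; apply: D => //; exact: h.
    by exists B => //; have [[D _] _ _] := hA _ _ FB Bx; apply: D => //; exact: h.
  - by move=> a x [B FB Bx]; exists B => //; have [[_ M] _ _] := hA _ _ FB Bx; exact: M.
  - by move=> x Ix; exists A0 => //; have [_ h _] := hA _ _ FA A0x; exact: h.
  - by move=> x [B FB Bx]; have [_ _ h] := hA _ _ FB Bx; exact: h.
have {QA}[A0|[[AD AM] IA AS]] := QA.
  exfalso; apply: (maxA I); last by right.
  by rewrite A0; split => // h; exact: (h 0 I0).
exists A; split => //.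
have big x : ~ A x -> exists a b, A a /\ S (a + b * x).
  move=> nAx; apply: contrapT => h.
  pose B : set R := fun y => exists a b, A a /\ y = a + b * x.
  have AB y : A y -> B y by move=> Ay; exists y, 0; rewrite mul0r addr0.
  apply: (maxA B).
    split => // h'; apply: nAx; apply: h'.
    by exists 0, 1; rewrite add0r mul1r; split=> //; exact: IA.
  right; split; first split.
  - move=> y z [a [b [h1 ->]]] [c [d [h2 ->]]]; exists (a + c), (b + d).
    by rewrite addrACA mulrDl; split=> //; exact: AD.
  - by move=> e y [a [b [h1 ->]]]; exists (e * a), (e * b); rewrite mulrDr mulrA; split=> //; exact: AM.
  - by move=> y /IA /AB.
  - by move=> y [a [b [h1 ->]]] h2; apply: h; exists a, b.
split => // [|A1|x y xy]; first exact: IA.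
  exact: (AS 1 A1 (ms_1 S)).
apply: contrapT => /not_orP [/big [a [b [Aa Sa]]] /big [c [d [Ac Sc]]]].
apply: (AS _ _ (ms_M Sa Sc)).
have -> : (a + b * x) * (c + d * y) = (c + d * y) * a + (b * x) * c + (b * d) * (x * y) by ring.
by apply: (AD); [apply: (AD)|]; apply: AM.
Qed.

Definition loc_prime (q : set R) : set (loc S) :=
  fun x => exists f : loc_frac S, x = loc_mk f /\ q (loc_num f).

Section PrimeOfLoc.
Variables (q : set R) (qp : prime_ideal q) (qS : forall x, q x -> ~ S x).

Lemma loc_primeE (f : loc_frac S) : loc_prime q (loc_mk f) <-> q (loc_num f).
Proof.
have [_ _ M _ P] := qp; split=> [[g [/loc_mkP [u Su e] h]]|h]; last by exists f.
have : q (u * loc_den g * loc_num f).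
  have -> : u * loc_den g * loc_num f = u * loc_den f * loc_num g by rewrite -!mulrA (mulrC _ (loc_num f)) e; ring.
  exact: M.
by move/P => [/qS h1|//]; exfalso; apply: h1; apply: ms_M => //; exact: loc_denP.
Qed.

Lemma loc_primeP : prime_ideal (loc_prime q).
Proof.
have [q0 D M n1 P] := qp; split.
- by apply/loc_primeE.
- elim/loc_ind => x; elim/loc_ind => y /loc_primeE hx /loc_primeE hy.
  rewrite -[_ + _]/(loc_add (loc_mk x) (loc_mk y)) loc_addE; apply/loc_primeE => /=.
  by apply: D; rewrite mulrC; apply: M.
- elim/loc_ind => x; elim/loc_ind => y /loc_primeE hy.
  by rewrite -[_ * _]/(loc_mul (loc_mk x) (loc_mk y)) loc_mulE; apply/loc_primeE; exact: M.
- by move/loc_primeE.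
- elim/loc_ind => x; elim/loc_ind => y.
  rewrite -[_ * _]/(loc_mul (loc_mk x) (loc_mk y)) loc_mulE => /loc_primeE /P [] h; [left|right]; exact/loc_primeE.
Qed.

Lemma loc_ofE (f : loc_frac S) : loc_mk f * loc_of S (loc_den f) = loc_of S (loc_num f).
Proof.
rewrite -[_ * _]/(loc_mul _ (loc_mk _)) loc_mulE; apply: loc_mk_eq => /=; ring.
Qed.

Lemma loc_of_unit (f : loc_frac S) : exists g, loc_mk f = g * loc_of S (loc_num f).
Proof.
exists (loc_mk (MkFrac 1 (loc_denP f))).
rewrite -[_ * _]/(loc_mul (loc_mk _) (loc_mk _)) loc_mulE; apply: loc_mk_eq => /=; ring.
Qed.

Lemma preim_prime (P : set (loc S)) : prime_ideal P -> prime_ideal (loc_of S @^-1` P)%classic.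
Proof.
move=> [z D M n1 pr]; split=> /=.
- by rewrite /preimage /= raddf0.
- by move=> x y hx hy; rewrite /preimage /= raddfD; exact: D.
- by move=> a x hx; rewrite /preimage /= rmorphM; exact: M.
- by rewrite /preimage /= rmorph1.
- by move=> x y; rewrite /preimage /= rmorphM; exact: pr.
Qed.

Lemma preim_lt (P P' : set (loc S)) : prime_ideal P -> prime_ideal P' -> (P `<` P')%classic ->
  (loc_of S @^-1` P `<` loc_of S @^-1` P')%classic.
Proof.
move=> [_ _ M _ _] [_ _ M' _ _] [h nh]; split=> [x /h //|h2]; apply: nh.
elim/loc_ind => f hf; have [g ->] := loc_of_unit f; apply: M; apply: h2.
by rewrite /preimage /= -loc_ofE mulrC; exact: M'.
Qed.

Lemma loc_prime_height : height_le1 q -> height_le1 (loc_prime q).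
Proof.
move=> hq P0 P1 p0 p1 [l01 l1]; apply: (hq _ _ (preim_prime p0) (preim_prime p1)).
split; first exact: preim_lt.
have e : q = (loc_of S @^-1` (loc_prime q))%classic.
  by apply/seteqP; split=> x hx; apply/(loc_primeE (frac_of S x)).
by rewrite {1}e; apply: preim_lt => //; exact: loc_primeP.
Qed.
End PrimeOfLoc.

Section Tensor.
Variable V : lmodType R.

(** A pair (v, r) stands for the fraction v / r in the localised module. Formal tensors are
    evaluated to such fractions, which detects when a pure tensor is zero. *)
Definition lfeq (x y : V * R) : Prop := exists2 u, S u & (u * y.2) *: x.1 = (u * x.2) *: y.1.
Definition lfadd (x y : V * R) : V * R := (y.2 *: x.1 + x.2 *: y.1, x.2 * y.2).
Definition lfatom (f : loc_frac S) (v : V) : V * R := (loc_num f *: v, loc_den f).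
Definition lfval (s : seq (loc S * V)) : V * R :=
  foldr (fun c => lfadd (lfatom (repr c.1) c.2)) (0, 1) s.

Lemma lfeq_refl x : lfeq x x. Proof. by exists 1 => //; exact: ms_1. Qed.
Lemma lfeq_sym x y : lfeq x y -> lfeq y x. Proof. by move=> [u h e]; exists u. Qed.
Lemma lfeq_trans y x z : S y.2 -> lfeq x y -> lfeq y z -> lfeq x z.
Proof.
move=> Sy [u Su e] [w Sw f]; exists (u * w * y.2); first by do 2?apply: ms_M => //.
have -> : u * w * y.2 * z.2 = (w * z.2) * (u * y.2) by ring.
rewrite -scalerA e scalerA; have -> : w * z.2 * (u * x.2) = (u * x.2) * (w * z.2) by ring.
by rewrite -scalerA f scalerA; congr (_ *: _); ring.
Qed.
Lemma lfadd_eq x x' y y' : lfeq x x' -> lfeq y y' -> lfeq (lfadd x y) (lfadd x' y').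
Proof.
move=> [u Su e] [w Sw f]; exists (u * w); [exact: ms_M|rewrite /=].
rewrite !scalerDr !scalerA; congr (_ + _).
  have -> : u * w * (x'.2 * y'.2) * y.2 = (w * y'.2 * y.2) * (u * x'.2) by ring.
  by rewrite -scalerA e scalerA; congr (_ *: _); ring.
have -> : u * w * (x'.2 * y'.2) * x.2 = (u * x'.2 * x.2) * (w * y'.2) by ring.
by rewrite -scalerA f scalerA; congr (_ *: _); ring.
Qed.
Lemma lfaddA x y z : lfadd x (lfadd y z) = lfadd (lfadd x y) z.
Proof. by rewrite /lfadd /= !scalerDr !scalerA addrA mulrA; congr (_ *: _ + _ *: _ + _, _); ring. Qed.
Lemma lfaddC x y : lfadd x y = lfadd y x.
Proof. by rewrite /lfadd addrC mulrC. Qed.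
Lemma lfadd0 x : lfadd (0, 1) x = x.
Proof. by case: x => v r; rewrite /lfadd /= scaler0 add0r scale1r mul1r. Qed.
Lemma lfval_cat s t : lfval (s ++ t) = lfadd (lfval s) (lfval t).
Proof. by elim: s => [|c s IH] /=; rewrite ?lfadd0 // IH lfaddA. Qed.
Lemma lfval_den s : S (lfval s).2.
Proof. by elim: s => [|c s IH] /=; [exact: ms_1 | apply: ms_M => //; exact: loc_denP]. Qed.
Lemma lfatom_eq f g v : loc_mk f = loc_mk g -> lfeq (lfatom f v) (lfatom g v).
Proof.
by move=> /loc_mkP [u Su e]; exists u => //; rewrite /= !scalerA -!mulrA (mulrC (loc_den g)) (mulrC (loc_den f)) e.
Qed.

Lemma lfval1 a v : lfval [:: (a, v)] = lfatom (repr a) v.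
Proof. by rewrite /= lfaddC lfadd0. Qed.

Lemma lfval_rel s t : tens_rel (loc_of S) s t -> lfeq (lfval s) (lfval t).
Proof.
elim=> {s t} [s|s t _|t s u _ st _ tu|s s' t t' _ h _ h'|s t|v|a b v|a v w|a r v].
- exact: lfeq_refl.
- exact: lfeq_sym.
- exact: (lfeq_trans (lfval_den t)).
- by rewrite !lfval_cat; exact: lfadd_eq.
- by rewrite !lfval_cat lfaddC; exact: lfeq_refl.
- rewrite lfval1; apply: (@lfeq_trans (lfatom (frac_of S 0) v)); first exact: ms_1.
    by apply: lfatom_eq; rewrite /loc_mk reprK.
  by exists 1; [exact: ms_1|rewrite /= scale0r !scaler0].
- rewrite -(cat1s _ [:: (b, v)]) lfval_cat !lfval1.
  apply: (@lfeq_trans (lfatom (frac_add (repr a) (repr b)) v)); first exact: loc_denP.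
    apply: lfatom_eq; rewrite -loc_addE /loc_mk !reprK //.
  exists 1; [exact: ms_1|rewrite /= !scalerDr !scalerA -scalerDl].
  by congr (_ *: _); ring.
- rewrite -(cat1s _ [:: (a, w)]) lfval_cat !lfval1; exists 1; [exact: ms_1|rewrite /=].
  by rewrite !scalerDr !scalerA; congr (_ *: _ + _ *: _); ring.
- rewrite !lfval1; apply: (@lfeq_trans (lfatom (frac_mul (repr a) (frac_of S r)) v)); first exact: loc_denP.
    by apply: lfatom_eq; rewrite -loc_mulE /loc_mk !reprK.
  by rewrite /lfatom /= -scalerA mulr1; exact: lfeq_refl.
Qed.

(** A prime of R of height at most 1 that avoids S extends to one of the localisation. An
    annihilator of the tensor of 1 and v outside it gives, through [lfval_rel], an annihilator of v
    in R outside q. *)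
Lemma loc_pseudo_null (q : set R) : pseudo_null (base_change (loc_of S : {rmorphism R -> loc S}) V) ->
  prime_ideal q -> (forall x, q x -> ~ S x) -> height_le1 q ->
  forall v : V, exists2 a, ~ q a & a *: v = 0.
Proof.
move=> pn qp qS hq v.
have [a na e] := pn _ (loc_primeP qp qS) (loc_prime_height qp qS hq) (tens_mk _ [:: (1, v)]).
have {}e : tens_mk (loc_of S : {rmorphism R -> loc S}) [:: (a, v)] = tens_mk _ [::].
  rewrite -[RHS]e -[RHS]/(tens_scale _ _) tens_scaleE /=; congr (tens_mk _ [:: (_, _)]); exact: (esym (mulr1 a)).
move/tens_mkP/lfval_rel: e; rewrite lfval1 => -[u Su] /=.
rewrite mulr1 scaler0 scalerA => h; exists (u * loc_num (repr a)) => //.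
have [_ _ _ _ P] := qp; move/P => [/qS //|hn]; apply: na.
by exists (repr a); rewrite /loc_mk reprK.
Qed.
End Tensor.
End Localisation.

Section IwasawaTorsion.
Variables (p : nat) (pp : prime p) (k : set algC) (K : Zp_extension p k).
Local Notation Lam := (iwasawa_algebra K).
Variables (V : lmodType Lam) (pn : pseudo_null (dagger V)).

Lemma phi_generator (phi : gal k K -> Zp p) : topological_iso_Zp phi -> exists g, phi g = 1.
Proof. by move=> [[psi _ psiK] _ _ _]; exists (psi 1). Qed.

Lemma dagger_not_p (x : Lam) : dagger_rel x -> ~ in_p p x.
Proof.
have [phi hphi] := ext_iso K; have [g0 hg0] := phi_generator hphi.
have hR := iw_ps_ring pp hphi hg0.
elim=> {x} [|g x g1 _ IH] => [[w e]|/(in_p_prime pp hR) [[w e]|//]].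
  by apply: (ps_Tp hR (m := 0)); rewrite expr0; exact: e.
exact: (group_sub1_not_p pp hphi g1 e).
Qed.

(** p Lambda avoids the denominators and has height at most 1: a prime strictly inside it omits p,
    so with f = f' p^m it would contain f', which is outside p Lambda when f is nonzero; that prime
    is therefore zero. *)
Lemma killed_not_p (v : V) : exists2 f, ~ in_p p f & f *: v = 0.
Proof.
have [phi hphi] := ext_iso K; have [g0 hg0] := phi_generator hphi.
have hR := iw_ps_ring pp hphi hg0.
have pr : prime_ideal (@in_p Lam p).
  split; first by exists 0; rewrite mul0rn.
  - by move=> x y [u ->] [w ->]; exists (u + w); rewrite mulrnDl.
  - by move=> a x; exact: in_pM.
  - by move=> h; apply: dagger_not_p h; exact: dagger_1.
  - by move=> x y; exact: (in_p_prime pp hR).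
apply: (loc_pseudo_null pn pr) => [x h /dagger_not_p //|P0 P1 [z0 _ _ _ _] [z1 D1 M1 n1 P] [[h0 nh0] [h1 nh1]]].
apply: nh0 => f P1f; have [->//|fn0] := pselect (f = 0); exfalso.
have [m [f' [ef nf']]] := in_p_dec hR fn0.
have np : ~ P1 p%:R by move=> hp; apply: nh1 => x [w ->]; rewrite -mulr_natr; exact: M1.
move: P1f; rewrite ef -mulr_natr => /P [/h1 //|]; elim: m {ef} => [|m IH]; first by rewrite expn0.
by rewrite expnS natrM => /P [].
Qed.

(** If the annihilator of v missed all products p^m s, it would lie in a prime q missing them. Such
    a q omits p, hence has height at most 1 by [no_chain], and avoids the denominators, so some
    element outside q kills v, a contradiction. *)
Lemma killed_dagger (v : V) : exists s m, dagger_rel s /\ (s *+ p ^ m) *: v = 0.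
Proof.
have [phi hphi] := ext_iso K; have [g0 hg0] := phi_generator hphi.
have hR := iw_ps_ring pp hphi hg0.
apply: contrapT => nh.
pose W (x : Lam) := exists s m, dagger_rel s /\ x = s *+ p ^ m.
have W1 : W 1 by exists 1, 0; split; [exact: dagger_1|rewrite expn0 mulr1n].
have WM x y : W x -> W y -> W (x * y).
  move=> [s [m [hs ->]]] [t [n [ht ->]]]; exists (s * t), (m + n); split; first exact: dagger_relM.
  by rewrite mulrnAl mulrnAr -mulrnA expnD mulnC.
have [|||x|q [qp Iq qW]] := @avoiding_prime _ (MkMultSet W1 WM) (fun x => x *: v = 0).
- by rewrite scale0r.
- by move=> x y hx hy; rewrite scalerDl hx hy addr0.
- by move=> a x hx; rewrite -scalerA hx scaler0.
- by move=> hx [s [m [hs e]]]; apply: nh; exists s, m; rewrite -e.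
have np : ~ q p%:R.
  by move=> h; apply: (qW _ h); exists 1, 1; split; [exact: dagger_1|rewrite expn1].
have [||f nf fv] := loc_pseudo_null pn qp _ _ v; last by apply: nf; exact: Iq.
- by move=> x qx hx; apply: (qW _ qx); exists x, 0; rewrite expn0 mulr1n.
- by move=> P0 P1 p0 p1 [h0 h1]; apply: np; exact: (no_chain pp hR p0 p1 qp (conj h0 h1)).
Qed.
End IwasawaTorsion.

(** * Galois modules *)

Lemma prime_restrict (M P : set algC) : subfield M -> prime_of [set: algC]%classic P ->
  prime_of M [set x | M x /\ P x]%classic.
Proof.
move=> sM hP; have [l pl Pl] := pr_char subfieldT hP; split.
- split=> [x [Mx Px]|]; first by split=> //; exact: (pr_int hP).
  by exists l%:R; [split=> //; exact: sf_nat | rewrite pnatr_eq0 -lt0n prime_gt0].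
- by move=> x y [? ?] [? ?]; split; [exact: (sfD sM)|exact: (prD hP)].
- by move=> a x [? ?] [? ?]; split; [exact: (sfM sM)|exact: (prM hP)].
- by move=> [_]; exact: (pr1 hP).
- move=> x y [Mx Ax] [My Ay] [_ Pxy].
  by have [h|h] := pr_or hP I Ax I Ay Pxy; [left|right].
Qed.

Lemma aut_fixV (t : aut) (F : set algC) : (forall x, F x -> F (t x)) -> (forall x, F x -> F ((t^-1)%g x)) ->
  forall x, F x <-> F (t x).
Proof. by move=> h1 h2 x; split=> [/h1 //|/h2]; rewrite autKV. Qed.

(** * Conjugation of extensions by an automorphism *)

Section Transport.
Variables (t : aut).

Section Conjugate.
Variables (F M F' M' : set algC) (hF : forall x, F' x <-> F (t x)) (hM : forall x, M' x <-> M (t x)).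

Definition gconj (g : gal F M) : gal F' M'.
Proof.
exists (fun x => (t^-1)%g (g (t x))) (fun x => (t^-1)%g (gal_inv g (t x))).
- by move=> x; rewrite autVK gal_funK autKV.
- by move=> x; rewrite autVK gal_invK autKV.
- by move=> x; apply: (iff_trans (hM x)); apply: (iff_trans _ (iff_sym (hM _))); rewrite autVK; exact: gal_stab.
- by move=> x nM; rewrite (gal_out g) ?autKV // => h; apply: nM; apply/hM.
- by move=> x /hF Fx; rewrite (gal_base g) ?autKV.
- by move=> x y /hM Mx /hM My; rewrite rmorphD (gal_add g) // rmorphD.
- by move=> x y /hM Mx /hM My; rewrite rmorphM (gal_mul g) // rmorphM.
Defined.

Lemma gconjE g x : gconj g x = (t^-1)%g (g (t x)). Proof. by []. Qed.

Lemma gconjM g h : gconj (g * h)%g = (gconj g * gconj h)%g.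
Proof. by apply: gal_ext => x; rewrite -[RHS]/(gconj g (gconj h x)) !gconjE autVK. Qed.

Lemma gconj_subfield : subfield F -> subfield F'.
Proof.
move=> [F1 FB Fd]; split; first by apply/hF; rewrite rmorph1.
- by move=> x y /hF Fx /hF Fy; apply/hF; rewrite rmorphB; exact: FB.
- by move=> x y /hF Fx /hF Fy; apply/hF; rewrite fmorph_div; exact: Fd.
Qed.
End Conjugate.

Variables (F M F' M' : set algC) (hF : forall x, F' x <-> F (t x)) (hM : forall x, M' x <-> M (t x)).

Lemma gconj_surj (g : gal F' M') : exists h : gal F M, gconj hF hM h = g.
Proof.
have hF' x : F x <-> F' ((t^-1)%g x) by apply: iff_sym; apply: (iff_trans (hF _)); rewrite autVK.
have hM' x : M x <-> M' ((t^-1)%g x) by apply: iff_sym; apply: (iff_trans (hM _)); rewrite autVK.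
suff [h hh] : exists h : gal F M, forall x, h x = t (g ((t^-1)%g x)).
  by exists h; apply: gal_ext => x; rewrite gconjE hh !autKV.
unshelve refine (ex_intro _ (@MkGal _ _ (fun x => t (g ((t^-1)%g x))) (fun x => t (gal_inv g ((t^-1)%g x))) _ _ _ _ _ _ _) _).
- by move=> x; rewrite autKV gal_funK autVK.
- by move=> x; rewrite autKV gal_invK autVK.
- by move=> x; apply: (iff_trans (hM' x)); apply: (iff_trans _ (iff_sym (hM' _))); rewrite autKV; exact: gal_stab.
- by move=> x nM; rewrite (gal_out g) ?autVK // => h; apply: nM; apply/hM'.
- by move=> x /hF' Fx; rewrite (gal_base g) ?autVK.
- by move=> x y /hM' Mx /hM' My; rewrite rmorphD (gal_add g) // rmorphD.
- by move=> x y /hM' Mx /hM' My; rewrite rmorphM (gal_mul g) // rmorphM.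
- by [].
Qed.

Definition gconj_quotient (Q : finite_quotient F' M') : finite_quotient F M.
Proof.
exists (fq_degree Q) (fq_perm Q) (fun g => fq_map Q (gconj hF hM g)).
- by move=> g h; rewrite gconjM fq_morph.
- by move=> x; have [s <-] := fq_surj x; have [g <-] := gconj_surj s; exists g.
- have [A AM hA] := fq_cont Q; exists (map t A) => [x /mapP [y yA ->]|g hg].
    by apply/hM; exact: AM.
  by apply: hA => x xA; rewrite gconjE hg ?map_f // autKV.
Defined.

Lemma gconj_int x : integers_of M x -> integers_of M' ((t^-1)%g x).
Proof. by move=> [Mx Ax]; split; [apply/hM; rewrite autVK|rewrite Aint_aut]. Qed.

Lemma gconj_prime (P : set algC) : prime_of M' P -> prime_of M (fun x => P ((t^-1)%g x)).
Proof.
move=> [[sP [x Px x0]] PD PM P1 Por]; split.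
- split=> [y /sP [/hM]|]; first by rewrite autVK Aint_aut.
  by exists (t x); [rewrite autKV|rewrite fmorph_eq0].
- by move=> y z; rewrite rmorphD; exact: PD.
- by move=> a y /gconj_int ha; rewrite rmorphM; exact: PM.
- by rewrite rmorph1.
- by move=> y z /gconj_int hy /gconj_int hz; rewrite rmorphM; exact: Por.
Qed.

Lemma gconj1 : gconj hF hM 1%g = 1%g.
Proof. by apply: gal_ext => x; rewrite gconjE autKV. Qed.

Lemma transport_p_split p : p_split p F M -> p_split p F' M'.
Proof.
move=> h P hP Pp; apply/seteqP; split=> [s|s -> //].
have [g <-] := gconj_surj s => hs; have := h _ (gconj_prime hP).
rewrite rmorph_nat => /(_ Pp) /seteqP [h1 _].
suff -> : g = 1%g by exact: gconj1.
by apply: h1 => x; have := hs ((t^-1)%g x); rewrite gconjE autVK.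
Qed.

Lemma transport_unramified p : unramified_abelian_pro_p p F M -> unramified_abelian_pro_p p F' M'.
Proof.
move=> [[sF sM FM fixF] com prop [unr arch]]; split.
- split; [exact: gconj_subfield hF sF|exact: gconj_subfield hM sM|by move=> x /hF /FM Mx; apply/hM|].
  move=> x /hM Mx h; apply/hF; apply: fixF => // g.
  by have := h (gconj hF hM g); rewrite gconjE => /(congr1 t); rewrite autVK.
- move=> s s'; have [g <-] := gconj_surj s; have [g' <-] := gconj_surj s'.
  by rewrite -!gconjM com.
- by move=> Q; exact: (prop (gconj_quotient Q)).
split.
- move=> P hP; have hP' := gconj_prime hP; pose P' : set algC := fun x => P ((t^-1)%g x).
  apply/seteqP; split=> [s|s ->]; last first.
    by move=> x _; rewrite subrr; exact: (pr0 (gconj_subfield hM sM) hP).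
  have [g <-] := gconj_surj s => hs; have := unr _ hP' => /seteqP [h _].
  suff -> : g = 1%g by exact: gconj1.
  apply: h => x ix; rewrite /P' rmorphB; have := hs _ (gconj_int ix).
  by rewrite gconjE autVK.
- move=> e [e1 eD eM] eF x Mx; rewrite -[x](autKV t).
  apply: (arch (fun y => e ((t^-1)%g y))); last by apply/hM.
    have hy y : M y -> M' ((t^-1)%g y) by move=> My; apply/hM; rewrite autVK.
    split; first by rewrite rmorph1.
    + by move=> y z /hy My /hy Mz; rewrite rmorphD; exact: eD.
    + by move=> y z /hy My /hy Mz; rewrite rmorphM; exact: eM.
  by move=> y Fy; apply: eF; apply/hF; rewrite autVK.
Qed.
End Transport.

(** * Stability and inertia of the maximal unramified extension *)

Section MaximalExtension.
Variables (p : nat) (k K L : set algC) (Kk : galois k K) (L_max : max_unramified p K L).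
Let UL : unramified_abelian_pro_p p K L. Proof. by case: L_max. Qed.
Let KL : galois K L. Proof. by case: UL. Qed.

Lemma stable_aut (t : aut) : fixes k t -> forall x, K x <-> K (t x).
Proof.
by move=> kt; apply: aut_fixV => x; apply: (galois_stable Kk) => //; exact: fixesV.
Qed.

Lemma conj_fixes (t s : aut) : fixes k t -> fixes K s -> fixes K (t * s * t^-1)%g.
Proof.
move=> kt Ks x Kx; rewrite !autM Ks ?autVK //; apply: (galois_stable Kk) => //; exact: fixesV.
Qed.

Lemma comm_fixes (t s : aut) : (forall g h : gal k K, g * h = h * g)%g -> fixes k t -> fixes k s -> fixes K (aut_comm t s).
Proof.
move=> com kt ks x Kx; rewrite /aut_comm !autM.
have ktV := fixesV kt; have ksV := fixesV ks.
have st u y : fixes k u -> K y -> K (u y) by exact: (galois_stable Kk).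
have e y : K y -> t (s y) = s (t y).
  move=> Ky.
  have := congr1 (fun g : gal k K => g y) (com (gres Kk kt) (gres Kk ks)).
  rewrite -[LHS]/(gres Kk kt (gres Kk ks y)) -[RHS]/(gres Kk ks (gres Kk kt y)).
  by rewrite !gresE //; exact: st.
by rewrite e ?autVK //; apply: (st _ _ ktV); exact: (st _ _ ksV).
Qed.

(** The image of L under t is again unramified, abelian and pro-p over K, because t preserves K; by
    maximality it is contained in L. *)
Lemma L_stable (t : aut) x : fixes k t -> L x -> L (t x).
Proof.
move=> kt Lx; have [_] := L_max; pose M : set algC := fun y => L ((t^-1)%g y).
have hK x' : K x' <-> K ((t^-1)%g x') by apply: stable_aut; exact: fixesV.
have hM x' : M x' <-> L ((t^-1)%g x') by [].
by move=> /(_ _ (transport_unramified hK hM UL)); apply; rewrite /M autKV.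
Qed.

Lemma unr_inertia (P : set algC) (s : aut) : prime_of [set: algC]%classic P -> fixes K s ->
  (forall y, y \in Aint -> P (s y - y)) -> fixes L s.
Proof.
move=> hP Ks hs x Lx; have [_ sL _ _] := KL; have [_ _ _ [unr _]] := UL.
have /seteqP [h _] := unr _ (prime_restrict sL hP).
have e : gres KL Ks = 1%g.
  apply: h => y [Ly Ay]; rewrite gresE //; split; last exact: hs.
  by apply: (sfB sL) => //; exact: (galois_stable KL).
by rewrite -(gresE KL Ks Lx) e.
Qed.

Lemma unr_arch (tau : aut) : fixes K (tau * cj * tau^-1)%g -> fixes L (tau * cj * tau^-1)%g.
Proof.
move=> Ks x Lx; have [_ _ _ [_ arch]] := UL; rewrite !autM cjE.
have h : (tau^-1)%g x \is Num.real.
  apply: (arch (tau^-1)%g) => //.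
    by split=> [|y z _ _|y z _ _]; rewrite ?rmorph1 ?rmorphD ?rmorphM.
  move=> y Ky; apply/CrealP; have := Ks _ Ky; rewrite !autM cjE => /(congr1 (tau^-1)%g).
  by rewrite autKV.
by rewrite (CrealP h) autVK.
Qed.
End MaximalExtension.

Lemma sub_telescope (V : zmodType) (x a b c d : V) : x - b - d = x - a - c + (a - b) + (c - d).
Proof.
have e u v : x - u - v = x - (u + v) by rewrite opprD addrA.
by rewrite !e -addrA (addrACA a) -opprD addrA subrK.
Qed.

(** * The topology of a Galois module and limits in it *)

Section GaloisModule.
Variables (p : nat) (pp : prime p) (k : set algC) (K : Zp_extension p k).
Local Notation Gam := (gal k K).
Local Notation Lam := (iwasawa_algebra K).
Local Notation pc := (@iw_const p k K).
Variables (M : set algC) (X : iwasawa_module K M) (KM : galois K M).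
Hypothesis stM : forall (t : aut) x, fixes k t -> M x -> M (t x).
Variables (phi : Gam -> Zp p) (hphi : topological_iso_Zp phi) (g0 : Gam) (hg0 : phi g0 = 1).
Local Notation Kk := (ext_galois K).

Lemma im_inj (x y : X) : (forall a, M a -> im_aut x a = im_aut y a) -> x = y.
Proof. by move=> h; apply: (bij_inj (im_bij X)); apply: gal_eqP. Qed.

Lemma im0 : im_aut (0 : X) = 1%g.
Proof. by apply: (mulgI (im_aut (0 : X))); rewrite mulg1 -im_morph addr0. Qed.

Lemma imN (x : X) : im_aut (- x) = (im_aut x)^-1%g.
Proof. by apply: (mulgI (im_aut x)); rewrite mulgV -im_morph subrr im0. Qed.

Definition fixgrp (A : seq algC) : set X := fun x => gal_fixing A (im_aut x).
Local Notation V := fixgrp.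

Lemma V0 A : V A 0. Proof. by rewrite /V im0 => a. Qed.
Lemma VD A x y : V A x -> V A y -> V A (x + y).
Proof. by move=> hx hy a aA; rewrite im_morph -[LHS]/(im_aut x (im_aut y a)) hy // hx. Qed.
Lemma VN A x : V A x -> V A (- x).
Proof.
by move=> hx a aA; rewrite imN -[in LHS](hx a aA) -[LHS]/(((im_aut x)^-1 * im_aut x)%g a) mulVg.
Qed.
Lemma VB A x y : V A x -> V A y -> V A (x - y). Proof. by move=> hx /VN; exact: VD. Qed.
Lemma VMn A x n : V A x -> V A (x *+ n).
Proof. by move=> hx; elim: n => [|n IH]; rewrite ?mulr0n ?mulrS; [exact: V0|exact: VD]. Qed.
Lemma V_sub A B x : {subset A <= B} -> V B x -> V A x.
Proof. by move=> AB h a /AB; exact: h. Qed.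
Lemma V_sum A I (r : seq I) (f : I -> X) : (forall i, V A (f i)) -> V A (\sum_(i <- r) f i).
Proof. by move=> h; elim: r => [|i r IH]; rewrite ?big_nil ?big_cons; [exact: V0|exact: VD]. Qed.

(** For a Galois-stable A the open subgroup [fixgrp A] is a Lambda-submodule, by [V_scale]; such
    lists are cofinal by [stable_seq_ex]. *)
Definition stable_seq (A : seq algC) : Prop :=
  (forall a, a \in A -> M a) /\ (forall t a, fixes k t -> a \in A -> t a \in A).

Lemma stable_seq_ex (A : seq algC) : (forall a, a \in A -> M a) -> exists2 B, stable_seq B & {subset A <= B}.
Proof.
move=> AM; exists [seq b <- flatten (map conjugates A) | `[< M b >]]; last first.
  move=> a aA; rewrite mem_filter; apply/andP; split; first by apply/asboolP; exact: AM.
  by apply/flatten_mapP; exists a => //; rewrite -{1}(aut1 a); exact: aut_conjugates.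
split=> [b|t b kt]; rewrite mem_filter => /andP[/asboolP Mb]; first by [].
move=> /flatten_mapP [a aA /conjugates_emb [s hs]]; rewrite mem_filter; apply/andP; split.
  by apply/asboolP; exact: stM.
by apply/flatten_mapP; exists a => //; rewrite -hs -autM; exact: aut_conjugates.
Qed.

Lemma stable_seq_cat A B : stable_seq A -> stable_seq B -> stable_seq (A ++ B).
Proof.
move=> [hA sA] [hB sB]; split=> [a|t a kt]; rewrite !mem_cat => /orP [h|h].
- exact: hA.
- exact: hB.
- by rewrite sA.
- by rewrite sB ?orbT.
Qed.

Lemma V_sep (x : X) : (forall A, stable_seq A -> V A x) -> x = 0.
Proof.
move=> h; apply: im_inj => a Ma; rewrite im0 -[RHS]/a.
have [|B hB AB] := @stable_seq_ex [:: a]; first by move=> b; rewrite inE => /eqP ->.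
by apply: (h B hB); apply: AB; rewrite mem_head.
Qed.

Lemma Kk_sub x : k x -> ext_field K x. Proof. by case: Kk => _ _ h _; exact: h. Qed.
Lemma fixesKk (s : aut) : fixes K s -> fixes k s. Proof. by move=> h x /Kk_sub; exact: h. Qed.
Lemma KM_sub x : ext_field K x -> M x. Proof. by case: KM => _ _ h _; exact: h. Qed.
Lemma fixesMK (s : aut) : fixes M s -> fixes K s. Proof. by move=> h x /KM_sub; exact: h. Qed.

Lemma cf_ex (s : aut) : exists x : X, fixes K s -> forall a, M a -> im_aut x a = s a.
Proof.
have [Ks|nKs] := pselect (fixes K s); last by exists 0.
have [psi _ psiK] := im_bij X; exists (psi (gres KM Ks)) => _ a Ma.
by rewrite psiK gresE.
Qed.
(* The element of X acting on M as s does; arbitrary when s does not fix K. *)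
Definition cf (s : aut) : X := projT1 (cid (cf_ex s)).

Lemma cfE (s : aut) a : fixes K s -> M a -> im_aut (cf s) a = s a.
Proof. by rewrite /cf; case: cid => x h Ks Ma; exact: h. Qed.

Lemma cf_eq (s : aut) x : fixes K s -> (forall a, M a -> im_aut x a = s a) -> cf s = x.
Proof. by move=> Ks h; apply: im_inj => a Ma; rewrite cfE ?h. Qed.

Lemma cfM (s t : aut) : fixes K s -> fixes K t -> cf (s * t)%g = cf s + cf t.
Proof.
move=> Ks Kt; apply: cf_eq; first exact: fixesM.
by move=> a Ma; rewrite im_morph -[LHS]/(im_aut _ (im_aut _ a)) !cfE //; apply: stM => //; exact: fixesKk.
Qed.
Lemma cf1 : cf 1%g = 0. Proof. by apply: cf_eq => // a Ma; rewrite im0. Qed.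
Lemma cfV (s : aut) : fixes K s -> cf (s^-1)%g = - cf s.
Proof.
move=> Ks; apply: (addrI (cf s)); rewrite subrr -cfM ?mulgV ?cf1 //; exact: fixesV.
Qed.
Lemma cf_fix (s : aut) : fixes M s -> cf s = 0.
Proof.
by move=> h; apply: cf_eq => [|a Ma]; [exact: fixesMK|rewrite im0 h].
Qed.
Lemma cf_surj (x : X) : exists2 s, fixes K s & cf s = x.
Proof.
have [s Ks hs] := glift KM (im_aut x); exists s => //.
by apply: cf_eq => // a Ma; rewrite hs.
Qed.
Lemma cf_V A (s : aut) : (forall a, a \in A -> M a) -> fixes K s ->
  (forall a, a \in A -> s a = a) <-> V A (cf s).
Proof.
by move=> AM Ks; split=> h a aA; have := h a aA; rewrite cfE //; exact: AM.
Qed.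
Lemma cf_agree A (s t : aut) : (forall a, a \in A -> M a) -> fixes K s -> fixes K t ->
  (forall a, a \in A -> s a = t a) -> V A (cf s - cf t).
Proof.
move=> AM Ks Kt h; rewrite addrC -cfV // -cfM //; last exact: fixesV.
apply/cf_V => //; first by apply: fixesM => //; exact: fixesV.
by move=> a aA; rewrite autM h // autKV.
Qed.

Lemma cf_conj (t s : aut) (kt : fixes k t) : fixes K s ->
  cf (t * s * t^-1)%g = iw_group (gres Kk kt) *: cf s.
Proof.
move=> Ks; apply: cf_eq; first exact: (conj_fixes Kk).
move=> a Ma; have Mta : M ((t^-1)%g a) by apply: stM => //; exact: fixesV.
have [|||||g hg] := @aut_restrict k M t => //; first by case: KM.
- by move=> x /Kk_sub; exact: KM_sub.
- by move=> x; exact: stM.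
- by move=> x; apply: stM; exact: fixesV.
rewrite -{1}(autVK t a) -(hg _ Mta) (@im_conj _ _ _ _ X g) //; last first.
  by move=> x Kx; rewrite hg ?gresE //; exact: KM_sub.
by rewrite cfE // hg ?autM //; apply: stM => //; exact: fixesKk.
Qed.

Lemma gres_ker (t t' : aut) (kt : fixes k t) (kt' : fixes k t') :
  gres Kk kt = gres Kk kt' -> exists2 u, fixes K u & t' = (t * u)%g.
Proof.
move=> e; exists (t^-1 * t')%g; last by rewrite mulKVg.
by move=> x Kx; rewrite autM -(gresE Kk kt' Kx) -e gresE // autKV.
Qed.

Lemma gres_lift (g : Gam) : exists t (kt : fixes k t), gres Kk kt = g.
Proof.
have [t kt ht] := glift Kk g; exists t, kt; apply: gal_eqP => x Kx.
by rewrite gresE // ht.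
Qed.

Lemma V_group A (g : Gam) x : stable_seq A -> V A x -> V A (iw_group g *: x).
Proof.
move=> [AM st]; have [t [kt <-]] := gres_lift g; have [s Ks <-] := cf_surj x.
move=> /(cf_V AM Ks) h; rewrite -cf_conj //; apply/cf_V => //; first exact: (conj_fixes Kk).
by move=> a aA; rewrite !autM h ?autVK //; apply: st => //; exact: fixesV.
Qed.

Lemma V_cont A x : (forall a, a \in A -> M a) -> exists N, forall m l, (N <= m)%N -> J hphi m l -> V A (l *: x).
Proof.
move=> AM; have [Q [n h]] := im_cont x AM; have [N hN] := J_cofinal pp hphi Q n.
by exists N => m l Nm Jl; apply: h; exact: (hN m Nm).
Qed.

(** Integral combinations of powers of g0 are dense in Lambda; they preserve V A because A is
    Galois-stable, and continuity disposes of the error. *)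
Lemma V_scale A l x : stable_seq A -> V A x -> V A (l *: x).
Proof.
move=> sA hx; have [N hN] := V_cont x sA.1.
have [c hc] := iw_dense pp hphi hg0 l N; have := hN N _ (leqnn N) hc.
rewrite scalerBl => h; rewrite -(subrK ((\sum_(i < p ^ N.+1) iw_group g0 ^+ i *+ c i) *: x) (l *: x)).
apply: VD => //; rewrite scaler_suml; apply: V_sum => i.
by rewrite -scalerMnl -iw_groupX; apply: VMn; exact: V_group.
Qed.

Lemma V_pn A x : (forall a, a \in A -> M a) -> exists n, V A (x *+ p ^ n).
Proof.
move=> AM; have [N hN] := V_cont x AM; exists N.+1.
by rewrite -[x in x *+ _]scale1r scalerMnl; apply: (hN N) => //; exact: JQ_pn.
Qed.

Lemma V_code A : (forall a, a \in A -> M a) ->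
  exists (T : finType) (code : X -> T), forall x y, code x = code y -> V A (x - y).
Proof.
move=> AM; pose C := flatten (map conjugates A).
have hC (x : X) (a : seq_sub A) : im_aut x (val a) \in C.
  apply/flatten_mapP; exists (val a); first exact: valP.
  by apply: (gal_conjugate KM); apply: AM; exact: valP.
exists {ffun seq_sub A -> seq_sub C}, (fun x => [ffun a => SeqSub (hC x a)]).
move=> x y e; have [s Ks cs] := cf_surj x; have [t Kt ct] := cf_surj y.
rewrite -cs -ct; apply: cf_agree => // a aA.
move/ffunP/(_ (SeqSub aA))/(congr1 val): e.
by rewrite !ffunE /= -cs -ct !cfE //; exact: AM.
Qed.

Lemma X_ulim T (U : set_system T) (f : T -> X) : UltraFilter U ->
  exists x, forall A, (forall a, a \in A -> M a) -> U [set t | V A (f t - x)]%classic.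
Proof.
move=> UU; have /choice [s hs] t : exists s, fixes K s /\ cf s = f t.
  by have [s Ks e] := cf_surj (f t); exists s.
have [s0 hs0] := aut_ulim s UU.
have Ks0 : fixes K s0.
  move=> x Kx; have [t /= h] := filter_ex (hs0 [:: x]).
  by rewrite -h ?inE //; have [Kt _] := hs t; exact: Kt.
exists (cf s0) => A AM; apply: filterS (hs0 A) => t /= h.
by have [Kt <-] := hs t; apply: cf_agree.
Qed.

(** Compactness of X: solutions modulo each V A converge along an ultrafilter refining the directed
    system of stable lists. With I empty this says that l X is closed. *)
Lemma X_closed (I : finType) (y : I -> X) (l : Lam) (x : X) :
  (forall A, stable_seq A -> exists (a : I -> Zp p) z, V A (x - \sum_i pc (a i) *: y i - l *: z)) ->
  exists (a : I -> Zp p) z, x = \sum_i pc (a i) *: y i + l *: z.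
Proof.
move=> h; pose F := filter_from [set A | stable_seq A]%classic (fun A => [set B | stable_seq B /\ {subset A <= B}]%classic).
have FF : ProperFilter F.
  apply: filter_from_proper; last by move=> A sA; exists A; split.
  apply: filter_from_filter; first by exists [::]; split.
  move=> A B sA sB; exists (A ++ B); first exact: stable_seq_cat.
  by move=> D [sD ABD]; split; split=> // a aA; apply: ABD; rewrite mem_cat aA ?orbT.
have [U [UU FU]] := ultraFilterLemma FF.
have /choice [az haz] A : exists az : (I -> Zp p) * X, stable_seq A -> V A (x - \sum_i pc (az.1 i) *: y i - l *: az.2).
  have [sA|nA] := pselect (stable_seq A); last by exists (fun=> 0, 0).
  by have [a [z hA]] := h A sA; exists (a, z).
have [z hz] := X_ulim (fun A => (az A).2) UU.
have /choice [a ha] i := Zp_ulim (fun A => (az A).1 i) UU.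
exists a, z; apply/eqP; rewrite -subr_eq0 opprD addrA; apply/eqP; apply: V_sep => A sA.
have /choice [n hn] i : exists n, forall b : Zp p, b n = 0 -> V A (pc b *: y i).
  have [Q [n hQ]] := im_cont (y i) sA.1; exists n => b bn; apply: hQ; exact: JQ_const.
have UA := ultra_seq (enum I) UU (fun i => ha i (n i)).
have UB : U [set B | stable_seq B /\ {subset A <= B}]%classic by apply: FU; exists A.
have [B /= [[h1 [sB AB]] h3]] := filter_ex (filterI (filterI UA UB) (hz A sA.1)).
have e : x - \sum_i pc (a i) *: y i - l *: z =
  (x - \sum_i pc ((az B).1 i) *: y i - l *: (az B).2)
  + \sum_i pc ((az B).1 i - a i) *: y i + l *: ((az B).2 - z).
  have -> : \sum_i pc ((az B).1 i - a i) *: y i = \sum_i pc ((az B).1 i) *: y i - \sum_i pc (a i) *: y i.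
    by rewrite -sumrB; apply: eq_bigr => i _; rewrite rmorphB scalerBl.
  rewrite scalerBr; exact: sub_telescope.
rewrite e; apply: VD; first apply: VD.
- exact: V_sub AB (haz B sB).
- apply: V_sum => i; apply: hn; by rewrite Zp_subE h1 ?subrr ?mem_enum.
- exact: V_scale.
Qed.

Lemma group_sub1_T (g : Gam) : exists m, iw_group g - 1 = (iw_group g0 - 1) * m :> Lam.
Proof.
have [a [m e]] := aug_dec pp hphi hg0 (iw_group g - 1); exists m; rewrite e.
suff -> : a = 0 by rewrite rmorph0 add0r.
have z (f : Gam) y : (iw_group f - 1 : Lam) (@trivial_fq p k K) y = 0 by rewrite iw_sub1E subrr.
have := z g 1%g; rewrite e iwD gr_mulE big1 ?addr0; last by move=> y _; rewrite z mul0r.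
by rewrite iw_singleE eqxx mulr1n.
Qed.

End GaloisModule.

(** * Characters of order p of Gal(L/k) *)

Section ExtendHom.
Variable X : zmodType.

Definition subgrp (Y : set X) : Prop := Y 0 /\ forall x y, Y x -> Y y -> Y (x - y).
Definition hom_on (Y : set X) (th : X -> algC) : Prop :=
  th 0 = 1 /\ forall x y, Y x -> Y y -> th (x + y) = th x * th y.
(** Only nonnegative multiples of x occur; this is a subgroup as soon as some positive multiple of x
    lies in the subgroup Y. *)
Definition adj (Y : set X) (x : X) : set X := fun u => exists y m, Y y /\ u = y + x *+ m.

Lemma subgrpN Y x : subgrp Y -> Y x -> Y (- x).
Proof. by move=> [Y0 YB] Yx; rewrite -sub0r; exact: YB. Qed.
Lemma subgrpD Y x y : subgrp Y -> Y x -> Y y -> Y (x + y).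
Proof. by move=> sY Yx Yy; rewrite -(opprK y); apply: sY.2 => //; exact: subgrpN. Qed.
Lemma subgrpMn Y x n : subgrp Y -> Y x -> Y (x *+ n).
Proof.
move=> sY Yx; elim: n => [|n IH]; first by rewrite mulr0n; case: sY.
by rewrite mulrS; exact: subgrpD.
Qed.

Lemma hom_onMn Y th x n : subgrp Y -> hom_on Y th -> Y x -> th (x *+ n) = th x ^+ n.
Proof.
move=> sY [h0 hM] Yx; elim: n => [|n IH]; first by rewrite mulr0n h0.
by rewrite mulrS hM ?exprS ?IH //; exact: subgrpMn.
Qed.

Lemma adj_sub Y x y : Y y -> adj Y x y. Proof. by move=> Yy; exists y, 0%N; rewrite mulr0n addr0. Qed.
Lemma adj_mem Y x : subgrp Y -> adj Y x x. Proof. by move=> [Y0 _]; exists 0, 1%N; rewrite add0r. Qed.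
Lemma adj_mono Y Y' x u : (forall y, Y y -> Y' y) -> adj Y x u -> adj Y' x u.
Proof. by move=> h [y [m [Yy ->]]]; exists y, m; split=> //; exact: h. Qed.

Lemma adj_subgrp Y x n : subgrp Y -> (0 < n)%N -> Y (x *+ n) -> subgrp (adj Y x).
Proof.
move=> sY n0 Yxn; split; first by apply: adj_sub; case: sY.
move=> _ _ [y [m [Yy ->]]] [y' [m' [Yy' ->]]].
exists (y - y' - (x *+ n) *+ m'), (m + m' * n.-1)%N; split.
  by apply: sY.2; [exact: sY.2|exact: subgrpMn].
rewrite mulrnDr opprD addrACA -[RHS]addrA; congr (_ + _).
rewrite addrCA; congr (_ + _); rewrite mulnC -!mulrnA.
case: n n0 Yxn => // n _ _ /=; rewrite mulSn mulrnDr opprD -addrA addNr addr0 //.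
Qed.

Lemma order_ex Y x : subgrp Y -> (exists2 n, (0 < n)%N & Y (x *+ n)) ->
  exists n, [/\ (0 < n)%N, Y (x *+ n) & forall m, Y (x *+ m) -> (n %| m)%N].
Proof.
move=> sY h; have {h} ex : exists n, (0 < n)%N && `[< Y (x *+ n) >].
  by have [n n0 hn] := h; exists n; rewrite n0; apply/asboolP.
case: (ex_minnP ex) => n /andP[n0 /asboolP Yn] min; exists n; split=> // m Ym.
rewrite /dvdn -leqn0 leqNgt; apply/negP => r0.
have : (n <= m %% n)%N.
  apply: min; rewrite r0; apply/asboolP.
  have -> : x *+ (m %% n) = x *+ m - (x *+ n) *+ (m %/ n).
    by rewrite {2}(divn_eq m n) mulrnDr -mulrnA [(n * _)%N]mulnC addrAC subrr add0r.
  by apply: sY.2 => //; exact: subgrpMn.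
by rewrite leqNgt ltn_mod n0.
Qed.

Lemma hom_extend Y th x n z : subgrp Y -> hom_on Y th -> (0 < n)%N -> Y (x *+ n) ->
  (forall m, Y (x *+ m) -> (n %| m)%N) -> z ^+ n = th (x *+ n) ->
  exists th', [/\ hom_on (adj Y x) th', forall y, Y y -> th' y = th y & th' x = z].
Proof.
move=> sY [t0 tM] n0 Yn min zn.
have wd y m y' m' : Y y -> Y y' -> y + x *+ m = y' + x *+ m' -> th y * z ^+ m = th y' * z ^+ m'.
  wlog le : y m y' m' / (m <= m')%N => [h|Yy Yy' e].
    by case/orP: (leq_total m m') => le Yy Yy' e; [|apply: esym]; apply: h.
  have ey : y - y' = x *+ (m' - m).
    apply/eqP; rewrite subr_eq addrC -(inj_eq (addIr (x *+ m))) e -addrA -mulrnDr subnK //.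
  have /dvdnP [q eq] : (n %| m' - m)%N by apply: min; rewrite -ey; exact: sY.2.
  have -> : y = y' + (x *+ n) *+ q by rewrite -mulrnA mulnC -eq -ey addrC subrK.
  rewrite tM //; last exact: subgrpMn.
  by rewrite (hom_onMn q sY) // -zn -exprM mulnC -eq -mulrA -exprD subnK.
have /choice [f hf] u : exists ym : X * nat, adj Y x u -> Y ym.1 /\ u = ym.1 + x *+ ym.2.
  have [[y [m h]]|na] := pselect (adj Y x u); first by exists (y, m).
  by exists (0, 0%N).
have val y m : Y y -> th (f (y + x *+ m)).1 * z ^+ (f (y + x *+ m)).2 = th y * z ^+ m.
  move=> Yy; have [Y1 e1] := hf (y + x *+ m) (ex_intro _ y (ex_intro _ m (conj Yy erefl))).
  exact: wd.
exists (fun u => th (f u).1 * z ^+ (f u).2); split.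
- split; first by have := val 0 0%N sY.1; rewrite mulr0n addr0 => ->; rewrite t0 mulr1.
  move=> _ _ [y [m [Yy ->]]] [y' [m' [Yy' ->]]]; rewrite addrACA -mulrnDr !val //; last exact: subgrpD.
  by rewrite tM // exprD mulrACA.
- by move=> y Yy; have := val y 0%N Yy; rewrite mulr0n addr0 => ->; rewrite mulr1.
- by have := val 0 1%N sY.1; rewrite add0r => ->; rewrite t0 mul1r.
Qed.

Lemma hom_extend_all Y th (r : seq X) : subgrp Y -> hom_on Y th ->
  (forall x, exists2 n, (0 < n)%N & Y (x *+ n)) ->
  (forall x, exists2 y, y \in r & Y (x - y)) ->
  exists th', hom_on setT th' /\ forall y, Y y -> th' y = th y.
Proof.
move=> sY hY tor cov.
have [Y' [th' [sY' YY' rY' h' e']]] : exists Y' th', [/\ subgrp Y', forall y, Y y -> Y' y,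
    forall y, y \in r -> Y' y, hom_on Y' th' & forall y, Y y -> th' y = th y].
  elim: (r) => [|x r' [Y' [th' [sY' YY' rY' h' e']]]]; first by exists Y, th.
  have [|n [n0 Yn min]] := order_ex (x := x) sY'.
    by have [n n0 hn] := tor x; exists n => //; exact: YY'.
  have [|th2 [h2 e2 _]] := hom_extend (z := n.-root (th' (x *+ n))) sY' h' n0 Yn min.
    by rewrite rootCK.
  exists (adj Y' x), th2; split=> //.
  - exact: adj_subgrp Yn.
  - by move=> y /YY'; exact: adj_sub.
  - by move=> y; rewrite inE => /orP [/eqP ->|/rY']; [exact: adj_mem|exact: adj_sub].
  - by move=> y Yy; rewrite e2 ?e' //; exact: YY'.
exists th'; split=> //; have all x : Y' x.
  by have [y yr Yxy] := cov x; rewrite -(subrK y x); apply: subgrpD; [|exact: YY'|exact: rY'].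
by split=> [|x y _ _]; case: h' => // _; apply.
Qed.

(** If x0 had order n > 1 modulo Y, the trivial character of Y would extend with a primitive n-th
    root of unity as its value at x0. *)
Lemma hom_separate Y (r : seq X) x0 : subgrp Y -> (forall x, exists2 n, (0 < n)%N & Y (x *+ n)) ->
  (forall x, exists2 y, y \in r & Y (x - y)) ->
  (forall th, hom_on setT th -> (forall y, Y y -> th y = 1) -> th x0 = 1) -> Y x0.
Proof.
move=> sY tor cov h; apply: contrapT => nY.
have [n [n0 Yn min]] := order_ex sY (tor x0).
have n1 : (1 < n)%N.
  by case: n n0 Yn min => [|[|n]] // _ Yn _; case: nY; rewrite -(mulr1n x0).
have [z pz] := C_prim_root_exists n0.
have [||th1 [h1 e1 ez]] := @hom_extend Y (fun=> 1) x0 n z sY _ n0 Yn min.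
- by split=> // x y _ _; rewrite mulr1.
- exact: (prim_expr_order pz).
have [||th [hth eth]] := @hom_extend_all _ th1 r (adj_subgrp sY n0 Yn) h1.
- by move=> x; have [m m0 hm] := tor x; exists m => //; exact: adj_sub.
- by move=> x; have [y yr hy] := cov x; exists y => //; exact: adj_sub.
have := h th hth => /(_ _) e.
have : z = 1.
  rewrite -ez -eth; last exact: adj_mem.
  by apply: e => y Yy; rewrite eth ?e1 //; exact: adj_sub.
by move=> z1; have := prim_order_dvd pz 1%N; rewrite z1 expr1n eqxx dvdn1 => /eqP n1'; rewrite n1' in n1.
Qed.

(** When p X lies in the subgroup Y, this is linear independence modulo Y over the field with p
    elements. *)
Fixpoint chain (Y : set X) (xs : seq X) : Prop :=
  if xs is x :: xs' then ~ Y x /\ chain (adj Y x) xs' else True.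
Fixpoint aspan (Y : set X) (xs : seq X) : set X :=
  if xs is x :: xs' then aspan (adj Y x) xs' else Y.

Lemma chain_mono Y Y' xs : (forall y, Y' y -> Y y) -> chain Y xs -> chain Y' xs.
Proof.
elim: xs Y Y' => [|x xs IH] //= Y Y' h [nx hc]; split; first by move/h.
by apply: IH hc => y; exact: adj_mono.
Qed.

Lemma chain_rcons Y xs x : chain Y xs -> ~ aspan Y xs x -> chain Y (rcons xs x).
Proof. by elim: xs Y => [|y xs IH] Y //= [ny hc] nx; split=> //; exact: IH. Qed.

Lemma aspanP Y xs x : aspan Y xs x -> exists (y : X) (a : 'I_(size xs) -> nat), Y y /\ x = y + \sum_(i < size xs) xs`_i *+ a i.
Proof.
elim: xs Y => [|x1 xs IH] Y /= h; first by exists x, (fun=> 0%N); rewrite big_ord0 addr0.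
have [_ [a [[y [m [Yy ->]]] ->]]] := IH _ h.
exists y, (fun i : 'I_(size xs).+1 => if unlift ord0 i is Some j then a j else m); split=> //.
rewrite big_ord_recl unlift_none /= -addrA; congr (_ + (_ + _)).
by apply: eq_bigr => i _; rewrite liftK.
Qed.

(** Each entry has order exactly p modulo what precedes it, so its value may be any p-th root of
    unity, whatever the earlier choices. *)
Lemma chain_hom p (zeta : algC) (xs : seq X) (us : seq nat) Y th : prime p -> zeta ^+ p = 1 -> subgrp Y ->
  hom_on Y th -> (forall x, Y (x *+ p)) -> (forall x, th (x *+ p) = 1) -> chain Y xs ->
  exists th', [/\ hom_on (aspan Y xs) th', subgrp (aspan Y xs), forall y, Y y -> aspan Y xs y /\ th' y = th y &
    forall i, (i < size xs)%N -> th' xs`_i = zeta ^+ nth 0%N us i].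
Proof.
move=> pp zp; elim: xs us Y th => [|x xs IH] us Y th sY hY Yp tp /=; first by exists th.
move=> [nx hc].
have [|n [n0 Yn min]] := @order_ex Y x sY; first by exists p => //; exact: prime_gt0.
have np : n = p.
  have /primeP [_ /(_ n (min _ (Yp x))) /orP [/eqP n1|/eqP //]] := pp.
  by case: nx; rewrite -(mulr1n x) -n1.
rewrite {n n0}np in Yn min.
have [|th1 [h1 e1 ex]] := @hom_extend Y th x p (zeta ^+ head 0%N us) sY hY (prime_gt0 pp) Yn min.
  by rewrite tp -exprM mulnC exprM zp expr1n.
have [|||th2 [h2 s2 e2 ei]] := IH (behead us) (adj Y x) th1 _ h1 _ _ hc.
- exact: adj_subgrp (prime_gt0 pp) Yn.
- by move=> y; exact: adj_sub.
- by move=> y; rewrite e1.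
exists th2; split=> //.
- by move=> y Yy; have [h ->] := e2 _ (adj_sub x Yy); rewrite e1.
- move=> [_|i] /=; first by have [_ ->] := e2 _ (adj_mem x sY); rewrite ex; case: us {IH ex ei}.
  by move=> hi; rewrite ei //; case: us {IH ex ei} => //= ; rewrite nth_nil.
Qed.
End ExtendHom.

(** * Primes above p, up to conjugation over a number field *)

Section PrimesAbove.
Variables (p : nat) (pp : prime p).

Lemma primes_over_conj (P Q : set algC) : prime_of [set: algC]%classic P -> prime_of [set: algC]%classic Q ->
  P p%:R -> Q p%:R -> exists s : aut, forall x, P x <-> Q (s x).
Proof.
move=> hP hQ Pp Qp; have [|eta _ h] := prime_transitive subfield_Crat hP hQ; last by exists eta.
move=> x /= xr Px; have /intrP [c ec] := Cint_rat_Aint xr (pr_int hP Px).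
have := pr_intP hP (c := c) Pp pp; rewrite -ec => /(_ Px) /dvdzP [m em].
by rewrite ec em rmorphM; apply: (prM hQ I) => //; exact: Aint_int.
Qed.

Lemma primes_over_finite (F : set algC) : number_field F ->
  exists Ps : seq (set algC), (forall i, (i < size Ps)%N -> prime_of [set: algC]%classic (nth classical_sets.set0 Ps i)) /\
  forall P, prime_of [set: algC]%classic P -> P p%:R ->
  exists i u, [/\ (i < size Ps)%N, fixes F u & forall x, P x <-> nth classical_sets.set0 Ps i (u x)].
Proof.
move=> nF; have [[P0 [hP0 Pp0]]|none] := pselect (exists P0, prime_of [set: algC]%classic P0 /\ P0 p%:R); last first.
  by exists [::]; split=> // P hP Pp; case: none; exists P.
have [D _] := nf_exists nF.
pose Pi (i : 'I_(nf_d D)) : set algC := fun x => P0 (@nf_e F D i x).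
exists (map Pi (enum 'I_(nf_d D))); rewrite size_map size_enum_ord; split.
  move=> i hi; rewrite (nth_map (Ordinal hi)) ?size_enum_ord //; set j := nth _ _ _.
  have [[P1 [q Pq q0]] P2 P3 P4 P5] := hP0; split.
  - split=> [x /P1 [_]|]; first by rewrite Aint_aut.
    by exists ((@nf_e F D j)^-1%g q); [rewrite /Pi autVK|rewrite fmorph_eq0].
  - by move=> x y; rewrite /Pi rmorphD; exact: P2.
  - by move=> a x [_ Aa]; rewrite /Pi rmorphM; apply: P3; split; rewrite ?Aint_aut.
  - by rewrite /Pi rmorph1.
  - by move=> x y [_ Ax] [_ Ay]; rewrite /Pi rmorphM; apply: P5; split; rewrite ?Aint_aut.
move=> P hP Pp; have [s hs] := primes_over_conj hP hP0 Pp Pp0.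
have [i hi] := nf_surj D s; exists i, ((@nf_e F D i)^-1 * s)%g; split.
- exact: ltn_ord.
- by move=> x Fx; rewrite autM hi // autKV.
- by move=> x; rewrite (nth_map i) ?size_enum_ord // nth_ord_enum /Pi autM autVK.
Qed.
End PrimesAbove.

Section Characters.
Variables (p : nat) (pp : prime p) (k : set algC) (nk : number_field k) (K : Zp_extension p k).
Variables (L : set algC) (L_max : max_unramified p K L).
Variables (phi : gal k K -> Zp p) (hphi : topological_iso_Zp phi).
Local Notation Kk := (ext_galois K).

Definition kphi (s : aut) : Zp p := if pselect (fixes k s) is left ks then phi (gres Kk ks) else 0.

Lemma kphiE (s : aut) (ks : fixes k s) : kphi s = phi (gres Kk ks).
Proof. by rewrite /kphi; case: pselect => // ks'; congr phi; exact: gres_irr. Qed.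
Lemma kphiM s t : fixes k s -> fixes k t -> kphi (s * t)%g = kphi s + kphi t.
Proof.
move=> ks kt; rewrite (kphiE ks) (kphiE kt) (kphiE (fixesM ks kt)) -(phiM hphi); congr phi; exact: gresM.
Qed.
Lemma kphi1 : kphi 1%g = 0.
Proof. by apply: (addrI (kphi 1%g)); rewrite addr0 -kphiM ?mulg1. Qed.
Lemma kphiV s : fixes k s -> kphi (s^-1)%g = - kphi s.
Proof.
move=> ks; apply: (addrI (kphi s)); rewrite subrr -kphiM ?mulgV ?kphi1 //; exact: fixesV.
Qed.
Lemma kphiX s n : fixes k s -> kphi (s ^+ n)%g = kphi s *+ n.
Proof.
move=> ks; elim: n => [|n IH]; first by rewrite expg0 kphi1 mulr0n.
by rewrite expgS kphiM ?IH ?mulrS //; exact: fixesX.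
Qed.
Lemma kphi_cont (A : seq algC) : (forall x, x \in A -> ext_field K x) ->
  exists n, forall s, fixes k s -> kphi s n = 0 -> forall x, x \in A -> s x = x.
Proof.
move=> AK; have [n hn] := phi_cont hphi AK; exists n => s ks; rewrite (kphiE ks) => /hn h x xA.
by rewrite -(gresE Kk ks (AK x xA)) h.
Qed.
Lemma kphi_open n : exists2 A : seq algC, forall x, x \in A -> ext_field K x &
  forall s, fixes k s -> (forall x, x \in A -> s x = x) -> kphi s n = 0.
Proof.
have [A AK h] := phi_open hphi n; exists A => // s ks hs; rewrite (kphiE ks); apply: h => x xA.
by rewrite gresE ?hs //; exact: AK.
Qed.
Lemma kphi_eq0 s : fixes k s -> (kphi s = 0 <-> fixes (ext_field K) s).
Proof.
move=> ks; rewrite (kphiE ks); split=> [e x Kx|h].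
  rewrite -(gresE Kk ks Kx); have -> : gres Kk ks = 1%g by apply: (phi_inj hphi); rewrite e (phi1 hphi).
  by [].
suff -> : gres Kk ks = 1%g by rewrite (phi1 hphi).
by apply: gal_eqP => x Kx; rewrite gresE // h.
Qed.

(** A conjugate of complex conjugation has square 1, so it acts trivially on K, whose group is
    torsion-free; and L/K is unramified at infinity. *)
Lemma conj_cj_L (tau : aut) : fixes k (tau * cj * tau^-1)%g -> fixes L (tau * cj * tau^-1)%g.
Proof.
move=> ks; apply: (unr_arch L_max) => x Kx; rewrite -(gresE Kk ks Kx).
have -> : gres Kk ks = 1%g; last by [].
apply: (gam_torsion_free pp hphi (n := 2)) => //; apply: gal_eqP => y Ky.
rewrite -[LHS]/(gres Kk ks (gres Kk ks y)) !gresE //; last exact: (galois_stable Kk).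
by rewrite !autM autKV !cjE conjCK autVK.
Qed.

Lemma inertia_L (P : set algC) (a : aut) : prime_of [set: algC]%classic P -> fixes k a ->
  (forall y, y \in Aint -> P (a y - y)) -> (P p%:R -> fixes (ext_field K) a) -> fixes L a.
Proof.
move=> hP ka ia hp; apply: (unr_inertia L_max hP) => //.
have [Pp|nP] := pselect (P p%:R); first exact: hp.
exact: (tame_inertia pp nk hphi hP nP ka ia).
Qed.

(* Characters of Gal(L/k) of order dividing p. *)
Record lchar (chi : aut -> algC) : Prop := LChar {
  lc_M : forall a b, fixes k a -> fixes k b -> chi (a * b)%g = chi a * chi b;
  lc_cont : exists A : seq algC, forall a, fixes k a -> (forall x, x \in A -> a x = x) -> chi a = 1;
  lc_p : forall a, fixes k a -> chi a ^+ p = 1;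
  lc_L : forall a, fixes L a -> chi a = 1
}.

Section OneChar.
Variables (chi : aut -> algC) (hc : lchar chi).
Lemma lc_1 : chi 1%g = 1. Proof. exact: (lc_L hc). Qed.
Lemma lc_neq0 a : fixes k a -> chi a != 0.
Proof.
move=> ka; apply/eqP => e; have := lc_p hc ka; rewrite e expr0n gtn_eqF ?prime_gt0 // => /eqP.
by rewrite eq_sym oner_eq0.
Qed.
Lemma lc_V a : fixes k a -> chi (a^-1)%g = (chi a)^-1.
Proof.
move=> ka; apply: (mulfI (lc_neq0 ka)); rewrite divff ?lc_neq0 // -(lc_M hc) ?mulgV ?lc_1 //; exact: fixesV.
Qed.
Lemma lc_X a n : fixes k a -> chi (a ^+ n)%g = chi a ^+ n.
Proof.
move=> ka; elim: n => [|n IH]; first by rewrite expg0 lc_1.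
by rewrite expgS (lc_M hc) ?exprS ?IH //; exact: fixesX.
Qed.
Lemma lc_J a u : fixes k a -> fixes k u -> chi (u * a * u^-1)%g = chi a.
Proof.
move=> ka ku; have kV := fixesV ku; rewrite !(lc_M hc) ?lc_V //; last exact: fixesM.
by rewrite mulrAC divff ?mul1r // lc_neq0.
Qed.
Lemma lc_agree a b : fixes k a -> fixes k b -> chi (a^-1 * b)%g = 1 -> chi b = chi a.
Proof.
move=> ka kb; rewrite (lc_M hc) ?lc_V //; last exact: fixesV.
by move=> /(congr1 (fun z => chi a * z)); rewrite mulr1 mulrA divff ?mul1r // lc_neq0.
Qed.
Lemma lc_limit (U : set_system nat) (f : nat -> aut) (s : aut) : UltraFilter U ->
  (forall n, fixes k (f n)) -> fixes k s ->
  (forall A : seq algC, U [set t | forall x, x \in A -> f t x = s x]%classic) ->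
  U [set t | chi (f t) = chi s]%classic.
Proof.
move=> UU kf ks h; have [A hA] := lc_cont hc; apply: filterS (h A) => t /= e.
apply: lc_agree => //; apply: hA => [|x xA]; first by apply: fixesM => //; exact: fixesV.
by rewrite autM e // autKV.
Qed.
End OneChar.

(** Inertia elements fixing K fix L, so only the image of inertia in Z_p matters. If it is not zero,
    representatives modulo p^(v+1) suffice for a v with some e not in class 0: an a' of class 0 is
    approximated by powers e^m, the limit of the e^(-m) a' fixes L, and continuity gives chi a' =
    chi e^m with an m common to both characters. *)
Lemma inertia_values (P : set algC) : prime_of [set: algC]%classic P -> forall F : set algC, (forall x, k x -> F x) ->
  exists2 E : seq aut, forall e, e \in (E : seq (gal _ _)) -> fixes F e &
  forall chi chi', lchar chi -> lchar chi' -> (forall e, e \in (E : seq (gal _ _)) -> chi e = chi' e) ->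
  forall a, fixes F a -> (forall y, y \in Aint -> P (a y - y)) -> chi a = chi' a.
Proof.
move=> hP F kF; have Fk s : fixes F s -> fixes k s by move=> h x /kF; exact: h.
pose In (a : aut) := fixes F a /\ forall y, y \in Aint -> P (a y - y).
have InM a b : In a -> In b -> In (a * b)%g.
  move=> [Fa ia] [Fb ib]; split; first exact: fixesM.
  move=> y Ay; rewrite autM; apply: (pr_trans hP (y := b y)).
    by apply: ia; rewrite Aint_aut.
  exact: ib.
have InV a : In a -> In (a^-1)%g.
  move=> [Fa ia]; split; first exact: fixesV.
  move=> y Ay; apply: (prBC subfieldT hP); have := ia ((a^-1)%g y); rewrite autVK Aint_aut; exact.
have InX a n : In a -> In (a ^+ n)%g.
  move=> ia; elim: n => [|n IH]; last by rewrite expgS; exact: InM.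
  by split=> [|y _]; rewrite expg0 // subrr; exact: (pr0 subfieldT hP).
have InL a : In a -> kphi a = 0 -> fixes L a.
  by move=> [Fa ia] /(kphi_eq0 (Fk _ Fa)) Ka; apply: (unr_inertia L_max hP).
have [[v [a0 [i0 hv]]]|none] := pselect (exists v a0, In a0 /\ kphi a0 v <> 0); last first.
  exists [::] => // chi chi' hc hc' _ a Fa ia.
  have La : fixes L a.
    apply: InL => //; apply: Zp_ext => n; apply: contrapT => h; apply: none; exists n, a.
    by split.
  by rewrite (lc_L hc) // (lc_L hc').
have /choice [r hr] (w : 'Z_(p ^ v.+1)) : exists r, In r /\ ((exists a, In a /\ kphi a v = w) -> kphi r v = w).
  have [[a [ia e]]|na] := pselect (exists a, In a /\ kphi a v = w); first by exists a.
  by exists 1%g; split=> [|[a h]]; [exact: (InX a0 0%N)|case: na; exists a].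
exists [seq r w | w <- enum 'Z_(p ^ v.+1)] => [e /mapP [w _ ->]|chi chi' hc hc' hE a Fa ia].
  by have [[]] := hr w.
pose e := r (kphi a0 v); have [ie he] := hr (kphi a0 v).
have ev : kphi e v <> 0 by rewrite he //; exists a0.
pose b := r (kphi a v); have [ib hb] := hr (kphi a v).
pose a' := (b^-1 * a)%g; have ia' : In a' by apply: InM => //; exact: InV.
have kb : fixes k b by apply: Fk; case: ib.
have ke : fixes k e by apply: Fk; case: ie.
have ka' : fixes k a' by apply: Fk; case: ia'.
have av : kphi a' v = 0.
  rewrite /a' kphiM ?kphiV //; [|exact: fixesV|exact: Fk].
  by rewrite -[LHS]/(- kphi b v + kphi a v) hb ?addNr //; exists a.
have eE w : chi (r w) = chi' (r w) by apply: hE; apply: map_f; rewrite mem_enum.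
have ea : a = (b * a')%g by rewrite mulKVg.
suff h : chi a' = chi' a' by rewrite ea (lc_M hc) // (lc_M hc') // h eE.
have /choice [m hm] := Zp_quot pp ev av.
pose f N := ((e ^+ m N)^-1 * a')%g.
have [U [UU Un]] := nat_ultra; have [s hs] := aut_ulim f UU.
have kf N : fixes k (f N) by apply: fixesM => //; apply: fixesV; exact: fixesX.
have Fs : fixes F s.
  move=> x Fx; have [N /= h] := filter_ex (hs [:: x]); rewrite -h ?inE //.
  have [Ff _] : In (f N) by apply: InM => //; apply: InV; exact: InX.
  exact: Ff.
have Is : In s.
  split=> // y Ay; have [N /= h] := filter_ex (hs [:: y]); rewrite -h ?inE //.
  have [_ If] : In (f N) by apply: InM => //; apply: InV; exact: InX.
  exact: If.
have s0 : kphi s = 0.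
  apply/kphi_eq0; first exact: Fk.
  move=> x Kx; have [|N0 hN0] := @kphi_cont [:: x]; first by move=> y; rewrite inE => /eqP ->.
  have [N /= [h1 h2]] := filter_ex (filterI (hs [:: x]) (Un N0)).
  have <- : f N x = s x by apply: h1; rewrite inE.
  apply: (hN0 (f N)) => //; last by rewrite inE.
  apply: (Zp_le0 pp h2); rewrite kphiM ?kphiV ?kphiX //; [|exact: fixesX|by apply: fixesV; exact: fixesX].
  by rewrite -[LHS]/(- (kphi e *+ m N) N + kphi a' N) hm Zp_mulrnE addNr.
have Ls := InL _ Is s0; have ks := Fk _ Fs.
have [N /= [h1 h2]] := filter_ex (filterI (lc_limit hc UU kf ks hs) (lc_limit hc' UU kf ks hs)).
have kX : fixes k (e ^+ m N)%g by exact: fixesX.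
have cE c (hc0 : lchar c) : c (f N) = c s -> c a' = c e ^+ m N.
  move=> h; have -> : a' = ((e ^+ m N)%g * f N)%g by rewrite mulKVg.
  by rewrite (lc_M hc0) // h (lc_L hc0 Ls) mulr1 (lc_X hc0).
by rewrite (cE _ hc h1) (cE _ hc' h2) eE.
Qed.
Lemma lchar_ratio (F : set algC) chi chi' : (forall x, k x -> F x) -> lchar chi -> lchar chi' ->
  (forall P a, prime_of [set: algC]%classic P -> P p%:R -> fixes F a ->
     (forall y, y \in Aint -> P (a y - y)) -> chi a = chi' a) ->
  unr_char F (fun a => chi a / chi' a) /\ (forall a, fixes F a -> (chi a / chi' a) ^+ p = 1).
Proof.
move=> kF hc hc' hP; have Fk s : fixes F s -> fixes k s by move=> h x /kF; exact: h.
have n0 a : fixes F a -> chi' a != 0 by move/Fk; exact: lc_neq0.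
have one a : fixes F a -> chi a = chi' a -> chi a / chi' a = 1 by move=> Fa ->; rewrite divff ?n0.
split; last by move=> a Fa; rewrite expr_div_n (lc_p hc) ?(lc_p hc') ?divr1 //; exact: Fk.
split.
- by move=> a b Fa Fb; rewrite (lc_M hc) ?(lc_M hc') ?invfM 1?mulrACA //; exact: Fk.
- have [A hA] := lc_cont hc; have [B hB] := lc_cont hc'; exists (A ++ B) => a Fa h.
  rewrite hA ?hB ?divr1 //; try exact: Fk; move=> x xA; apply: h; rewrite mem_cat xA ?orbT //.
- move=> P a hPP Fa ia; have [Pp|nP] := pselect (P p%:R); first by apply: one => //; exact: (hP P).
  have La : fixes L a by apply: (inertia_L hPP (Fk _ Fa) ia).
  by rewrite (lc_L hc) // (lc_L hc') // divr1.
- move=> tau Fa; have La := conj_cj_L (Fk _ Fa).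
  by rewrite (lc_L hc) // (lc_L hc') // divr1.
Qed.

(** F is k(zeta_p). Every s^(p-1) fixes zeta_p by Fermat, and characters killed by p are determined
    by their values on (p-1)-st powers. *)
Lemma adjoin_unity_root : exists z F, [/\ p.-primitive_root z, number_field F, forall x, k x -> F x, F z &
  forall s, fixes k s -> fixes F (s ^+ p.-1)%g].
Proof.
have [z pz] := C_prim_root_exists (prime_gt0 pp); exists z.
pose F : set algC := fun x => forall s : aut, fixes k s -> s z = z -> s x = x.
have sF : subfield F.
  split=> [s _ _|x y hx hy s ks sz|x y hx hy s ks sz]; first exact: rmorph1.
    by rewrite rmorphB /= hx ?hy.
  by rewrite fmorph_div /= hx ?hy.
exists F; split=> //.
- have [B hB] := number_field_gen nk; have [N nN hN] := nf_of_list (z :: B).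
  apply: (number_field_sub nN sF) => x Fx; apply: subfield_fix; first by case: nN.
  move=> s Ns; apply: Fx; last by apply: Ns; apply: hN; rewrite mem_head.
  by apply: hB => b bB; apply: Ns; apply: hN; rewrite inE bB orbT.
- by move=> x kx s ks _; exact: ks.
move=> s ks x Fx; apply: Fx; first exact: fixesX.
have [|j hj] := prim_rootP pz (x := s z).
  by rewrite -rmorphXn /= (prim_expr_order pz) rmorph1.
have e n : (s ^+ n)%g z = z ^+ (j ^ n).
  elim: n => [|n IH]; first by rewrite expg0 expn0 expr1.
  by rewrite expgS autM IH rmorphXn /= hj -exprM expnS.
rewrite e -[RHS]expr1; apply/eqP; rewrite (eq_prim_root_expr pz) -(totient_prime pp).
apply/eqP; apply: cyclic.Euler_exp_totient; rewrite coprime_sym prime_coprime //; apply/negP => pj.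
have : s z = 1 by rewrite hj; apply/eqP; rewrite -(prim_order_dvd pz).
rewrite -(rmorph1 s) => /fmorph_inj z1; have := prim_order_dvd pz 1%N.
by rewrite z1 expr1n eqxx dvdn1 => /eqP p1; move: pp; rewrite p1.
Qed.

(** Characters are sorted by their values on the finitely many inertia elements [E]. Inside a class,
    the ratio to a reference character is unramified over F, hence one of finitely many. *)
Lemma lchar_finite : exists (T : finType) (code : (aut -> algC) -> T), forall chi chi',
  lchar chi -> lchar chi' -> code chi = code chi' -> forall a, fixes k a -> chi a = chi' a.
Proof.
have [z [F [pz nF kF Fz Fpow]]] := adjoin_unity_root.
have Fk s : fixes F s -> fixes k s by move=> h x /kF; exact: h.
have [Ps [hPs conjPs]] := primes_over_finite pp nF.
have [E hE] : exists E : seq aut, (forall e, e \in (E : seq (gal _ _)) -> fixes F e) /\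
  forall chi chi', lchar chi -> lchar chi' -> (forall e, e \in (E : seq (gal _ _)) -> chi e = chi' e) ->
  forall P, (exists2 i, (i < size Ps)%N & P = nth classical_sets.set0 Ps i) ->
  forall a, fixes F a -> (forall y, y \in Aint -> P (a y - y)) -> chi a = chi' a.
  elim: (Ps) hPs => [|P Ps' IH] hPs'; first by exists [::]; split=> // chi chi' _ _ _ P [].
  have [E1 [h1 h2]] := IH (fun i => hPs' i.+1).
  have [E2 h3 h4] := inertia_values (hPs' 0%N isT) kF; exists (E2 ++ E1); split.
    by move=> e; rewrite mem_cat => /orP []; [exact: h3|exact: h1].
  move=> chi chi' hc hc' he Q [[|i] hi ->] /=.
    by apply: h4 => // e eE; apply: he; rewrite mem_cat eE.
  move=> a Fa; apply: (h2 chi chi' hc hc') => //; last by exists i.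
  by move=> e eE; apply: he; rewrite mem_cat eE orbT.
have [FE agE] := hE.
have [T [code hcode]] := unr_char_finite pp nF (ex_intro2 _ _ z Fz pz).
have /choice [ex hex] (u : algC) : exists i : 'I_p, u ^+ p = 1 -> u = z ^+ i.
  have [e|ne] := pselect (u ^+ p = 1); first by have [i hi] := prim_rootP pz e; exists i.
  by exists (Ordinal (prime_gt0 pp)).
pose code1 (chi : aut -> algC) := [ffun j : 'I_(size E) => ex (chi (nth 1%g E j))].
have code1P chi chi' : lchar chi -> lchar chi' -> code1 chi = code1 chi' ->
    forall e, e \in (E : seq (gal _ _)) -> chi e = chi' e.
  move=> hc hc' /ffunP h e eE; have ie : (index e E < size E)%N by rewrite index_mem.
  have := h (Ordinal ie); rewrite !ffunE /= nth_index // => h'.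
  have p1 := lc_p hc (Fk _ (FE _ eE)); have p2 := lc_p hc' (Fk _ (FE _ eE)).
  exact: etrans (hex _ p1) (etrans (congr1 (fun i : 'I_p => z ^+ i) h') (esym (hex _ p2))).
have /choice [ref href] (t : {ffun 'I_(size E) -> 'I_p}) : exists r, (exists chi, lchar chi /\ code1 chi = t) ->
    lchar r /\ code1 r = t.
  have [[chi h]|n] := pselect (exists chi, lchar chi /\ code1 chi = t); first by exists chi.
  by exists (fun=> 1) => /n.
exists ({ffun 'I_(size E) -> 'I_p} * T)%type,
  (fun chi => (code1 chi, code (fun a => chi a / ref (code1 chi) a))) => chi chi' hc hc' [e1 e2] a ka.
have [hr e3] := href _ (ex_intro _ chi (conj hc erefl)).
have ratio psi : lchar psi -> code1 psi = code1 chi -> unr_char F (fun a => psi a / ref (code1 chi) a) /\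
    (forall a, fixes F a -> (psi a / ref (code1 chi) a) ^+ p = 1).
  move=> hpsi e4; apply: lchar_ratio => // P b hP Pp Fb ib.
  have [i [u [hi Fu hu]]] := conjPs P hP Pp.
  have kb := Fk _ Fb; have ku := Fk _ Fu.
  rewrite -(lc_J hpsi kb ku) -(lc_J hr kb ku).
  apply: (agE _ _ hpsi hr _ (nth classical_sets.set0 Ps i)) => //.
  - by apply: code1P => //; rewrite e3.
  - by exists i.
  - by apply: fixesM; [exact: fixesM|exact: fixesV].
  - move=> y Ay; have := ib ((u^-1)%g y); rewrite Aint_aut => /(_ Ay) /hu.
    by have -> : (u * b * u^-1)%g y - y = u (b ((u^-1)%g y) - (u^-1)%g y) by rewrite rmorphB /= autVK.
have FE' b : fixes F b -> chi b = chi' b.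
  move=> Fb; have [r1 r2] := ratio chi hc erefl; have [r3 r4] := ratio chi' hc' (esym e1).
  have := hcode _ _ r1 r3 r2 r4; rewrite {2}e1 e2 -e1 => /(_ erefl b Fb).
  by apply: mulIf; rewrite invr_eq0; apply: lc_neq0 => //; exact: Fk.
have := FE' _ (Fpow a ka); rewrite (lc_X hc) // (lc_X hc') // => h.
have ep : chi a ^+ p = chi' a ^+ p by rewrite (lc_p hc) ?(lc_p hc').
move: ep; rewrite -(prednK (prime_gt0 pp)) !exprSr h.
by apply: mulfI; rewrite expf_neq0 // lc_neq0.
Qed.
End Characters.

(** * Finite generation over Z_p *)

Lemma aut_order (A : seq algC) (t : aut) : (forall a, a \in A -> t a \in A) ->
  exists2 r, (0 < r)%N & forall a, a \in A -> (t ^+ r)%g a = a.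
Proof.
move=> tA; have tnA n a : a \in A -> (t ^+ n)%g a \in A.
  by elim: n a => [|n IH] a aA; rewrite ?expg0 // expgS autM tA // IH.
pose f n := [ffun a : seq_sub A => SeqSub (tnA n _ (valP a))].
have [i [j [ij _ e]]] := pigeon f; exists (j - i)%N; first by rewrite subn_gt0.
move=> a aA; move/ffunP/(_ (SeqSub aA))/(congr1 val): e; rewrite !ffunE => e.
apply: (fmorph_inj (t ^+ i)%g); rewrite -[LHS]autM -expgD subnKC ?(ltnW ij) //; exact: esym e.
Qed.

Section Generation.
Variables (p : nat) (pp : prime p) (k : set algC) (nk : number_field k) (K : Zp_extension p k).
Variables (L : set algC) (L_max : max_unramified p K L) (X : iwasawa_module K L).
Variables (phi : gal k K -> Zp p) (hphi : topological_iso_Zp phi) (g0 : gal k K) (hg0 : phi g0 = 1).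
Local Notation Lam := (iwasawa_algebra K).
Local Notation Kk := (ext_galois K).
Local Notation pc := (@iw_const p k K).
Local Notation T := (iw_group g0 - 1 : Lam).
Local Notation kphi := (kphi phi).
Let KL : galois K L. Proof. by case: L_max => -[]. Qed.
Let stL (t : aut) x (kt : fixes k t) (Lx : L x) : L (t x) := L_stable Kk L_max kt Lx.
Local Notation cf := (cf X KL).
Local Notation V := (@fixgrp p k K L X).
Local Notation stable_seq := (stable_seq k L).

(** Adding the open subgroup [V A] makes the quotient finite, so that its characters are
    continuous. *)
Definition fixgrp_pT (A : seq algC) : set X := fun x => exists y z v, V A v /\ x = y *+ p + T *: z + v.
Local Notation W := fixgrp_pT.

Lemma W_subgrp A : subgrp (W A).
Proof.
split; first by exists 0, 0, 0; rewrite mul0rn scaler0 !addr0; split=> //; exact: V0.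
move=> _ _ [y [z [v [hv ->]]]] [y' [z' [v' [hv' ->]]]]; exists (y - y'), (z - z'), (v - v').
split; first exact: VB.
by rewrite mulrnBl scalerBr !opprD addrACA (addrACA (y *+ p)).
Qed.
Lemma V_W A x : V A x -> W A x.
Proof. by move=> h; exists 0, 0, x; rewrite mul0rn scaler0 !add0r. Qed.
Lemma W_p A x : W A (x *+ p).
Proof. by exists x, 0, 0; rewrite scaler0 !addr0; split=> //; exact: V0. Qed.
Lemma W_T A x : W A (T *: x).
Proof. by exists 0, x, 0; rewrite mul0rn add0r addr0; split=> //; exact: V0. Qed.
Lemma W_group A g x : W A (iw_group g *: x - x).
Proof.
have [m em] := group_sub1_T pp hphi hg0 g.
by rewrite -{2}(scale1r x) -scalerBl em -scalerA; exact: W_T.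
Qed.
Lemma W_sub A B x : {subset A <= B} -> W B x -> W A x.
Proof. by move=> AB [y [z [v [hv ->]]]]; exists y, z, v; split=> //; exact: V_sub hv. Qed.

Section ExtendToGk.
Variables (A : seq algC) (sA : stable_seq A).

(* If s = t^m x on a large finite set, with t lifting g0 and x fixing K, the class of cf x modulo W
   depends only on s: this extends the characters of X/W from Gal(L/K) to Gal(L/k). *)
Lemma extend_cf : exists C : aut -> X,
  [/\ forall s t, fixes k s -> fixes k t -> W A (C (s * t)%g - (C s + C t)),
      forall s, fixes (ext_field K) s -> W A (C s - cf s) &
      exists B : seq algC, forall s, fixes k s -> (forall b, b \in B -> s b = b) -> W A (C s)].
Proof.
have [t [kt ht]] := gres_lift g0.
have pt : kphi t = 1 by rewrite (kphiE phi kt) ht.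
have kX n : fixes k (t ^+ n)%g := fixesX n kt.
have AL a : a \in A -> L a by case: sA => h _; exact: h.
have Ast s a : fixes k s -> a \in A -> s a \in A by case: sA => _ h; exact: h.
have [r r0 hr] := aut_order (fun a => @Ast t a kt).
(* t^r is trivial on A; p^v is the p-part of r and r' the rest. B below is large enough to detect
   [kphi] modulo p^(v+1). *)
pose v := logn p r; pose r' := (r %/ p ^ v)%N.
have er : r = (r' * p ^ v)%N by rewrite /r' divnK // pfactor_dvdnn.
have cpr : coprime p r'.
  rewrite prime_coprime //; apply/negP => /dvdnP [c ec].
  have : (p ^ v.+1 %| r)%N by rewrite er ec -mulnA -expnS dvdn_mull.
  by rewrite (pfactor_dvdn _ pp r0) ltnn.
have [B0 B0K hB0] := kphi_open hphi v.
have [B [BK Bst] B0B] := stable_seq_ex (fun s x (ks : fixes k s) => galois_stable Kk ks) B0K.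
have A1st s a : fixes k s -> a \in A ++ B -> s a \in A ++ B.
  by move=> ks; rewrite !mem_cat => /orP [h|h]; apply/orP; [left; exact: Ast|right; exact: Bst].
have [r1 r10 hr1] := aut_order (fun a => @A1st t a kt).
have hrX n a : a \in A -> (t ^+ (r * n))%g a = a.
  move=> aA; elim: n => [|n IH]; first by rewrite muln0 expg0.
  by rewrite mulnS expgD autM IH hr.
have hr1X n a : a \in A ++ B -> (t ^+ (r1 * n))%g a = a.
  move=> aA; elim: n => [|n IH]; first by rewrite muln0 expg0.
  by rewrite mulnS expgD autM IH hr1.
pose Rel (s : aut) (x : aut) (m : nat) := fixes (ext_field K) x /\ forall a, a \in A ++ B -> s a = (t ^+ m)%g (x a).
(* The automorphisms with integral [kphi] are dense. One with value n - m is t^(n-m) times an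
   element fixing K, and on A ++ B, where t^r1 is trivial, t^(-m) is replaced by t^(m (r1 - 1)). *)
have Relex s : fixes k s -> exists x m, Rel s x m.
  move=> ks; pose H : set aut := fun h => fixes k h /\ exists m n : nat, kphi h + m%:R = n%:R.
  have gH : aut_group H.
    split.
    - by split=> //; exists 0%N, 0%N; rewrite kphi1 // add0r.
    - move=> h h' [kh [m [n e]]] [kh' [m' [n' e']]]; split; first exact: fixesM.
      by exists (m + m')%N, (n + n')%N; rewrite kphiM // !natrD addrACA e e'.
    - move=> h [kh [m [n e]]]; split; first exact: fixesV.
      by exists n, m; rewrite kphiV // -e addKr.
  have [|h [kh [m [n e]]] hs] := closure_agree (d := s) (A ++ B) gH.
    move=> x hx; have Kx : ext_field K x.
      apply: subfield_fix; first by case: Kk.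
      move=> u Ku; apply: hx; have ku := fixesKk Ku; split=> //.
      by exists 0%N, 0%N; rewrite (kphi_eq0 hphi ku).2 // addr0.
    have [|i hi] := gam_generator hphi hg0 (gres Kk ks) (A := [:: x]).
      by move=> y; rewrite inE => /eqP ->.
    rewrite -(gresE Kk ks Kx) hi ?inE // -ht; elim: i {hi} => [|i IH]; first by rewrite expg0.
    rewrite expgS -[LHS]/(gres Kk kt ((gres Kk kt ^+ i)%g x)) IH gresE //.
    by apply: hx; split=> //; exists 0%N, 1%N; rewrite pt addr0.
  have kx : fixes k ((t ^+ (n + m * r1.-1))^-1 * (h * t ^+ (r1 * m)))%g.
    by apply: fixesM; [apply: fixesV|apply: fixesM].
  exists ((t ^+ (n + m * r1.-1))^-1 * (h * t ^+ (r1 * m)))%g, (n + m * r1.-1)%N; split; last first.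
    by move=> a aA; rewrite -autM mulKVg autM hr1X // hs.
  have e2 : kphi (h * t ^+ (r1 * m))%g = kphi (t ^+ (n + m * r1.-1))%g.
    rewrite kphiM // !kphiX // pt -(prednK r10) /= mulSn mulrnDr addrA e -mulrnDr mulnC //.
  apply/(kphi_eq0 hphi kx); rewrite kphiM //; [|exact: fixesV|exact: fixesM].
  by rewrite kphiV // e2 addNr.
have cfW x y : fixes (ext_field K) x -> fixes (ext_field K) y -> (forall a, a \in A -> x a = y a) -> W A (cf x - cf y).
  by move=> Kx Ky h; apply: V_W; apply: cf_agree.
have wd s x m x' m' : Rel s x m -> Rel s x' m' -> W A (cf x - cf x').
  wlog le : x m x' m' / (m <= m')%N => [hw|[Kx hx] [Kx' hx']].
    case/orP: (leq_total m m') => le h h'; first exact: (hw x m x' m').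
    by rewrite -opprB; apply: subgrpN; [exact: W_subgrp|exact: (hw x' m' x m)].
  set d := (m' - m)%N; have em : m' = (m + d)%N by rewrite subnKC.
  have xx' a : a \in A ++ B -> x a = (t ^+ d)%g (x' a).
    move=> aA; apply: (fmorph_inj (t ^+ m)%g); apply: etrans (esym (hx a aA)) _.
    by rewrite hx' // em expgD autM.
  have kx := fixesKk Kx; have kx' := fixesKk Kx'.
  have pd : (p ^ v.+1 %| d)%N.
    have : kphi (t ^+ d)%g v = 0.
      apply: hB0 => // b /B0B bB; have Kb : ext_field K b by exact: BK.
      by have := xx' b; rewrite mem_cat bB orbT Kx // Kx' // => /(_ isT).
    rewrite kphiX // pt Zp_natE => /(congr1 val).
    have q1 : (1 < p ^ v.+1)%N by rewrite -(Zp_mod pp).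
    by rewrite /= (val_Zp_nat q1) => /eqP.
  (* y acts on A as t^d, and r divides d r', so r' (cf y) is in V A. As p (cf y) is in W and r' is
     prime to p, cf y itself is in W. *)
  pose y : aut := (x * x'^-1)%g; have Ky : fixes (ext_field K) y by apply: fixesM => //; exact: fixesV.
  have ky := fixesKk Ky.
  have hy a : a \in A -> y a = (t ^+ d)%g a.
    move=> aA; have xA : (x'^-1)%g a \in A by apply: Ast => //; exact: fixesV.
    by rewrite autM xx' ?mem_cat ?xA // autVK.
  have ey : cf x - cf x' = cf y by rewrite (cfM X KL stL) ?(cfV X KL stL) //; exact: fixesV.
  clearbody y.
  have hyn n a : a \in A -> (y ^+ n)%g a = (t ^+ (d * n))%g a.
    move=> aA; elim: n => [|n IH]; first by rewrite muln0 !expg0.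
    by rewrite expgS autM IH mulnS expgD autM hy //; apply: Ast.
  have cfX n : cf (y ^+ n)%g = cf y *+ n.
    elim: n => [|n IH]; first by rewrite expg0 mulr0n cf1.
    by rewrite expgS (cfM X KL stL) ?IH ?mulrS //; exact: fixesX.
  have Wr : W A (cf y *+ r').
    apply: V_W; rewrite -cfX; apply/(cf_V X KL AL); first exact: fixesX.
    move=> a aA; rewrite hyn //; have /dvdnP [c ->] := pd.
    have -> : (c * p ^ v.+1 * r' = r * (c * p))%N by rewrite expnS er; ring.
    exact: hrX.
  rewrite ey.
  have [n' [_ Wn' min]] := order_ex (W_subgrp A) (ex_intro2 _ _ p (prime_gt0 pp) (W_p A (cf y))).
  have d1 := min _ (W_p A (cf y)); have d2 := min _ Wr.
  have n1 : (n' %| 1)%N by rewrite -(eqP cpr) dvdn_gcd d1 d2.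
  by move: n1 Wn'; rewrite dvdn1 => /eqP ->; rewrite mulr1n.
have /choice [f hf] s : exists xm : aut * nat, fixes k s -> Rel s xm.1 xm.2.
  have [ks|nk'] := pselect (fixes k s); last by exists (1%g, 0%N).
  by have [x [m h]] := Relex s ks; exists (x, m).
exists (fun s => cf (f s).1); split.
- move=> s u ks ku; have [Kx hx] := hf s ks; have [Ky hy] := hf u ku.
  move: (f s) Kx hx (f u) Ky hy => [x m] /= Kx hx [y n] /= Ky hy.
  have kV : fixes k (t ^+ n)^-1%g by exact: fixesV.
  pose x' := ((t ^+ n)^-1 * x * (t ^+ n)^-1^-1)%g.
  have Kx' : fixes (ext_field K) x' by exact: (conj_fixes Kk).
  have R1 : Rel (s * u)%g (x' * y)%g (m + n)%N.
    split; first exact: fixesM.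
    move=> a aA; rewrite autM hy // hx; last by exact: (A1st _ _ (kX n) (A1st _ _ (fixesKk Ky) aA)).
    by rewrite /x' invgK !autM expgD autM autVK.
  have h1 := wd _ _ _ _ _ (hf _ (fixesM ks ku)) R1.
  have e : cf (x' * y)%g = iw_group (gres Kk kV) *: cf x + cf y.
    by rewrite (cfM X KL stL) // (cf_conj X KL stL kV).
  have h2 := W_group A (gres Kk kV) (cf x).
  have -> : cf (f (s * u)%g).1 - (cf x + cf y) = (cf (f (s * u)%g).1 - cf (x' * y)%g) + (iw_group (gres Kk kV) *: cf x - cf x).
    by rewrite e -addrA; congr (_ + _); rewrite !opprD addrACA addNr add0r addrC.
  by apply: subgrpD => //; exact: W_subgrp.
- move=> s Ks; have R0 : Rel s s 0%N by split=> // a _; rewrite expg0.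
  exact: (wd _ _ _ _ _ (hf s (fixesKk Ks)) R0).
- exists (A ++ B) => s ks hs.
  have R0 : Rel s 1%g 0%N by split=> // a aA; rewrite hs // expg0.
  by have := wd _ _ _ _ _ (hf s ks) R0; rewrite cf1 subr0.
Qed.
End ExtendToGk.

Lemma W_reps A : stable_seq A -> exists r : seq X, forall x, exists2 y, y \in r & V A (x - y).
Proof.
move=> sA; have [T' [code hcode]] := V_code X KL stL sA.1.
have /choice [rep hrep] (u : T') : exists y, (exists x, code x = u) -> code y = u.
  by have [[x h]|n] := pselect (exists x, code x = u); [exists x|exists 0 => /n].
exists (map rep (enum T')) => x; exists (rep (code x)); first by rewrite map_f // mem_enum.
by apply: hcode; rewrite hrep //; exists x.
Qed.

(** A chain of length d gives p^d characters of X modulo W, and by [extend_cf] as many characters of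
    Gal(L/k), which a code in a fixed finite type tells apart. So d < p^d <= #|T'|, uniformly in
    A. *)
Lemma chain_bound : exists D, forall A xs, stable_seq A -> chain (W A) xs -> (size xs <= D)%N.
Proof.
have [T' [code hcode]] := lchar_finite pp nk L_max hphi.
exists #|T'| => A xs sA hc; set d := size xs.
have [z pz] := C_prim_root_exists (prime_gt0 pp).
have zp := prim_expr_order pz.
have [C [CM CK [B CB]]] := extend_cf sA.
have [r hr] := W_reps sA.
have ex (u : {ffun 'I_d -> 'I_p}) : exists th, [/\ hom_on setT th, forall w, W A w -> th w = 1 &
    forall i : 'I_d, th xs`_i = z ^+ u i].
  pose us := [seq (u i : nat) | i <- enum 'I_d].
  have [|||th [h1 s1 h2 h3]] := @chain_hom X p z xs us (W A) (fun=> 1) pp zp (W_subgrp A) _ _ _ hc.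
  - by split=> // a b _ _; rewrite mulr1.
  - by move=> x; exact: W_p.
  - by [].
  have [||th' [h4 h5]] := hom_extend_all (r := r) s1 h1.
  - by move=> x; exists p; [exact: prime_gt0|apply: (h2 _ (W_p A x)).1].
  - by move=> x; have [y yr hy] := hr x; exists y => //; apply: (h2 _ (V_W hy)).1.
  exists th'; split=> // [w Ww|i]; first by have [h6 h7] := h2 w Ww; rewrite h5.
  have sp : forall j (zs : seq X) Y, subgrp Y -> (forall x, Y (x *+ p)) -> (j < size zs)%N -> aspan Y zs zs`_j.
    move=> {h4 h5 i} j zs; elim: zs j => [|x zs IH] [|j] Y sY Yp //= hj.
      have : adj Y x x by exact: adj_mem.
      elim: zs (adj Y x) {IH hj} => //= w zs IH' Y' h; apply: IH'; exact: adj_sub.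
    apply: IH => //; first exact: adj_subgrp (prime_gt0 pp) (Yp x).
    by move=> w; apply: adj_sub.
  rewrite h5; last exact: (sp _ _ _ (W_subgrp A) (W_p A)).
  by rewrite h3 // /us (nth_map i) ?size_enum_ord // nth_ord_enum.
have /choice [th hth] := ex.
have thW u x y : W A (x - y) -> th u x = th u y.
  have [[_ hM] h1 _] := hth u; move=> hW.
  by rewrite -(subrK y x) hM // h1 // mul1r.
have lc u : lchar p k L (fun s => th u (C s)).
  have [[t0 hM] h1 _] := hth u; split.
  - by move=> a b ka kb; rewrite (thW u _ _ (CM a b ka kb)) hM.
  - by exists B => a ka ha; apply: h1; exact: CB.
  - move=> a ka; have sT : subgrp [set: X]%classic by [].
    by rewrite -(hom_onMn p sT (conj t0 hM) I) h1 //; exact: W_p.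
  - move=> a La; have Ka := fixesMK KL La.
    by rewrite (thW u _ _ (CK a Ka)) (cf_fix X KL La) t0.
have inj : injective (fun u => code (fun s => th u (C s))).
  move=> u u' e; apply/ffunP => i; have [s Ks cs] := cf_surj KL xs`_i.
  have := hcode _ _ (lc u) (lc u') e s (fixesKk Ks).
  rewrite (thW u _ _ (CK s Ks)) (thW u' _ _ (CK s Ks)) cs.
  have [_ _ ->] := hth u; have [_ _ ->] := hth u'.
  move/eqP; rewrite (eq_prim_root_expr pz) !modn_small // => /eqP e'; exact: val_inj.
have := leq_card _ inj; rewrite card_ffun !card_ord; apply: leq_trans.
by rewrite ltnW // ltn_expl // prime_gt1.
Qed.

(** A chain of maximal length over all A, found for some A0, is still a chain for A ++ A0, and by
    maximality it spans X there; the result descends to A. *)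
Lemma W_generators : exists xs : seq X, forall A, stable_seq A -> forall x,
  exists a : 'I_(size xs) -> nat, W A (x - \sum_(i < size xs) xs`_i *+ a i).
Proof.
have [D hD] := chain_bound.
pose P n := `[< exists A xs, [/\ stable_seq A, chain (W A) xs & size xs = n] >].
have [||n /asboolP [A0 [xs [sA0 hc <-]]] max] := @ex_maxnP P D.
- by exists 0%N; apply/asboolP; exists [::], [::]; split.
- by move=> n /asboolP [A [xs [sA hc <-]]]; exact: (hD A xs sA hc).
exists xs => A sA x.
have sB : stable_seq (A ++ A0) by exact: stable_seq_cat.
have hB : chain (W (A ++ A0)) xs.
  by apply: chain_mono hc => y; apply: W_sub => a aA; rewrite mem_cat aA orbT.
have : aspan (W (A ++ A0)) xs x.
  apply: contrapT => nx; have := max (size xs).+1; rewrite ltnn => h; suff: false by [].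
  apply: h; apply/asboolP; exists (A ++ A0), (rcons xs x); split=> //; last by rewrite size_rcons.
  exact: chain_rcons.
move=> /aspanP [y [a [hy ->]]]; exists a; rewrite addrK.
by apply: W_sub hy => b bA; rewrite mem_cat bA.
Qed.

Lemma V_unif A (l : nat -> Lam) : stable_seq A -> (forall x, exists N, forall n, (N <= n)%N -> V A (l n *: x)) ->
  exists N, forall x, V A (l N *: x).
Proof.
move=> sA h; have [r hr] := W_reps sA; have /choice [f hf] := h.
exists (\max_(y <- r) f y) => x; have [y yr hy] := hr x.
rewrite -(subrK y x) scalerDr; apply: VD; first exact: (V_scale pp KL stL hphi hg0).
by apply: hf; exact: leq_bigmax_seq.
Qed.

Lemma V_pn_unif A : stable_seq A -> exists N, forall x : X, V A (x *+ p ^ N).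
Proof.
move=> sA; have [|N hN] := V_unif (l := fun n => 1 *+ p ^ n) sA.
  move=> x; have [N hN] := V_cont pp hphi x sA.1; exists N.+1 => n Nn.
  apply: (hN N) => //; rewrite -(subnK Nn) expnD mulrnA; exact: JQ_pn.
by exists N => x; rewrite -[x in x *+ _]scale1r scalerMnl.
Qed.

Hypothesis pn : pseudo_null (dagger X).

Lemma fin_gen : exists (n : nat) (y : 'I_n -> X), forall x, exists a : 'I_n -> Zp p, x = \sum_i pc (a i) *: y i.
Proof.
have hR := iw_ps_ring pp hphi hg0.
have [xs hxs] := W_generators.
have [f nf fxs] : exists2 f : Lam, ~ in_p p f & forall x, x \in xs -> f *: x = 0.
  elim: (xs) => [|x xs' [f nf hf]]; first by exists 1 => //; apply: dagger_not_p => //; exact: dagger_1.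
  have [f1 nf1 hf1] := killed_not_p pp pn x; exists (f1 * f) => [/(in_p_prime pp hR) [] //|y].
  by rewrite inE => /orP [/eqP ->|/hf h]; rewrite -scalerA ?h ?scaler0 // scalerA mulrC -scalerA hf1 scaler0.
have [j [a0 [b0 eT]]] := not_in_p_T pp hR nf.
(* Nakayama for T: the remainder in T^M X is rewritten with [hxs], the multiples of p being
   collected in y. *)
have gen A M x : stable_seq A -> exists (c : 'I_(size xs) -> Lam) y z v, V A v /\
    x = \sum_(i < size xs) c i *: xs`_i + y *+ p + T ^+ M *: z + v.
  move=> sA; elim: M x => [|M IH] x.
    by exists (fun=> 0), 0, x, 0; rewrite expr0 scale1r mul0rn big1 ?add0r ?addr0 => [|i _]; rewrite ?scale0r //; split=> //; exact: V0.
  have [c [y [z [v [hv e]]]]] := IH x; have [a [y' [z' [v' [hv' e']]]]] := hxs A sA z.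
  move/eqP: e'; rewrite subr_eq => /eqP e'.
  exists (fun i => c i + T ^+ M *+ a i), (y + T ^+ M *: y'), z', (T ^+ M *: v' + v); split.
    by apply: VD => //; exact: (V_scale pp KL stL hphi hg0).
  rewrite e e'; under [in RHS]eq_bigr => i _ do rewrite scalerDl -scalerMnl scalerMnr.
  rewrite big_split /= -scaler_sumr mulrnDl !scalerDr exprSr -scalerA -scalerMnr.
  move: (\sum_(i < _) c i *: _) (T ^+ M *: \sum_(i < _) _) (T ^+ M *: (T *: z')) (T ^+ M *: y' *+ p) (T ^+ M *: v') (y *+ p) => A1 A2 A3 A4 A5 A6.
  by rewrite !addrA !(addrAC _ _ A2).
have Vkill A : stable_seq A -> exists M, forall x, V A (T ^+ M *: x).
  move=> sA; apply: (V_unif (l := fun n => T ^+ n) sA) => x.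
  have [N hN] := V_cont pp hphi x sA.1; have [M hM] := T_small pp hphi hg0 N.
  by exists M => n Mn; apply: (hN N) => //; rewrite -[T ^+ n]mulr1; exact: hM.
(* T^M X is in V A for large M, and T^j = f a0 + b0 p with f killing the xs, so T^j X lies in p X +
   V A. *)
have Tj A x : stable_seq A -> exists y v, V A v /\ T ^+ j *: x = y *+ p + v.
  move=> sA; have [M hM] := Vkill A sA; have [c [y [z [v [hv e]]]]] := gen A M x sA.
  have fx : f *: x = f *: y *+ p + f *: (T ^+ M *: z) + f *: v.
    rewrite e !scalerDr scaler_sumr big1 ?add0r -?scalerMnr // => i _.
    by rewrite scalerA mulrC -scalerA fxs ?scaler0 // mem_nth.
  exists (a0 *: (f *: y) + b0 *: x), (a0 *: (f *: (T ^+ M *: z) + f *: v)); split.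
    apply: (V_scale pp KL stL hphi hg0) => //; apply: VD; last exact: (V_scale pp KL stL hphi hg0).
    exact: (V_scale pp KL stL hphi hg0).
  rewrite eT scalerDl -scalerMnl (mulrC f) -scalerA fx -(addrA (f *: y *+ p)) scalerDr -scalerMnr mulrnDl addrAC.
  by [].
(* Expanding the coefficients c i up to degree j in T leaves the T^l xs_i with l < j as generators
   over Z_p modulo p X + V A. *)
have Xp A x : stable_seq A -> exists (b : 'I_(size xs) * 'I_j -> Zp p) y,
    V A (x - \sum_il pc (b il) *: (T ^+ (il.2 : nat) *: xs`_(il.1)) - p%:R *: y).
  move=> sA; have [c [y [z [v [hv e]]]]] := gen A j x sA.
  have /choice [bm hbm] (i : 'I_(size xs)) : exists bm : (nat -> Zp p) * Lam, c i = \sum_(l < j) pc (bm.1 l) * T ^+ l + T ^+ j * bm.2.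
    by have [b [m em]] := T_dec hR j (c i); exists (b, m).
  have /choice [yv hyv] u : exists yv : X * X, V A yv.2 /\ T ^+ j *: u = yv.1 *+ p + yv.2.
    by have [y1 [v1 h]] := Tj A u sA; exists (y1, v1).
  pose w := \sum_(i < size xs) (bm i).2 *: xs`_i + z.
  exists (fun il : 'I_(size xs) * 'I_j => (bm il.1).1 il.2), (y + (yv w).1).
  have [hw ew] := hyv w.
  suff -> : x - \sum_(il : 'I_(size xs) * 'I_j) pc ((bm il.1).1 il.2) *: (T ^+ (il.2 : nat) *: xs`_(il.1)) - p%:R *: (y + (yv w).1) = (yv w).2 + v by exact: VD.
  have e1 : \sum_(i < size xs) c i *: xs`_i = \sum_(il : 'I_(size xs) * 'I_j) pc ((bm il.1).1 il.2) *: (T ^+ (il.2 : nat) *: xs`_(il.1)) + T ^+ j *: \sum_(i < size xs) (bm i).2 *: xs`_i.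
    rewrite scaler_sumr -(pair_bigA _ (fun i (l : 'I_j) => pc ((bm i).1 l) *: (T ^+ l *: xs`_i))) -big_split.
    apply: eq_bigr => i _; rewrite hbm scalerDl scaler_suml -scalerA; congr (_ + _).
    by apply: eq_bigr => l _; rewrite scalerA.
  rewrite e e1 scaler_nat mulrnDl; move: ew; rewrite /w scalerDr.
  move: (\sum_il _) (T ^+ j *: \sum_(i < _) _) (T ^+ j *: z) (y *+ p) ((yv _).1 *+ p) ((yv _).2) => A1 A2 A3 A4 A5 A6 ew'.
  have -> : A1 + A2 + A4 + A3 + v - A1 - (A4 + A5) = (A2 + A3) - A5 + v.
    by rewrite opprD !addrA (addrAC _ _ (- A1)) !(addrAC _ _ (- A1)) subrr add0r !(addrAC _ _ (- A4)) (addrAC _ _ A4) addrK (addrAC _ v).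
  by rewrite ew' [A5 + A6]addrC addrK.
(* Compactness removes V A. Iteration then gives generation modulo every p^n X, and compactness once
   more gives equality. *)
have Xgen x : exists (b : 'I_(size xs) * 'I_j -> Zp p) y, x = \sum_il pc (b il) *: (T ^+ (il.2 : nat) *: xs`_(il.1)) + p%:R *: y.
  by apply: (X_closed pp KL stL hphi hg0) => A sA; exact: Xp.
pose I := ('I_(size xs) * 'I_j)%type; pose yy (il : I) := T ^+ (il.2 : nat) *: xs`_(il.1).
have Xn n x : exists (b : I -> Zp p) y, x = \sum_il pc (b il) *: yy il + y *+ p ^ n.
  elim: n x => [|n IH] x; first by exists (fun=> 0), x; rewrite expn0 mulr1n big1 ?add0r // => i _; rewrite rmorph0 scale0r.
  have [b [y e]] := IH x; have [b' [y' e']] := Xgen y.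
  exists (fun i => b i + b' i *+ p ^ n), y'; rewrite e e' scaler_nat mulrnDl -mulrnA expnS addrA; congr (_ + _).
  rewrite -sumrMnl -big_split; apply: eq_bigr => i _ /=.
  by rewrite rmorphD raddfMn /= scalerDl scalerMnl.
have Xfin x : exists b : I -> Zp p, x = \sum_il pc (b il) *: yy il.
  have [|b [z e]] := X_closed pp KL stL hphi hg0 (y := yy) (l := 0) (x := x).
    move=> A sA; have [N hN] := V_pn_unif sA.
    have [b [y e]] := Xn N x; exists b, 0; rewrite scaler0 subr0 e addrC addKr.
    exact: hN.
  by exists b; rewrite e scale0r addr0.
exists #|{: I}|, (fun i => yy (enum_val i)) => x; have [b ->] := Xfin x.
exists (fun i => b (enum_val i)); rewrite (reindex_onto enum_val enum_rank) => [|i _]; last by rewrite enum_rankK.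
by apply: eq_bigl => i; rewrite enum_valK eqxx.
Qed.

End Generation.

(** * Invariants and coinvariants *)

Lemma scale_sub1_pow (R : comNzRingType) (V : lmodType R) (a g : R) m (y : V) :
  a *: y - y = (g - 1) *: ((\sum_(i < m) g ^+ i) *: y) + (a - g ^+ m) *: y.
Proof.
rewrite scalerA -subrX1 -scalerDl; have -> : g ^+ m - 1 + (a - g ^+ m) = a - 1 by ring.
by rewrite scalerBl scale1r.
Qed.

Lemma abelian_subext (K L M : set algC) : galois K L -> (forall s t : gal K L, s * t = t * s)%g ->
  subfield M -> (forall x, K x -> M x) -> (forall x, M x -> L x) -> galois K M.
Proof.
move=> KL com sM KM ML; have [sK sL sKL _] := KL.
have st s a : fixes K s -> M a -> M (s a).
  move=> Ks Ma; apply: subfield_fix => // t Mt; have Kt : fixes K t by move=> x /KM; exact: Mt.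
  have Ls u y : fixes K u -> L y -> L (u y) by exact: (galois_stable KL).
  have La := ML _ Ma.
  have := congr1 (fun g : gal K L => g a) (com (gres KL Kt) (gres KL Ks)).
  rewrite -[LHS]/(gres KL Kt (gres KL Ks a)) -[RHS]/(gres KL Ks (gres KL Kt a)) !gresE //; try exact: Ls.
  by rewrite (Mt a Ma).
split=> // x Mx h; apply: subfield_fix => // s Ks.
have [||g hg] := aut_restrict sM KM Ks.
- by move=> y; exact: st.
- by move=> y; apply: st; exact: fixesV.
by rewrite -hg.
Qed.

Section Decomposition.
Variables (p : nat) (pp : prime p) (k : set algC) (nk : number_field k) (K : Zp_extension p k).
Variables (K_ns : nonsplit p k K) (L : set algC) (L_max : max_unramified p K L) (X : iwasawa_module K L).
Variables (phi : gal k K -> Zp p) (hphi : topological_iso_Zp phi) (g0 : gal k K) (hg0 : phi g0 = 1).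
Local Notation Lam := (iwasawa_algebra K).
Local Notation Kk := (ext_galois K).
Local Notation pc := (@iw_const p k K).
Let KL : galois K L. Proof. by case: L_max => -[]. Qed.
Let stL (t : aut) x (kt : fixes k t) (Lx : L x) : L (t x) := L_stable Kk L_max kt Lx.
Local Notation cf := (cf X KL).
Local Notation V := (@fixgrp p k K L X).
Local Notation stable_seq := (stable_seq k L).

Lemma J_group n (g g' : gal k K) : phi g n = phi g' n -> J hphi n (iw_group g - iw_group g').
Proof.
move=> e; have -> : iw_group g - iw_group g' = iw_group g' * (iw_group (g'^-1 * g)%g - 1) :> Lam.
  by rewrite mulrBr mulr1 -iw_groupM mulKVg.
apply: JQM => y; rewrite iw_sub1E.
have -> : fq_map (stdq hphi n) (g'^-1 * g)%g = fq_map (stdq hphi n) 1%g.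
  apply/stdq_eq; rewrite (phiM hphi) (phiV hphi) (phi1 hphi) addrC Zp_subE e; exact: subrr.
by rewrite subrr.
Qed.

Lemma prime_aut (P : set algC) (t : aut) : prime_of [set: algC]%classic P ->
  prime_of [set: algC]%classic (fun x => P (t x)).
Proof.
move=> hP; have hT x : [set: algC]%classic x <-> [set: algC]%classic ((t^-1)%g x) by [].
by have := @gconj_prime (t^-1)%g setT setT hT P hP; rewrite invgK.
Qed.

(* As no prime over p splits in K/k, every element of Gal(K/k) has a lift in the decomposition group. *)
Lemma stab_lift (g : gal k K) (P : set algC) : prime_of [set: algC]%classic P -> P p%:R ->
  exists t (kt : fixes k t), gres Kk kt = g /\ forall x, P x <-> P (t x).
Proof.
move=> hP Pp; have [t0 [kt0 ht0]] := gres_lift g.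
have sK : subfield (ext_field K) by case: Kk.
have sk : subfield k by case: nk.
have hP' := prime_aut t0 hP.
have e := K_ns (prime_restrict sk hP) (conj (sf_nat sk p) Pp) (prime_restrict sK hP) (prime_restrict sK hP').
have {}e : [set x | ext_field K x /\ P x]%classic = [set x | ext_field K x /\ P (t0 x)]%classic.
  apply: e; apply/seteqP; split=> x /=.
  - by move=> [[_ Px] kx].
  - by move=> [kx Px]; split=> //; split=> //; exact: (@Kk_sub _ _ K _ kx).
  - by move=> [[_ Px] kx]; split=> //; move: Px; rewrite kt0.
  - by move=> [kx Px]; split=> //; split; [exact: (@Kk_sub _ _ K _ kx)|rewrite kt0].
have [x Kx Px|u Ku hu] := prime_transitive sK hP hP'.
  by have : [set x | ext_field K x /\ P x]%classic x by []; rewrite e => -[].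
have kt := fixesM kt0 (fixesKk Ku); exists (t0 * u)%g, kt; split=> //.
rewrite -ht0; apply: gal_eqP => x Kx; rewrite !gresE // autM Ku //.
Qed.

Lemma comm_L (P : set algC) (t s : aut) : prime_of [set: algC]%classic P -> fixes k t -> fixes k s ->
  (forall x, P x <-> P (t x)) -> (forall x, P x <-> P (s x)) -> fixes L (aut_comm t s).
Proof.
move=> hP kt ks ht hs; apply: (unr_inertia L_max hP); last exact: aut_comm_inertia.
by apply: (comm_fixes Kk) => //; exact: gal_mulC.
Qed.

Lemma comm_fixK (t s : aut) : fixes k t -> fixes k s -> fixes (ext_field K) (aut_comm t s).
Proof. by move=> kt ks; apply: (comm_fixes Kk) => //; exact: gal_mulC. Qed.

Lemma cf_comm (t s : aut) (kt : fixes k t) : fixes (ext_field K) s ->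
  cf (aut_comm t s) = iw_group (gres Kk kt) *: cf s - cf s.
Proof.
move=> Ks; have h := conj_fixes Kk kt Ks.
by rewrite /aut_comm (cfM X KL stL) ?(cfV X KL stL) ?(cf_conj X KL stL kt) //; exact: fixesV.
Qed.

Lemma inertia_stab (P : set algC) (s : aut) : prime_of [set: algC]%classic P ->
  (forall y, y \in Aint -> P (s y - y)) -> forall x, P x <-> P (s x).
Proof.
move=> hP h x; split=> [Px|Px].
  by rewrite -(subrK x (s x)); apply: (prD hP) => //; apply: h; exact: (pr_int hP).
have Ax : x \in Aint by have := pr_int hP Px; rewrite Aint_aut.
by rewrite -(subKr (s x) x); apply: (prB subfieldT hP) => //; exact: h.
Qed.

Section Bound.
Variables (h : gal k K) (h1 : h <> 1%g) (A : seq algC) (sA : stable_seq A).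

Definition fixgrp_sub1 : set X := fun x => exists z v, V A v /\ x = (iw_group h - 1) *: z + v.
Local Notation U := fixgrp_sub1.

Lemma U_subgrp : subgrp U.
Proof.
split; first by exists 0, 0; rewrite scaler0 addr0; split=> //; exact: V0.
move=> _ _ [z [v [hv ->]]] [z' [v' [hv' ->]]]; exists (z - z'), (v - v').
by split; [exact: VB|rewrite scalerBr opprD addrACA].
Qed.
Lemma V_U x : V A x -> U x.
Proof. by move=> hx; exists 0, x; rewrite scaler0 add0r. Qed.
Lemma U_scale l x : U x -> U (l *: x).
Proof.
move=> [z [v [hv ->]]]; exists (l *: z), (l *: v); split; first exact: (V_scale pp KL stL hphi hg0).
by rewrite scalerDr !scalerA mulrC.
Qed.

Lemma fixK_sub (s : aut) : fixes (fixK h) s -> fixes k s.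
Proof. by move=> Fs x kx; apply: Fs; exact: fixK_k. Qed.

Lemma K_fixK (s : aut) : fixes (ext_field K) s -> fixes (fixK h) s.
Proof. by move=> Ks x [Kx _]; exact: Ks. Qed.

Lemma U_group (s : aut) (ks : fixes k s) y : fixes (fixK h) s -> U (iw_group (gres Kk ks) *: y - y).
Proof.
move=> Fs; have [N hN] := V_cont pp hphi y sA.1; have [m hm] := fixK_phi pp hphi ks Fs N.
have hV : V A ((iw_group (gres Kk ks) - iw_group (h ^+ m)%g) *: y).
  by apply: (hN N) => //; apply: J_group; rewrite hm (phiX hphi) Zp_mulrnE.
exists ((\sum_(i < m) iw_group h ^+ i) *: y), ((iw_group (gres Kk ks) - iw_group (h ^+ m)%g) *: y); split=> //.
rewrite iw_groupX; exact: scale_sub1_pow.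
Qed.

(** [tu, s] = t [u, s] t^(-1) [t, s], and [u, s] is u times the inverse of its conjugate by s. As s
    fixes the fixed field of h, it acts on X as a limit of powers of h, hence trivially modulo U. *)
Lemma U_comm_lift (t u s : aut) : fixes k t -> fixes (ext_field K) u -> fixes (fixK h) s ->
  U (cf (aut_comm (t * u)%g s) - cf (aut_comm t s)).
Proof.
move=> kt Ku Fs; have ks := fixK_sub Fs; have ku := fixesKk Ku.
have -> : aut_comm (t * u)%g s = (t * aut_comm u s * t^-1 * aut_comm t s)%g.
  by rewrite /aut_comm invMg !mulgA !(mulgK, mulgKV).
have K1 := comm_fixK ku ks; have K2 := comm_fixK kt ks.
rewrite (cfM X KL stL) //; last exact: (conj_fixes Kk).
rewrite (cf_conj X KL stL kt) // addrK; apply: U_scale.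
have -> : aut_comm u s = (u * (s * u^-1 * s^-1))%g by rewrite /aut_comm !mulgA.
have KV := fixesV Ku.
rewrite (cfM X KL stL) ?(cf_conj X KL stL ks) ?(cfV X KL stL) //; last exact: (conj_fixes Kk).
rewrite scalerN -opprB; apply: subgrpN; first exact: U_subgrp.
exact: U_group.
Qed.

Variables (t : aut) (kt : fixes k t).

Lemma U_commM (s s' : aut) : fixes (fixK h) s -> fixes (fixK h) s' ->
  U (cf (aut_comm t (s * s')%g) - (cf (aut_comm t s) + cf (aut_comm t s'))).
Proof.
move=> Fs Fs'; have ks := fixK_sub Fs; have ks' := fixK_sub Fs'.
have -> : aut_comm t (s * s')%g = (aut_comm t s * (s * aut_comm t s' * s^-1))%g.
  by rewrite /aut_comm invMg !mulgA !(mulgK, mulgKV).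
have K1 := comm_fixK kt ks; have K2 := comm_fixK kt ks'.
rewrite (cfM X KL stL) //; last exact: (conj_fixes Kk).
rewrite (cf_conj X KL stL ks) // opprD addrACA subrr add0r.
exact: U_group.
Qed.

Lemma comm_unr_char th : hom_on setT th -> (forall w, U w -> th w = 1) ->
  unr_char (fixK h) (fun s => th (cf (aut_comm t s))).
Proof.
move=> [t0 hM] tU; have thU x y : U (x - y) -> th x = th y.
  by move=> hW; rewrite -(subrK y x) hM // tU // mul1r.
have triv s : fixes L s -> th (cf (aut_comm t s)) = 1.
  by move=> Ls; have Ks := fixesMK KL Ls; rewrite (cf_comm kt Ks) (cf_fix X KL Ls) scaler0 subr0.
split.
- by move=> a b Fa Fb; rewrite (thU _ _ (U_commM Fa Fb)) hM.
- exists A => a Fa ha; apply: tU; apply: V_U; have ka := fixK_sub Fa.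
  apply/(cf_V X KL sA.1); first exact: comm_fixK.
  move=> x xA; have haV y : y \in A -> (a^-1)%g y = y by move=> yA; rewrite -{1}(ha y yA) autKV.
  rewrite /aut_comm !autM haV // ha ?autVK //; apply: sA.2 => //; exact: fixesV.
- move=> P a hP Fa ia; have ka := fixK_sub Fa.
  have [Pp|nP] := pselect (P p%:R); last first.
    by apply: triv; apply: (inertia_L pp nk L_max hphi hP ka ia) => /nP.
  have [t' [kt' [e ht']]] := stab_lift (gres Kk kt) hP Pp.
  have [u Ku eu] := gres_ker e.
  have z : cf (aut_comm t' a) = 0.
    by apply: (cf_fix X KL); apply: (comm_L hP) => //; exact: inertia_stab.
  have := U_comm_lift kt' Ku Fa; rewrite -eu z subr0; exact: tU.
- by move=> tau Fa; apply: triv; apply: (conj_cj_L pp L_max hphi); exact: fixK_sub.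
Qed.
End Bound.

(** The exponent is that of [unr_char_bound] for the fixed field of h, hence the same for all
    generators of the augmentation submodule. Characters separate X modulo the open submodule U, and
    compactness passes from U to (h - 1) X. *)
Lemma aug_bound (h : gal k K) : h <> 1%g -> exists a, forall w : X, aug_rel w -> exists y : X, w *+ p ^ a = (iw_group h - 1) *: y.
Proof.
move=> h1; have [C hC] := unr_char_bound pp (fixK_nf pp nk hphi h1).
exists C => w; elim=> {w} [g x||x y _ [x' ex] _ [y' ey]]; last 2 first.
- by exists 0; rewrite mul0rn scaler0.
- by exists (x' - y'); rewrite mulrnBl ex ey scalerBr.
have [t [kt ht]] := gres_lift g; have [s Ks cs] := cf_surj KL x.
have [A sA|a [z e]] := X_closed pp KL stL hphi hg0 (I := void) (y := fun=> 0) (l := iw_group h - 1)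
  (x := ((iw_group g - 1) *: x) *+ p ^ C); last first.
  by exists z; rewrite e sum_void add0r.
suff [z [v [hv e]]] : fixgrp_sub1 h A (((iw_group g - 1) *: x) *+ p ^ C).
  by exists (fun=> 0), z; rewrite sum_void subr0 e addrC addKr.
have [r hr] := W_reps L_max X sA.
apply: (hom_separate (r := r) (U_subgrp h A)).
- move=> y; have [n hn] := V_pn pp hphi y sA.1; exists (p ^ n)%N; first by rewrite expn_gt0 prime_gt0.
  exact: V_U.
- by move=> y; have [u ur hu] := hr y; exists u => //; exact: V_U.
move=> th hth tU; have unr := comm_unr_char sA kt hth tU.
have pw b : fixes (fixK h) b -> exists n, th (cf (aut_comm t b)) ^+ (p ^ n) = 1.
  move=> Fb; have [n hn] := V_pn pp hphi (cf (aut_comm t b)) sA.1; exists n.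
  have sT : subgrp [set: X]%classic by [].
  by rewrite -(hom_onMn _ sT hth I) tU //; exact: V_U.
have := hC _ unr pw s (K_fixK (h := h) Ks).
have sT : subgrp [set: X]%classic by [].
by rewrite (cf_comm kt Ks) -(hom_onMn _ sT hth I) cs ht scalerBl scale1r.
Qed.

Definition invariant (x : X) : Prop := forall g : gal k K, iw_group g *: x = x.

Lemma invariant_scale l x : invariant x -> invariant (l *: x).
Proof. by move=> hx g; rewrite scalerA mulrC -scalerA hx. Qed.
Lemma invariantD x y : invariant x -> invariant y -> invariant (x + y).
Proof. by move=> hx hy g; rewrite scalerDr hx hy. Qed.
Lemma invariantN x : invariant x -> invariant (- x).
Proof. by move=> hx g; rewrite scalerN hx. Qed.

Let comL (s t : gal K L) : (s * t = t * s)%g. Proof. by case: L_max => -[_ h _ _] _; exact: h. Qed.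

Definition fixed_inv : set algC := fun a => L a /\ forall x, invariant x -> im_aut x a = a.

Lemma fixed_inv_subfield : subfield fixed_inv.
Proof.
have [sK sL _ _] := KL; split.
- by split=> [|x _]; [exact: sf1|exact: (gal1 KL)].
- move=> a b [La ha] [Lb hb]; split=> [|x hx]; first exact: (sfB sL).
  rewrite gal_add //; last exact: (sfN sL).
  have eN : im_aut x (- b) = - im_aut x b.
    by apply/eqP; rewrite -addr_eq0 -gal_add ?(gal0 KL) ?addNr //; [rewrite (gal0 KL)|exact: (sfN sL)].
  by rewrite ha // eN hb.
- move=> a b [La ha] [Lb hb]; split=> [|x hx]; first exact: (sf_div sL).
  have [->|b0] := eqVneq b 0; first by rewrite invr0 mulr0 (gal0 KL).
  apply: (mulIf b0); rewrite -{2}(hb x hx) -gal_mul //; last exact: (sf_div sL).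
  by rewrite divfK // ha.
Qed.

Lemma fixed_inv_split : p_split p K fixed_inv.
Proof.
have sM := fixed_inv_subfield.
have KM x : ext_field K x -> fixed_inv x.
  by move=> Kx; split=> [|y _]; [exact: (KM_sub KL)|exact: gal_base].
have KMg : galois K fixed_inv by apply: (abelian_subext KL comL sM KM) => x [].
move=> P hP Pp; apply/seteqP; split=> [sg hsg|sg -> //].
have [s Ks hs] := glift KMg sg; have [Q hQ PQ] := lying_over sM hP.
(* s is corrected by an eta fixing [fixed_inv], so that s eta stabilises a prime Q above P. *)
have [x Mx Qx|eta Meta heta] := prime_transitive sM hQ (prime_aut s hQ).
  rewrite hs //; apply/PQ; first exact: (proj1 (gal_stab sg x) Mx).
  exact: (proj1 (hsg x) (proj1 (PQ x Mx) Qx)).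
have Keta : fixes (ext_field K) eta by move=> x /KM; exact: Meta.
have Ks1 := fixesM Ks Keta.
have hs1 x : Q x <-> Q ((s * eta)%g x) by exact: heta.
have Qp : Q p%:R by apply/PQ => //; exact: (sf_nat sM).
have inv : invariant (cf (s * eta)%g).
  move=> g; have [t [kt [ht hst]]] := stab_lift g hQ Qp.
  have Lc := comm_L hQ kt (fixesKk Ks1) hst hs1.
  have := cf_comm kt Ks1; rewrite (cf_fix X KL Lc) ht => /esym /eqP.
  by rewrite subr_eq0 => /eqP.
apply: gal_eqP => x Mx; rewrite -hs //; have [Lx hx] := Mx.
by have := hx _ inv; rewrite cfE // autM (Meta x Mx).
Qed.

(** L' contains the fixed field of the invariants because all primes above p split there. So x is a
    limit of invariants, and being invariant is a closed condition. *)
Lemma fixed_kernel (L' : set algC) (L'_max : max_p_split p K L L') x :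
  (forall a, L' a -> im_aut x a = a) -> invariant x.
Proof.
move=> hx; have [_ maxL'] := L'_max.
have ML' a : fixed_inv a -> L' a.
  apply: (maxL' fixed_inv); split; [exact: fixed_inv_subfield| | |exact: fixed_inv_split].
  - by move=> y Ky; split=> [|z _]; [exact: (KM_sub KL)|exact: gal_base].
  - by move=> y [].
have [s Ks cs] := cf_surj KL x.
pose H : set aut := fun h => fixes (ext_field K) h /\ invariant (cf h).
have gH : aut_group H.
  split.
  - by split=> // g; rewrite cf1 scaler0.
  - by move=> h h' [Kh ih] [Kh' ih']; split; [exact: fixesM|rewrite (cfM X KL stL) //; exact: invariantD].
  - by move=> h [Kh ih]; split; [exact: fixesV|rewrite (cfV X KL stL) //; exact: invariantN].
have fixH a : (forall h, H h -> h a = a) -> s a = a.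
  move=> ha; have La : L a.
    apply: subfield_fix; first by case: KL.
    by move=> u Lu; apply: ha; split; [exact: (fixesMK KL)|rewrite (cf_fix X KL Lu) => g; rewrite scaler0].
  rewrite -(cfE X KL Ks La) cs; apply: hx; apply: ML'; split=> // y hy.
  by have [h Kh ch] := cf_surj KL y; rewrite -ch cfE //; apply: ha; split=> //; rewrite ch.
move=> g; apply/eqP; rewrite -subr_eq0; apply/eqP; apply: (V_sep stL) => A sA.
have [h [Kh ih] agr] := closure_agree A gH fixH.
have hV : V A (x - cf h) by rewrite -cs; apply: (cf_agree X KL stL sA.1) => // a aA; rewrite agr.
have -> : iw_group g *: x - x = iw_group g *: (x - cf h) - (x - cf h).
  by rewrite scalerBr ih opprB addrA subrK.
by apply: VB => //; exact: (V_group KL stL).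
Qed.
End Decomposition.

Lemma Zp_domain p (pp : prime p) (a b : Zp p) : a <> 0 -> a * b = 0 -> b = 0.
Proof.
move=> /Zp_neq0 [n an] ab.
have [|c hc] := Zp_quotE pp (a := (p ^ n.+1)%:R) an.
  have q1 : (1 < p ^ n.+1)%N by rewrite -(Zp_mod pp).
  by rewrite Zp_natE; apply: val_inj; rewrite /= (val_Zp_nat q1) modnn.
have : b *+ p ^ n.+1 = 0 by rewrite -mulr_natl hc mulrAC ab mul0r.
elim: (n.+1) => [|m IH]; first by rewrite expn0 mulr1n.
by rewrite expnSr mulrnA => /(Zp_torsion pp).
Qed.

Lemma Zp_mul_neq0 p (pp : prime p) (a b : Zp p) : a <> 0 -> b <> 0 -> a * b <> 0.
Proof. by move=> a0 b0 /(Zp_domain pp a0). Qed.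

Lemma Zp_pow_neq0 p (pp : prime p) n : (p ^ n)%:R <> 0 :> Zp p.
Proof.
elim: n => [|n IH]; first by rewrite expn0; apply/eqP; rewrite oner_eq0.
by rewrite expnSr natrM mulr_natr => /(Zp_torsion pp).
Qed.

Lemma scale_step (R : comNzRingType) (V : lmodType R) (q c s t : R) (y w d z : V) :
  c *: y = w + d -> q *: w = t *: z -> (q * c) *: (s *: y) = (t * s) *: z + q *: (s *: d).
Proof.
move=> e1 e2; rewrite scalerA; have -> : q * c * s = q * s * c by ring.
rewrite -scalerA e1 scalerDr (mulrC q) -!scalerA e2 !scalerA; congr (_ *: _ + _ *: _); ring.
Qed.

(** * The projection from X to X' and its kernel *)

Section Projection.
Variables (p : nat) (pp : prime p) (k : set algC) (nk : number_field k) (K : Zp_extension p k).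
Variables (K_ns : nonsplit p k K) (L : set algC) (L_max : max_unramified p K L) (X : iwasawa_module K L).
Variables (L' : set algC) (L'_max : max_p_split p K L L') (X' : iwasawa_module K L').
Variables (phi : gal k K -> Zp p) (hphi : topological_iso_Zp phi) (g0 : gal k K) (hg0 : phi g0 = 1).
Local Notation Lam := (iwasawa_algebra K).
Local Notation Kk := (ext_galois K).
Local Notation pc := (@iw_const p k K).
Let KL : galois K L. Proof. by case: L_max => -[]. Qed.
Let stL (t : aut) x (kt : fixes k t) (Lx : L x) : L (t x) := L_stable Kk L_max kt Lx.
Let KL' : galois K L'.
Proof.
have [[sL' KL1 L1L _] _] := L'_max; have [[_ com _ _] _] := L_max.
by apply: (abelian_subext KL com sL') => x; [exact: KL1|exact: L1L].
Qed.
Let L'L x : L' x -> L x. Proof. by case: L'_max => -[_ _ h _] _; exact: h. Qed.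

Lemma p_split_stable (t : aut) x : fixes k t -> L' x -> L' (t x).
Proof.
move=> kt L'x; have [[sL' KL1 L1L sp] max] := L'_max; have ktV := fixesV kt.
have hK y : ext_field K y <-> ext_field K ((t^-1)%g y) by exact: (stable_aut Kk).
have hM y : [set y | L' ((t^-1)%g y)]%classic y <-> L' ((t^-1)%g y) by [].
have L'x' : L' ((t^-1)%g (t x)) by rewrite autKV.
apply: (max [set y | L' ((t^-1)%g y)]%classic _ _ L'x').
split.
- exact: (gconj_subfield hM sL').
- by move=> y /hK; exact: KL1.
- by move=> y /= /L1L; move/(stL kt); rewrite autVK.
- exact: (transport_p_split hK hM sp).
Qed.
Local Notation stL' := p_split_stable.
Local Notation c1 := (cf X KL).
Local Notation c2 := (cf X' KL').

Lemma cf_lift (x : X) : exists s, fixes (ext_field K) s /\ c1 s = x.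
Proof. by have [s Ks cs] := cf_surj KL x; exists s. Qed.
Definition pi (x : X) : X' := c2 (projT1 (cid (cf_lift x))).

Lemma pi_cf (s : aut) : fixes (ext_field K) s -> pi (c1 s) = c2 s.
Proof.
move=> Ks; rewrite /pi; case: cid => u /= [Ku e].
apply: cf_eq => // a L'a; rewrite cfE //.
by rewrite -(cfE X KL Ks (L'L L'a)) -e cfE //; exact: L'L.
Qed.

Lemma piD x y : pi (x + y) = pi x + pi y.
Proof.
have [s Ks <-] := cf_surj KL x; have [t Kt <-] := cf_surj KL y.
rewrite -(cfM X KL stL) // !pi_cf ?(cfM X' KL' stL') //; exact: fixesM.
Qed.
Lemma piN x : pi (- x) = - pi x.
Proof.
have [s Ks <-] := cf_surj KL x.
rewrite -(cfV X KL stL) // !pi_cf ?(cfV X' KL' stL') //; exact: fixesV.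
Qed.
Lemma pi0 : pi 0 = 0.
Proof. by apply: (addrI (pi 0)); rewrite -piD !addr0. Qed.
Lemma piMn x n : pi (x *+ n) = pi x *+ n.
Proof. by elim: n => [|n IH]; rewrite ?mulr0n ?pi0 // !mulrS piD IH. Qed.
Lemma pi_group g x : pi (iw_group g *: x) = iw_group g *: pi x.
Proof.
have [s Ks <-] := cf_surj KL x; have [t [kt <-]] := gres_lift g.
rewrite -(cf_conj X KL stL) // !pi_cf ?(cf_conj X' KL' stL' kt) //; exact: (conj_fixes Kk).
Qed.
Lemma pi_surj x' : exists x, pi x = x'.
Proof. by have [s Ks <-] := cf_surj KL' x'; exists (c1 s); rewrite pi_cf. Qed.

Lemma pi_fixgrp A x : (forall a, a \in A -> L' a) -> fixgrp A x -> fixgrp A (pi x).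
Proof.
move=> AL'; have [s Ks <-] := cf_surj KL x; rewrite pi_cf // => h.
apply/(cf_V X' KL' AL' Ks); apply/(cf_V X KL _ Ks) => //.
by move=> a /AL' /L'L.
Qed.

(** Additivity gives compatibility with natural numbers only; c is approximated by its residue
    [c N], and the continuity of both module structures disposes of the difference. *)
Lemma pi_const c x : pi (pc c *: x) = pc c *: pi x.
Proof.
apply/eqP; rewrite -subr_eq0; apply/eqP; apply: (V_sep stL') => A sA.
have AL a : a \in A -> L a by move=> /sA.1 /L'L.
have [Q [n hQ]] := im_cont x AL; have [Q' [n' hQ']] := im_cont (pi x) sA.1.
pose N := maxn n n'; have e : pc c = (c N : nat)%:R + pc (c - (c N : nat)%:R).
  by rewrite rmorphB /= rmorph_nat addrC subrK.
have z m : (m <= N)%N -> (c - (c N : nat)%:R) m = 0.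
  move=> mN; apply: (Zp_le0 pp mN); rewrite Zp_subE Zp_natE natr_Zp; exact: subrr.
have -> : pi (pc c *: x) - pc c *: pi x = pi (pc (c - (c N : nat)%:R) *: x) - pc (c - (c N : nat)%:R) *: pi x.
  by rewrite {1 2}e !scalerDl !scaler_nat piD piMn opprD addrACA subrr add0r.
apply: VB.
  by apply: pi_fixgrp sA.1 _; apply: hQ; apply: JQ_const; apply: z; exact: leq_maxl.
by apply: hQ'; apply: JQ_const; apply: z; exact: leq_maxr.
Qed.

Lemma pi_ker x : pi x = 0 -> invariant x.
Proof.
move=> px; apply: (fixed_kernel nk K_ns L_max L'_max) => a L'a.
have [s Ks cs] := cf_surj KL x; rewrite -cs cfE //; last exact: L'L.
by rewrite -(cfE X' KL' Ks L'a) -pi_cf // cs px im0.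
Qed.

Lemma pi_aug w' : aug_rel w' -> exists2 w, aug_rel w & pi w = w'.
Proof.
elim=> {w'} [g v'||x' y' _ [x hx <-] _ [y hy <-]].
- have [v <-] := pi_surj v'; exists ((iw_group g - 1) *: v); first exact: aug_gen.
  by rewrite !scalerBl !scale1r piD piN pi_group.
- by exists 0; [exact: aug_0|exact: pi0].
- by exists (x - y); [exact: aug_B|rewrite piD piN].
Qed.

Lemma coinv_torsion : coinvariant_rank X' = Some 0%N ->
  forall v' : X', exists2 c : Zp p, c <> 0 & aug_rel (pc c *: v').
Proof.
rewrite /coinvariant_rank /rank; case: pselect => // h; case: (cid h) => r hr /= [r0] v'.
move: hr; rewrite r0 => -[_ /(_ (fun=> \pi_(coinvariants X')%qT v')) nind].
apply: contrapT => hc; apply: nind => c; rewrite big_ord1 => e i.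
apply: contrapT => ci; apply: hc; exists (c ord0); first by rewrite (ord1 i) in ci.
apply/aug_subP; rewrite -[_ *: _]subr0; apply/coinv_piP.
by rewrite -coinv_scaleE; exact: etrans e (esym (raddf0 \pi_(coinvariants X')%qT)).
Qed.

Lemma split_invariant : coinvariant_rank X' = Some 0%N ->
  forall v : X, exists c w d, [/\ c <> 0, aug_rel w, invariant d & pc c *: v = w + d].
Proof.
move=> h0 v; have [c c0 /pi_aug [w hw e]] := coinv_torsion h0 (pi v).
exists c, w, (pc c *: v - w); split=> //; last by rewrite addrC subrK.
by apply: pi_ker; rewrite piD piN pi_const e subrr.
Qed.

(** If c v = s y + d with d invariant, write c' y = w + d' by [split_invariant] and p^a w = (h - 1)
    y' by [aug_bound]. Multiplying the first equation by p^a c' produces (h - 1) s y', and the other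
    terms remain invariant. *)
Lemma dagger_split (s : Lam) : coinvariant_rank X' = Some 0%N -> dagger_rel s ->
  forall v : X, exists c y d, [/\ c <> 0, invariant d & pc c *: v = s *: y + d].
Proof.
move=> h0; elim=> {s} [|h s h1 _ IH] v.
  exists 1, v, 0; rewrite rmorph1 !scale1r addr0; split=> //; first by apply/eqP; rewrite oner_eq0.
  by move=> g; rewrite scaler0.
have [c [y [d [c0 hd e]]]] := IH v.
have [c' [w [d' [c'0 hw hd' e']]]] := split_invariant h0 y.
have [a ha] := aug_bound pp nk K_ns L_max X hphi hg0 h1; have [y' ey] := ha w hw.
pose q : Zp p := (p ^ a)%:R.
exists (q * c' * c), y', (pc q *: (s *: d') + pc (q * c') *: d); split.
- by do 2!apply: (Zp_mul_neq0 pp) => //; exact: (Zp_pow_neq0 pp).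
- by apply: invariantD; do ?apply: invariant_scale.
- have eq1 : pc q *: w = (iw_group h - 1) *: y' by rewrite /q rmorph_nat scaler_nat.
  rewrite rmorphM -scalerA e scalerDr addrA; congr (_ + _).
  by rewrite rmorphM; exact: scale_step eq1.
Qed.
End Projection.

(** * Comparison of the ranks of a module and of its coinvariants *)

Section Ranks.
Variables (p : nat) (pp : prime p) (k : set algC) (K : Zp_extension p k).
Local Notation pc := (@iw_const p k K).
Variables (V : lmodType (iwasawa_algebra K)).
Hypothesis aug_torsion : forall w : V, aug_rel w -> exists2 c : Zp p, c <> 0 & pc c *: w = 0.
Local Notation proj := (\pi_(coinvariants V)%qT : V -> coinvariants V).

Lemma proj_sum n (c : 'I_n -> Zp p) (v : 'I_n -> Zp_module V) :
  proj (\sum_i c i *: v i) = \sum_i c i *: (proj (v i) : Zp_module (coinvariants V)).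
Proof.
rewrite raddf_sum; apply: eq_bigr => i _; exact: (esym (coinv_scaleE _ _)).
Qed.

(** A relation in the coinvariants lifts to an element of the augmentation submodule, which is
    torsion, so a nonzero multiple of it is a relation in V. *)
Lemma proj_indep n (v : 'I_n -> Zp_module V) :
  lin_indep v <-> lin_indep (fun i => proj (v i) : Zp_module (coinvariants V)).
Proof.
split=> h c e i.
  have : aug_rel (\sum_i c i *: v i : V).
    apply/aug_subP; rewrite -[X in X \in _]subr0; apply/coinv_piP.
    by rewrite proj_sum e; exact: esym (raddf0 proj).
  move=> /aug_torsion [d d0 hd]; apply: (Zp_domain pp d0).
  apply: (h (fun i => d * c i)); rewrite -[RHS]hd -[RHS]/(d *: (\sum_i c i *: v i : Zp_module V)).
  by rewrite scaler_sumr; apply: eq_bigr => j _; rewrite scalerA.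
apply: h; rewrite -proj_sum e; exact: raddf0 proj.
Qed.

Lemma rank_coinvariants : rank (Zp_module V) = rank (Zp_module (coinvariants V)).
Proof.
have e r : has_rank (Zp_module V) r <-> has_rank (Zp_module (coinvariants V)) r.
  have lift n (u : 'I_n -> Zp_module (coinvariants V)) : exists v : 'I_n -> Zp_module V, u = fun i => proj (v i).
    by exists (fun i => repr (u i : coinvariants V)); apply: funext => i; rewrite reprK.
  split=> -[[v hv] hn]; split.
  - by exists (fun i => proj (v i)); apply/proj_indep.
  - by move=> u; have [w ->] := lift _ u; move/proj_indep; exact: hn.
  - by have [w ew] := lift _ v; exists w; apply/proj_indep; rewrite -ew.
  - by move=> w /proj_indep; exact: hn.
have {}e : has_rank (Zp_module V) = has_rank (Zp_module (coinvariants V)).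
  by apply: funext => r; apply: propext; exact: e.
pose f (P : nat -> Prop) := if pselect (exists r, P r) is left h then Some (projT1 (cid h)) else None.
by rewrite -[LHS]/(f (has_rank (Zp_module V))) e.
Qed.
End Ranks.

Theorem theorem5p8 (p : nat) (p_prime : prime p)
  (k : set algC) (k_nf : number_field k)
  (K : Zp_extension p k) (K_ns : nonsplit p k K)
  (L : set algC) (L_max : max_unramified p K L)
  (L' : set algC) (L'_max : max_p_split p K L L')
  (X : iwasawa_module K L) (X' : iwasawa_module K L')
  (X_dagger : pseudo_null (dagger X))
  (X'_semisimple : coinvariant_rank X' = Some 0%N) :
  finitely_generated (Zp_module X) /\
  rank (Zp_module X) = coinvariant_rank X.
Proof.
have [phi hphi] := ext_iso K; have [g0 hg0] := phi_generator hphi.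
have [n [y hy]] := fin_gen p_prime k_nf L_max hphi hg0 X_dagger.
split; first by exists n, y.
apply: (rank_coinvariants p_prime).
(* Finitely many generators over Z_p allow one annihilator p^m s for all of X. *)
have [s [m [hs hsm]]] : exists s m, dagger_rel s /\ forall v : X, (s *+ p ^ m) *: v = 0.
  have [s [m [hs hsm]]] : exists s m, dagger_rel s /\ forall i, (s *+ p ^ m) *: y i = 0.
    have {hy} : forall l : seq 'I_n, exists s m, dagger_rel s /\ forall i, i \in l -> (s *+ p ^ m) *: y i = 0.
      elim=> [|i l [s [m [hs hsm]]]]; first by exists 1, 0%N; split=> //; exact: dagger_1.
      have [s' [m' [hs' e]]] := killed_dagger p_prime X_dagger (y i).
      exists (s * s'), (m + m')%N; split; first exact: dagger_relM.
      have -> : s * s' *+ p ^ (m + m') = (s *+ p ^ m) * (s' *+ p ^ m').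
        by rewrite mulrnAr mulrnAl -mulrnA expnD.
      move=> j; rewrite inE => /orP [/eqP ->|/hsm h]; first by rewrite -scalerA e scaler0.
      by rewrite mulrC -scalerA h scaler0.
    by move=> /(_ (enum 'I_n)) [s [m [hs h]]]; exists s, m; split=> // i; apply: h; rewrite mem_enum.
  exists s, m; split=> // v; have [a ->] := hy v.
  by rewrite scaler_sumr big1 // => i _; rewrite scalerA mulrC -scalerA hsm scaler0.
(* In c v = s z + d the term s z disappears after multiplication by p^m. *)
have inv (v : X) : exists2 c : Zp p, c <> 0 & invariant (iw_const K c *: v).
  have [c [z [d [c0 hd e]]]] := dagger_split p_prime k_nf K_ns L_max L'_max hphi hg0 X'_semisimple hs v.
  exists ((p ^ m)%:R * c); first exact: (Zp_mul_neq0 p_prime (Zp_pow_neq0 p_prime (n := m)) c0).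
  have -> : iw_const K ((p ^ m)%:R * c) *: v = (s *+ p ^ m) *: z + (p ^ m)%:R *: d.
    by rewrite rmorphM -scalerA e rmorph_nat scalerDr scalerA mulr_natl.
  by rewrite hsm add0r; exact: invariant_scale.
move=> w; elim=> {w} [g v||u w _ [c c0 ec] _ [d d0 ed]].
(* Here c (g - 1) v = (g - 1) (c v) = 0. *)
- have [c c0 hc] := inv v; exists c => //.
  by rewrite scalerA mulrC -scalerA scalerBl hc scale1r subrr.
- by exists 1; [apply/eqP; rewrite oner_eq0|rewrite scaler0].
- exists (c * d); first exact: (Zp_mul_neq0 p_prime).
  by rewrite rmorphM -scalerA scalerBr ed subr0 scalerA mulrC -scalerA ec scaler0.
Qed.
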